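(* Let $r\ge 7$ and let $f=f(x,\mu)$ be a real-valued $C^r$ function defined on a neighbourhood of $(0,0)\in\mathbb{R}\times\mathbb{R}$, regarded as a one-parameter family of maps $x\mapsto f(x,\mu)$. Suppose $f(0,\mu)=0$ for all $\mu$ in a neighbourhood of $0$, and $$f_x(0,0)=1,\quad f_{xx}(0,0)=0,\quad f_{x\mu}(0,0)>0,\quad f_{xxx}(0,0)<0.$$ Let $$g(y,\nu,a,b)=y+\nu y-y^3+a y^5+b\nu y^2 .$$ There exist a neighbourhood $N$ of $x=0$ and $\mu_0>0$ such that if $\mu\in(-\mu_0,0)$ then $f(\cdot,\mu)$ has one fixed point in $N$ (namely $x=0$, which is stable), and if $\mu\in(0,\mu_0)$ then $f(\cdot,\mu)$ has three fixed points in $N$ ($x=0$, which is unstable, and two stable fixed points). Moreover, there exist a neighbourhood $M$ of $y=0$, a $C^1$ function $\nu(\mu)$, and continuous functions $a(\mu)$ and $b(\mu)$ with $$\nu(0)=0,\qquad \nu'(0)=f_{x\mu}(0,0),$$ $$a(0)=\left(\frac{3f_{xxxxx}}{10f_{xxx}^2}-\frac{3f_{xxxx}^2}{8f_{xxx}^3}\right)\Big|_{(0,0)},\qquad b(0)=\sqrt{\frac{6}{-f_{xxx}}}\left(\frac{f_{xxxx}}{4f_{xxx}}+\frac{f_{xx\mu}}{2f_{x\mu}}\right)\Big|_{(0,0)},$$ such that, with $\tilde g(y,\mu)=g(y,\nu(\mu),a(\mu),b(\mu))$: 1. if $\mu\in(-\mu_0,\mu_0)\setminus\{0\}$ then $f|_N$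 and $\tilde g|_M$ are $C^{r-1}$-conjugate on the basins of attraction/repulsion of their corresponding fixed points (that is, for each fixed point of $f|_N$ there is a $C^{r-1}$-conjugacy from its basin of attraction or repulsion, according to its stability, to that of the corresponding fixed point of $\tilde g|_M$); 2. if $\mu=0$ then $f|_N$ is $C^1$-conjugate to $\tilde g|_M$.
   Context: Subscripts denote partial derivatives. For fixed $\mu$, $f|_N$ denotes the map $x\mapsto f(x,\mu)$ restricted to $N$, and $\tilde g|_M$ the map $y\mapsto\tilde g(y,\mu)$ restricted to $M$. Two maps $F:U\to\mathbb{R}$ and $G:V\to\mathbb{R}$ are topologically conjugate if there is a homeomorphism $h:U\to V$ with $h\circ F=G\circ h$ (for restricted maps this relation is understood at points where both sides are defined, i.e. whose image remains in the domain). They are differentiably conjugate if $h$ is a diffeomorphism, and $C^s$-conjugate ($s\ge1$) if the diffeomorphism $h$ is of class $C^s$. If $x$ is a fixed point of $F$, then $h(x)$ is the corresponding fixed point of $G$. The basin of attraction of a stable fixed point in a neighbourhood is the set of points of the neighbourhood whose forward orbits stay in the neighbourhood and converge to the fixed point; the basin of repulsion of an unstable fixed point is the set of points of the neighbourhood whose backward orbits stay in the neighbourhood and converge to the fixed point (the maps are locally invertible). *)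

(* Defs.v *)
From Stdlib Require Import Reals.
From Coquelicot Require Import Coquelicot.

Local Open Scope R_scope.

Definition g (y nu a b : R) : R :=
  y + nu * y - y ^ 3 + a * y ^ 5 + b * nu * y ^ 2.

(* Meant for open [U]: derivatives are the two-sided ones of the total function. *)
Definition C_on (s : nat) (U : R -> Prop) (h : R -> R) : Prop :=
  forall x, U x -> forall k, (k <= s)%nat ->
    ex_derive_n h k x /\ continuous (Derive_n h k) x.

Definition C2d_on (r : nat) (U : R * R -> Prop) (f : R -> R -> R) : Prop :=
  forall x mu, U (x, mu) -> ex_diff_n f r x mu.

Definition fixed_in (F : R -> R) (N : R -> Prop) (x : R) : Prop :=
  N x /\ F x = x.

Definition lyapunov_stable (F : R -> R) (p : R) : Prop :=
  forall eps, 0 < eps -> exists delta, 0 < delta /\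
    forall x, Rabs (x - p) < delta ->
      forall n, Rabs (Nat.iter n F x - p) < eps.

Definition locally_attracting (F : R -> R) (p : R) : Prop :=
  locally p (fun x => is_lim_seq (fun n => Nat.iter n F x) p).

(* A map defined only near [p] is represented by a total function. Both notions
   below do not depend on its values away from [p]. *)
Definition stable (F : R -> R) (p : R) : Prop :=
  F p = p /\ lyapunov_stable F p /\ locally_attracting F p.

Definition unstable (F : R -> R) (p : R) : Prop :=
  F p = p /\ ~ lyapunov_stable F p.

Definition basin_attraction (F : R -> R) (N : R -> Prop) (p x : R) : Prop :=
  (forall n, N (Nat.iter n F x)) /\
  is_lim_seq (fun n => Nat.iter n F x) p.

(* [u n] is the n-th backward iterate of [x]; it is determined by [x] when [F]
   is injective on [N]. *)
Definition basin_repulsion (F : R -> R) (N : R -> Prop) (p x : R) : Prop :=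
  exists u : nat -> R,
    u 0%nat = x /\ (forall n, F (u (S n)) = u n) /\
    (forall n, N (u n)) /\ is_lim_seq u p.

Definition C_diffeo (s : nat) (U V : R -> Prop) (h : R -> R) : Prop :=
  open U /\ open V /\ C_on s U h /\
  exists k : R -> R, C_on s V k /\
    (forall x, U x -> V (h x) /\ k (h x) = x) /\
    (forall y, V y -> U (k y) /\ h (k y) = y).

(* [h] conjugates the restrictions of [F] to [U] and of [G] to [V]; the composite
   [h o F] is only defined at the points of [U] that [F] maps into [U]. *)
Definition C_conjugacy (s : nat) (F : R -> R) (U : R -> Prop)
    (G : R -> R) (V : R -> Prop) (h : R -> R) : Prop :=
  C_diffeo s U V h /\
  forall x, U x -> U (F x) -> h (F x) = G (h x).

Definition basin_conjugate (s : nat) (F : R -> R) (N : R -> Prop)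
    (G : R -> R) (M : R -> Prop) (x y : R) : Prop :=
  (stable F x /\ stable G y /\ exists h, h x = y /\
     C_conjugacy s F (basin_attraction F N x) G (basin_attraction G M y) h) \/
  (unstable F x /\ unstable G y /\ exists h, h x = y /\
     C_conjugacy s F (basin_repulsion F N x) G (basin_repulsion G M y) h).

(* The correspondence [c] is a bijection between the fixed points of [F] in [N]
   and those of [G] in [M]. *)
Definition conjugate_on_basins (s : nat) (F : R -> R) (N : R -> Prop)
    (G : R -> R) (M : R -> Prop) : Prop :=
  exists c : R -> R,
    (forall x, fixed_in F N x -> fixed_in G M (c x)) /\
    (forall x x', fixed_in F N x -> fixed_in F N x' -> c x = c x' -> x = x') /\
    (forall y, fixed_in G M y -> exists x, fixed_in F N x /\ c x = y) /\
    (forall x, fixed_in F N x -> basin_conjugate s F N G M x (c x)).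

(* Main.v *)
Require Import Defs.
From Stdlib Require Import Reals.
From Coquelicot Require Import Coquelicot.
From Stdlib Require Import Factorial Lra Lia ClassicalEpsilon Ranalysis5.
Open Scope R_scope.

(** Near the origin [f(x, mu) = x + nu x + A x^2 + B x^3 + C x^4 + E x^5 + O(x^6)]
    with [nu] of the sign of [mu], [A = O(nu)] and [B] close to [- c], where [c >
    0]. Around a hyperbolic fixed point of multiplier [m] there is a coordinate
    [phi], as smooth as the map and defined on the whole basin, in which the map is
    multiplication by [m] ([koenigs]). Two maps with the same multiplier are
    therefore conjugate by [psi^-1 (lam * phi)] for every scaling [lam] that carries
    the image of one basin onto that of the other ([conjugacy_from_linearizations]).
    The parameter [nu] is chosen so that the multipliers at [0] agree, and the work
    lies in the images of the basins and in the other multipliers.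

    For [mu > 0] every basin ends at a neighbouring fixed point, where [phi] is
    unbounded; its image is a half-line or the whole line, and equality of the
    multipliers suffices ([bistable_conjugate]). The two multipliers away from [0]
    are prescribed by means of [a] and [b]: solving the equations of the two fixed
    points of [g] for [b] leaves one equation for [a], which is monotone
    ([multiplier_matching]), and the asymptotic expansion of the multipliers of [f]
    shows that its solution tends to the stated [a(0)], and [b] to [b(0)]
    ([multiplier_asymptotics]).

    For [mu < 0] the whole of [N] is one basin, with bounded image, and a single
    scaling has to match two end points ([monostable_conjugate]). This is one
    condition, on the ratio of the Koenigs coordinates of the two ends. The constant
    [a(0)] is kept and the condition is solved for [b]: the logarithm of that ratio
    decreases with [b] for [g] ([g_asymmetry_decreasing]), and an estimate of
    [phi'/phi] which is uniform in [nu] gives its leading term, of order [sqrt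
    |nu|], with an error of order [nu ln |nu|] ([basin_asymmetry]). Hence the
    solution tends to the same [b(0)] ([asymmetry_matching]).

    For [mu = 0] the origin is parabolic, and on either side the map is a
    translation in its Fatou coordinate. The resulting conjugacies of the two sides
    have the same derivative [sqrt c] at [0], and together they form a
    diffeomorphism of class C^1 ([parabolic_conjugacy]). *)

(** * Functions of class C^k on an open set *)

(** Iterating [Derive] on whole functions, instead of taking n-th derivatives at a
    point, lets an induction on [k] pass to the derivative of the function under
    study. *)
Fixpoint Ck (k : nat) (U : R -> Prop) (h : R -> R) : Prop :=
  match k with
  | O => forall x, U x -> continuous h x
  | S k => (forall x, U x -> ex_derive h x) /\ Ck k U (Derive h)
  end.

Lemma Ck_continuous k U h x : Ck k U h -> U x -> continuous h x.
Proof.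
destruct k; simpl; intros H Ux; [now apply H|].
apply (ex_derive_continuous h x), H, Ux.
Qed.

Lemma open_locally (U : R -> Prop) x : open U -> U x -> locally x U.
Proof. intros HU Ux; exact (HU x Ux). Qed.

Lemma Ck_ext k (U : R -> Prop) h1 h2 : open U ->
  (forall x, U x -> h1 x = h2 x) -> Ck k U h1 -> Ck k U h2.
Proof.
intros oU; revert h1 h2; induction k as [|k IH]; intros h1 h2 E; simpl.
- intros H x Ux. apply (continuous_ext_loc _ h1); [|now apply H].
  generalize (open_locally U x oU Ux); apply filter_imp; auto.
- intros [H1 H2]; split.
  + intros x Ux. apply (ex_derive_ext_loc h1); [|now apply H1].
    generalize (open_locally U x oU Ux); apply filter_imp; auto.
  + apply (IH (Derive h1)); [|exact H2].
    intros x Ux; apply Derive_ext_loc.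
    generalize (open_locally U x oU Ux); apply filter_imp; auto.
Qed.

Lemma Ck_sub k (U V : R -> Prop) h :
  (forall x, V x -> U x) -> Ck k U h -> Ck k V h.
Proof.
intros E; revert h; induction k as [|k IH]; simpl; intros h; [auto|].
intros [H1 H2]; split; auto.
Qed.

Lemma Ck_local k (U : R -> Prop) h :
  (forall x, U x -> exists V : R -> Prop, V x /\ Ck k V h) -> Ck k U h.
Proof.
revert h; induction k as [|k IH]; simpl; intros h H.
- intros x Ux; destruct (H x Ux) as [V [Vx HV]]; auto.
- split.
  + intros x Ux; destruct (H x Ux) as [V [Vx HV]]; now apply HV.
  + apply IH; intros x Ux; destruct (H x Ux) as [V [Vx HV]].
    exists V; tauto.
Qed.

Lemma Ck_intro k (U : R -> Prop) h h' : open U ->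
  (forall x, U x -> is_derive h x (h' x)) -> Ck k U h' -> Ck (S k) U h.
Proof.
intros oU H1 H2; split.
- intros x Ux; exists (h' x); auto.
- apply (Ck_ext k U h'); auto. intros x Ux; symmetry; apply is_derive_unique; auto.
Qed.

Lemma Ck_S k U h : Ck (S k) U h -> Ck k U h.
Proof.
revert h; induction k as [|k IH]; intros h [H1 H2].
- intros x Ux; apply (ex_derive_continuous h x); auto.
- split; auto.
Qed.

Lemma Ck_le j k U h : (j <= k)%nat -> Ck k U h -> Ck j U h.
Proof. induction 1; auto. intros; apply IHle, Ck_S; auto. Qed.

Lemma Ck_deriv k U h x : Ck (S k) U h -> U x -> is_derive h x (Derive h x).
Proof. intros [H _] Ux; apply Derive_correct; auto. Qed.

Lemma Ck_const k U c : Ck k U (fun _ => c).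
Proof.
apply (Ck_sub _ (fun _ => True)); auto.
revert c; induction k; intros c.
- intros x _; apply continuous_const.
- apply (Ck_intro k _ _ (fun _ => 0)); auto.
  + apply open_true.
  + intros x _; apply (is_derive_const c x).
Qed.

Lemma Ck_id k U : Ck k U (fun x => x).
Proof.
apply (Ck_sub _ (fun _ => True)); auto.
destruct k.
- intros x _; apply continuous_id.
- apply (Ck_intro k _ _ (fun _ => 1)).
  + apply open_true.
  + intros x _; apply (is_derive_id x).
  + apply Ck_const.
Qed.

Lemma Ck_plus k (U : R -> Prop) f g : open U ->
  Ck k U f -> Ck k U g -> Ck k U (fun x => f x + g x).
Proof.
intros oU; revert f g; induction k as [|k IH]; intros f g Hf Hg.
- intros x Ux; apply (continuous_plus f g); auto.
- apply (Ck_intro k U _ (fun x => Derive f x + Derive g x)); auto.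
  + intros x Ux; apply (is_derive_plus f g); eapply Ck_deriv; eauto.
  + apply IH; [apply Hf | apply Hg].
Qed.

Lemma Ck_mult k (U : R -> Prop) f g : open U ->
  Ck k U f -> Ck k U g -> Ck k U (fun x => f x * g x).
Proof.
intros oU; revert f g; induction k as [|k IH]; intros f g Hf Hg.
- intros x Ux; apply (continuous_mult f g); auto.
- apply (Ck_intro k U _ (fun x => Derive f x * g x + f x * Derive g x)); auto.
  + intros x Ux; apply (is_derive_mult f g); try (eapply Ck_deriv; eauto).
    intros; apply Rmult_comm.
  + apply Ck_plus; auto; apply IH; try apply Hf; try apply Hg; apply Ck_S; auto.
Qed.

Lemma Ck_scal k (U : R -> Prop) c f : open U ->
  Ck k U f -> Ck k U (fun x => c * f x).
Proof. intros oU Hf; apply (Ck_mult k U (fun _ => c)); auto using Ck_const. Qed.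

Lemma Ck_opp k (U : R -> Prop) f : open U ->
  Ck k U f -> Ck k U (fun x => - f x).
Proof.
intros oU Hf; apply (Ck_ext k U (fun x => (-1) * f x)); auto using Ck_scal.
intros; ring.
Qed.

Lemma Ck_comp k (U V : R -> Prop) f g : open U -> open V ->
  (forall x, U x -> V (g x)) ->
  Ck k V f -> Ck k U g -> Ck k U (fun x => f (g x)).
Proof.
intros oU oV HUV; revert f; induction k as [|k IH]; intros f Hf Hg.
- intros x Ux; apply (continuous_comp g f); auto; apply Hf; auto.
- apply (Ck_intro k U _ (fun x => Derive g x * Derive f (g x))); auto.
  + intros x Ux; apply (is_derive_comp f g); eapply Ck_deriv; eauto.
  + apply Ck_mult; auto; [apply Hg|]. apply IH; [apply Hf | apply Ck_S; auto].
Qed.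

Lemma continuous_Rinv t : t <> 0 -> continuous Rinv t.
Proof.
intros Ht. apply continuity_pt_filterlim, continuity_pt_inv; auto.
apply derivable_continuous_pt, derivable_pt_id.
Qed.

Lemma Ck_inv k (U : R -> Prop) f : open U ->
  (forall x, U x -> f x <> 0) -> Ck k U f -> Ck k U (fun x => / f x).
Proof.
intros oU Hn; revert k; induction k as [|k IH]; intros Hf.
- intros x Ux. apply (continuous_comp f Rinv); [now apply Hf|].
  now apply continuous_Rinv, Hn.
- apply (Ck_intro k U _ (fun x => - Derive f x * (/ f x * / f x))); auto.
  + intros x Ux. replace (- Derive f x * (/ f x * / f x)) with (- Derive f x / f x ^ 2)
      by (field; auto). apply is_derive_inv; [eapply Ck_deriv; eauto | auto].
  + assert (H := IH (Ck_S _ _ _ Hf)).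
    apply Ck_mult; auto; [apply Ck_opp; auto; apply Hf | apply Ck_mult; auto].
Qed.

Lemma Ck_exp k U : Ck k U exp.
Proof.
apply (Ck_sub _ (fun _ => True)); auto.
induction k as [|k IH].
- intros x _; apply continuity_pt_filterlim, derivable_continuous_pt, derivable_pt_exp.
- apply (Ck_intro k _ _ exp); auto using open_true.
  intros x _; apply is_derive_exp.
Qed.

Lemma Ck_C_on k (U : R -> Prop) h : open U -> Ck k U h -> C_on k U h.
Proof.
intros oU; revert h; induction k as [|k IH]; intros h Hh x Ux j Hj.
- replace j with 0%nat by lia; simpl; auto.
- destruct j as [|j].
  + split; [exact I|]. apply (Ck_continuous (S k) U); auto.
  + destruct Hh as [H1 H2]. destruct (IH _ H2 x Ux j ltac:(lia)) as [H3 H4].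
    split.
    * destruct j; simpl in *; [now apply H1|].
      apply (ex_derive_ext (Derive_n (Derive h) j)); [|exact H3].
      intros t. rewrite (Derive_n_comp h j 1). now rewrite Nat.add_comm.
    * apply (continuous_ext (Derive_n (Derive h) j)); [|exact H4].
      intros t. rewrite (Derive_n_comp h j 1). now rewrite Nat.add_comm.
Qed.

(** * Increasing functions and their inverses *)

Definition Ioo (a b x : R) : Prop := a < x < b.

Lemma open_Ioo a b : open (Ioo a b).
Proof. apply open_and; [apply open_gt | apply open_lt]. Qed.

Lemma mean_value f a b : a < b ->
  (forall x, a <= x <= b -> ex_derive f x) ->
  exists c, a < c < b /\ f b - f a = Derive f c * (b - a).
Proof.
intros ab H.
destruct (MVT_cor2 f (Derive f) a b ab) as [c [E Hc]].
- intros c Hc; apply is_derive_Reals, Derive_correct, H, Hc.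
- exists c; auto.
Qed.

Lemma deriv_pos_increasing f a b :
  (forall x, Ioo a b x -> ex_derive f x) ->
  (forall x, Ioo a b x -> 0 < Derive f x) ->
  forall x y, Ioo a b x -> Ioo a b y -> x < y -> f x < f y.
Proof.
intros D P x y [Hx Hx'] [Hy Hy'] xy.
destruct (mean_value f x y xy) as [c [Hc E]].
- intros z Hz; apply D; split; lra.
- assert (0 < Derive f c) by (apply P; split; lra). nra.
Qed.

Lemma increasing_inj f (J : R -> Prop) :
  (forall x y, J x -> J y -> x < y -> f x < f y) ->
  forall x y, J x -> J y -> f x = f y -> x = y.
Proof.
intros H x y Jx Jy E.
destruct (Rtotal_order x y) as [L|[L|L]]; auto;
 [generalize (H x y Jx Jy L)|generalize (H y x Jy Jx L)]; lra.
Qed.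

Lemma increasing_lt_inv f (J : R -> Prop) :
  (forall x y, J x -> J y -> x < y -> f x < f y) ->
  forall x y, J x -> J y -> f x < f y -> x < y.
Proof.
intros H x y Jx Jy E.
destruct (Rtotal_order x y) as [L|[L|L]]; auto.
- subst; lra.
- generalize (H y x Jy Jx L); lra.
Qed.

Lemma ivt f a b v : a <= b ->
  (forall x, a <= x <= b -> continuous f x) -> f a <= v <= f b ->
  exists c, a <= c <= b /\ f c = v.
Proof.
intros ab Hc [H1 H2].
destruct (Req_dec (f a) v) as [E|N1]; [exists a; split; [lra|auto]|].
destruct (Req_dec (f b) v) as [E|N2]; [exists b; split; [lra|auto]|].
assert (a < b) by (destruct ab as [|E]; auto; subst; lra).
destruct (IVT_interv (fun x => f x - v) a b) as [z [Hz E]]; auto; try lra.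
- intros z Hz. apply continuity_pt_minus.
  + apply continuity_pt_filterlim, Hc, Hz.
  + apply derivable_continuous_pt, derivable_pt_const.
- exists z; split; auto; lra.
Qed.

Definition inv_on (J : R -> Prop) (phi : R -> R) (v : R) : R :=
  epsilon (inhabits 0) (fun y => J y /\ phi y = v).

Definition image (J : R -> Prop) (phi : R -> R) (v : R) : Prop :=
  exists y, J y /\ phi y = v.

Lemma inv_on_spec J phi v : image J phi v ->
  J (inv_on J phi v) /\ phi (inv_on J phi v) = v.
Proof. intros H. exact (epsilon_spec (inhabits 0) (fun y => J y /\ phi y = v) H). Qed.

Section Inverse.
Variables (a b : R) (phi : R -> R).
Hypothesis D : forall x, Ioo a b x -> ex_derive phi x.
Hypothesis P : forall x, Ioo a b x -> 0 < Derive phi x.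

Lemma inv_on_left y : Ioo a b y -> inv_on (Ioo a b) phi (phi y) = y.
Proof.
intros Jy. destruct (inv_on_spec (Ioo a b) phi (phi y)) as [H1 H2].
- exists y; auto.
- apply (increasing_inj phi (Ioo a b)); auto. now apply deriv_pos_increasing.
Qed.

(** The values at [y0 - e] and [y0 + e] enclose [phi y0]; this yields both the openness
    of the image and the continuity of the inverse. *)
Lemma inverse_near y0 e : Ioo a b y0 -> 0 < e -> exists d, 0 < d /\
  forall v, Rabs (v - phi y0) < d -> exists y, Ioo a b y /\ phi y = v /\ Rabs (y - y0) < e.
Proof.
intros [J1 J2] He.
set (e' := Rmin (e / 2) (Rmin ((y0 - a) / 2) ((b - y0) / 2))).
assert (He' : 0 < e' /\ e' < e /\ e' < y0 - a /\ e' < b - y0).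
{ unfold e', Rmin. repeat destruct Rle_dec; lra. }
clearbody e'.
assert (I1 : Ioo a b (y0 - e')) by (split; lra).
assert (I2 : Ioo a b (y0 + e')) by (split; lra).
assert (I0 : Ioo a b y0) by (split; lra).
assert (M1 := deriv_pos_increasing phi a b D P _ _ I1 I0 ltac:(lra)).
assert (M2 := deriv_pos_increasing phi a b D P _ _ I0 I2 ltac:(lra)).
exists (Rmin (phi y0 - phi (y0 - e')) (phi (y0 + e') - phi y0)). split.
- apply Rmin_case; lra.
- intros v Hv.
  assert (Hv1 := Rlt_le_trans _ _ _ Hv (Rmin_l _ _)).
  assert (Hv2 := Rlt_le_trans _ _ _ Hv (Rmin_r _ _)).
  apply Rabs_def2 in Hv1; apply Rabs_def2 in Hv2.
  destruct (ivt phi (y0 - e') (y0 + e') v) as [y [Hy E]]; try lra.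
  + intros x Hx. apply (ex_derive_continuous phi x), D; split; lra.
  + exists y; repeat split; try lra. apply Rabs_def1; lra.
Qed.

Lemma open_image : open (image (Ioo a b) phi).
Proof.
intros v [y0 [J E]]. destruct (inverse_near y0 1 J Rlt_0_1) as [d [Hd H]].
exists (mkposreal d Hd). intros v' Hv'.
destruct (H v') as [y [Jy [Ey _]]].
- rewrite E. exact Hv'.
- exists y; auto.
Qed.

Lemma inv_on_continuous v : image (Ioo a b) phi v ->
  continuous (inv_on (Ioo a b) phi) v.
Proof.
intros [y0 [J E]]. subst v. apply filterlim_locally. intros eps.
destruct (inverse_near y0 eps J (cond_pos eps)) as [d [Hd H]].
exists (mkposreal d Hd). intros v' Hv'.
destruct (H v') as [y [Jy [Ey Ly]]]; [exact Hv'|].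
rewrite <- Ey, !inv_on_left by auto. exact Ly.
Qed.

Lemma inv_on_derive v : image (Ioo a b) phi v ->
  is_derive (inv_on (Ioo a b) phi) v (/ Derive phi (inv_on (Ioo a b) phi v)).
Proof.
intros Hv. assert (C := inv_on_continuous v Hv).
destruct Hv as [y0 [J E]]. subst v. rewrite inv_on_left by auto.
apply is_derive_Reals. intros eps Heps.
assert (P0 := P y0 J). set (l := Derive phi y0) in *.
assert (Dl : derivable_pt_lim phi y0 l) by (apply is_derive_Reals, Derive_correct, D, J).
assert (Ci : continuous Rinv l).
{ apply continuous_Rinv; lra. }
destruct (proj1 (filterlim_locally _ _) Ci (mkposreal eps Heps)) as [d1 Hd1].
destruct (Dl d1 (cond_pos d1)) as [d2 Hd2].
destruct (proj1 (filterlim_locally _ _) C d2) as [d3 Hd3].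
destruct (open_image (phi y0)) as [d4 Hd4]; [exists y0; auto|].
assert (Hd : 0 < Rmin d3 d4) by (apply Rmin_case; apply cond_pos).
exists (mkposreal _ Hd). simpl. intros h Hh Lh.
assert (Hb3 : ball (phi y0) d3 (phi y0 + h)).
{ unfold ball; simpl; unfold AbsRing_ball, abs, minus, plus, opp; simpl.
  replace (phi y0 + h + - phi y0) with h by ring.
  eapply Rlt_le_trans; [exact Lh | apply Rmin_l]. }
assert (Hb4 : ball (phi y0) d4 (phi y0 + h)).
{ unfold ball; simpl; unfold AbsRing_ball, abs, minus, plus, opp; simpl.
  replace (phi y0 + h + - phi y0) with h by ring.
  eapply Rlt_le_trans; [exact Lh | apply Rmin_r]. }
destruct (Hd4 _ Hb4) as [y [Jy Ey]].
specialize (Hd3 _ Hb3). rewrite <- Ey in *. rewrite !inv_on_left in * by auto.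
assert (Ne : y - y0 <> 0).
{ intros E0. replace y with y0 in Ey by lra. lra. }
specialize (Hd2 (y - y0) Ne Hd3).
replace (y0 + (y - y0)) with y in Hd2 by ring.
assert (K := Hd1 _ Hd2).
replace h with (phi y - phi y0) in * by lra.
replace ((y - y0) / (phi y - phi y0)) with (/ ((phi y - phi y0) / (y - y0))).
- exact K.
- field; auto.
Qed.

Lemma Ck_inv_on k : Ck k (Ioo a b) phi ->
  Ck k (image (Ioo a b) phi) (inv_on (Ioo a b) phi).
Proof.
assert (O := open_image).
induction k as [|k IH]; intros H.
- intros v Hv; now apply inv_on_continuous.
- apply (Ck_intro k _ _ (fun v => / Derive phi (inv_on (Ioo a b) phi v))); auto.
  + intros v Hv; now apply inv_on_derive.
  + apply (Ck_comp k _ (Ioo a b) (fun y => / Derive phi y)); auto using open_Ioo.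
    * intros v Hv; now apply inv_on_spec.
    * apply Ck_inv; auto using open_Ioo.
      -- intros x Hx; apply Rgt_not_eq, P, Hx.
      -- apply H.
    * apply IH, Ck_S, H.
Qed.
End Inverse.

(** * The cohomological equation over a contraction *)

Section Contraction.
Variables (p rho theta : R) (F : R -> R).
Let B := Ioo (p - rho) (p + rho).
Hypothesis theta01 : 0 <= theta < 1.
Hypothesis Fp : F p = p.
Hypothesis DF : forall x, B x -> ex_derive F x.
Hypothesis F'le : forall x, B x -> Rabs (Derive F x) <= theta.

Lemma open_B : open B.
Proof. apply open_Ioo. Qed.

(** Only closed balls of smaller radius are considered, because continuous data on the
    open ball may be unbounded. *)
Definition bounded_inside (v : R -> R) : Prop :=
  forall s, 0 < s < rho -> exists M, 0 <= M /\ forall x, Rabs (x - p) <= s -> Rabs (v x) <= M.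

Lemma in_ball x s : s < rho -> Rabs (x - p) <= s -> B x.
Proof. intros H1 H2. apply Rabs_le_between in H2. split; lra. Qed.

Lemma ball_inside x : B x -> exists s, 0 < s < rho /\ Rabs (x - p) < s.
Proof.
intros [H1 H2]. exists ((Rabs (x - p) + rho) / 2).
assert (Rabs (x - p) < rho) by (apply Rabs_def1; lra).
generalize (Rabs_pos (x - p)); lra.
Qed.

Lemma contraction_dist x : B x -> Rabs (F x - p) <= theta * Rabs (x - p).
Proof.
intros [Hx1 Hx2]. rewrite <- Fp at 1.
destruct (Rtotal_order x p) as [L|[L|L]].
- destruct (mean_value F x p L) as [c [Hc E]].
  + intros z Hz; apply DF; split; lra.
  + rewrite Rabs_minus_sym, E, Rabs_mult, (Rabs_minus_sym p x).
    apply Rmult_le_compat_r; [apply Rabs_pos|]. apply F'le; split; lra.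
- subst. rewrite !Rminus_diag, Rabs_R0; lra.
- destruct (mean_value F p x L) as [c [Hc E]].
  + intros z Hz; apply DF; split; lra.
  + rewrite E, Rabs_mult.
    apply Rmult_le_compat_r; [apply Rabs_pos|]. apply F'le; split; lra.
Qed.

Lemma contraction_ball x s : s < rho -> Rabs (x - p) <= s -> Rabs (F x - p) <= s.
Proof.
intros H1 H2. generalize (contraction_dist x (in_ball x s H1 H2)) (Rabs_pos (x - p)). nra.
Qed.

Lemma contraction_maps x : B x -> B (F x).
Proof.
intros Hx. destruct (ball_inside x Hx) as [s [Hs1 Hs2]].
apply (in_ball _ s); [lra|]. apply contraction_ball; lra.
Qed.

Lemma continuous_bounded_inside v : Ck 0 B v -> bounded_inside v.
Proof.
intros Hv s Hs.
destruct (continuity_ab_maj (fun x => Rabs (v x)) (p - s) (p + s)) as [m [Hm _]]; [lra| |].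
- intros c Hc. apply continuity_pt_filterlim.
  apply (continuous_comp v Rabs); [apply Hv; split; lra|].
  apply continuous_Rabs.
- exists (Rabs (v m)); split; [apply Rabs_pos|].
  intros x Hx. apply Hm. apply Rabs_le_between in Hx; lra.
Qed.

Fixpoint orbit_term (c v : R -> R) (n : nat) (x : R) : R :=
  match n with O => v x | S n => c x * orbit_term c v n (F x) end.

(** Unrolling [w x = v x + c x * w (F x)] gives this series, which converges
    geometrically when [|c| <= theta < 1]. *)
Definition cohom_sum (c v : R -> R) (x : R) : R := Series (fun n => orbit_term c v n x).

(** The partial sums of the series, in the recursive form that can be differentiated. *)
Fixpoint cohom_approx (c v : R -> R) (n : nat) (x : R) : R :=
  match n with O => 0 | S n => v x + c x * cohom_approx c v n (F x) end.

Lemma orbit_term_bound c v s M : 0 < s < rho ->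
  (forall x, B x -> Rabs (c x) <= theta) ->
  (forall x, Rabs (x - p) <= s -> Rabs (v x) <= M) ->
  forall n x, Rabs (x - p) <= s -> Rabs (orbit_term c v n x) <= M * theta ^ n.
Proof.
intros Hs Hc Hv; induction n as [|n IH]; intros x Hx; simpl.
- rewrite Rmult_1_r; auto.
- rewrite Rabs_mult.
  assert (H1 := IH _ (contraction_ball x s (proj2 Hs) Hx)).
  assert (H2 := Hc x (in_ball x s (proj2 Hs) Hx)).
  replace (M * (theta * theta ^ n)) with (theta * (M * theta ^ n)) by ring.
  apply Rmult_le_compat; auto using Rabs_pos.
Qed.

Lemma ex_series_orbit_term c v x : (forall x, B x -> Rabs (c x) <= theta) ->
  bounded_inside v -> B x -> ex_series (fun n => orbit_term c v n x).
Proof.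
intros Hc Hv Hx. destruct (ball_inside x Hx) as [s [Hs1 Hs2]].
destruct (Hv s Hs1) as [M [HM0 HM]].
apply (ex_series_le (V := R_CompleteNormedModule) _ (fun n => M * theta ^ n)).
- intros n. apply (orbit_term_bound c v s M Hs1 Hc HM n x); lra.
- apply (ex_series_scal_l M (fun n => theta ^ n)).
  apply ex_series_geom. rewrite Rabs_pos_eq; lra.
Qed.

Lemma cohom_sum_eq c v x : (forall x, B x -> Rabs (c x) <= theta) ->
  bounded_inside v -> B x -> cohom_sum c v x = v x + c x * cohom_sum c v (F x).
Proof.
intros Hc Hv Hx. unfold cohom_sum. rewrite Series_incr_1.
- simpl. now rewrite Series_scal_l.
- now apply ex_series_orbit_term.
Qed.

Lemma cohom_sum_bounded c v : (forall x, B x -> Rabs (c x) <= theta) ->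
  bounded_inside v -> bounded_inside (cohom_sum c v).
Proof.
intros Hc Hv s Hs. destruct (Hv s Hs) as [M [HM0 HM]].
assert (G : ex_series (fun n => M * theta ^ n)).
{ apply (ex_series_scal_l M (fun n => theta ^ n)).
  apply ex_series_geom. rewrite Rabs_pos_eq; lra. }
assert (Bd : forall x, Rabs (x - p) <= s -> Rabs (cohom_sum c v x) <= Series (fun n => M * theta ^ n)).
{ intros x Hx. unfold cohom_sum.
  assert (T := orbit_term_bound c v s M Hs Hc HM).
  eapply Rle_trans; [apply Series_Rabs|].
  - apply (ex_series_le (V := R_CompleteNormedModule) _ (fun n => M * theta ^ n)); auto.
    intros n. unfold norm; simpl; unfold abs; simpl. rewrite Rabs_Rabsolu; auto.
  - apply Series_le; auto. intros n; split; auto using Rabs_pos. }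
exists (Series (fun n => M * theta ^ n)). split; [|exact Bd].
eapply Rle_trans; [apply Rabs_pos | apply (Bd p)]. rewrite Rminus_diag, Rabs_R0; lra.
Qed.

Lemma cohom_approx_bound c v w s M : 0 < s < rho ->
  (forall x, B x -> Rabs (c x) <= theta) ->
  (forall x, B x -> w x = v x + c x * w (F x)) ->
  (forall x, Rabs (x - p) <= s -> Rabs (w x) <= M) ->
  forall n x, Rabs (x - p) <= s -> Rabs (cohom_approx c v n x - w x) <= M * theta ^ n.
Proof.
intros Hs Hc Hw HM; induction n as [|n IH]; intros x Hx; simpl.
- rewrite Rmult_1_r, Rminus_0_l, Rabs_Ropp; auto.
- assert (Bx := in_ball x s (proj2 Hs) Hx). rewrite (Hw x Bx).
  replace (_ - _) with (c x * (cohom_approx c v n (F x) - w (F x))) by ring.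
  rewrite Rabs_mult.
  assert (H1 := IH _ (contraction_ball x s (proj2 Hs) Hx)).
  replace (M * (theta * theta ^ n)) with (theta * (M * theta ^ n)) by ring.
  apply Rmult_le_compat; auto using Rabs_pos.
Qed.

(** A solution that is bounded on smaller balls is the uniform limit there of the
    approximations, whatever its origin. *)
Lemma cohom_continuous c v w :
  (forall x, B x -> Rabs (c x) <= theta) -> Ck 0 B c -> Ck 0 B v ->
  bounded_inside w -> (forall x, B x -> w x = v x + c x * w (F x)) -> Ck 0 B w.
Proof.
intros Hc Cc Cv Bw Hw x Bx.
assert (Ca : forall n, Ck 0 B (cohom_approx c v n)).
{ induction n as [|n IH].
  - apply (Ck_const 0 B 0).
  - apply (Ck_plus 0 B v (fun x => c x * cohom_approx c v n (F x))); auto using open_B.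
    apply Ck_mult; auto using open_B.
    apply (Ck_comp 0 B B (cohom_approx c v n)); auto using open_B, contraction_maps.
    intros y By. apply (ex_derive_continuous F y); auto. }
destruct (ball_inside x Bx) as [s [Hs1 Hs2]].
destruct (Bw s Hs1) as [M [HM0 HM]].
assert (A := cohom_approx_bound c v w s M Hs1 Hc Hw HM).
apply filterlim_locally. intros eps.
destruct (pow_lt_1_zero theta) with (y := eps / 4 / (M + 1)) as [n Hn].
{ rewrite Rabs_pos_eq; lra. }
{ apply Rdiv_lt_0_compat; [generalize (cond_pos eps)|]; lra. }
specialize (Hn n (le_n n)). rewrite Rabs_pos_eq in Hn by (apply pow_le; lra).
assert (Hn' : M * theta ^ n <= eps / 4).
{ apply Rlt_div_r in Hn; [|lra]. generalize (pow_le theta n); nra. }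
assert (E2 : 0 < eps / 2) by (generalize (cond_pos eps); lra).
assert (C1 := proj1 (filterlim_locally _ _) (Ca n x Bx) (mkposreal _ E2)).
assert (C2 : locally x (fun y => Rabs (y - p) <= s)).
{ assert (H : 0 < s - Rabs (x - p)) by lra. exists (mkposreal _ H).
  intros y Hy. unfold ball in Hy; simpl in Hy; unfold AbsRing_ball, abs, minus, plus, opp in Hy.
  simpl in Hy. generalize (Rabs_triang (y + - x) (x - p)).
  replace (y + - x + (x - p)) with (y - p) by ring. lra. }
generalize (filter_and _ _ C1 C2). apply filter_imp. intros y [Hy1 Hy2].
unfold ball in *; simpl in *; unfold AbsRing_ball, abs, minus, plus, opp in *; simpl in *.
generalize (A n x ltac:(lra)) (A n y Hy2). intros A1 A2.
apply Rabs_def1; [apply Rabs_def2 in Hy1|apply Rabs_def2 in Hy1];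
apply Rabs_le_between in A1; apply Rabs_le_between in A2; lra.
Qed.

(** Formal differentiation gives for [w'] an equation of the same kind, with multiplier
    [c * F'] and right-hand side [v' + c' * (w o F)]. Its solution [w1] is the uniform
    limit of the derivatives of the approximations to [w], and is therefore the
    derivative of [w]. *)
Lemma cohom_is_derive c v w :
  (forall x, B x -> Rabs (c x) <= theta) -> Ck 1 B c -> Ck 1 B v -> Ck 0 B (Derive F) ->
  bounded_inside w -> (forall x, B x -> w x = v x + c x * w (F x)) ->
  exists w1, bounded_inside w1 /\
  (forall x, B x -> w1 x = (Derive v x + Derive c x * w (F x)) + (c x * Derive F x) * w1 (F x)) /\
  (forall x, B x -> is_derive w x (w1 x)).
Proof.
intros Hc Cc Cv CF Bw Hw.
assert (Cw : Ck 0 B w) by (apply (cohom_continuous c v); auto; apply Ck_S; auto).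
set (V := fun x => Derive v x + Derive c x * w (F x)).
set (c1 := fun x => c x * Derive F x).
assert (Hc1 : forall x, B x -> Rabs (c1 x) <= theta).
{ intros x Bx. unfold c1. rewrite Rabs_mult.
  generalize (Hc x Bx) (F'le x Bx) (Rabs_pos (c x)) (Rabs_pos (Derive F x)). nra. }
assert (CV : Ck 0 B V).
{ apply Ck_plus; auto using open_B; [apply Cv|].
  apply Ck_mult; auto using open_B; [apply Cc|].
  apply (Ck_comp 0 B B); auto using open_B, contraction_maps.
  intros y By. apply (ex_derive_continuous F y); auto. }
assert (BV := continuous_bounded_inside V CV).
set (w1 := cohom_sum c1 V).
assert (Bw1 : bounded_inside w1) by now apply cohom_sum_bounded.
assert (Hw1 : forall x, B x -> w1 x = V x + c1 x * w1 (F x)) by (intros; now apply cohom_sum_eq).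
exists w1. split; [auto|]. split; [exact Hw1|].
assert (Cw1 : Ck 0 B w1).
{ apply (cohom_continuous c1 V); auto. apply Ck_mult; auto using open_B. apply Ck_S; auto. }
pose (wd := fix wd n x := match n with O => 0 | S n =>
   Derive v x + Derive c x * cohom_approx c v n (F x) + c x * Derive F x * wd n (F x) end).
intros x Bx. destruct (ball_inside x Bx) as [s [Hs1 Hs2]].
destruct (Bw s Hs1) as [M [HM0 HM]].
destruct (Bw1 s Hs1) as [M1 [HM10 HM1]].
destruct (continuous_bounded_inside (Derive c) (proj2 Cc) s Hs1) as [Mc [HMc0 HMc]].
assert (A := cohom_approx_bound c v w s M Hs1 Hc Hw HM).
(* The error is of order [n theta^n]; a rate [tau] above [theta] absorbs the factor
   [n]. *)
set (tau := (1 + theta) / 2). set (K := M1 + Mc * M / (tau - theta)).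
assert (Htau : theta < tau < 1) by (unfold tau; lra).
assert (Q0 : 0 <= Mc * M / (tau - theta)) by (apply Rdiv_le_0_compat; nra).
assert (HK : Mc * M <= K * (tau - theta)).
{ unfold K. rewrite Rmult_plus_distr_r. unfold Rdiv at 1.
  rewrite Rmult_assoc, Rinv_l by lra. nra. }
assert (K0 : M1 <= K) by (unfold K; lra).
assert (Ad : forall n y, Rabs (y - p) <= s -> Rabs (wd n y - w1 y) <= K * tau ^ n).
{ induction n as [|n IH]; intros y Hy; simpl wd.
  - rewrite Rminus_0_l, Rabs_Ropp, pow_O, Rmult_1_r. generalize (HM1 y Hy); lra.
  - assert (By := in_ball y s (proj2 Hs1) Hy).
    rewrite (Hw1 y By). unfold V, c1.
    replace (_ - _) with (Derive c y * (cohom_approx c v n (F y) - w (F y))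
       + c y * Derive F y * (wd n (F y) - w1 (F y))) by ring.
    assert (HF := contraction_ball y s (proj2 Hs1) Hy).
    eapply Rle_trans; [apply Rabs_triang|]. rewrite 2!Rabs_mult.
    assert (P1 : Rabs (Derive c y) * Rabs (cohom_approx c v n (F y) - w (F y)) <= Mc * (M * theta ^ n)).
    { apply Rmult_le_compat; auto using Rabs_pos. }
    assert (P2 : Rabs (c y * Derive F y) * Rabs (wd n (F y) - w1 (F y)) <= theta * (K * tau ^ n)).
    { apply Rmult_le_compat; auto using Rabs_pos. apply (Hc1 y By). }
    assert (P3 : theta ^ n <= tau ^ n) by (apply pow_incr; lra).
    assert (P4 : 0 <= tau ^ n) by (apply pow_le; lra).
    simpl pow. assert (P5 : Mc * M * theta ^ n <= Mc * M * tau ^ n) by (apply Rmult_le_compat_l; nra).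
    assert (P6 : Mc * M * tau ^ n <= K * (tau - theta) * tau ^ n) by (apply Rmult_le_compat_r; lra).
    lra. }
apply is_derive_Reals.
assert (s0 : 0 < s) by lra.
apply (derivable_pt_lim_CVU (cohom_approx c v) wd w w1 x p (mkposreal s s0)).
- exact Hs2.
- intros y n Hy. apply is_derive_Reals.
  assert (By : B y). { apply (in_ball y s); [lra|]. apply Rlt_le, Hy. }
  clear Hy. revert y By. induction n as [|n IH]; intros y By; simpl cohom_approx; simpl wd.
  + apply (is_derive_const 0 y).
  + rewrite Rplus_assoc. apply (is_derive_plus v (fun x => c x * cohom_approx c v n (F x))).
    * eapply Ck_deriv; eauto.
    * rewrite Rmult_assoc.
      apply (is_derive_mult c (fun x => cohom_approx c v n (F x))).
      -- eapply Ck_deriv; eauto.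
      -- apply (is_derive_comp (cohom_approx c v n) F).
         ++ apply IH, contraction_maps, By.
         ++ apply Derive_correct, DF, By.
      -- intros; apply Rmult_comm.
- intros y Hy. assert (Hy' : Rabs (y - p) <= s) by (apply Rlt_le, Hy).
  intros eps He.
  destruct (pow_lt_1_zero theta) with (y := eps / (M + 1)) as [N HN].
  { rewrite Rabs_pos_eq; lra. }
  { apply Rdiv_lt_0_compat; lra. }
  exists N. intros n Hn. unfold Rdist. specialize (HN n Hn).
  rewrite Rabs_pos_eq in HN by (apply pow_le; lra). apply Rlt_div_r in HN; [|lra].
  generalize (A n y Hy') (pow_le theta n (proj1 theta01)). nra.
- intros eps He.
  destruct (pow_lt_1_zero tau) with (y := eps / (K + 1)) as [N HN].
  { rewrite Rabs_pos_eq; lra. }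
  { apply Rdiv_lt_0_compat; lra. }
  exists N. intros n y Hn Hy. assert (Hy' : Rabs (y - p) <= s) by (apply Rlt_le, Hy).
  specialize (HN n Hn).
  rewrite Rabs_pos_eq in HN by (apply pow_le; lra). apply Rlt_div_r in HN; [|lra].
  rewrite Rabs_minus_sym.
  generalize (Ad n y Hy'). nra.
- intros y Hy. apply continuity_pt_filterlim, Cw1.
  apply (in_ball y s); [lra|]. apply Rlt_le, Hy.
Qed.

(** The equation satisfied by [w'] has the same form, and so the regularity of the data
    passes to [w] one derivative at a time. *)
Lemma cohom_Ck k : forall c v w,
  (forall x, B x -> Rabs (c x) <= theta) -> Ck k B c -> Ck k B v -> Ck k B (Derive F) ->
  bounded_inside w -> (forall x, B x -> w x = v x + c x * w (F x)) -> Ck k B w.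
Proof.
induction k as [|k IH]; intros c v w Hc Cc Cv CF Bw Hw.
- now apply (cohom_continuous c v).
- assert (C0 : forall h, Ck (S k) B h -> Ck 0 B h) by (intros h; apply Ck_le; lia).
  assert (C1 : forall h, Ck (S k) B h -> Ck 1 B h) by (intros h; apply Ck_le; lia).
  destruct (cohom_is_derive c v w) as [w1 [Bw1 [Hw1 D]]]; auto.
  assert (Cw : Ck k B w) by (apply (IH c v); auto using Ck_S).
  apply (Ck_intro k B w w1); auto using open_B.
  apply (IH (fun x => c x * Derive F x) (fun x => Derive v x + Derive c x * w (F x))); auto using Ck_S.
  + intros x Bx. rewrite Rabs_mult.
    generalize (Hc x Bx) (F'le x Bx) (Rabs_pos (c x)) (Rabs_pos (Derive F x)). nra.
  + apply Ck_mult; auto using open_B, Ck_S.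
  + apply Ck_plus; auto using open_B; [apply Cv|].
    apply Ck_mult; auto using open_B; [apply Cc|].
    apply (Ck_comp k B B); auto using open_B, contraction_maps.
    apply Ck_S. split; auto. now apply Ck_S.
Qed.
End Contraction.

(** * Attracting fixed points and the Koenigs linearization *)

Definition attracting (F : R -> R) (a p b : R) : Prop :=
  a < p < b /\ F p = p /\
  (forall x, Ioo a b x -> continuous F x) /\
  (forall x y, Ioo a b x -> Ioo a b y -> x < y -> F x < F y) /\
  (forall x, a < x < p -> x < F x) /\
  (forall x, p < x < b -> F x < x).

Section Attracting.
Variables (F : R -> R) (a p b : R).
Hypothesis H : attracting F a p b.

Lemma attracting_right x : p < x < b -> p < F x < x.
Proof.
destruct H as [P [Fp [C [M [L Q]]]]]. intros Hx. split; [|apply Q, Hx].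
rewrite <- Fp at 1. apply M; unfold Ioo; lra.
Qed.

Lemma attracting_left x : a < x < p -> x < F x < p.
Proof.
destruct H as [P [Fp [C [M [L Q]]]]]. intros Hx. split; [apply L, Hx|].
rewrite <- Fp. apply M; unfold Ioo; lra.
Qed.

Lemma attracting_maps x : Ioo a b x -> Ioo a b (F x).
Proof.
assert (P := proj1 H). assert (Fp := proj1 (proj2 H)).
intros [H1 H2]. unfold Ioo. destruct (Rtotal_order x p) as [E|[E|E]].
- generalize (attracting_left x); lra.
- subst; lra.
- generalize (attracting_right x); lra.
Qed.

Lemma attracting_iter_maps x n : Ioo a b x -> Ioo a b (Nat.iter n F x).
Proof. intros Hx; induction n; simpl; auto using attracting_maps. Qed.

Lemma attracting_iter_right x n : p < x < b ->
  p < Nat.iter n F x <= x /\ Nat.iter (S n) F x < Nat.iter n F x.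
Proof.
intros Hx. assert (A : p < Nat.iter n F x <= x).
{ induction n as [|n IH]; simpl; [lra|].
  generalize (attracting_right (Nat.iter n F x)); lra. }
split; [exact A|]. simpl. apply attracting_right; lra.
Qed.

Lemma attracting_iter_left x n : a < x < p ->
  x <= Nat.iter n F x < p /\ Nat.iter n F x < Nat.iter (S n) F x.
Proof.
intros Hx. assert (A : x <= Nat.iter n F x < p).
{ induction n as [|n IH]; simpl; [lra|].
  generalize (attracting_left (Nat.iter n F x)); lra. }
split; [exact A|]. simpl. apply attracting_left; lra.
Qed.

(** Orbits are monotone and bounded, and a limit inside the interval is a fixed
    point. *)
Lemma attracting_iter_lim x : Ioo a b x -> is_lim_seq (fun n => Nat.iter n F x) p.
Proof.
destruct H as [P [Fp [C [M [L Q]]]]]. intros [H1 H2].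
set (u := fun n => Nat.iter n F x).
assert (K : forall l : R, is_lim_seq u l -> Ioo a b l -> F l = l).
{ intros l Hl Il.
  assert (U : is_lim_seq (fun n => F (u n)) (F l)).
  { apply is_lim_seq_continuous; auto. apply continuity_pt_filterlim, C, Il. }
  apply is_lim_seq_incr_1 in Hl.
  apply is_lim_seq_unique in Hl. apply is_lim_seq_unique in U.
  assert (E : Lim_seq (fun n => u (S n)) = Lim_seq (fun n => F (u n))) by (apply Lim_seq_ext; reflexivity).
  rewrite Hl, U in E. now injection E. }
destruct (Rtotal_order x p) as [E|[E|E]].
- destruct (ex_finite_lim_seq_incr u p) as [l Hl].
  + intros n. left. apply attracting_iter_left; lra.
  + intros n. left. apply attracting_iter_left; lra.
  + assert (l <= p).
    { apply (is_lim_seq_le u (fun _ => p) l p); auto using is_lim_seq_const.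
      intros n; left; apply attracting_iter_left; lra. }
    assert (x <= l).
    { apply (is_lim_seq_le (fun _ => x) u x l); auto using is_lim_seq_const.
      intros n; apply attracting_iter_left; lra. }
    assert (El : F l = l) by (apply K; auto; split; lra).
    destruct (Req_dec l p) as [->|N]; auto. generalize (L l); lra.
- subst x. apply (is_lim_seq_ext (fun _ => p)); [|apply is_lim_seq_const].
  intros n; induction n; simpl; auto. unfold u in *; simpl. now rewrite <- IHn.
- destruct (ex_finite_lim_seq_decr u p) as [l Hl].
  + intros n. left. apply attracting_iter_right; lra.
  + intros n. left. apply attracting_iter_right; lra.
  + assert (p <= l).
    { apply (is_lim_seq_le (fun _ => p) u p l); auto using is_lim_seq_const.
      intros n; left; apply attracting_iter_right; lra. }
    assert (l <= x).
    { apply (is_lim_seq_le u (fun _ => x) l x); auto using is_lim_seq_const.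
      intros n; apply attracting_iter_right; lra. }
    assert (El : F l = l) by (apply K; auto; split; lra).
    destruct (Req_dec l p) as [->|N]; auto. generalize (Q l); lra.
Qed.
End Attracting.

Lemma exists_antiderivative (f : R -> R) a b p : Ioo a b p ->
  (forall x, Ioo a b x -> continuous f x) ->
  exists G, G p = 0 /\ forall x, Ioo a b x -> is_derive G x (f x).
Proof.
intros Hp Cf. exists (RInt f p). split; [exact (RInt_point p f)|].
intros x Hx. apply (is_derive_RInt f (RInt f p) p x).
- generalize (open_locally (Ioo a b) x (open_Ioo a b) Hx). apply filter_imp.
  intros y Hy. apply (RInt_correct (V := R_CompleteNormedModule) f p y).
  apply (ex_RInt_continuous (V := R_CompleteNormedModule) f). intros z Hz. apply Cf.
  unfold Ioo, Rmin, Rmax in *. destruct Rle_dec in Hz; lra.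
- apply Cf, Hx.
Qed.

Lemma derive_zero_constant f a b : (forall x, Ioo a b x -> is_derive f x 0) ->
  forall x y, Ioo a b x -> Ioo a b y -> f x = f y.
Proof.
intros D. assert (K : forall x y, Ioo a b x -> Ioo a b y -> x < y -> f x = f y).
{ intros x y Hx Hy xy. destruct (mean_value f x y xy) as [c [Hc E]].
  - intros z Hz; exists 0; apply D; unfold Ioo in *; lra.
  - rewrite (is_derive_unique f c 0) in E by (apply D; unfold Ioo in *; lra). lra. }
intros x y Hx Hy. destruct (Rtotal_order x y) as [E|[E|E]]; auto.
- now subst.
- symmetry; auto.
Qed.

Lemma locally_ball_lt (p : R) (P : R -> Prop) : locally p P ->
  exists d, 0 < d /\ forall x, Rabs (x - p) < d -> P x.
Proof. intros [d Hd]. exists d. split; [apply cond_pos|]. exact Hd. Qed.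

Lemma iter_Ck k (U : R -> Prop) F n : open U -> (forall x, U x -> U (F x)) ->
  Ck k U F -> Ck k U (Nat.iter n F).
Proof.
intros oU HU CF. induction n as [|n IH]; simpl.
- apply Ck_id.
- apply (Ck_comp k U U F); auto. clear IH. intros x Ux; induction n; simpl; auto.
Qed.

Section Koenigs.
Variables (k : nat) (F : R -> R) (a p b m : R).
Hypothesis At : attracting F a p b.
Hypothesis CF : Ck (S (S k)) (Ioo a b) F.
Hypothesis F'pos : forall x, Ioo a b x -> 0 < Derive F x.
Hypothesis F'p : Derive F p = m.
Hypothesis m1 : m < 1.

(** Write [phi' = exp w]. The logarithm of [phi'(F) * F' = m * phi'] is an equation for
    [w], and its derivative is the cohomological equation [W = F''/F' + F' * (W o F)]
    for [W = w'], whose multiplier [F'] is at most [theta < 1] near [p]. Solving for [W]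
    and integrating twice, no derivative is lost. *)
Lemma koenigs_local : exists rho phi, 0 < rho /\
  (forall x, Ioo (p - rho) (p + rho) x -> Ioo a b x /\ Ioo (p - rho) (p + rho) (F x)) /\
  Ck (S (S k)) (Ioo (p - rho) (p + rho)) phi /\
  (forall x, Ioo (p - rho) (p + rho) x -> 0 < Derive phi x) /\
  phi p = 0 /\ Derive phi p = 1 /\
  forall x, Ioo (p - rho) (p + rho) x -> phi (F x) = m * phi x.
Proof.
assert (Hp : Ioo a b p) by apply At.
assert (Fp : F p = p) by apply At.
assert (m0 : 0 < m) by (rewrite <- F'p; auto).
set (theta := (1 + m) / 2).
assert (Ht : 0 <= theta < 1) by (unfold theta; lra).
assert (CF' : Ck (S k) (Ioo a b) (Derive F)) by apply CF.
assert (L : locally p (fun x => Ioo a b x /\ Derive F x < theta)).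
{ apply filter_and; [apply open_locally; auto using open_Ioo|].
  apply (Ck_continuous _ _ _ _ CF' Hp (fun y => y < theta)).
  apply (open_lt theta). rewrite F'p. unfold theta; lra. }
destruct (locally_ball_lt p _ L) as [rho [rho0 Hrho]].
set (B := Ioo (p - rho) (p + rho)).
assert (HB : forall x, B x -> Ioo a b x /\ Derive F x < theta).
{ intros x [B1 B2]. apply Hrho. apply Rabs_def1; lra. }
assert (Bp : B p) by (unfold B, Ioo; lra).
assert (oB : open B) by apply open_Ioo.
assert (DF : forall x, B x -> ex_derive F x) by (intros x Bx; apply CF, HB, Bx).
assert (F'le : forall x, B x -> Rabs (Derive F x) <= theta).
{ intros x Bx. destruct (HB x Bx) as [I1 I2]. rewrite Rabs_pos_eq; [lra|]. left; auto. }
assert (BF : forall x, B x -> B (F x)) by (apply (contraction_maps p rho theta F); auto).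
assert (F'posB : forall x, B x -> 0 < Derive F x) by (intros x Bx; apply F'pos, HB, Bx).
assert (CFB : Ck (S (S k)) B F) by (apply (Ck_sub _ (Ioo a b)); auto; intros x Bx; apply HB, Bx).
assert (CF'B : Ck (S k) B (Derive F)) by apply CFB.
set (v := fun x => Derive (Derive F) x * / Derive F x).
assert (Cv : Ck k B v).
{ apply Ck_mult; auto; [apply CF'B|]. apply Ck_inv; auto using Ck_S.
  intros x Bx; apply Rgt_not_eq, F'posB, Bx. }
assert (Bv : bounded_inside p rho v).
{ apply continuous_bounded_inside, (Ck_le 0 k); auto; lia. }
set (W := cohom_sum F (Derive F) v).
assert (EW : forall x, B x -> W x = v x + Derive F x * W (F x)).
{ intros x Bx. apply (cohom_sum_eq p rho theta F); auto. }
assert (CW : Ck k B W).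
{ apply (cohom_Ck p rho theta F) with (c := Derive F) (v := v); auto using Ck_S.
  apply (cohom_sum_bounded p rho theta F); auto. }
destruct (exists_antiderivative W (p - rho) (p + rho) p Bp) as [w [wp Dw]].
{ intros x Bx. apply (Ck_continuous k B); auto. }
assert (Cw : Ck (S k) B w) by (apply (Ck_intro k B w W); auto).
assert (Cew : Ck (S k) B (fun x => exp (w x))).
{ apply (Ck_comp (S k) B (fun _ => True) exp w); auto using open_true, Ck_exp. }
destruct (exists_antiderivative (fun x => exp (w x)) (p - rho) (p + rho) p Bp) as [phi [phip Dphi]].
{ intros x Bx. apply (Ck_continuous (S k) B (fun x => exp (w x))); auto. }
assert (Ew : forall x, B x -> exp (w (F x)) * Derive F x = m * exp (w x)).
{ intros x Bx.
  assert (E : exp (w (F x)) * Derive F x * exp (- w x) = exp (w (F p)) * Derive F p * exp (- w p)).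
  { apply (derive_zero_constant (fun x => exp (w (F x)) * Derive F x * exp (- w x)) (p - rho) (p + rho)); auto.
    intros z Bz. assert (P0 := F'posB z Bz).
    assert (D1 : is_derive (fun x => exp (w (F x))) z (Derive F z * W (F z) * exp (w (F z)))).
    { apply (is_derive_comp exp (fun x => w (F x))); [apply is_derive_exp|].
      apply (is_derive_comp w F); [apply Dw, BF, Bz | apply Derive_correct, DF, Bz]. }
    assert (D2 : is_derive (Derive F) z (Derive (Derive F) z)) by (apply Derive_correct, CF'B, Bz).
    assert (D3 : is_derive (fun x => exp (- w x)) z (- W z * exp (- w z))).
    { apply (is_derive_comp exp (fun x => - w x)); [apply is_derive_exp|].
      apply (is_derive_opp w), Dw, Bz. }
    assert (D4 := is_derive_mult _ _ _ _ _ (is_derive_mult _ _ _ _ _ D1 D2 Rmult_comm) D3 Rmult_comm).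
    eapply eq_ind; [exact D4|]. unfold plus, mult; simpl. rewrite (EW z Bz). unfold v.
    field. lra. }
  rewrite Fp, F'p, wp, Ropp_0, exp_0 in E.
  replace (exp (w (F x)) * Derive F x) with (exp (w (F x)) * Derive F x * exp (- w x) * exp (w x)).
  - rewrite E; ring.
  - rewrite (Rmult_assoc _ (exp (- w x))), <- exp_plus, Rplus_opp_l, exp_0; ring. }
assert (D' : forall x, B x -> Derive phi x = exp (w x)).
{ intros x Bx; apply is_derive_unique, Dphi, Bx. }
exists rho, phi. split; [exact rho0|]. split; [|split; [|split; [|split; [|split]]]]; auto.
- intros x Bx; split; [apply HB, Bx | apply BF, Bx].
- apply (Ck_intro (S k) B phi (fun x => exp (w x))); auto.
- intros x Bx. rewrite D' by auto. apply exp_pos.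
- rewrite D', wp, exp_0; auto.
- intros x Bx.
  assert (E : phi (F x) - m * phi x = phi (F p) - m * phi p).
  { apply (derive_zero_constant (fun x => phi (F x) - m * phi x) (p - rho) (p + rho)); auto.
    intros z Bz.
    assert (D1 : is_derive (fun x => phi (F x)) z (Derive F z * exp (w (F z)))).
    { apply (is_derive_comp phi F); [apply Dphi, BF, Bz | apply Derive_correct, DF, Bz]. }
    assert (D2 : is_derive (fun x => m * phi x) z (m * exp (w z))).
    { apply is_derive_scal, Dphi, Bz. }
    assert (D3 := is_derive_minus _ _ _ _ _ D1 D2).
    eapply eq_ind; [exact D3|]. unfold minus, plus, opp; simpl. rewrite <- (Ew z Bz); ring. }
  rewrite Fp, phip in E. lra.
Qed.

(** Every orbit enters the ball on which the local linearization [phi0] is defined, and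
    from then on [phi0 (F^n x) / m^n] does not depend on [n]. So the limit is locally
    given by a fixed [n] and has the regularity of [phi0] and [F]. *)
Theorem koenigs : exists phi,
  Ck (S (S k)) (Ioo a b) phi /\
  (forall x, Ioo a b x -> 0 < Derive phi x) /\
  phi p = 0 /\ Derive phi p = 1 /\
  forall x, Ioo a b x -> phi (F x) = m * phi x.
Proof.
assert (Hp : Ioo a b p) by apply At.
assert (m0 : 0 < m) by (rewrite <- F'p; auto).
destruct koenigs_local as [rho [phi0 [rho0 [HB [C0 [P0 [Z0 [O0 E0]]]]]]]].
set (B := Ioo (p - rho) (p + rho)) in *.
assert (Bp : B p) by (unfold B, Ioo; lra).
set (phi := fun x => real (Lim_seq (fun n => phi0 (Nat.iter n F x) / m ^ n))).
assert (St : forall x n, B (Nat.iter n F x) -> phi x = phi0 (Nat.iter n F x) / m ^ n).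
{ intros x n Hn. unfold phi.
  rewrite (Lim_seq_ext_loc _ (fun _ => phi0 (Nat.iter n F x) / m ^ n)); [now rewrite Lim_seq_const|].
  exists n. intros j Hj.
  assert (K : B (Nat.iter j F x) /\ phi0 (Nat.iter j F x) / m ^ j = phi0 (Nat.iter n F x) / m ^ n); [|apply K].
  induction Hj as [|j Hj [IH1 IH2]]; [auto|]. simpl. split; [apply HB, IH1|].
  rewrite <- IH2, E0 by auto. field. split; [apply pow_nonzero|]; lra. }
assert (Ev : forall x, Ioo a b x -> exists n, B (Nat.iter n F x)).
{ intros x Hx. assert (L := attracting_iter_lim F a p b At x Hx).
  apply is_lim_seq_spec in L. destruct (L (mkposreal rho rho0)) as [n Hn].
  exists n. specialize (Hn n (le_n n)). simpl in Hn. apply Rabs_def2 in Hn. unfold B, Ioo; lra. }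
assert (CI : forall n, Ck (S (S k)) (Ioo a b) (Nat.iter n F)).
{ intros n. apply iter_Ck; auto using open_Ioo. apply (attracting_maps F a p b At). }
assert (Loc : forall x, Ioo a b x -> exists n (V : R -> Prop), V x /\ open V /\ (forall y, V y -> Ioo a b y /\ B (Nat.iter n F y))
   /\ forall y, V y -> phi0 (Nat.iter n F y) * / m ^ n = phi y).
{ intros x Hx. destruct (Ev x Hx) as [n Hn].
  assert (L : locally x (fun y => Ioo a b y /\ B (Nat.iter n F y))).
  { apply filter_and; [apply open_locally; auto using open_Ioo|].
    apply (Ck_continuous _ _ _ _ (CI n) Hx B). apply open_locally; auto. apply open_Ioo. }
  destruct (locally_ball_lt x _ L) as [d [d0 Hd]].
  assert (HV : forall y, Ioo (x - d) (x + d) y -> Ioo a b y /\ B (Nat.iter n F y)).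
  { intros y [Y1 Y2]; apply Hd. apply Rabs_def1; lra. }
  exists n, (Ioo (x - d) (x + d)).
  split; [unfold Ioo; lra|]. split; [apply open_Ioo|]. split; [exact HV|].
  intros y Hy. symmetry; apply St, HV, Hy. }
assert (Cphi : Ck (S (S k)) (Ioo a b) phi).
{ apply Ck_local. intros x Hx. destruct (Loc x Hx) as [n [V [Vx [oV [HV EV]]]]].
  exists V; split; auto. apply (Ck_ext _ V (fun y => phi0 (Nat.iter n F y) * / m ^ n)); auto.
  apply Ck_mult; auto using Ck_const.
  apply (Ck_comp _ V B phi0); auto.
  - apply open_Ioo.
  - intros y Hy; apply HV, Hy.
  - apply (Ck_sub _ (Ioo a b)); auto. intros y Hy; apply HV, Hy. }
assert (I'pos : forall n x, Ioo a b x -> 0 < Derive (Nat.iter n F) x).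
{ induction n as [|n IH]; intros x Hx; simpl.
  - rewrite Derive_id; lra.
  - rewrite (Derive_comp F (Nat.iter n F)).
    + apply Rmult_lt_0_compat; [apply IH, Hx|]. apply F'pos, (attracting_iter_maps F a p b At), Hx.
    + apply CF, (attracting_iter_maps F a p b At), Hx.
    + apply (CI n), Hx. }
assert (Ep : forall x, B x -> phi x = phi0 x).
{ intros x Bx. rewrite (St x 0%nat Bx). simpl. field. }
exists phi. split; [exact Cphi|]. split; [|split; [|split]].
- intros x Hx. destruct (Loc x Hx) as [n [V [Vx [oV [HV EV]]]]].
  rewrite <- (Derive_ext_loc (fun y => phi0 (Nat.iter n F y) * / m ^ n)).
  + rewrite Derive_scal_l. apply Rmult_lt_0_compat; [|apply Rinv_0_lt_compat, pow_lt, m0].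
    rewrite (Derive_comp phi0 (Nat.iter n F)).
    * apply Rmult_lt_0_compat; [apply I'pos, Hx|]. apply P0, HV, Vx.
    * apply C0, HV, Vx.
    * apply (CI n), Hx.
  + generalize (open_locally V x oV Vx). apply filter_imp. auto.
- rewrite Ep; auto.
- rewrite (Derive_ext_loc _ phi0); auto.
  generalize (open_locally B p (open_Ioo _ _) Bp). apply filter_imp. auto.
- intros x Hx. destruct (Ev (F x)) as [n Hn]; [now apply (attracting_maps F a p b At)|].
  rewrite (St (F x) n Hn). rewrite <- Nat.iter_succ_r in *.
  rewrite (St x (S n) Hn). simpl pow. field. split; [apply pow_nonzero|]; lra.
Qed.
End Koenigs.

(** * Conjugacies built from linearizations *)

Lemma C_on_iff s (U V : R -> Prop) h : (forall x, U x <-> V x) -> C_on s U h -> C_on s V h.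
Proof. intros E H x Vx; apply H, E, Vx. Qed.

Lemma C_conjugacy_iff s F (U U' : R -> Prop) G (V V' : R -> Prop) h :
  (forall x, U x <-> U' x) -> (forall x, V x <-> V' x) ->
  C_conjugacy s F U G V h -> C_conjugacy s F U' G V' h.
Proof.
intros EU EV [[oU [oV [CU [k [CV [H1 H2]]]]]] Hc]. split; [split|].
- apply (open_ext U); auto.
- split; [apply (open_ext V); auto|]. split; [apply (C_on_iff s U); auto|].
  exists k. split; [apply (C_on_iff s V); auto|]. split.
  + intros x Ux. destruct (H1 x (proj2 (EU x) Ux)) as [K1 K2]. split; auto. apply EV, K1.
  + intros y Vy. destruct (H2 y (proj2 (EV y) Vy)) as [K1 K2]. split; auto. apply EU, K1.
- intros x Ux UF. apply Hc; apply EU; auto.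
Qed.

Section ConjugacyFromLinearizations.
Variables (k : nat) (F G : R -> R) (a b a' b' p q m lam : R) (phi psi : R -> R).
Let I := Ioo a b.
Let J := Ioo a' b'.
Hypothesis Ip : I p.
Hypothesis Jq : J q.
Hypothesis GJ : forall y, J y -> J (G y).
Hypothesis Cphi : Ck (S k) I phi.
Hypothesis Cpsi : Ck (S k) J psi.
Hypothesis phi'pos : forall x, I x -> 0 < Derive phi x.
Hypothesis psi'pos : forall y, J y -> 0 < Derive psi y.
Hypothesis phip : phi p = 0.
Hypothesis psiq : psi q = 0.
Hypothesis Ephi : forall x, I x -> phi (F x) = m * phi x.
Hypothesis Epsi : forall y, J y -> psi (G y) = m * psi y.
Hypothesis lam0 : lam <> 0.
Hypothesis images : forall v, image I phi v <-> image J psi (lam * v).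

(** In the linearizing coordinates both maps are multiplication by [m], which commutes
    with multiplication by [lam]; hence [h = psi^-1 (lam * phi)]. *)
Lemma conjugacy_from_linearizations : exists h, h p = q /\ C_conjugacy (S k) F I G J h.
Proof.
assert (oI : open I) by apply open_Ioo.
assert (oJ : open J) by apply open_Ioo.
assert (Dphi : forall x, I x -> ex_derive phi x) by apply Cphi.
assert (Dpsi : forall x, J x -> ex_derive psi x) by apply Cpsi.
assert (IL : forall x, I x -> inv_on I phi (phi x) = x) by (apply inv_on_left; auto).
assert (JL : forall y, J y -> inv_on J psi (psi y) = y) by (apply inv_on_left; auto).
assert (oIm : open (image I phi)) by (apply open_image; auto).
assert (oJm : open (image J psi)) by (apply open_image; auto).
assert (im1 : forall x, I x -> image J psi (lam * phi x)).
{ intros x Ix. apply images. exists x; auto. }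
assert (im2 : forall y, J y -> image I phi (/ lam * psi y)).
{ intros y Jy. apply images. exists y. split; auto. field; auto. }
exists (fun x => inv_on J psi (lam * phi x)). split.
{ rewrite phip, Rmult_0_r, <- psiq. auto. }
split.
- split; [exact oI|]. split; [exact oJ|]. split.
  + apply Ck_C_on; auto.
    apply (Ck_comp _ I (image J psi) (inv_on J psi) (fun x => lam * phi x)); auto.
    * apply Ck_inv_on; auto.
    * apply Ck_scal; auto.
  + exists (fun y => inv_on I phi (/ lam * psi y)). split; [|split].
    * apply Ck_C_on; auto.
      apply (Ck_comp _ J (image I phi) (inv_on I phi) (fun y => / lam * psi y)); auto.
      -- apply Ck_inv_on; auto.
      -- apply Ck_scal; auto.
    * intros x Ix. destruct (inv_on_spec J psi _ (im1 x Ix)) as [H1 H2]. split; auto.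
      rewrite H2, <- Rmult_assoc, Rinv_l, Rmult_1_l; auto.
    * intros y Jy. destruct (inv_on_spec I phi _ (im2 y Jy)) as [H1 H2]. split; auto.
      rewrite H2, <- Rmult_assoc, Rinv_r, Rmult_1_l; auto.
- intros x Ix IFx. rewrite Ephi by auto.
  destruct (inv_on_spec J psi _ (im1 x Ix)) as [H1 H2].
  rewrite <- (JL (G (inv_on J psi (lam * phi x)))) by auto.
  rewrite Epsi, H2 by auto. f_equal. ring.
Qed.
End ConjugacyFromLinearizations.

Section Images.
Variables (phi : R -> R) (a b : R).
Hypothesis D : forall x, Ioo a b x -> ex_derive phi x.
Hypothesis P : forall x, Ioo a b x -> 0 < Derive phi x.

Let mono := deriv_pos_increasing phi a b D P.
Let cont x (Hx : Ioo a b x) : continuous phi x := ex_derive_continuous phi x (D x Hx).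

Lemma image_bounded c d v : a < c -> c < d -> d < b ->
  image (Ioo c d) phi v <-> phi c < v < phi d.
Proof.
intros ac cd db. split.
- intros [x [[X1 X2] E]]. rewrite <- E. split; apply mono; unfold Ioo; lra.
- intros [V1 V2]. destruct (ivt phi c d v) as [x [Hx E]]; try lra.
  + intros x Hx; apply cont; unfold Ioo; lra.
  + exists x. split; auto.
    assert (x <> c) by (intros ->; lra). assert (x <> d) by (intros ->; lra).
    unfold Ioo; lra.
Qed.

Lemma image_unbounded_left d v :
  (forall w, exists x, Ioo a b x /\ phi x < w) -> a < d < b ->
  image (Ioo a d) phi v <-> v < phi d.
Proof.
intros Hu ad. split.
- intros [x [[X1 X2] E]]. rewrite <- E. apply mono; unfold Ioo; lra.
- intros V. destruct (Hu v) as [x [[X1 X2] E]].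
  assert (xd : x < d).
  { apply (increasing_lt_inv phi (Ioo a b)); auto; unfold Ioo; lra. }
  destruct (proj2 (image_bounded x d v X1 xd (proj2 ad))) as [z [Hz Ez]]; [lra|].
  exists z; split; auto. unfold Ioo in *; lra.
Qed.

Lemma image_unbounded_right c v :
  (forall w, exists x, Ioo a b x /\ w < phi x) -> a < c < b ->
  image (Ioo c b) phi v <-> phi c < v.
Proof.
intros Hu ac. split.
- intros [x [[X1 X2] E]]. rewrite <- E. apply mono; unfold Ioo; lra.
- intros V. destruct (Hu v) as [x [[X1 X2] E]].
  assert (cx : c < x).
  { apply (increasing_lt_inv phi (Ioo a b)); auto; unfold Ioo; lra. }
  destruct (proj2 (image_bounded c x v (proj1 ac) cx X2)) as [z [Hz Ez]]; [lra|].
  exists z; split; auto. unfold Ioo in *; lra.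
Qed.

Lemma image_unbounded v :
  (forall w, exists x, Ioo a b x /\ phi x < w) ->
  (forall w, exists x, Ioo a b x /\ w < phi x) -> image (Ioo a b) phi v.
Proof.
intros H1 H2. destruct (H1 v) as [x [Hx Ex]]. destruct (H2 v) as [y [Hy Ey]].
assert (xy : x < y) by (apply (increasing_lt_inv phi (Ioo a b)); auto; lra).
destruct (proj2 (image_bounded x y v (proj1 Hx) xy (proj2 Hy))) as [z [Hz Ez]]; [lra|].
exists z; split; auto. unfold Ioo in *; lra.
Qed.
End Images.

Lemma geometric_large m w c : 0 < m < 1 -> 0 < c -> exists n, w < c / m ^ n.
Proof.
intros Hm Hc. destruct (pow_lt_1_zero m) with (y := c / (Rabs w + 1)) as [n Hn].
- rewrite Rabs_pos_eq; lra.
- apply Rdiv_lt_0_compat; generalize (Rabs_pos w); lra.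
- exists n. specialize (Hn n (le_n n)).
  assert (P0 : 0 < m ^ n) by (apply pow_lt; lra).
  rewrite Rabs_pos_eq in Hn by lra.
  apply Rlt_div_r in Hn; [|generalize (Rabs_pos w); lra].
  apply Rlt_div_r; auto. generalize (Rle_abs w); nra.
Qed.

Section Unbounded.
Variables (F phi : R -> R) (a p b m : R).
Hypothesis At : attracting F a p b.
Hypothesis D : forall x, Ioo a b x -> ex_derive phi x.
Hypothesis P : forall x, Ioo a b x -> 0 < Derive phi x.
Hypothesis phip : phi p = 0.
Hypothesis E : forall x, Ioo a b x -> phi (F x) = m * phi x.
Hypothesis Hm : 0 < m < 1.

(** Backward orbits stay inside a basin that reaches up to a neighbouring fixed point,
    and each backward step divides the linearizing coordinate by [m]. *)
Lemma koenigs_unbounded_left : (forall y, a < y < p -> exists x, a < x < p /\ F x = y) ->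
  forall w, exists x, Ioo a b x /\ phi x < w.
Proof.
intros S w. destruct At as [apb _].
set (y0 := (a + p) / 2).
assert (Y0 : phi y0 < 0).
{ rewrite <- phip. apply (deriv_pos_increasing phi a b D P); unfold Ioo, y0; lra. }
destruct (geometric_large m (- w) (- phi y0) Hm) as [n Hn]; [lra|].
assert (K : exists x, a < x < p /\ phi x = phi y0 / m ^ n).
{ clear Hn. induction n as [|n [x [Hx IH]]].
  - exists y0. split; [unfold y0; lra|]. simpl; field.
  - destruct (S x Hx) as [z [Hz Ez]]. exists z; split; auto.
    assert (Ez' := E z ltac:(unfold Ioo; lra)). rewrite Ez, IH in Ez'.
    apply (Rmult_eq_reg_l m); [|lra]. rewrite <- Ez'. simpl. field.
    split; [apply pow_nonzero|]; lra. }
destruct K as [x [Hx Ex]]. exists x. split; [unfold Ioo; lra|].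
rewrite Ex. unfold Rdiv in *. lra.
Qed.

Lemma koenigs_unbounded_right : (forall y, p < y < b -> exists x, p < x < b /\ F x = y) ->
  forall w, exists x, Ioo a b x /\ w < phi x.
Proof.
intros S w. destruct At as [apb _].
set (y0 := (p + b) / 2).
assert (Y0 : 0 < phi y0).
{ rewrite <- phip. apply (deriv_pos_increasing phi a b D P); unfold Ioo, y0; lra. }
destruct (geometric_large m w (phi y0) Hm) as [n Hn]; [lra|].
assert (K : exists x, p < x < b /\ phi x = phi y0 / m ^ n).
{ clear Hn. induction n as [|n [x [Hx IH]]].
  - exists y0. split; [unfold y0; lra|]. simpl; field.
  - destruct (S x Hx) as [z [Hz Ez]]. exists z; split; auto.
    assert (Ez' := E z ltac:(unfold Ioo; lra)). rewrite Ez, IH in Ez'.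
    apply (Rmult_eq_reg_l m); [|lra]. rewrite <- Ez'. simpl. field.
    split; [apply pow_nonzero|]; lra. }
destruct K as [x [Hx Ex]]. exists x. split; [unfold Ioo; lra|].
rewrite Ex. exact Hn.
Qed.
End Unbounded.

Lemma attracting_stable F a p b : attracting F a p b -> stable F p.
Proof.
intros At. assert (apb := proj1 At). assert (Fp := proj1 (proj2 At)).
assert (Dist : forall x n, Ioo a b x -> Rabs (Nat.iter n F x - p) <= Rabs (x - p)).
{ intros x n [X1 X2]. destruct (Rtotal_order x p) as [L|[L|L]].
  - destruct (attracting_iter_left F a p b At x n) as [K _]; [lra|].
    rewrite !Rabs_left1; lra.
  - subst x. assert (K : Nat.iter n F p = p) by (induction n; simpl; congruence).
    rewrite K; lra.
  - destruct (attracting_iter_right F a p b At x n) as [K _]; [lra|].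
    rewrite !Rabs_pos_eq; lra. }
split; [exact Fp|]. split.
- intros eps He. exists (Rmin eps (Rmin (p - a) (b - p))). split.
  + unfold Rmin; repeat destruct Rle_dec; lra.
  + intros x Hx n.
    assert (H1 := Rlt_le_trans _ _ _ Hx (Rmin_l _ _)).
    assert (H2 := Rlt_le_trans _ _ _ Hx (Rmin_r _ _)).
    assert (H3 := Rlt_le_trans _ _ _ H2 (Rmin_l _ _)).
    assert (H4 := Rlt_le_trans _ _ _ H2 (Rmin_r _ _)).
    apply Rabs_def2 in H3; apply Rabs_def2 in H4.
    eapply Rle_lt_trans; [apply Dist; unfold Ioo; lra | exact H1].
- generalize (open_locally (Ioo a b) p (open_Ioo a b) apb).
  unfold locally_attracting. apply filter_imp.
  intros x Hx. now apply (attracting_iter_lim F a p b At).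
Qed.

(** An orbit confined near [p] would increase to a fixed point above [p]. *)
Lemma repelling_unstable F p d : F p = p -> p < d ->
  (forall x, p < x < d -> continuous F x) -> (forall x, p < x < d -> x < F x) -> unstable F p.
Proof.
intros Fp pd C L. split; [exact Fp|]. intros St.
destruct (St ((d - p) / 2) ltac:(lra)) as [delta [d0 Hd]].
set (x := p + Rmin (delta / 2) ((d - p) / 4)).
assert (Hx : p < x /\ x - p < delta /\ x < (p + d) / 2).
{ unfold x, Rmin; destruct Rle_dec; lra. }
set (u := fun n => Nat.iter n F x).
assert (U : forall n, x <= u n <= (p + d) / 2).
{ assert (U1 : forall n, u n <= (p + d) / 2).
  { intros n. assert (K := Hd x ltac:(apply Rabs_def1; lra) n). apply Rabs_def2 in K.
    unfold u. lra. }
  induction n as [|n IH]; [unfold u; simpl; lra|]. split; auto.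
  unfold u in *; simpl. generalize (L (Nat.iter n F x)); lra. }
destruct (ex_finite_lim_seq_incr u ((p + d) / 2)) as [l Hl].
- intros n. left. apply (L (u n)). generalize (U n); lra.
- intros n; apply U.
- assert (Hl2 : l <= (p + d) / 2).
  { apply (is_lim_seq_le u (fun _ => (p + d) / 2) l ((p + d) / 2)); auto using is_lim_seq_const.
    intros n; apply U. }
  assert (Hl1 : x <= l).
  { apply (is_lim_seq_le (fun _ => x) u x l); auto using is_lim_seq_const. intros n; apply U. }
  assert (Fl : is_lim_seq (fun n => F (u n)) (F l)).
  { apply is_lim_seq_continuous; auto. apply continuity_pt_filterlim, C; lra. }
  apply is_lim_seq_incr_1 in Hl.
  apply is_lim_seq_unique in Hl. apply is_lim_seq_unique in Fl.
  assert (E : Lim_seq (fun n => u (S n)) = Lim_seq (fun n => F (u n))) by (apply Lim_seq_ext; reflexivity).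
  rewrite Hl, Fl in E. injection E. generalize (L l); lra.
Qed.

(** * Maps with three fixed points *)

Lemma attracting_sub F a p b a' b' : attracting F a p b ->
  a <= a' < p -> p < b' <= b -> attracting F a' p b'.
Proof.
intros [H1 [H2 [H3 [H4 [H5 H6]]]]] Ha Hb. unfold attracting, Ioo in *.
split; [lra|]. split; [auto|]. repeat split; intros; [apply H3|apply H4|apply H5|apply H6]; lra.
Qed.

Definition bistable (n : nat) (F : R -> R) (d x2 x1 : R) : Prop :=
  - d < x2 < 0 /\ 0 < x1 < d /\
  Ck n (Ioo (- d) d) F /\ (forall x, Ioo (- d) d x -> 0 < Derive F x) /\
  F 0 = 0 /\ F x1 = x1 /\ F x2 = x2 /\
  (forall x, 0 < x < x1 -> x < F x) /\ (forall x, x1 < x < d -> F x < x) /\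
  (forall x, x2 < x < 0 -> F x < x) /\ (forall x, - d < x < x2 -> x < F x).

Definition monostable (n : nat) (F : R -> R) (d : R) : Prop :=
  0 < d /\ Ck n (Ioo (- d) d) F /\ (forall x, Ioo (- d) d x -> 0 < Derive F x) /\
  F 0 = 0 /\ (forall x, 0 < x < d -> F x < x) /\ (forall x, - d < x < 0 -> x < F x).

Section PitchPos.
Variables (n : nat) (F : R -> R) (d x2 x1 : R).
Hypothesis H : bistable (S n) F d x2 x1.

Lemma bistable_mono x y : Ioo (- d) d x -> Ioo (- d) d y -> x < y -> F x < F y.
Proof.
destruct H as [H1 [H2 [H3 [H4 _]]]]. apply deriv_pos_increasing; auto. apply H3.
Qed.

Lemma bistable_cont x : Ioo (- d) d x -> continuous F x.
Proof. destruct H as [H1 [H2 [H3 _]]]. intros Hx. exact (Ck_continuous _ _ _ _ H3 Hx). Qed.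

Lemma bistable_right : attracting F 0 x1 d.
Proof.
assert (M := bistable_mono). assert (C := bistable_cont).
destruct H as [H1 [H2 [H3 [H4 [H5 [H6 [H7 [H8 [H9 [H10 H11]]]]]]]]]].
unfold attracting, Ioo in *. split; [lra|]. split; [auto|].
split; [intros x Hx; apply C; lra|].
split; [intros x y Hx Hy; apply M; lra|]. auto.
Qed.

Lemma bistable_left : attracting F (- d) x2 0.
Proof.
assert (M := bistable_mono). assert (C := bistable_cont).
destruct H as [H1 [H2 [H3 [H4 [H5 [H6 [H7 [H8 [H9 [H10 H11]]]]]]]]]].
unfold attracting, Ioo in *. split; [lra|]. split; [auto|].
split; [intros x Hx; apply C; lra|].
split; [intros x y Hx Hy; apply M; lra|]. auto.
Qed.

Lemma bistable_onto l r y : - d < l -> l < r -> r < d -> F l = l -> F r = r -> l < y < r ->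
  exists x, l < x < r /\ F x = y.
Proof.
intros dl lr rd Fl Fr Hy. destruct (ivt F l r y) as [x [Hx E]]; try lra.
- intros x Hx; apply bistable_cont; unfold Ioo; lra.
- exists x; split; auto.
  assert (x <> l) by (intros ->; lra). assert (x <> r) by (intros ->; lra). lra.
Qed.

Let P := inv_on (Ioo x2 x1) F.

Lemma bistable_inv y : Ioo x2 x1 y -> Ioo x2 x1 (P y) /\ F (P y) = y.
Proof.
intros Hy. apply inv_on_spec.
destruct H as [H1 [H2 [H3 [H4 [H5 [H6 [H7 _]]]]]]].
destruct (bistable_onto x2 x1 y) as [x [Hx E]]; auto; try lra. exists x; auto.
Qed.

Lemma bistable_deriv x : Ioo x2 x1 x -> ex_derive F x /\ 0 < Derive F x.
Proof.
destruct H as [H1 [H2 [H3 [H4 _]]]]. unfold Ioo in *. intros Hx. split; [apply H3|apply H4]; unfold Ioo; lra.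
Qed.

Lemma bistable_inv_F x : Ioo x2 x1 x -> P (F x) = x.
Proof. intros Hx. apply inv_on_left; auto; apply bistable_deriv. Qed.

Lemma bistable_image y : image (Ioo x2 x1) F y <-> Ioo x2 x1 y.
Proof.
assert (E := H). destruct E as [H1 [H2 [H3 [H4 [H5 [H6 [H7 _]]]]]]].
split.
- intros [x [[X1 X2] E]]. rewrite <- E, <- H6, <- H7 at 1. rewrite <- H6.
  split; apply bistable_mono; unfold Ioo in *; lra.
- intros Hy. exists (P y). now apply bistable_inv.
Qed.

Lemma bistable_inv_Ck : Ck (S n) (Ioo x2 x1) P.
Proof.
apply (Ck_sub _ (image (Ioo x2 x1) F)); [intros y Hy; now apply bistable_image|].
apply Ck_inv_on; try apply bistable_deriv.
destruct H as [H1 [H2 [H3 _]]]. apply (Ck_sub _ (Ioo (- d) d)); auto. unfold Ioo; intros; lra.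
Qed.

Lemma bistable_inv_derive y : Ioo x2 x1 y -> Derive P y = / Derive F (P y).
Proof.
intros Hy. apply is_derive_unique, inv_on_derive; try apply bistable_deriv.
now apply bistable_image.
Qed.

(** Passing to the inverse turns the basin of repulsion into a basin of attraction, to
    which the linearization theorem applies. *)
Lemma bistable_inv_attracting : attracting P x2 0 x1.
Proof.
assert (C := bistable_inv_Ck). assert (I := bistable_inv).
assert (D : forall y, Ioo x2 x1 y -> 0 < Derive P y).
{ intros y Hy. rewrite bistable_inv_derive by auto. apply Rinv_0_lt_compat, bistable_deriv, I, Hy. }
assert (M := bistable_mono). assert (IF := bistable_inv_F).
destruct H as [H1 [H2 [H3 [H4 [H5 [H6 [H7 [H8 [H9 [H10 H11]]]]]]]]]].
split; [lra|]. split; [|split; [|split; [|split]]].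
- rewrite <- H5 at 1. apply IF. unfold Ioo; lra.
- intros y Hy. apply (Ck_continuous _ _ _ _ C Hy).
- apply deriv_pos_increasing; auto. apply C.
- intros y Hy. destruct (I y) as [[I1 I2] I3]; [unfold Ioo; lra|].
  apply Rnot_le_lt. intros [K|K].
  + assert (F (P y) < F y) by (apply M; unfold Ioo; lra). generalize (H10 y Hy); lra.
  + rewrite K in I3. generalize (H10 y Hy); lra.
- intros y Hy. destruct (I y) as [[I1 I2] I3]; [unfold Ioo; lra|].
  apply Rnot_le_lt. intros [K|K].
  + assert (F y < F (P y)) by (apply M; unfold Ioo; lra). generalize (H8 y Hy); lra.
  + rewrite <- K in I3. generalize (H8 y Hy); lra.
Qed.

Section Basins.
Variable d' : R.
Hypothesis Hd' : x1 < d' /\ - d' < x2 /\ d' < d.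
Let N := Ioo (- d') d'.

Lemma bistable_basin_right x : Ioo 0 d' x <-> basin_attraction F N x1 x.
Proof.
assert (E := H). destruct E as [H1 [H2 [H3 [H4 [H5 [H6 [H7 [H8 [H9 [H10 H11]]]]]]]]]].
assert (At : attracting F 0 x1 d').
{ apply (attracting_sub F 0 x1 d); try lra. apply bistable_right. }
split.
- intros Hx. split.
  + intros j. assert (K := attracting_iter_maps F 0 x1 d' At x j Hx). unfold N, Ioo in *; lra.
  + now apply (attracting_iter_lim F 0 x1 d').
- intros [Nx L]. destruct (Rle_lt_dec x 0) as [X|X].
  + exfalso. assert (K : forall j, Nat.iter j F x <= 0).
    { induction j as [|j IH]; simpl; [auto|].
      destruct IH as [IH|IH].
      - rewrite <- H5. left. apply bistable_mono; auto.
        + specialize (Nx j); unfold N, Ioo in *; lra.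
        + unfold Ioo; lra.
      - rewrite IH, H5; lra. }
    assert (x1 <= 0).
    { apply (is_lim_seq_le (fun j => Nat.iter j F x) (fun _ => 0) x1 0); auto using is_lim_seq_const. }
    lra.
  + specialize (Nx 0%nat). simpl in Nx. unfold N, Ioo in *; lra.
Qed.

Lemma bistable_basin_left x : Ioo (- d') 0 x <-> basin_attraction F N x2 x.
Proof.
assert (E := H). destruct E as [H1 [H2 [H3 [H4 [H5 [H6 [H7 [H8 [H9 [H10 H11]]]]]]]]]].
assert (At : attracting F (- d') x2 0).
{ apply (attracting_sub F (- d) x2 0); try lra. apply bistable_left. }
split.
- intros Hx. split.
  + intros j. assert (K := attracting_iter_maps F (- d') x2 0 At x j Hx). unfold N, Ioo in *; lra.
  + now apply (attracting_iter_lim F (- d') x2 0).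
- intros [Nx L]. destruct (Rle_lt_dec 0 x) as [X|X].
  + exfalso. assert (K : forall j, 0 <= Nat.iter j F x).
    { induction j as [|j IH]; simpl; [auto|].
      destruct IH as [IH|IH].
      - rewrite <- H5 at 1. left. apply bistable_mono; auto.
        + unfold Ioo; lra.
        + specialize (Nx j); unfold N, Ioo in *; lra.
      - rewrite <- IH, H5; lra. }
    assert (0 <= x2).
    { apply (is_lim_seq_le (fun _ => 0) (fun j => Nat.iter j F x) 0 x2); auto using is_lim_seq_const. }
    lra.
  + specialize (Nx 0%nat). simpl in Nx. unfold N, Ioo in *; lra.
Qed.

Lemma bistable_basin_middle x : Ioo x2 x1 x <-> basin_repulsion F N 0 x.
Proof.
assert (E := H). destruct E as [H1 [H2 [H3 [H4 [H5 [H6 [H7 [H8 [H9 [H10 H11]]]]]]]]]].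
assert (At := bistable_inv_attracting).
split.
- intros Hx. exists (fun j => Nat.iter j P x). split; [reflexivity|].
  assert (K := fun j => attracting_iter_maps P x2 0 x1 At x j Hx).
  split; [|split].
  + intros j. simpl. now apply bistable_inv.
  + intros j. specialize (K j). unfold N, Ioo in *; lra.
  + now apply (attracting_iter_lim P x2 0 x1).
- intros [u [u0 [Fu [Nu Lu]]]].
  assert (ND : forall j, Ioo (- d) d (u j)) by (intros j; specialize (Nu j); unfold N, Ioo in *; lra).
  split; apply Rnot_le_lt; intros X.
  + assert (K : forall j, u j <= x2).
    { induction j as [|j IH]; [lra|]. apply Rnot_lt_le. intros Q.
      assert (F x2 < F (u (S j))) by (apply bistable_mono; auto; unfold Ioo; lra).
      rewrite Fu in *; lra. }
    assert (0 <= x2) by (apply (is_lim_seq_le u (fun _ => x2) 0 x2); auto using is_lim_seq_const). lra.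
  + assert (K : forall j, x1 <= u j).
    { induction j as [|j IH]; [lra|]. apply Rnot_lt_le. intros Q.
      assert (F (u (S j)) < F x1) by (apply bistable_mono; auto; unfold Ioo; lra).
      rewrite Fu in *; lra. }
    assert (x1 <= 0) by (apply (is_lim_seq_le (fun _ => x1) u x1 0); auto using is_lim_seq_const). lra.
Qed.

Lemma bistable_fixed x : fixed_in F N x <-> x = 0 \/ x = x1 \/ x = x2.
Proof.
assert (E := H). destruct E as [H1 [H2 [H3 [H4 [H5 [H6 [H7 [H8 [H9 [H10 H11]]]]]]]]]].
unfold fixed_in, N, Ioo. split.
- intros [[X1 X2] Fx].
  destruct (Rtotal_order x x2) as [L|[L|L]]; [generalize (H11 x); lra | lra |].
  destruct (Rtotal_order x 0) as [L1|[L1|L1]]; [generalize (H10 x); lra | lra |].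
  destruct (Rtotal_order x x1) as [L2|[L2|L2]]; [generalize (H8 x); lra | lra | generalize (H9 x); lra].
- intros [X|[X|X]]; subst x; (split; [lra|auto]).
Qed.
End Basins.

Lemma bistable_unstable : unstable F 0.
Proof.
assert (C := bistable_cont).
destruct H as [H1 [H2 [H3 [H4 [H5 [H6 [H7 [H8 _]]]]]]]].
apply (repelling_unstable F 0 x1); auto; try lra.
intros x Hx; apply C; unfold Ioo; lra.
Qed.

Lemma bistable_stable_right : stable F x1.
Proof. apply (attracting_stable F 0 x1 d), bistable_right. Qed.

Lemma bistable_stable_left : stable F x2.
Proof. apply (attracting_stable F (- d) x2 0), bistable_left. Qed.
End PitchPos.

(** Each of the three basins ends at a neighbouring fixed point on at least one side, so
    its image under the linearization is a half-line or the whole line. A suitable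
    scaling always matches two such images, and only the multipliers have to agree. *)
Theorem bistable_conjugate k F d x2 x1 G e y2 y1 d' e' :
  bistable (S (S k)) F d x2 x1 -> bistable (S (S k)) G e y2 y1 ->
  x1 < d' /\ - d' < x2 /\ d' < d -> y1 < e' /\ - e' < y2 /\ e' < e ->
  Derive F 0 = Derive G 0 -> 1 < Derive F 0 ->
  Derive F x1 = Derive G y1 -> Derive F x1 < 1 ->
  Derive F x2 = Derive G y2 -> Derive F x2 < 1 ->
  conjugate_on_basins (S (S k)) F (Ioo (- d') d') G (Ioo (- e') e').
Proof.
intros HF HG Hd' He' M0 M0' M1 M1' M2 M2'.
assert (A := HF). destruct A as [A1 [A2 [A3 [A4 [A5 [A6 [A7 A8]]]]]]].
assert (B := HG). destruct B as [B1 [B2 [B3 [B4 [B5 [B6 [B7 B8]]]]]]].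
(* By their signs the fixed points determine this bijection. *)
set (c := fun x => if Rlt_dec 0 x then y1 else if Rlt_dec x 0 then y2 else 0).
assert (c0 : c 0 = 0) by (unfold c; repeat destruct Rlt_dec; lra).
assert (c1 : c x1 = y1) by (unfold c; repeat destruct Rlt_dec; lra).
assert (c2 : c x2 = y2) by (unfold c; repeat destruct Rlt_dec; lra).
assert (FF := bistable_fixed _ F d x2 x1 HF d' Hd').
assert (FG := bistable_fixed _ G e y2 y1 HG e' He').
exists c. split; [|split; [|split]].
- intros x Hx. apply FG. apply FF in Hx. destruct Hx as [X|[X|X]]; subst x; rewrite ?c0, ?c1, ?c2; auto.
- intros x x' Hx Hx'. apply FF in Hx. apply FF in Hx'.
  destruct Hx as [X|[X|X]]; destruct Hx' as [X'|[X'|X']]; subst x x'; rewrite ?c0, ?c1, ?c2; lra.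
- intros y Hy. apply FG in Hy. destruct Hy as [Y|[Y|Y]]; subst y.
  + exists 0. rewrite FF. auto.
  + exists x1. rewrite FF. auto.
  + exists x2. rewrite FF. auto.
- intros x Hx. apply FF in Hx. destruct Hx as [X|[X|X]]; subst x; rewrite ?c0, ?c1, ?c2.
  +
    (* The unstable point: the inverse maps are linearized, and [1 / F'(0)] is inverted
       again when the conjugacy is built. *)
    right. split; [now apply (bistable_unstable (S k) F d x2 x1)|].
    split; [now apply (bistable_unstable (S k) G e y2 y1)|].
    assert (AtP := bistable_inv_attracting _ F d x2 x1 HF).
    assert (AtQ := bistable_inv_attracting _ G e y2 y1 HG).
    set (P := inv_on (Ioo x2 x1) F) in *. set (Q := inv_on (Ioo y2 y1) G) in *.
    assert (P0 : P 0 = 0) by apply AtP. assert (Q0 : Q 0 = 0) by apply AtQ.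
    assert (P'0 : Derive P 0 = / Derive F 0).
    { unfold P. rewrite (bistable_inv_derive _ F d x2 x1 HF) by (unfold Ioo; lra). fold P. now rewrite P0. }
    assert (Q'0 : Derive Q 0 = / Derive F 0).
    { unfold Q. rewrite (bistable_inv_derive _ G e y2 y1 HG) by (unfold Ioo; lra). fold Q. now rewrite Q0, M0. }
    assert (m1 : 0 < / Derive F 0 < 1).
    { split; [apply Rinv_0_lt_compat; lra|]. rewrite <- Rinv_1. apply Rinv_lt_contravar; lra. }
    assert (IP := bistable_inv _ F d x2 x1 HF). fold P in IP.
    assert (IQ := bistable_inv _ G e y2 y1 HG). fold Q in IQ.
    assert (PF := bistable_inv_F _ F d x2 x1 HF). fold P in PF.
    assert (QG := bistable_inv_F _ G e y2 y1 HG). fold Q in QG.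
    assert (FI : forall x, Ioo x2 x1 x -> Ioo x2 x1 (F x)).
    { intros x Hx. apply (bistable_image _ F d x2 x1 HF). exists x; auto. }
    assert (GI : forall x, Ioo y2 y1 x -> Ioo y2 y1 (G x)).
    { intros x Hx. apply (bistable_image _ G e y2 y1 HG). exists x; auto. }
    destruct (koenigs k P x2 0 x1 (/ Derive F 0) AtP) as [phi [Cphi [Dphi [phi0 [_ Ephi]]]]]; auto; try lra.
    { apply (bistable_inv_Ck _ F d x2 x1 HF). }
    { intros x Hx. unfold P. rewrite (bistable_inv_derive _ F d x2 x1 HF) by auto.
      apply Rinv_0_lt_compat, (bistable_deriv _ F d x2 x1 HF), IP, Hx. }
    destruct (koenigs k Q y2 0 y1 (/ Derive F 0) AtQ) as [psi [Cpsi [Dpsi [psi0 [_ Epsi]]]]]; auto; try lra.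
    { apply (bistable_inv_Ck _ G e y2 y1 HG). }
    { intros x Hx. unfold Q. rewrite (bistable_inv_derive _ G e y2 y1 HG) by auto.
      apply Rinv_0_lt_compat, (bistable_deriv _ G e y2 y1 HG), IQ, Hx. }
    destruct (conjugacy_from_linearizations (S k) F G x2 x1 y2 y1 0 0 (Derive F 0) 1 phi psi) as [h [h0 Ch]]; auto;
      try (unfold Ioo; lra).
    { intros x Hx. rewrite <- (PF x Hx) at 2. rewrite Ephi by auto. field; lra. }
    { intros x Hx. rewrite <- (QG x Hx) at 2. rewrite Epsi by auto. field; lra. }
    { intros v. rewrite Rmult_1_l.
      split; intros _.
      - apply image_unbounded; auto; [apply Cpsi| |].
        + apply (koenigs_unbounded_left Q psi y2 0 y1 (/ Derive F 0)); auto; [apply Cpsi|].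
          intros y Hy. exists (G y). rewrite QG by (unfold Ioo; lra). split; auto.
          destruct (GI y ltac:(unfold Ioo; lra)). destruct B8 as [_ [_ [B8 _]]].
          generalize (B8 y); lra.
        + apply (koenigs_unbounded_right Q psi y2 0 y1 (/ Derive F 0)); auto; [apply Cpsi|].
          intros y Hy. exists (G y). rewrite QG by (unfold Ioo; lra). split; auto.
          destruct (GI y ltac:(unfold Ioo; lra)). destruct B8 as [B8 _].
          generalize (B8 y); lra.
      - apply image_unbounded; auto; [apply Cphi| |].
        + apply (koenigs_unbounded_left P phi x2 0 x1 (/ Derive F 0)); auto; [apply Cphi|].
          intros y Hy. exists (F y). rewrite PF by (unfold Ioo; lra). split; auto.
          destruct (FI y ltac:(unfold Ioo; lra)). destruct A8 as [_ [_ [A8 _]]].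
          generalize (A8 y); lra.
        + apply (koenigs_unbounded_right P phi x2 0 x1 (/ Derive F 0)); auto; [apply Cphi|].
          intros y Hy. exists (F y). rewrite PF by (unfold Ioo; lra). split; auto.
          destruct (FI y ltac:(unfold Ioo; lra)). destruct A8 as [A8 _].
          generalize (A8 y); lra. }
    exists h. split; auto. revert Ch. apply C_conjugacy_iff.
    * now apply (bistable_basin_middle (S k) F d x2 x1).
    * now apply (bistable_basin_middle (S k) G e y2 y1).
  + left. split; [now apply (bistable_stable_right (S k) F d x2 x1)|].
    split; [now apply (bistable_stable_right (S k) G e y2 y1)|].
    assert (AtF := bistable_right _ F d x2 x1 HF). assert (AtG := bistable_right _ G e y2 y1 HG).
    assert (m0 : 0 < Derive F x1) by (apply A4; unfold Ioo; lra).
    assert (C1 : Ck (S (S k)) (Ioo 0 d) F) by (apply (Ck_sub _ (Ioo (- d) d)); auto; unfold Ioo; intros; lra).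
    assert (C2 : Ck (S (S k)) (Ioo 0 e) G) by (apply (Ck_sub _ (Ioo (- e) e)); auto; unfold Ioo; intros; lra).
    destruct (koenigs k F 0 x1 d (Derive F x1) AtF) as [phi [Cphi [Dphi [phi0 [_ Ephi]]]]]; auto.
    { intros x Hx; apply A4; unfold Ioo in *; lra. }
    destruct (koenigs k G 0 y1 e (Derive F x1) AtG) as [psi [Cpsi [Dpsi [psi0 [_ Epsi]]]]]; auto.
    { intros x Hx; apply B4; unfold Ioo in *; lra. }
    assert (AtG' := attracting_sub G 0 y1 e 0 e' AtG ltac:(lra) ltac:(lra)).
    assert (Q1 : 0 < phi d').
    { rewrite <- phi0. apply (deriv_pos_increasing phi 0 d); auto; try apply Cphi; unfold Ioo; lra. }
    assert (Q2 : 0 < psi e').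
    { rewrite <- psi0. apply (deriv_pos_increasing psi 0 e); auto; try apply Cpsi; unfold Ioo; lra. }
    assert (lam0 : 0 < psi e' / phi d') by (apply Rdiv_lt_0_compat; lra).
    assert (SF : forall x, Ioo 0 d' x -> Ioo 0 d x) by (unfold Ioo; intros; lra).
    assert (SG : forall x, Ioo 0 e' x -> Ioo 0 e x) by (unfold Ioo; intros; lra).
    destruct (conjugacy_from_linearizations (S k) F G 0 d' 0 e' x1 y1 (Derive F x1) (psi e' / phi d') phi psi)
      as [h [h0 Ch]]; auto; try (unfold Ioo; lra).
    { apply (attracting_maps G 0 y1 e' AtG'). }
    { apply (Ck_sub _ (Ioo 0 d)); auto. }
    { apply (Ck_sub _ (Ioo 0 e)); auto. }
    { intros v. rewrite (image_unbounded_left phi 0 d) by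
        (auto; try apply Cphi; try lra;
         apply (koenigs_unbounded_left F phi 0 x1 d (Derive F x1)); auto; try apply Cphi;
         intros y Hy; apply (bistable_onto (S k) F d x2 x1); auto; lra).
      rewrite (image_unbounded_left psi 0 e) by
        (auto; try apply Cpsi; try lra;
         apply (koenigs_unbounded_left G psi 0 y1 e (Derive F x1)); auto; try apply Cpsi;
         intros y Hy; apply (bistable_onto (S k) G e y2 y1); auto; lra).
      replace (psi e') with (psi e' / phi d' * phi d') at 2 by (field; lra).
      split; intros V; [apply Rmult_lt_compat_l | apply Rmult_lt_reg_l in V]; auto. }
    exists h. split; auto. revert Ch. apply C_conjugacy_iff.
    * now apply (bistable_basin_right (S k) F d x2 x1).
    * now apply (bistable_basin_right (S k) G e y2 y1).
  + left. split; [now apply (bistable_stable_left (S k) F d x2 x1)|].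
    split; [now apply (bistable_stable_left (S k) G e y2 y1)|].
    assert (AtF := bistable_left _ F d x2 x1 HF). assert (AtG := bistable_left _ G e y2 y1 HG).
    assert (m0 : 0 < Derive F x2) by (apply A4; unfold Ioo; lra).
    assert (C1 : Ck (S (S k)) (Ioo (- d) 0) F) by (apply (Ck_sub _ (Ioo (- d) d)); auto; unfold Ioo; intros; lra).
    assert (C2 : Ck (S (S k)) (Ioo (- e) 0) G) by (apply (Ck_sub _ (Ioo (- e) e)); auto; unfold Ioo; intros; lra).
    destruct (koenigs k F (- d) x2 0 (Derive F x2) AtF) as [phi [Cphi [Dphi [phi0 [_ Ephi]]]]]; auto.
    { intros x Hx; apply A4; unfold Ioo in *; lra. }
    destruct (koenigs k G (- e) y2 0 (Derive F x2) AtG) as [psi [Cpsi [Dpsi [psi0 [_ Epsi]]]]]; auto.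
    { intros x Hx; apply B4; unfold Ioo in *; lra. }
    assert (AtG' := attracting_sub G (- e) y2 0 (- e') 0 AtG ltac:(lra) ltac:(lra)).
    assert (Q1 : phi (- d') < 0).
    { rewrite <- phi0. apply (deriv_pos_increasing phi (- d) 0); auto; try apply Cphi; unfold Ioo; lra. }
    assert (Q2 : psi (- e') < 0).
    { rewrite <- psi0. apply (deriv_pos_increasing psi (- e) 0); auto; try apply Cpsi; unfold Ioo; lra. }
    assert (lam0 : 0 < psi (- e') / phi (- d')).
    { replace (psi (- e') / phi (- d')) with ((- psi (- e')) / (- phi (- d'))) by (field; lra).
      apply Rdiv_lt_0_compat; lra. }
    assert (SF : forall x, Ioo (- d') 0 x -> Ioo (- d) 0 x) by (unfold Ioo; intros; lra).
    assert (SG : forall x, Ioo (- e') 0 x -> Ioo (- e) 0 x) by (unfold Ioo; intros; lra).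
    destruct (conjugacy_from_linearizations (S k) F G (- d') 0 (- e') 0 x2 y2 (Derive F x2)
      (psi (- e') / phi (- d')) phi psi) as [h [h0 Ch]]; auto; try (unfold Ioo; lra).
    { apply (attracting_maps G (- e') y2 0 AtG'). }
    { apply (Ck_sub _ (Ioo (- d) 0)); auto. }
    { apply (Ck_sub _ (Ioo (- e) 0)); auto. }
    { intros v. rewrite (image_unbounded_right phi (- d) 0) by
        (auto; try apply Cphi; try lra;
         apply (koenigs_unbounded_right F phi (- d) x2 0 (Derive F x2)); auto; try apply Cphi;
         intros y Hy; apply (bistable_onto (S k) F d x2 x1); auto; lra).
      rewrite (image_unbounded_right psi (- e) 0) by
        (auto; try apply Cpsi; try lra;
         apply (koenigs_unbounded_right G psi (- e) y2 0 (Derive F x2)); auto; try apply Cpsi;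
         intros y Hy; apply (bistable_onto (S k) G e y2 y1); auto; lra).
      replace (psi (- e')) with (psi (- e') / phi (- d') * phi (- d')) at 1 by (field; lra).
      split; intros V; [apply Rmult_lt_compat_l | apply Rmult_lt_reg_l in V]; auto. }
    exists h. split; auto. revert Ch. apply C_conjugacy_iff.
    * now apply (bistable_basin_left (S k) F d x2 x1).
    * now apply (bistable_basin_left (S k) G e y2 y1).
Qed.

(** * Maps with a single, attracting fixed point *)

(** The normalized linearization at [0] as an explicit limit: since it is defined by the
    map alone, it can be compared between maps and followed along a family. *)
Definition koenigs_value (F : R -> R) (m x : R) : R :=
  real (Lim_seq (fun n => Nat.iter n F x / m ^ n)).

Lemma linearization_iter F a p b phi m : attracting F a p b ->
  (forall x, Ioo a b x -> phi (F x) = m * phi x) ->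
  forall n x, Ioo a b x -> phi (Nat.iter n F x) = m ^ n * phi x.
Proof.
intros At E n x Hx. induction n as [|n IH]; simpl; [ring|].
rewrite E, IH; [ring|]. now apply (attracting_iter_maps F a p b At).
Qed.

(** As [phi] is tangent to the identity, [phi (F^n x) = m^n * phi x] may be replaced by
    [F^n x] in the limit. *)
Lemma koenigs_limit F a b phi m : attracting F a 0 b -> 0 < m ->
  phi 0 = 0 -> is_derive phi 0 1 -> (forall x, Ioo a b x -> phi (F x) = m * phi x) ->
  forall x, Ioo a b x -> is_lim_seq (fun n => Nat.iter n F x / m ^ n) (phi x).
Proof.
intros At m0 phi0 D E x Hx.
assert (F0 : F 0 = 0) by apply At.
assert (L := attracting_iter_lim F a 0 b At x Hx).
assert (I := linearization_iter F a 0 b phi m At E).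
destruct (Req_dec x 0) as [->|N].
- rewrite phi0. apply (is_lim_seq_ext (fun _ => 0)); [|apply is_lim_seq_const].
  intros n. assert (K : Nat.iter n F 0 = 0) by (induction n; simpl; congruence).
  rewrite K. field. apply pow_nonzero; lra.
- set (u := fun n => Nat.iter n F x) in *.
  assert (un : forall n, u n <> 0).
  { intros n. destruct (Rtotal_order x 0) as [X|[X|X]]; [|lra|].
    - destruct (attracting_iter_left F a 0 b At x n) as [K _]; [unfold Ioo in *; lra|]. unfold u; lra.
    - destruct (attracting_iter_right F a 0 b At x n) as [K _]; [unfold Ioo in *; lra|]. unfold u; lra. }
  assert (Q : is_lim_seq (fun n => phi (u n) / u n) 1).
  { apply is_lim_seq_spec. intros eps. apply is_derive_Reals in D.
    destruct (D eps (cond_pos eps)) as [del Hdel].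
    apply is_lim_seq_spec in L. destruct (L del) as [n0 Hn0].
    exists n0. intros n Hn. specialize (Hn0 n Hn). simpl in Hn0. rewrite Rminus_0_r in Hn0.
    specialize (Hdel (u n) (un n) Hn0). now rewrite Rplus_0_l, phi0, Rminus_0_r in Hdel. }
  assert (Q' : is_lim_seq (fun n => phi x * / (phi (u n) / u n)) (phi x * / 1)).
  { apply (is_lim_seq_mult' (fun _ => phi x) (fun n => / (phi (u n) / u n))); [apply is_lim_seq_const|].
    apply (is_lim_seq_inv _ 1 Q). intros X; injection X; lra. }
  rewrite Rinv_1, Rmult_1_r in Q'.
  apply is_lim_seq_spec in Q. destruct (Q (mkposreal 1 Rlt_0_1)) as [n0 Hn0]. simpl in Hn0.
  apply (is_lim_seq_ext_loc (fun n => phi x * / (phi (u n) / u n))); auto.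
  exists n0. intros n Hn. specialize (Hn0 n Hn).
  assert (P0 : phi (u n) <> 0).
  { intros Z. rewrite Z in Hn0. unfold Rdiv in Hn0. rewrite Rmult_0_l, Rminus_0_l, Rabs_Ropp, Rabs_R1 in Hn0. lra. }
  assert (En := I n x Hx). fold (u n) in En.
  assert (mn : m ^ n <> 0) by (apply pow_nonzero; lra).
  assert (px : phi x <> 0) by (intros Z; rewrite Z, Rmult_0_r in En; auto).
  rewrite En. fold (u n). field. auto.
Qed.

Lemma monostable_attracting n F d : monostable (S n) F d -> attracting F (- d) 0 d.
Proof.
intros [H1 [H2 [H3 [H4 [H5 H6]]]]]. split; [lra|]. split; [auto|].
split; [intros x Hx; apply (Ck_continuous _ _ _ _ H2 Hx)|].
split; [apply deriv_pos_increasing; auto; apply H2|]. auto.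
Qed.

Lemma monostable_linearization k F d : monostable (S (S k)) F d -> Derive F 0 < 1 ->
  exists phi, Ck (S (S k)) (Ioo (- d) d) phi /\
  (forall x, Ioo (- d) d x -> 0 < Derive phi x) /\
  phi 0 = 0 /\ Derive phi 0 = 1 /\
  (forall x, Ioo (- d) d x -> phi (F x) = Derive F 0 * phi x) /\
  (forall x, Ioo (- d) d x -> koenigs_value F (Derive F 0) x = phi x).
Proof.
intros H M. assert (At := monostable_attracting (S k) F d H).
destruct H as [H1 [H2 [H3 [H4 [H5 H6]]]]].
destruct (koenigs k F (- d) 0 d (Derive F 0) At) as [phi [C [P [Z [O E]]]]]; auto.
exists phi. repeat (split; auto); try apply C.
intros x Hx. unfold koenigs_value.
rewrite (is_lim_seq_unique _ (phi x)); auto.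
apply (koenigs_limit F (- d) d phi); auto.
- apply H3; unfold Ioo; lra.
- rewrite <- O. apply Derive_correct, C. unfold Ioo; lra.
Qed.

Lemma monostable_basin n F d d' : monostable (S n) F d -> 0 < d' < d ->
  forall x, Ioo (- d') d' x <-> basin_attraction F (Ioo (- d') d') 0 x.
Proof.
intros H Hd' x.
assert (At := attracting_sub F (- d) 0 d (- d') d' (monostable_attracting n F d H) ltac:(lra) ltac:(lra)).
split.
- intros Hx. split.
  + intros j. now apply (attracting_iter_maps F (- d') 0 d').
  + now apply (attracting_iter_lim F (- d') 0 d').
- intros [Nx _]. exact (Nx 0%nat).
Qed.

Lemma monostable_fixed n F d d' : monostable (S n) F d -> 0 < d' < d ->
  forall x, fixed_in F (Ioo (- d') d') x <-> x = 0.
Proof.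
intros [H1 [H2 [H3 [H4 [H5 H6]]]]] Hd' x. unfold fixed_in, Ioo. split.
- intros [[X1 X2] Fx].
  destruct (Rtotal_order x 0) as [L1|[L1|L1]]; [generalize (H6 x); lra | lra | generalize (H5 x); lra].
- intros ->; split; [lra|auto].
Qed.

(** The whole interval is one basin, whose image under the linearization is a bounded
    interval around [0]. The scaling is fixed by one end point, and the hypothesis on
    the Koenigs values says that it also carries the other end point to the right
    place. *)
Theorem monostable_conjugate k F d G e d' e' :
  monostable (S (S k)) F d -> monostable (S (S k)) G e -> 0 < d' < d -> 0 < e' < e ->
  Derive F 0 = Derive G 0 -> Derive F 0 < 1 ->
  koenigs_value F (Derive F 0) d' * koenigs_value G (Derive G 0) (- e') =
  koenigs_value G (Derive G 0) e' * koenigs_value F (Derive F 0) (- d') ->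
  conjugate_on_basins (S (S k)) F (Ioo (- d') d') G (Ioo (- e') e').
Proof.
intros HF HG Hd' He' M M' Ratio.
assert (FF := monostable_fixed (S k) F d d' HF Hd').
assert (FG := monostable_fixed (S k) G e e' HG He').
exists (fun x => x). split; [|split; [|split]].
- intros x Hx. apply FF in Hx. now apply FG.
- auto.
- intros y Hy. exists y. split; auto. apply FG in Hy. now apply FF.
- intros x Hx. apply FF in Hx. subst x. left.
  assert (AtF := monostable_attracting (S k) F d HF).
  assert (AtG := monostable_attracting (S k) G e HG).
  split; [now apply (attracting_stable F (- d) 0 d)|].
  split; [now apply (attracting_stable G (- e) 0 e)|].
  destruct (monostable_linearization k F d HF M') as [phi [Cphi [Dphi [phi0 [_ [Ephi Vphi]]]]]].
  destruct (monostable_linearization k G e HG) as [psi [Cpsi [Dpsi [psi0 [_ [Epsi Vpsi]]]]]]; [lra|].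
  rewrite <- M in *. rewrite !Vphi, !Vpsi in Ratio by (unfold Ioo; lra).
  assert (AtG' := attracting_sub G (- e) 0 e (- e') e' AtG ltac:(lra) ltac:(lra)).
  assert (Mphi : forall x y, Ioo (- d) d x -> Ioo (- d) d y -> x < y -> phi x < phi y).
  { apply deriv_pos_increasing; auto; apply Cphi. }
  assert (Mpsi : forall x y, Ioo (- e) e x -> Ioo (- e) e y -> x < y -> psi x < psi y).
  { apply deriv_pos_increasing; auto; apply Cpsi. }
  assert (Q1 : 0 < phi d') by (rewrite <- phi0; apply Mphi; unfold Ioo; lra).
  assert (Q2 : 0 < psi e') by (rewrite <- psi0; apply Mpsi; unfold Ioo; lra).
  assert (lam0 : 0 < psi e' / phi d') by (apply Rdiv_lt_0_compat; lra).
  assert (SF : forall x, Ioo (- d') d' x -> Ioo (- d) d x) by (unfold Ioo; intros; lra).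
  assert (SG : forall x, Ioo (- e') e' x -> Ioo (- e) e x) by (unfold Ioo; intros; lra).
  destruct (conjugacy_from_linearizations (S k) F G (- d') d' (- e') e' 0 0 (Derive F 0)
    (psi e' / phi d') phi psi) as [h [h0 Ch]]; auto; try (unfold Ioo; lra).
  + apply (attracting_maps G (- e') 0 e' AtG').
  + apply (Ck_sub _ (Ioo (- d) d)); auto.
  + apply (Ck_sub _ (Ioo (- e) e)); auto.
  + intros v.
    rewrite (image_bounded phi (- d) d) by (auto; try apply Cphi; lra).
    rewrite (image_bounded psi (- e) e) by (auto; try apply Cpsi; lra).
    assert (E1 : psi (- e') = psi e' / phi d' * phi (- d')).
    { apply (Rmult_eq_reg_l (phi d')); [|lra]. rewrite Ratio. field; lra. }
    assert (E2 : psi e' = psi e' / phi d' * phi d') by (field; lra).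
    set (lam := psi e' / phi d') in *. rewrite E1, E2.
    split; intros [V1 V2].
    * split; apply Rmult_lt_compat_l; auto.
    * apply Rmult_lt_reg_l in V1; auto. apply Rmult_lt_reg_l in V2; auto.
  + exists h. split; auto. revert Ch. apply C_conjugacy_iff.
    * now apply (monostable_basin (S k) F d).
    * now apply (monostable_basin (S k) G e).
Qed.

(** * Limits from the right at 0 *)

Definition tends0 (u : R -> R) (l : R) : Prop := filterlim u (at_right 0) (locally l).

Lemma near0_spec (P : R -> Prop) :
  at_right 0 P <-> exists eta, 0 < eta /\ forall x, 0 < x < eta -> P x.
Proof.
split.
- intros [e He]. exists e. split; [apply cond_pos|]. intros x Hx. apply He; [|lra].
  unfold ball; simpl; unfold AbsRing_ball, abs, minus, plus, opp; simpl. apply Rabs_def1; lra.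
- intros [e [e0 He]]. exists (mkposreal e e0). intros x Hx X. apply He. split; auto.
  unfold ball in Hx; simpl in Hx; unfold AbsRing_ball, abs, minus, plus, opp in Hx; simpl in Hx.
  apply Rabs_def2 in Hx; lra.
Qed.

Lemma near0_lt e : 0 < e -> at_right 0 (fun x => 0 < x < e).
Proof. intros He. apply near0_spec. exists e; auto. Qed.

Lemma tends0_spec u l : tends0 u l <->
  forall eps, 0 < eps -> exists eta, 0 < eta /\ forall x, 0 < x < eta -> Rabs (u x - l) < eps.
Proof.
split.
- intros H eps e0. apply near0_spec.
  exact (proj1 (filterlim_locally _ _) H (mkposreal eps e0)).
- intros H. apply filterlim_locally. intros eps. apply near0_spec. apply (H eps (cond_pos eps)).
Qed.

Lemma tends0_near u l (P : R -> Prop) : tends0 u l -> locally l P -> at_right 0 (fun x => P (u x)).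
Proof. intros H HP. exact (H P HP). Qed.

Lemma tends0_lt u l q : tends0 u l -> l < q -> at_right 0 (fun x => u x < q).
Proof. intros H L. apply (tends0_near u l (fun z => z < q) H). now apply (open_lt q). Qed.

Lemma tends0_gt u l q : tends0 u l -> q < l -> at_right 0 (fun x => q < u x).
Proof. intros H L. apply (tends0_near u l (fun z => q < z) H). now apply (open_gt q). Qed.

Lemma tends0_ext u v l : at_right 0 (fun x => u x = v x) -> tends0 u l -> tends0 v l.
Proof. intros E H. apply (filterlim_ext_loc u v); auto. Qed.

Lemma tends0_const c : tends0 (fun _ => c) c.
Proof. apply filterlim_const. Qed.

Lemma tends0_continuous (u : R -> R) (l : R) : continuous u 0 -> u 0 = l -> tends0 u l.
Proof.
intros C <- P HP. exact (filter_le_within (F := locally 0) (fun x => 0 < x) (fun x => P (u x)) (C P HP)).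
Qed.

Lemma tends0_id : tends0 (fun x => x) 0.
Proof. apply (tends0_continuous (fun x => x)); auto. apply continuous_id. Qed.

Lemma tends0_comp f u l : continuous f l -> tends0 u l -> tends0 (fun x => f (u x)) (f l).
Proof. intros C H. apply (filterlim_comp _ _ _ u f _ (locally l)); auto. Qed.

Lemma tends0_subst u v l : at_right 0 (fun x => 0 < v x) -> tends0 v 0 -> tends0 u l ->
  tends0 (fun x => u (v x)) l.
Proof.
intros P V U. rewrite tends0_spec in *. intros eps e0.
destruct (U eps e0) as [e1 [e10 H1]]. destruct (V e1 e10) as [e2 [e20 H2]].
apply near0_spec in P. destruct P as [e3 [e30 H3]].
exists (Rmin e2 e3). split; [apply Rmin_case; auto|].
intros x Hx. assert (A := Rmin_l e2 e3). assert (B := Rmin_r e2 e3).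
apply H1. split; [apply H3; lra|]. specialize (H2 x ltac:(lra)). apply Rabs_def2 in H2; lra.
Qed.

Lemma tends0_plus u v a b : tends0 u a -> tends0 v b -> tends0 (fun x => u x + v x) (a + b).
Proof.
intros U V. unfold tends0. eapply filterlim_comp_2; [exact U|exact V|apply (filterlim_plus a b)]. Qed.

Lemma tends0_opp u a : tends0 u a -> tends0 (fun x => - u x) (- a).
Proof. intros U. apply (filterlim_comp _ _ _ u Ropp _ (locally a)); auto. apply (filterlim_opp a). Qed.

Lemma tends0_minus u v a b : tends0 u a -> tends0 v b -> tends0 (fun x => u x - v x) (a - b).
Proof. intros U V. apply (tends0_plus u (fun x => - v x)); auto. now apply tends0_opp. Qed.

Lemma tends0_mult u v a b : tends0 u a -> tends0 v b -> tends0 (fun x => u x * v x) (a * b).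
Proof.
intros U V. unfold tends0. eapply filterlim_comp_2; [exact U|exact V|apply (filterlim_mult a b)]. Qed.

Lemma tends0_inv u a : a <> 0 -> tends0 u a -> tends0 (fun x => / u x) (/ a).
Proof.
intros N U. apply (tends0_comp Rinv); auto. now apply continuous_Rinv.
Qed.

Lemma tends0_div u v a b : b <> 0 -> tends0 u a -> tends0 v b -> tends0 (fun x => u x / v x) (a / b).
Proof. intros N U V. apply tends0_mult; auto. now apply tends0_inv. Qed.

Lemma tends0_pow u a n : tends0 u a -> tends0 (fun x => u x ^ n) (a ^ n).
Proof.
intros U. induction n as [|n IH]; simpl; [apply tends0_const|]. now apply tends0_mult.
Qed.

Lemma tends0_sqrt u a : 0 < a -> tends0 u a -> tends0 (fun x => sqrt (u x)) (sqrt a).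
Proof.
intros P U. apply (tends0_comp sqrt); auto. apply continuity_pt_filterlim, continuity_pt_sqrt; lra.
Qed.

Lemma tends0_eq u a b : tends0 u a -> a = b -> tends0 u b.
Proof. intros H <-; auto. Qed.

Lemma tends0_small u v K : at_right 0 (fun x => Rabs (u x) <= K * Rabs (v x)) ->
  tends0 v 0 -> tends0 u 0.
Proof.
intros B V. rewrite tends0_spec in *. intros eps e0. apply near0_spec in B. destruct B as [e1 [e10 H1]].
assert (K1 : 0 < Rabs K + 1) by (generalize (Rabs_pos K); lra).
destruct (V (eps / (Rabs K + 1))) as [e2 [e20 H2]]; [now apply Rdiv_lt_0_compat|].
exists (Rmin e1 e2). split; [apply Rmin_case; auto|].
intros x Hx. assert (A := Rmin_l e1 e2). assert (A' := Rmin_r e1 e2).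
specialize (H1 x ltac:(lra)). specialize (H2 x ltac:(lra)). rewrite Rminus_0_r in *.
apply Rlt_div_r in H2; auto.
generalize (Rle_abs K) (Rabs_pos (v x)); nra.
Qed.

Lemma tends0_le u v a b : at_right 0 (fun x => u x <= v x) -> tends0 u a -> tends0 v b -> a <= b.
Proof.
intros L U V. apply (filterlim_le (F := at_right 0) u v a b); auto.
Qed.

Lemma tends0_squeeze u v w a : at_right 0 (fun x => u x <= v x <= w x) ->
  tends0 u a -> tends0 w a -> tends0 v a.
Proof.
intros N U W. rewrite tends0_spec in *. intros eps e0. apply near0_spec in N. destruct N as [e1 [e10 N]].
destruct (U eps e0) as [e2 [e20 H2]]. destruct (W eps e0) as [e3 [e30 H3]].
exists (Rmin e1 (Rmin e2 e3)). split; [repeat apply Rmin_case; auto|].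
intros x Hx. assert (A := Rmin_l e1 (Rmin e2 e3)). assert (B := Rmin_r e1 (Rmin e2 e3)).
assert (A' := Rmin_l e2 e3). assert (B' := Rmin_r e2 e3).
specialize (N x ltac:(lra)). specialize (H2 x ltac:(lra)). specialize (H3 x ltac:(lra)).
apply Rabs_def2 in H2. apply Rabs_def2 in H3. apply Rabs_def1; lra.
Qed.

Lemma derive_quotient_tends0 (h : R -> R) l : is_derive h 0 l -> h 0 = 0 -> tends0 (fun x => h x / x) l.
Proof.
intros D Z. apply tends0_spec. intros eps e0. apply is_derive_Reals in D.
destruct (D eps e0) as [del Hdel]. exists del. split; [apply cond_pos|]. intros x Hx.
specialize (Hdel x ltac:(lra)). rewrite Rplus_0_l, Z, Rminus_0_r in Hdel. apply Hdel.
apply Rabs_def1; lra.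
Qed.

Lemma sqrt_tends0 u : tends0 u 0 -> tends0 (fun x => sqrt (u x)) 0.
Proof.
intros U. rewrite <- sqrt_0. apply (tends0_comp sqrt); auto.
apply continuity_pt_filterlim, continuity_pt_sqrt; lra.
Qed.

Lemma continuous_ln t : 0 < t -> continuous ln t.
Proof. intros Ht. apply (ex_derive_continuous ln t). exists (/ t). now apply is_derive_ln. Qed.

Lemma exp_monotone a b : a <= b -> exp a <= exp b.
Proof. intros [ab|ab]; [left; now apply exp_increasing | subst; lra]. Qed.

(** * Fatou coordinates of a parabolic fixed point *)

Section CoboundarySum.
Variables (F l : R -> R) (d K : R).
Hypothesis CF : forall x, Ioo 0 d x -> continuous F x.
Hypothesis HF : forall x, Ioo 0 d x -> 0 < F x < x.
Hypothesis Cl : forall x, Ioo 0 d x -> continuous l x.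
Hypothesis Hl : forall x, Ioo 0 d x -> Rabs (l x) <= K * (x - F x).

Lemma half_maps x : Ioo 0 d x -> Ioo 0 d (F x).
Proof. intros Hx. generalize (HF x Hx). unfold Ioo in *; lra. Qed.

Lemma half_iter_maps x n : Ioo 0 d x -> Ioo 0 d (Nat.iter n F x).
Proof. intros Hx; induction n; simpl; auto using half_maps. Qed.

Lemma half_iter_continuous n x : Ioo 0 d x -> continuous (Nat.iter n F) x.
Proof.
intros Hx. induction n as [|n IH]; simpl.
- apply continuous_id.
- apply (continuous_comp (Nat.iter n F) F); auto. apply CF, half_iter_maps, Hx.
Qed.

Lemma half_iter_lim x : Ioo 0 d x -> is_lim_seq (fun n => Nat.iter n F x) 0.
Proof.
intros Hx. set (u := fun n => Nat.iter n F x).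
assert (I : forall n, Ioo 0 d (u n)) by (intros n; apply half_iter_maps, Hx).
assert (De : forall n, u (S n) <= u n) by (intros n; left; apply (HF (u n)), I).
assert (Hu : forall n, u n <= x).
{ induction n as [|n IH]; [unfold u; simpl; lra|]. generalize (De n); lra. }
destruct (ex_finite_lim_seq_decr u 0) as [q Hq]; auto.
- intros n; left; apply I.
- assert (q0 : 0 <= q).
  { apply (is_lim_seq_le (fun _ => 0) u 0 q); auto using is_lim_seq_const. intros n; left; apply I. }
  assert (qx : q <= x).
  { apply (is_lim_seq_le u (fun _ => x) q x); auto using is_lim_seq_const. }
  destruct (Req_dec q 0) as [->|N]; auto.
  assert (Iq : Ioo 0 d q) by (unfold Ioo in *; lra).
  assert (U : is_lim_seq (fun n => F (u n)) (F q)).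
  { apply is_lim_seq_continuous; auto. apply continuity_pt_filterlim, CF, Iq. }
  apply is_lim_seq_incr_1 in Hq. apply is_lim_seq_unique in Hq. apply is_lim_seq_unique in U.
  assert (E : Lim_seq (fun n => u (S n)) = Lim_seq (fun n => F (u n))) by (apply Lim_seq_ext; reflexivity).
  rewrite Hq, U in E. injection E. generalize (HF q Iq); lra.
Qed.

(** The solution of [S = l + S o F]. A parabolic map does not contract; the series
    converges because [|l x| <= K * (x - F x)], which telescopes along an orbit. *)
Definition coboundary_sum (x : R) : R := Series (fun n => l (Nat.iter n F x)).

Lemma telescoping_series x : Ioo 0 d x ->
  is_series (fun n => K * (Nat.iter n F x - Nat.iter (S n) F x)) (K * x).
Proof.
intros Hx. apply (is_series_scal_l K (fun n => Nat.iter n F x - Nat.iter (S n) F x)).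
assert (E : forall n, sum_n (fun n => Nat.iter n F x - Nat.iter (S n) F x) n = x - Nat.iter (S n) F x).
{ induction n as [|n IH].
  - rewrite sum_O. reflexivity.
  - rewrite sum_Sn, IH. unfold plus; simpl. ring. }
change (is_lim_seq (sum_n (fun n => Nat.iter n F x - Nat.iter (S n) F x)) (Finite x)).
apply (is_lim_seq_ext (fun n => x - Nat.iter (S n) F x)); [auto|].
replace (Finite x) with (Finite (x - 0)) by (f_equal; ring).
apply (is_lim_seq_minus' (fun _ => x)); [apply is_lim_seq_const|].
apply (is_lim_seq_incr_1 (fun n => Nat.iter n F x)). now apply half_iter_lim.
Qed.

Lemma coboundary_ex_series_abs x : Ioo 0 d x -> ex_series (fun n => Rabs (l (Nat.iter n F x))).
Proof.
intros Hx. eapply (ex_series_le (V := R_CompleteNormedModule)).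
- intros n. unfold norm; simpl; unfold abs; simpl. rewrite Rabs_Rabsolu.
  apply Hl, half_iter_maps, Hx.
- eexists. apply (telescoping_series x Hx).
Qed.

Lemma coboundary_sum_eq x : Ioo 0 d x -> coboundary_sum x = l x + coboundary_sum (F x).
Proof.
intros Hx. unfold coboundary_sum. rewrite Series_incr_1.
- f_equal. apply Series_ext. intros n. now rewrite Nat.iter_succ_r.
- apply ex_series_Rabs, coboundary_ex_series_abs, Hx.
Qed.

Lemma coboundary_sum_bound x : Ioo 0 d x -> Rabs (coboundary_sum x) <= K * x.
Proof.
intros Hx. unfold coboundary_sum.
eapply Rle_trans; [apply Series_Rabs, coboundary_ex_series_abs, Hx|].
rewrite <- (is_series_unique _ _ (telescoping_series x Hx)).
apply Series_le.
- intros n; split; [apply Rabs_pos|]. apply Hl, half_iter_maps, Hx.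
- eexists. apply (telescoping_series x Hx).
Qed.

Lemma coboundary_sum_continuous x : 0 <= K -> Ioo 0 d x -> continuous coboundary_sum x.
Proof.
intros K0 Hx.
pose (T := fix T n x := match n with O => 0 | S n => l x + T n (F x) end).
assert (ET : forall n y, Ioo 0 d y -> coboundary_sum y = T n y + coboundary_sum (Nat.iter n F y)).
{ induction n as [|n IH]; intros y Hy; simpl T.
  - simpl; ring.
  - rewrite coboundary_sum_eq, (IH (F y)) by auto using half_maps.
    rewrite <- Nat.iter_succ_r. ring. }
assert (CT : forall n y, Ioo 0 d y -> continuous (T n) y).
{ induction n as [|n IH]; intros y Hy.
  - apply continuous_const.
  - apply (continuous_plus l (fun x => T n (F x))); auto.
    apply (continuous_comp F (T n)); auto. apply IH, half_maps, Hy. }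
apply filterlim_locally. intros eps. assert (e0 := cond_pos eps).
assert (L := half_iter_lim x Hx). apply is_lim_seq_spec in L.
assert (e1 : 0 < eps / 4 / (K + 1)) by (apply Rdiv_lt_0_compat; lra).
destruct (L (mkposreal _ e1)) as [n Hn]. specialize (Hn n (le_n n)). simpl in Hn.
rewrite Rminus_0_r in Hn.
assert (In := half_iter_maps x n Hx). rewrite Rabs_pos_eq in Hn by (left; apply In).
assert (Sm : forall z, z < eps / 4 / (K + 1) -> Ioo 0 d z -> Rabs (coboundary_sum z) < eps / 4).
{ intros z Hz Iz. eapply Rle_lt_trans; [apply coboundary_sum_bound, Iz|].
  apply Rlt_div_r in Hz; [|lra]. destruct Iz. nra. }
assert (e2 : 0 < eps / 2) by lra.
assert (C1 := proj1 (filterlim_locally _ _) (CT n x Hx) (mkposreal _ e2)).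
assert (C2 : locally x (fun y => Nat.iter n F y < eps / 4 / (K + 1))).
{ apply (half_iter_continuous n x Hx (fun z => z < eps / 4 / (K + 1))). now apply (open_lt _). }
assert (C3 := open_locally (Ioo 0 d) x (open_Ioo 0 d) Hx).
generalize (filter_and _ _ C1 (filter_and _ _ C2 C3)). apply filter_imp. intros y [Y1 [Y2 Y3]].
unfold ball in *; simpl in *; unfold AbsRing_ball, abs, minus, plus, opp in *; simpl in *.
rewrite (ET n x Hx), (ET n y Y3).
assert (B1 := Sm _ Hn In). assert (B2 := Sm _ Y2 (half_iter_maps y n Y3)).
apply Rabs_def2 in B1; apply Rabs_def2 in B2; apply Rabs_def2 in Y1. apply Rabs_def1; lra.
Qed.
End CoboundarySum.

Lemma limit_le_right (u : R -> R) d q : 0 < d -> continuous u 0 ->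
  (forall x, 0 < x < d -> q <= u x) -> q <= u 0.
Proof.
intros d0 C H. apply Rnot_lt_le. intros L.
destruct (locally_ball_lt 0 _ (C (fun y => y < q) (open_lt q (u 0) L))) as [e [e0 He]].
set (x := Rmin (e / 2) (d / 2)).
assert (Hx : 0 < x /\ x < e /\ x < d) by (unfold x, Rmin; destruct Rle_dec; lra).
assert (u x < q) by (apply He; rewrite Rminus_0_r; apply Rabs_def1; lra).
assert (q <= u x) by (apply H; lra). lra.
Qed.

Lemma limit_ge_right (u : R -> R) d q : 0 < d -> continuous u 0 ->
  (forall x, 0 < x < d -> u x <= q) -> u 0 <= q.
Proof.
intros d0 C H. apply Ropp_le_cancel.
apply (limit_le_right (fun x => - u x) d); auto.
- apply (continuous_opp u); auto.
- intros x Hx; apply Ropp_le_contravar; auto.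
Qed.

Lemma ln_1p_bound t : Rabs t <= 1 / 2 -> Rabs (ln (1 + t) - t) <= 2 * t ^ 2.
Proof.
intros Ht. apply Rabs_le_between in Ht.
assert (U : ln (1 + t) <= t).
{ rewrite <- (ln_exp t) at 2. apply ln_le; [lra|]. apply exp_ineq1_le. }
assert (V : - ln (1 + t) <= / (1 + t) - 1).
{ rewrite <- ln_Rinv by lra. rewrite <- (ln_exp (/ (1 + t) - 1)).
  apply ln_le; [apply Rinv_0_lt_compat; lra|].
  generalize (exp_ineq1_le (/ (1 + t) - 1)); lra. }
assert (W : / (1 + t) - 1 = - t + t ^ 2 * / (1 + t)) by (field; lra).
assert (X : / (1 + t) <= 2).
{ rewrite <- (Rinv_inv 2). apply Rinv_le_contravar; lra. }
assert (Y : t ^ 2 * / (1 + t) <= t ^ 2 * 2) by (apply Rmult_le_compat_l; [nra|auto]).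
apply Rabs_le_between. split; [lra|]. nra.
Qed.

(** One side of a map [x - c x^3 + O(x^4)]. The last two inequalities make [d] small
    enough for the cubic term to dominate. *)
Definition parabolic (F : R -> R) (d c K : R) : Prop :=
  0 < d <= 1 /\ 0 < c /\ 0 <= K /\ Ck 1 (Ioo 0 d) F /\
  (forall x, Ioo 0 d x -> Rabs (F x - x + c * x ^ 3) <= K * x ^ 4) /\
  (forall x, Ioo 0 d x -> Rabs (Derive F x - 1 + 3 * c * x ^ 2) <= K * x ^ 3) /\
  K * d <= c / 2 /\ 4 * c * d ^ 2 <= 1 / 2.

Section Parabolic.
Variables (F : R -> R) (d c K : R).
Hypothesis H : parabolic F d c K.

Lemma parabolic_bounds x : Ioo 0 d x ->
  x - F x >= c / 2 * x ^ 3 /\ x / 2 < F x /\ 1 / 2 <= Derive F x /\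
  Rabs (F x / x - 1) <= 1 / 2 /\ Rabs (Derive F x - 1) <= 1 / 2.
Proof.
destruct H as [H1 [H2 [H3 [H4 [H5 [H6 [H7 H8]]]]]]]. intros Hx.
assert (A := H5 x Hx). assert (B := H6 x Hx). destruct Hx as [X1 X2].
assert (x3 : 0 < x ^ 3) by (apply pow_lt; auto). assert (x2 : 0 < x ^ 2) by (apply pow_lt; auto).
assert (Kx : K * x <= c / 2) by nra.
assert (cx : c * x ^ 2 <= 1 / 8) by nra.
replace (K * x ^ 4) with (K * x * x ^ 3) in A by ring.
replace (K * x ^ 3) with (K * x * x ^ 2) in B by ring.
assert (A' : K * x * x ^ 3 <= c / 2 * x ^ 3) by (apply Rmult_le_compat_r; lra).
assert (B' : K * x * x ^ 2 <= c / 2 * x ^ 2) by (apply Rmult_le_compat_r; lra).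
apply Rabs_le_between in A; apply Rabs_le_between in B.
assert (E3 : c * x ^ 3 <= x * / 8) by (simpl in *; nra).
split; [lra|]. split; [lra|]. split; [lra|]. split; [|apply Rabs_le_between; lra].
apply Rabs_le_between. replace (F x / x - 1) with ((F x - x) / x) by (field; lra).
split; [apply Rle_div_r | apply Rle_div_l]; lra.
Qed.

Lemma parabolic_half x : Ioo 0 d x -> 0 < F x < x.
Proof.
intros Hx. destruct (parabolic_bounds x Hx) as [B1 [B2 _]].
destruct H as [_ [c0 _]]. destruct Hx as [X1 X2].
assert (0 < x ^ 3) by (apply pow_lt; auto). nra.
Qed.

Let l x := 3 * ln (F x / x) - ln (Derive F x).
Let K1 := 4 * K + 6 * (c + K) ^ 2 + 2 * (3 * c + K) ^ 2.

(** The terms [- 3 c x^2] and [3 c x^2] of the two logarithms cancel, and the remainder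
    [O(x^3)] is comparable to the displacement. *)
Lemma parabolic_l_bound x : Ioo 0 d x -> Rabs (l x) <= 2 * K1 / c * (x - F x).
Proof.
intros Hx. destruct (parabolic_bounds x Hx) as [B1 [B2 [B3 [B4 B5]]]].
destruct H as [H1 [c0 [H3 [H4 [H5 [H6 [H7 H8]]]]]]].
assert (A := H5 x Hx). assert (B := H6 x Hx). destruct Hx as [X1 X2].
assert (x3 : 0 < x ^ 3) by (apply pow_lt; auto). assert (x2 : 0 < x ^ 2) by (apply pow_lt; auto).
set (u := F x / x - 1) in *. set (w := Derive F x - 1) in *.
assert (L1 := ln_1p_bound u B4). assert (L2 := ln_1p_bound w B5).
replace (1 + u) with (F x / x) in L1 by (unfold u; ring).
replace (1 + w) with (Derive F x) in L2 by (unfold w; ring).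
assert (Hu : Rabs (u + c * x ^ 2) <= K * x ^ 3).
{ replace (u + c * x ^ 2) with ((F x - x + c * x ^ 3) / x) by (unfold u; field; lra).
  unfold Rdiv. rewrite Rabs_mult, (Rabs_pos_eq (/ x)) by (left; apply Rinv_0_lt_compat; auto).
  apply Rle_div_l; [lra|]. lra. }
assert (Hw : Rabs (w + 3 * c * x ^ 2) <= K * x ^ 3) by exact B.
assert (x32 : x ^ 3 <= x ^ 2) by (simpl in *; nra).
assert (x43 : x ^ 4 <= x ^ 3) by (simpl in *; nra).
apply Rabs_le_between in Hu; apply Rabs_le_between in Hw.
apply Rabs_le_between in L1; apply Rabs_le_between in L2.
assert (u2 : u ^ 2 <= (c + K) ^ 2 * x ^ 3).
{ apply Rle_trans with (((c + K) * x ^ 2) ^ 2).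
  - apply pow_maj_Rabs. apply Rabs_le_between. split; nra.
  - replace (((c + K) * x ^ 2) ^ 2) with ((c + K) ^ 2 * x ^ 4) by ring.
    apply Rmult_le_compat_l; [apply pow2_ge_0|auto]. }
assert (w2 : w ^ 2 <= (3 * c + K) ^ 2 * x ^ 3).
{ apply Rle_trans with (((3 * c + K) * x ^ 2) ^ 2).
  - apply pow_maj_Rabs. apply Rabs_le_between. split; nra.
  - replace (((3 * c + K) * x ^ 2) ^ 2) with ((3 * c + K) ^ 2 * x ^ 4) by ring.
    apply Rmult_le_compat_l; [apply pow2_ge_0|auto]. }
assert (M : Rabs (l x) <= K1 * x ^ 3).
{ unfold l, K1. apply Rabs_le_between. split; nra. }
eapply Rle_trans; [exact M|].
assert (K10 : 0 <= K1) by (unfold K1; generalize (pow2_ge_0 (c + K)) (pow2_ge_0 (3 * c + K)); lra).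
replace (2 * K1 / c * (x - F x)) with (K1 * (2 / c * (x - F x))) by (field; lra).
apply Rmult_le_compat_l; auto.
replace (x ^ 3) with (2 / c * (c / 2 * x ^ 3)) by (field; lra).
apply Rmult_le_compat_l; [|lra]. apply Rlt_le, Rdiv_lt_0_compat; lra.
Qed.

Lemma parabolic_deriv x : Ioo 0 d x -> is_derive F x (Derive F x).
Proof. intros Hx. apply Derive_correct. apply H, Hx. Qed.

Lemma parabolic_l_cont x : Ioo 0 d x -> continuous l x.
Proof.
intros Hx. destruct (parabolic_bounds x Hx) as [B1 [B2 [B3 _]]].
assert (C' : continuous (Derive F) x) by (apply H, Hx).
assert (C : continuous F x) by (apply (ex_derive_continuous F x); eexists; apply parabolic_deriv, Hx).
destruct Hx as [X1 X2].
apply (continuous_minus (fun x => 3 * ln (F x / x)) (fun x => ln (Derive F x))).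
- apply (continuous_mult (fun _ => 3) (fun x => ln (F x / x))); [apply continuous_const|].
  apply (continuous_comp (fun x => F x / x) ln).
  + apply (continuous_mult F Rinv); auto.
    apply continuous_Rinv; lra.
  + apply continuous_ln. apply Rdiv_lt_0_compat; lra.
- apply (continuous_comp (Derive F) ln); auto. apply continuous_ln; lra.
Qed.

(** With [S = l + S o F], the function [Y = c x^3 exp S] transforms under [F] like a
    vector field; up to sign it is the one whose time-one map is [F]. *)
Lemma parabolic_field : exists (Y : R -> R) K2, 0 <= K2 /\
  (forall x, Ioo 0 d x -> continuous Y x) /\
  (forall x, Ioo 0 d x -> 0 < Y x) /\
  (forall x, Ioo 0 d x -> Y (F x) = Derive F x * Y x) /\
  (forall x, Ioo 0 d x -> c * x ^ 3 * exp (- (K2 * x)) <= Y x <= c * x ^ 3 * exp (K2 * x)).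
Proof.
assert (CF : forall x, Ioo 0 d x -> continuous F x).
{ intros x Hx. apply (ex_derive_continuous F x); eexists; apply parabolic_deriv, Hx. }
assert (HF := parabolic_half). assert (Cl := parabolic_l_cont). assert (Bl := parabolic_l_bound).
assert (c0 : 0 < c) by apply H. assert (K0 : 0 <= K) by apply H.
set (K2 := 2 * K1 / c) in *.
assert (K20 : 0 <= K2).
{ unfold K2, K1. apply Rdiv_le_0_compat; [|lra].
  generalize (pow2_ge_0 (c + K)) (pow2_ge_0 (3 * c + K)); lra. }
set (S := coboundary_sum F l).
assert (SE : forall x, Ioo 0 d x -> S x = l x + S (F x)) by (intros; apply (coboundary_sum_eq F l d K2); auto).
assert (SB : forall x, Ioo 0 d x -> Rabs (S x) <= K2 * x) by (intros; apply (coboundary_sum_bound F l d K2); auto).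
assert (SC : forall x, Ioo 0 d x -> continuous S x) by (intros; apply (coboundary_sum_continuous F l d K2); auto).
exists (fun x => c * x ^ 3 * exp (S x)), K2. split; [exact K20|]. split; [|split; [|split]].
- intros x Hx. apply (continuous_mult (fun x => c * x ^ 3) (fun x => exp (S x))).
  + apply (ex_derive_continuous (fun x => c * x ^ 3) x). now auto_derive.
  + apply (continuous_comp S exp); auto.
    apply (ex_derive_continuous exp). eexists; apply is_derive_exp.
- intros x [X1 X2]. apply Rmult_lt_0_compat; [|apply exp_pos].
  apply Rmult_lt_0_compat; auto. now apply pow_lt.
- intros x Hx. destruct (parabolic_bounds x Hx) as [B1 [B2 [B3 _]]].
  rewrite (SE x Hx), exp_plus.
  assert (E : exp (l x) = (F x / x) ^ 3 / Derive F x).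
  { unfold l. destruct Hx as [X1 X2].
    assert (P0 : 0 < F x / x) by (apply Rdiv_lt_0_compat; lra).
    unfold Rminus. rewrite exp_plus, exp_Ropp, (exp_ln (Derive F x)) by lra.
    replace (3 * ln (F x / x)) with (ln (F x / x) + (ln (F x / x) + ln (F x / x))) by ring.
    rewrite !exp_plus, !exp_ln by auto. simpl; field. lra. }
  rewrite E. destruct Hx as [X1 X2]. field. split; lra.
- intros x Hx. assert (B := SB x Hx). apply Rabs_le_between in B. destruct Hx as [X1 X2].
  assert (0 < c * x ^ 3) by (apply Rmult_lt_0_compat; auto; now apply pow_lt).
  split; apply Rmult_le_compat_l; try lra; apply exp_monotone; lra.
Qed.

(** Integrating [/ Y] makes [Phi x - Phi (F x)] constant. The mean value theorem
    expresses this constant as [(x - F x) / Y xi], which tends to [1] as [x] tends to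
    [0]. *)
Lemma fatou_coordinate d' : Ioo 0 d d' -> exists (Phi Y : R -> R) K2, 0 <= K2 /\
  (forall x, Ioo 0 d x -> continuous Y x) /\
  (forall x, Ioo 0 d x -> 0 < Y x) /\
  (forall x, Ioo 0 d x -> c * x ^ 3 * exp (- (K2 * x)) <= Y x <= c * x ^ 3 * exp (K2 * x)) /\
  (forall x, Ioo 0 d x -> is_derive Phi x (/ Y x)) /\
  Phi d' = 0 /\
  (forall x, Ioo 0 d x -> Phi (F x) = Phi x - 1).
Proof.
intros Hd'. destruct parabolic_field as [Y [K2 [K20 [CY [PY [EY BY]]]]]].
assert (HF := parabolic_half).
destruct (exists_antiderivative (fun x => / Y x) 0 d d' Hd') as [Phi [Z D]].
{ intros x Hx. apply (continuous_comp Y Rinv); auto.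
  apply continuous_Rinv, Rgt_not_eq, PY, Hx. }
exists Phi, Y, K2. split; [auto|]. repeat (split; [now auto|]).
assert (MF : forall x, Ioo 0 d x -> Ioo 0 d (F x)).
{ intros x Hx. generalize (HF x Hx). unfold Ioo in *; lra. }
set (kap := Phi d' - Phi (F d')).
assert (Ek : forall x, Ioo 0 d x -> Phi x - Phi (F x) = kap).
{ intros x Hx. apply (derive_zero_constant (fun x => Phi x - Phi (F x)) 0 d); auto.
  intros z Hz.
  assert (D1 : is_derive (fun x => Phi (F x)) z (Derive F z * / Y (F z))).
  { apply (is_derive_comp Phi F); [apply D, MF, Hz | apply parabolic_deriv, Hz]. }
  assert (D2 := is_derive_minus _ _ _ _ _ (D z Hz) D1).
  eapply eq_ind; [exact D2|]. unfold minus, plus, opp; simpl. rewrite (EY z Hz).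
  destruct (parabolic_bounds z Hz) as [_ [_ [B3 _]]]. assert (P0 := PY z Hz). field. lra. }
assert (c0 : 0 < c) by apply H. assert (K0 : 0 <= K) by apply H. assert (d0 : 0 < d) by apply H.
assert (KM : forall x, Ioo 0 d x -> exists xi, F x < xi < x /\ kap = / Y xi * (x - F x)).
{ intros x Hx. assert (Fx := HF x Hx). destruct (mean_value Phi (F x) x (proj2 Fx)) as [xi [Hxi E]].
  - intros z Hz. eexists; apply D. unfold Ioo in *; lra.
  - exists xi; split; auto. rewrite (Ek x Hx) in E.
    now rewrite (is_derive_unique Phi xi (/ Y xi)) in E by (apply D; unfold Ioo in *; lra). }
assert (k1 : kap <= 1).
{ set (u := fun x => (c + K * x) * exp (K2 * x) / (c * (1 - c * x ^ 2 - K * x ^ 3) ^ 3)).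
  replace 1 with (u 0) by (unfold u; rewrite !Rmult_0_r, exp_0; field; lra).
  apply (limit_le_right u d); auto.
  - apply (ex_derive_continuous u 0). unfold u. auto_derive. simpl. rewrite !Rmult_0_l, !Rmult_0_r. lra.
  - intros x Hx. destruct (KM x Hx) as [xi [Hxi E]]. assert (Fx := HF x Hx).
    assert (Ixi : Ioo 0 d xi) by (unfold Ioo; lra).
    destruct (parabolic_bounds x Hx) as [B1 [B2 _]].
    assert (A : Rabs (F x - x + c * x ^ 3) <= K * x ^ 4) by (apply H, Hx).
    apply Rabs_le_between in A.
    set (q := 1 - c * x ^ 2 - K * x ^ 3).
    assert (xq : x * q <= F x) by (unfold q; nra).
    assert (q0 : 0 < q).
    { destruct H as [G1 [_ [_ [_ [_ [_ [G7 G8]]]]]]].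
      assert (x ^ 2 <= d ^ 2) by (apply pow_incr; lra).
      replace (K * x ^ 3) with (K * x * x ^ 2) in q by ring. unfold q.
      nra. }
    assert (Yl : c * (x * q) ^ 3 * exp (- (K2 * x)) <= Y xi).
    { eapply Rle_trans; [|apply BY, Ixi].
      apply Rmult_le_compat.
      - apply Rmult_le_pos; [lra|]. apply pow_le, Rmult_le_pos; lra.
      - left; apply exp_pos.
      - apply Rmult_le_compat_l; [lra|]. apply pow_incr. split; [apply Rmult_le_pos; lra|lra].
      - apply exp_monotone. nra. }
    assert (P1 : 0 < c * (x * q) ^ 3 * exp (- (K2 * x))).
    { apply Rmult_lt_0_compat; [|apply exp_pos]. apply Rmult_lt_0_compat; auto.
      apply pow_lt, Rmult_lt_0_compat; lra. }
    rewrite E. apply Rle_trans with (/ (c * (x * q) ^ 3 * exp (- (K2 * x))) * ((c + K * x) * x ^ 3)).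
    + apply Rmult_le_compat; try lra.
      * left; apply Rinv_0_lt_compat; lra.
      * apply Rinv_le_contravar; auto.
    + right. unfold u. fold q. rewrite exp_Ropp. assert (0 < exp (K2 * x)) by apply exp_pos. field. lra. }
assert (k2 : 1 <= kap).
{ set (u := fun x => (c - K * x) * exp (- (K2 * x)) / c).
  replace 1 with (u 0) by (unfold u; rewrite !Rmult_0_r, Ropp_0, exp_0; field; lra).
  apply (limit_ge_right u d); auto.
  - apply (ex_derive_continuous u 0). unfold u. auto_derive. lra.
  - intros x Hx. destruct (KM x Hx) as [xi [Hxi E]]. assert (Fx := HF x Hx).
    assert (Ixi : Ioo 0 d xi) by (unfold Ioo; lra).
    assert (A : Rabs (F x - x + c * x ^ 3) <= K * x ^ 4) by (apply H, Hx).
    apply Rabs_le_between in A.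
    assert (Kx : K * x <= c / 2).
    { destruct H as [G1 [_ [_ [_ [_ [_ [G7 G8]]]]]]]. nra. }
    assert (x3 : 0 < x ^ 3) by (apply pow_lt; lra).
    assert (Yl : Y xi <= c * x ^ 3 * exp (K2 * x)).
    { eapply Rle_trans; [apply BY, Ixi|].
      apply Rmult_le_compat.
      - apply Rmult_le_pos; [lra|]. apply pow_le; lra.
      - left; apply exp_pos.
      - apply Rmult_le_compat_l; [lra|]. apply pow_incr. lra.
      - apply exp_monotone. nra. }
    rewrite E. apply Rle_trans with (/ (c * x ^ 3 * exp (K2 * x)) * ((c - K * x) * x ^ 3)).
    + right. unfold u. rewrite exp_Ropp. assert (0 < exp (K2 * x)) by apply exp_pos. field. lra.
    + apply Rmult_le_compat.
      * left; apply Rinv_0_lt_compat. apply Rmult_lt_0_compat; [|apply exp_pos]. apply Rmult_lt_0_compat; lra.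
      * apply Rmult_le_pos; lra.
      * apply Rinv_le_contravar; auto.
      * replace ((c - K * x) * x ^ 3) with (c * x ^ 3 - K * x ^ 4) by ring. lra. }
intros x Hx. assert (E := Ek x Hx). lra.
Qed.
End Parabolic.

(** * Conjugacy of parabolic maps *)

Lemma derive_nonneg_le f a b : a <= b ->
  (forall x, a <= x <= b -> exists l, is_derive f x l /\ 0 <= l) -> f a <= f b.
Proof.
intros [ab|ab] H; [|subst; lra]. destruct (mean_value f a b ab) as [c [Hc E]].
- intros x Hx. destruct (H x Hx) as [l [D _]]. now exists l.
- destruct (H c) as [l [D P]]; [lra|]. rewrite (is_derive_unique f c l D) in E. nra.
Qed.

(** The derivative of [Phi] lies between multiples of [x^-3] whose ratio tends to [1],
    and [- / (2 c x^2)] is a primitive of [/ (c x^3)]. *)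
Lemma fatou_asymptotics (Phi Y : R -> R) d c K : 0 < d -> 0 < c -> 0 <= K ->
  (forall x, Ioo 0 d x -> 0 < Y x) ->
  (forall x, Ioo 0 d x -> c * x ^ 3 * exp (- (K * x)) <= Y x <= c * x ^ 3 * exp (K * x)) ->
  (forall x, Ioo 0 d x -> is_derive Phi x (/ Y x)) ->
  tends0 (fun x => x ^ 2 * Phi x) (- / (2 * c)).
Proof.
intros d0 c0 K0 PY BY D. apply tends0_spec. intros eps e0.
assert (L1 : tends0 (fun x => exp (K * x) / (2 * c)) (/ (2 * c))).
{ apply tends0_continuous; [|rewrite Rmult_0_r, exp_0; field; lra].
  apply (ex_derive_continuous (fun x => exp (K * x) / (2 * c)) 0). auto_derive. lra. }
assert (L2 : tends0 (fun x => exp (- (K * x)) / (2 * c)) (/ (2 * c))).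
{ apply tends0_continuous; [|rewrite Rmult_0_r, Ropp_0, exp_0; field; lra].
  apply (ex_derive_continuous (fun x => exp (- (K * x)) / (2 * c)) 0). auto_derive. lra. }
assert (q1 : / (2 * c) < / (2 * c) + eps / 2) by lra.
assert (q2 : / (2 * c) - eps / 2 < / (2 * c)) by lra.
assert (N := filter_and _ _ (tends0_lt _ _ _ L1 q1)
  (filter_and _ _ (tends0_gt _ _ _ L2 q2) (near0_lt d d0))).
apply near0_spec in N. destruct N as [e1 [e10 N]].
set (z := e1 / 2). destruct (N z) as [N1 [N2 Hz]]; [unfold z; lra|].
set (E1 := exp (K * z) / (2 * c)) in *. set (E2 := exp (- (K * z)) / (2 * c)) in *.
assert (U : forall x, 0 < x < z -> x ^ 2 * Phi x <= x ^ 2 * (Phi z + E2 / z ^ 2) - E2).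
{ intros x Hx.
  assert (L : Phi x + E2 / x ^ 2 <= Phi z + E2 / z ^ 2).
  { apply (derive_nonneg_le (fun t => Phi t + E2 / t ^ 2)); [lra|]. intros t Ht.
    assert (It : Ioo 0 d t) by (unfold Ioo; lra).
    exists (/ Y t + E2 * (- (2 * t) / (t ^ 2) ^ 2)). split.
    - apply (is_derive_plus Phi (fun t => E2 / t ^ 2)); [now apply D|].
      apply is_derive_scal. apply is_derive_inv; [|apply pow_nonzero; lra].
      auto_derive; auto. ring.
    - assert (Q := proj2 (BY t It)).
      assert (t3 : 0 < t ^ 3) by (apply pow_lt; lra).
      replace (E2 * (- (2 * t) / (t ^ 2) ^ 2)) with (- / (c * t ^ 3 * exp (K * z))).
      2:{ unfold E2. rewrite exp_Ropp. assert (0 < exp (K * z)) by apply exp_pos. field. lra. }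
      assert (Y t <= c * t ^ 3 * exp (K * z)).
      { eapply Rle_trans; [exact Q|]. apply Rmult_le_compat_l.
        - apply Rmult_le_pos; lra.
        - apply exp_monotone. nra. }
      assert (/ (c * t ^ 3 * exp (K * z)) <= / Y t) by (apply Rinv_le_contravar; auto). lra. }
  assert (x2 : 0 < x ^ 2) by (apply pow_lt; lra).
  apply Rmult_le_compat_l with (r := x ^ 2) in L; [|lra].
  replace (x ^ 2 * (Phi x + E2 / x ^ 2)) with (x ^ 2 * Phi x + E2) in L by (field; lra). lra. }
assert (V : forall x, 0 < x < z -> x ^ 2 * (Phi z + E1 / z ^ 2) - E1 <= x ^ 2 * Phi x).
{ intros x Hx.
  assert (L : - (Phi x + E1 / x ^ 2) <= - (Phi z + E1 / z ^ 2)).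
  { apply (derive_nonneg_le (fun t => - (Phi t + E1 / t ^ 2))); [lra|]. intros t Ht.
    assert (It : Ioo 0 d t) by (unfold Ioo; lra).
    exists (- (/ Y t + E1 * (- (2 * t) / (t ^ 2) ^ 2))). split.
    - apply (is_derive_opp (fun t => Phi t + E1 / t ^ 2)).
      apply (is_derive_plus Phi (fun t => E1 / t ^ 2)); [now apply D|].
      apply is_derive_scal. apply is_derive_inv; [|apply pow_nonzero; lra].
      auto_derive; auto. ring.
    - assert (Q := proj1 (BY t It)).
      assert (t3 : 0 < t ^ 3) by (apply pow_lt; lra).
      replace (E1 * (- (2 * t) / (t ^ 2) ^ 2)) with (- / (c * t ^ 3 * exp (- (K * z)))).
      2:{ unfold E1. rewrite exp_Ropp. assert (0 < exp (K * z)) by apply exp_pos. field. lra. }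
      assert (c * t ^ 3 * exp (- (K * z)) <= Y t).
      { eapply Rle_trans; [|exact Q]. apply Rmult_le_compat_l.
        - apply Rmult_le_pos; lra.
        - apply exp_monotone. nra. }
      assert (/ Y t <= / (c * t ^ 3 * exp (- (K * z)))).
      { apply Rinv_le_contravar; auto. apply Rmult_lt_0_compat; [|apply exp_pos]. apply Rmult_lt_0_compat; lra. }
      lra. }
  assert (x2 : 0 < x ^ 2) by (apply pow_lt; lra).
  apply Rmult_le_compat_l with (r := x ^ 2) in L; [|lra].
  replace (x ^ 2 * - (Phi x + E1 / x ^ 2)) with (- (x ^ 2 * Phi x + E1)) in L by (field; lra). lra. }
assert (S : forall w, at_right 0 (fun x => - (eps / 2) < x ^ 2 * w < eps / 2)).
{ intros w. assert (T : tends0 (fun x => x ^ 2 * w) 0).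
  { eapply tends0_eq; [apply tends0_mult; [apply tends0_pow, tends0_id|apply tends0_const]|]. simpl; ring. }
  apply filter_and; [apply (tends0_gt _ _ _ T); lra | apply (tends0_lt _ _ _ T); lra]. }
apply near0_spec.
generalize (filter_and _ _ (S (Phi z + E2 / z ^ 2)) (filter_and _ _ (S (Phi z + E1 / z ^ 2)) (near0_lt z ltac:(lra)))).
apply filter_imp. intros x [S1 [S2 Hx]]. assert (U' := U x Hx). assert (V' := V x Hx).
apply Rabs_def1; lra.
Qed.

(** Both maps are the translation by [-1] in their Fatou coordinates, so [h = Psi^-1 o
    Phi] conjugates them. The asymptotics of [Phi] and [Psi] determine the limits of [h
    x / x] and [h'], which are needed to join two sides smoothly. *)
Lemma half_conjugacy F d c K G e c' K' d' e' :
  parabolic F d c K -> parabolic G e c' K' -> Ioo 0 d d' -> Ioo 0 e e' ->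
  exists h h' : R -> R,
  (forall x, Ioo 0 d' x -> Ioo 0 e' (h x) /\ is_derive h x (h' x) /\ 0 < h' x /\ continuous h' x) /\
  (forall y, Ioo 0 e' y -> exists x, Ioo 0 d' x /\ h x = y) /\
  (forall x, Ioo 0 d' x -> h (F x) = G (h x)) /\
  tends0 (fun x => h x / x) (sqrt (c / c')) /\ tends0 h' (sqrt (c / c')).
Proof.
intros HF HG Hd He.
destruct (fatou_coordinate F d c K HF d' Hd) as [Phi [Y [k [k0 [CY [PY [BY [DPhi [ZPhi EPhi]]]]]]]]].
destruct (fatou_coordinate G e c' K' HG e' He) as [Psi [W [k' [k'0 [CW [PW [BW [DPsi [ZPsi EPsi]]]]]]]]].
assert (c0 : 0 < c) by apply HF. assert (c'0 : 0 < c') by apply HG.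
assert (d0 : 0 < d) by apply HF. assert (e0 : 0 < e) by apply HG.
assert (APhi := fatou_asymptotics Phi Y d c k d0 c0 k0 PY BY DPhi).
assert (APsi := fatou_asymptotics Psi W e c' k' e0 c'0 k'0 PW BW DPsi).
assert (DP : forall x, Ioo 0 d x -> ex_derive Phi x) by (intros x Hx; eexists; apply DPhi, Hx).
assert (DQ : forall x, Ioo 0 e x -> ex_derive Psi x) by (intros x Hx; eexists; apply DPsi, Hx).
assert (PP : forall x, Ioo 0 d x -> 0 < Derive Phi x).
{ intros x Hx. rewrite (is_derive_unique _ _ _ (DPhi x Hx)). apply Rinv_0_lt_compat, PY, Hx. }
assert (PQ : forall x, Ioo 0 e x -> 0 < Derive Psi x).
{ intros x Hx. rewrite (is_derive_unique _ _ _ (DPsi x Hx)). apply Rinv_0_lt_compat, PW, Hx. }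
assert (Sd : forall x, Ioo 0 d' x -> Ioo 0 d x) by (unfold Ioo in *; intros; lra).
assert (Se : forall x, Ioo 0 e' x -> Ioo 0 e x) by (unfold Ioo in *; intros; lra).
assert (MP := deriv_pos_increasing Phi 0 d DP PP).
assert (MQ := deriv_pos_increasing Psi 0 e DQ PQ).
assert (Unb : forall (T : R -> R) q b, 0 < q -> 0 < b -> tends0 (fun x => x ^ 2 * T x) (- / (2 * q)) ->
   forall w, exists x, Ioo 0 b x /\ T x < w).
{ intros T q b q0 b0 A w.
  assert (iq : 0 < / (4 * q)) by (apply Rinv_0_lt_compat; lra).
  assert (A1 := tends0_lt _ _ (- / (4 * q)) A ltac:(replace (/ (2 * q)) with (2 * / (4 * q)) by (field; lra); lra)).
  assert (A2 : tends0 (fun x => x ^ 2 * w) 0).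
  { eapply tends0_eq; [apply tends0_mult; [apply tends0_pow, tends0_id|apply tends0_const]|]. simpl; ring. }
  assert (A3 := tends0_gt _ _ (- / (4 * q)) A2 ltac:(lra)).
  assert (N := filter_and _ _ A1 (filter_and _ _ A3 (near0_lt b b0))).
  apply near0_spec in N. destruct N as [t [t0 N]]. destruct (N (t / 2)) as [N1 [N2 N3]]; [lra|].
  exists (t / 2). split; [exact N3|]. assert (0 < (t / 2) ^ 2) by (apply pow_lt; lra).
  apply (Rmult_lt_reg_l ((t / 2) ^ 2)); auto. lra. }
assert (ImP : forall v, image (Ioo 0 d') Phi v <-> v < 0).
{ intros v. rewrite (image_unbounded_left Phi 0 d); auto; [now rewrite ZPhi|]. apply (Unb Phi c d); auto. }
assert (ImQ : forall v, image (Ioo 0 e') Psi v <-> v < 0).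
{ intros v. rewrite (image_unbounded_left Psi 0 e); auto; [now rewrite ZPsi|]. apply (Unb Psi c' e); auto. }
assert (NP : forall x, Ioo 0 d' x -> Phi x < 0) by (intros x Hx; apply ImP; exists x; auto).
assert (NQ : forall x, Ioo 0 e' x -> Psi x < 0) by (intros x Hx; apply ImQ; exists x; auto).
set (inv := inv_on (Ioo 0 e') Psi).
assert (IS : forall v, v < 0 -> Ioo 0 e' (inv v) /\ Psi (inv v) = v).
{ intros v Hv. apply inv_on_spec, ImQ, Hv. }
assert (IL : forall y, Ioo 0 e' y -> inv (Psi y) = y) by (apply inv_on_left; auto).
set (h := fun x => inv (Phi x)). set (h' := fun x => / Y x * W (h x)).
assert (Hh : forall x, Ioo 0 d' x -> Ioo 0 e' (h x)) by (intros x Hx; apply IS, NP, Hx).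
assert (Eh : forall x, Ioo 0 d' x -> Psi (h x) = Phi x) by (intros x Hx; apply IS, NP, Hx).
assert (Dh : forall x, Ioo 0 d' x -> is_derive h x (h' x)).
{ intros x Hx. apply (is_derive_comp inv Phi); [|apply DPhi, Sd, Hx].
  assert (D := inv_on_derive 0 e' Psi ltac:(auto) ltac:(auto) (Phi x) (proj2 (ImQ _) (NP x Hx))).
  fold inv in D. fold (h x) in D.
  rewrite (is_derive_unique _ _ _ (DPsi (h x) (Se _ (Hh x Hx)))), Rinv_inv in D. exact D. }
assert (Ch : forall x, Ioo 0 d' x -> continuous h x).
{ intros x Hx. apply (ex_derive_continuous h x). eexists; apply Dh, Hx. }
assert (T0 : tends0 h 0).
{ apply tends0_spec. intros eps eps0. set (y := Rmin (eps / 2) (e' / 2)).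
  assert (Hy : 0 < y /\ y < eps /\ y < e') by (unfold y, Rmin, Ioo in *; destruct Rle_dec; lra).
  destruct (Unb Phi c d c0 d0 APhi (Psi y)) as [x0 [Hx0 L0]].
  exists (Rmin x0 d'). split; [apply Rmin_case; [apply Hx0|apply Hd]|]. intros x Hx.
  assert (A1 := Rmin_l x0 d'). assert (A2 := Rmin_r x0 d').
  assert (Ix : Ioo 0 d' x) by (unfold Ioo; lra).
  assert (h x < y).
  { apply (increasing_lt_inv Psi (Ioo 0 e) MQ); [apply Se, Hh, Ix | unfold Ioo in *; lra |].
    rewrite Eh by auto. apply Rlt_trans with (Phi x0); auto. apply MP; auto. lra. }
  assert (0 < h x) by apply (Hh x Ix). rewrite Rminus_0_r. apply Rabs_def1; lra. }
assert (Nd : at_right 0 (fun x => Ioo 0 d' x)) by (apply near0_lt, Hd).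
assert (Nh : at_right 0 (fun x => 0 < h x)).
{ revert Nd. apply filter_imp. intros x Hx. apply (Hh x Hx). }
assert (ic : 0 < / (2 * c)) by (apply Rinv_0_lt_compat; lra).
assert (cc : 0 < c / c') by (apply Rdiv_lt_0_compat; auto).
assert (T2 : tends0 (fun x => (h x / x) ^ 2) (c / c')).
{ apply (tends0_ext (fun x => (h x ^ 2 * Psi (h x)) / (x ^ 2 * Phi x))).
  - revert Nd. apply filter_imp. intros x Hx. rewrite (Eh x Hx). assert (N := NP x Hx).
    destruct Hx. field. lra.
  - eapply tends0_eq.
    + apply tends0_div; [|apply (tends0_subst (fun y => y ^ 2 * Psi y) h _ Nh T0 APsi) | exact APhi]. lra.
    + field. lra. }
assert (T1 : tends0 (fun x => h x / x) (sqrt (c / c'))).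
{ apply (tends0_ext (fun x => sqrt ((h x / x) ^ 2))); [|now apply tends0_sqrt].
  generalize (filter_and _ _ Nd Nh). apply filter_imp. intros x [Hx Hhx]. destruct Hx.
  apply sqrt_pow2. left; apply Rdiv_lt_0_compat; auto. }
assert (EqY : forall (T : R -> R) q b s, 0 < q -> 0 < b ->
  (forall x, Ioo 0 b x -> q * x ^ 3 * exp (- (s * x)) <= T x <= q * x ^ 3 * exp (s * x)) ->
  tends0 (fun x => T x / (q * x ^ 3)) 1).
{ intros T q b s q0 b0 B.
  apply (tends0_squeeze (fun x => exp (- (s * x))) _ (fun x => exp (s * x))).
  - generalize (near0_lt b b0). apply filter_imp. intros x Hx. destruct (B x Hx) as [B1 B2].
    assert (0 < q * x ^ 3) by (apply Rmult_lt_0_compat; auto; apply pow_lt; lra).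
    split; [apply Rle_div_r | apply Rle_div_l]; lra.
  - apply tends0_continuous; [|rewrite Rmult_0_r, Ropp_0, exp_0; auto].
    apply (ex_derive_continuous (fun x => exp (- (s * x))) 0). now auto_derive.
  - apply tends0_continuous; [|rewrite Rmult_0_r, exp_0; auto].
    apply (ex_derive_continuous (fun x => exp (s * x)) 0). now auto_derive. }
exists h, h'. split; [|split; [|split; [|split]]].
- intros x Hx. split; [auto|]. split; [auto|]. assert (Y0 := PY x (Sd x Hx)). split.
  + apply Rmult_lt_0_compat; auto. now apply Rinv_0_lt_compat.
  + apply (continuous_mult (fun x => / Y x) (fun x => W (h x))).
    * apply (continuous_comp Y Rinv); [apply CY, Sd, Hx|].
      apply continuous_Rinv; lra.
    * apply (continuous_comp h W); [apply Ch, Hx | apply CW, Se, Hh, Hx].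
- intros y Hy. destruct (proj2 (ImP _) (NQ y Hy)) as [x [Hx Ex]].
  exists x; split; auto. unfold h. rewrite Ex. auto.
- intros x Hx.
  assert (HGh := parabolic_half G e c' K' HG (h x) (Se _ (Hh x Hx))).
  assert (IGh : Ioo 0 e' (G (h x))) by (generalize (Hh x Hx); unfold Ioo in *; lra).
  rewrite <- (IL (G (h x)) IGh), EPsi, Eh by auto. unfold h. now rewrite EPhi by auto.
- exact T1.
- apply (tends0_ext (fun x => (W (h x) / (c' * h x ^ 3)) / (Y x / (c * x ^ 3)) * (c' / c * (h x / x) ^ 3))).
  + generalize (filter_and _ _ Nd Nh). apply filter_imp. intros x [Hx Hhx].
    assert (Y0 := PY x (Sd x Hx)). destruct Hx. unfold h'. field. repeat split; lra.
  + eapply tends0_eq.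
    * apply tends0_mult; [apply tends0_div|apply tends0_mult; [apply tends0_const | apply tends0_pow, T1]].
      2: apply (tends0_subst (fun y => W y / (c' * y ^ 3)) h 1 Nh T0), (EqY W c' e k'); auto.
      2: apply (EqY Y c d k); auto. lra.
    * replace (sqrt (c / c') ^ 3) with (sqrt (c / c') * (sqrt (c / c') * sqrt (c / c'))) by ring.
      rewrite sqrt_sqrt by lra. field. lra.
Qed.

(** The conjugacies of the two sides have the same derivative [sqrt (c / c')] at [0],
    because [c] and [c'] are common to both sides; glued together they are of class
    C^1. *)
Lemma parabolic_conjugacy F d c K G e c' K' d' e' :
  F 0 = 0 -> G 0 = 0 ->
  parabolic F d c K -> parabolic (fun x => - F (- x)) d c K ->
  parabolic G e c' K' -> parabolic (fun y => - G (- y)) e c' K' ->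
  Ioo 0 d d' -> Ioo 0 e e' ->
  exists h, C_conjugacy 1 F (Ioo (- d') d') G (Ioo (- e') e') h.
Proof.
intros F0 G0 HF HF' HG HG' Hd He.
destruct (half_conjugacy F d c K G e c' K' d' e' HF HG Hd He) as [p [p' [P1 [P2 [P3 [P4 P5]]]]]].
destruct (half_conjugacy _ d c K _ e c' K' d' e' HF' HG' Hd He) as [q [q' [Q1 [Q2 [Q3 [Q4 Q5]]]]]].
assert (c0 : 0 < c) by apply HF. assert (c'0 : 0 < c') by apply HG.
assert (s0 : 0 < sqrt (c / c')) by (apply sqrt_lt_R0, Rdiv_lt_0_compat; auto).
set (s := sqrt (c / c')) in *.
set (h := fun x => if Rlt_dec 0 x then p x else if Rlt_dec x 0 then - q (- x) else 0).
set (h' := fun x => if Rlt_dec 0 x then p' x else if Rlt_dec x 0 then q' (- x) else s).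
assert (h0 : h 0 = 0) by (unfold h; repeat destruct Rlt_dec; lra).
assert (h'0 : h' 0 = s) by (unfold h'; repeat destruct Rlt_dec; lra).
assert (hp : forall x, 0 < x -> h x = p x) by (intros; unfold h; destruct Rlt_dec; lra).
assert (h'p : forall x, 0 < x -> h' x = p' x) by (intros; unfold h'; destruct Rlt_dec; lra).
assert (hn : forall x, x < 0 -> h x = - q (- x)) by (intros; unfold h; repeat destruct Rlt_dec; lra).
assert (h'n : forall x, x < 0 -> h' x = q' (- x)) by (intros; unfold h'; repeat destruct Rlt_dec; lra).
assert (Dh : forall x, Ioo (- d') d' x -> is_derive h x (h' x)).
{ intros x Hx. destruct (Rtotal_order x 0) as [L|[L|L]].
  - apply (is_derive_ext_loc (fun x => - q (- x))).
    + generalize (open_lt 0 x L). apply filter_imp. intros y Hy. symmetry; auto.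
    + rewrite h'n by auto. replace (q' (- x)) with (- (- 1 * q' (- x))) by ring.
      apply (is_derive_opp (fun x => q (- x))). apply (is_derive_comp q Ropp).
      * apply Q1. unfold Ioo in *; lra.
      * auto_derive; auto; ring.
  - subst x. rewrite h'0. apply is_derive_Reals. intros eps eps0.
    rewrite tends0_spec in P4, Q4. destruct (P4 eps eps0) as [e1 [e10 E1]].
    destruct (Q4 eps eps0) as [e2 [e20 E2]].
    assert (m0 : 0 < Rmin e1 e2) by (apply Rmin_case; auto).
    exists (mkposreal _ m0). simpl. intros t Ht Lt.
    assert (A1 := Rmin_l e1 e2). assert (A2 := Rmin_r e1 e2).
    rewrite Rplus_0_l, h0, Rminus_0_r. apply Rabs_def2 in Lt.
    destruct (Rlt_le_dec 0 t) as [T|T].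
    + rewrite hp by auto. apply E1. lra.
    + rewrite hn by lra. replace (- q (- t) / t) with (q (- t) / (- t)) by (field; auto). apply E2. lra.
  - apply (is_derive_ext_loc p).
    + generalize (open_gt 0 x L). apply filter_imp. intros y Hy. symmetry; auto.
    + rewrite h'p by auto. apply P1. unfold Ioo in *; lra. }
assert (Ch' : forall x, Ioo (- d') d' x -> continuous h' x).
{ intros x Hx. destruct (Rtotal_order x 0) as [L|[L|L]].
  - apply (continuous_ext_loc _ (fun x => q' (- x))).
    + generalize (open_lt 0 x L). apply filter_imp. intros y Hy. symmetry; auto.
    + apply (continuous_comp Ropp q').
      * apply (ex_derive_continuous Ropp x). auto_derive. auto.
      * apply Q1. unfold Ioo in *; lra.
  - subst x. apply filterlim_locally. rewrite h'0. intros eps.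
    rewrite tends0_spec in P5, Q5. destruct (P5 eps (cond_pos eps)) as [e1 [e10 E1]].
    destruct (Q5 eps (cond_pos eps)) as [e2 [e20 E2]].
    assert (m0 : 0 < Rmin e1 e2) by (apply Rmin_case; auto).
    exists (mkposreal _ m0). intros t Lt. unfold ball in *; simpl in *.
    unfold AbsRing_ball, abs, minus, plus, opp in *; simpl in *.
    assert (A1 := Rmin_l e1 e2). assert (A2 := Rmin_r e1 e2). apply Rabs_def2 in Lt.
    destruct (Rtotal_order t 0) as [T|[T|T]].
    + rewrite h'n by auto. apply E2. lra.
    + subst t. rewrite h'0. replace (s + - s) with 0 by ring. rewrite Rabs_R0. apply cond_pos.
    + rewrite h'p by auto. apply E1. lra.
  - apply (continuous_ext_loc _ p').
    + generalize (open_gt 0 x L). apply filter_imp. intros y Hy. symmetry; auto.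
    + apply P1. unfold Ioo in *; lra. }
assert (Ph' : forall x, Ioo (- d') d' x -> 0 < Derive h x).
{ intros x Hx. rewrite (is_derive_unique _ _ _ (Dh x Hx)).
  destruct (Rtotal_order x 0) as [L|[L|L]].
  - rewrite h'n by auto. apply Q1. unfold Ioo in *; lra.
  - subst x; now rewrite h'0.
  - rewrite h'p by auto. apply P1. unfold Ioo in *; lra. }
assert (C1 : Ck 1 (Ioo (- d') d') h) by (apply (Ck_intro 0 _ h h'); auto using open_Ioo).
assert (Dx : forall x, Ioo (- d') d' x -> ex_derive h x) by apply C1.
assert (Hh : forall x, Ioo (- d') d' x -> Ioo (- e') e' (h x)).
{ intros x Hx. destruct (Rtotal_order x 0) as [L|[L|L]].
  - rewrite hn by auto. destruct (Q1 (- x)) as [[A B] _]; unfold Ioo in *; lra.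
  - subst x. rewrite h0. unfold Ioo in *; lra.
  - rewrite hp by auto. destruct (P1 x) as [[A B] _]; unfold Ioo in *; lra. }
assert (Im : forall y, Ioo (- e') e' y -> image (Ioo (- d') d') h y).
{ intros y Hy. destruct (Rtotal_order y 0) as [L|[L|L]].
  - destruct (Q2 (- y)) as [x [Hx E]]; [unfold Ioo in *; lra|].
    exists (- x). split; [unfold Ioo in *; lra|].
    rewrite hn, Ropp_involutive by (destruct Hx; lra). lra.
  - subst y. exists 0. split; auto. unfold Ioo in *; lra.
  - destruct (P2 y) as [x [Hx E]]; [unfold Ioo in *; lra|].
    exists x. split; [unfold Ioo in *; lra|]. rewrite hp by apply Hx. auto. }
exists h. split.
- split; [apply open_Ioo|]. split; [apply open_Ioo|]. split; [apply Ck_C_on; auto; apply open_Ioo|].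
  exists (inv_on (Ioo (- d') d') h). split; [|split].
  + apply Ck_C_on; [apply open_Ioo|]. apply (Ck_sub _ (image (Ioo (- d') d') h)); auto.
    apply Ck_inv_on; auto.
  + intros x Hx. split; auto. apply inv_on_left; auto.
  + intros y Hy. apply inv_on_spec, Im, Hy.
- intros x Hx _. destruct (Rtotal_order x 0) as [L|[L|L]].
  + assert (I : Ioo 0 d (- x)) by (unfold Ioo in *; lra).
    assert (B := parabolic_half _ d c K HF' (- x) I). simpl in B. rewrite Ropp_involutive in B.
    rewrite (hn x L), (hn (F x)) by lra.
    assert (E := Q3 (- x) ltac:(unfold Ioo in *; lra)). simpl in E. rewrite Ropp_involutive in E. lra.
  + subst x. now rewrite F0, h0, G0.
  + assert (I : Ioo 0 d x) by (unfold Ioo in *; lra).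
    assert (B := parabolic_half F d c K HF x I).
    rewrite (hp x L), (hp (F x)) by lra. apply P3. unfold Ioo in *; lra.
Qed.

(** * Unfoldings of the cubic map *)

(** Conjugation by [x -> - x], by which statements on the right of [0] carry over to the
    left. *)
Definition reflect (F : R -> R) (x : R) : R := - F (- x).

(** Taylor control of order 3 which is uniform along a family: [nu], [A] and [B] depend
    on the parameter, [c] and [K] do not. *)
Definition unfolding (F : R -> R) (c K d nu A B : R) : Prop :=
  (forall x, Ioo (- d) d x -> ex_derive F x /\ ex_derive (Derive F) x) /\
  (forall x, Ioo (- d) d x ->
     Rabs (F x - x - (nu * x + A * x ^ 2 + B * x ^ 3)) <= K * Rabs x ^ 4) /\
  (forall x, Ioo (- d) d x ->
     Rabs (Derive F x - 1 - (nu + 2 * A * x + 3 * B * x ^ 2)) <= K * Rabs x ^ 3) /\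
  (forall x, Ioo (- d) d x ->
     Rabs (Derive (Derive F) x - (2 * A + 6 * B * x)) <= K * Rabs x ^ 2) /\
  Rabs A <= K * Rabs nu /\ Rabs (B + c) <= K * Rabs nu.

(** The smallness of the radius and of [nu] that makes the terms [nu x] and [- c x^3]
    dominate. *)
Definition small_params (c K d nu : R) : Prop :=
  0 < c /\ 1 <= K /\ 0 < d <= 1 / 2 /\ K * d <= 1 / 4 /\ K * d <= c / 8 /\ c * d ^ 2 <= 1 / 32 /\
  K * Rabs nu <= c / 8 /\ Rabs nu <= 1 / 8 /\ 4 * K ^ 2 * Rabs nu < c.

Lemma Derive_reflect F x : ex_derive F (- x) -> is_derive (reflect F) x (Derive F (- x)).
Proof.
intros D. unfold reflect. replace (Derive F (- x)) with (- (- 1 * Derive F (- x))) by ring.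
apply (is_derive_opp (fun x => F (- x))). apply (is_derive_comp F Ropp).
- now apply Derive_correct.
- auto_derive; auto; ring.
Qed.

Lemma reflect_Ck k F d : Ck k (Ioo (- d) d) F -> Ck k (Ioo (- d) d) (reflect F).
Proof.
intros C. unfold reflect. apply Ck_opp; [apply open_Ioo|].
apply (Ck_comp k _ (Ioo (- d) d) F); auto using open_Ioo.
- unfold Ioo; intros; lra.
- apply Ck_opp; [apply open_Ioo | apply Ck_id].
Qed.

Lemma unfolding_reflect F c K d nu A B : unfolding F c K d nu A B ->
  unfolding (reflect F) c K d nu (- A) B.
Proof.
intros [H1 [H2 [H3 [H4 [H5 H6]]]]].
assert (N : forall x, Ioo (- d) d x -> Ioo (- d) d (- x)) by (unfold Ioo; intros; lra).
assert (D1 : forall x, Ioo (- d) d x -> is_derive (reflect F) x (Derive F (- x))).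
{ intros x Hx. apply Derive_reflect, H1, N, Hx. }
assert (E1 : forall x, Ioo (- d) d x -> Derive (reflect F) x = Derive F (- x)).
{ intros x Hx. apply is_derive_unique, D1, Hx. }
assert (D2 : forall x, Ioo (- d) d x -> is_derive (Derive (reflect F)) x (- Derive (Derive F) (- x))).
{ intros x Hx. apply (is_derive_ext_loc (fun x => Derive F (- x))).
  - generalize (open_locally _ x (open_Ioo (- d) d) Hx). apply filter_imp. intros y Hy. now rewrite E1.
  - replace (- Derive (Derive F) (- x)) with (- 1 * Derive (Derive F) (- x)) by ring.
    apply (is_derive_comp (Derive F) Ropp); [apply Derive_correct, H1, N, Hx|]. auto_derive; auto; ring. }
split; [|split; [|split; [|split; [|split]]]].
- intros x Hx. split; eexists; eauto.
- intros x Hx. assert (Q := H2 (- x) (N x Hx)). rewrite Rabs_Ropp in Q. unfold reflect.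
  rewrite <- Rabs_Ropp.
  replace (- (- F (- x) - x - (nu * x + - A * x ^ 2 + B * x ^ 3)))
    with (F (- x) - - x - (nu * - x + A * (- x) ^ 2 + B * (- x) ^ 3)) by ring. exact Q.
- intros x Hx. assert (Q := H3 (- x) (N x Hx)). rewrite Rabs_Ropp in Q. rewrite E1 by auto.
  replace (nu + 2 * - A * x + 3 * B * x ^ 2) with (nu + 2 * A * - x + 3 * B * (- x) ^ 2) by ring. exact Q.
- intros x Hx. assert (Q := H4 (- x) (N x Hx)). rewrite Rabs_Ropp in Q.
  rewrite (is_derive_unique _ _ _ (D2 x Hx)). rewrite <- Rabs_Ropp.
  replace (- (- Derive (Derive F) (- x) - (2 * - A + 6 * B * x)))
    with (Derive (Derive F) (- x) - (2 * A + 6 * B * - x)) by ring. exact Q.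
- now rewrite Rabs_Ropp.
- exact H6.
Qed.

Section Unfolding.
Variables (F : R -> R) (c K d nu A B : R).
Hypothesis HS : small_params c K d nu.
Hypothesis HU : unfolding F c K d nu A B.

Lemma unfolding_fixes0 : F 0 = 0.
Proof.
destruct HU as [_ [H2 _]]. destruct HS as [_ [_ [d0 _]]].
assert (Q := H2 0 ltac:(unfold Ioo; lra)). rewrite Rabs_R0, pow_i, Rmult_0_r in Q by lia.
apply Rabs_le_between in Q. simpl in Q. lra.
Qed.

Lemma unfolding_multiplier0 : Derive F 0 = 1 + nu.
Proof.
destruct HU as [_ [_ [H3 _]]]. destruct HS as [_ [_ [d0 _]]].
assert (Q := H3 0 ltac:(unfold Ioo; lra)). rewrite Rabs_R0, pow_i, Rmult_0_r in Q by lia.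
apply Rabs_le_between in Q. simpl in Q. lra.
Qed.

Lemma unfolding_cubic_bounds : - (9 / 8) * c <= B <= - (7 / 8) * c.
Proof.
destruct HU as [_ [_ [_ [_ [_ H6]]]]]. destruct HS as [c0 [K1 [Hd [S1 [S2 [S3 [S4 [S5 S6]]]]]]]].
apply Rabs_le_between in H6. lra.
Qed.

Lemma unfolding_derivative_near_1 x : Ioo (- d) d x -> Rabs (Derive F x - 1) <= 1 / 2.
Proof.
intros Hx. assert (HB := unfolding_cubic_bounds).
destruct HU as [_ [_ [H3 [_ [H5 _]]]]]. destruct HS as [c0 [K1 [Hd [S1 [S2 [S3 [S4 [S5 S6]]]]]]]].
assert (Q := H3 x Hx). assert (ax : Rabs x < d) by (apply Rabs_def1; unfold Ioo in Hx; lra).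
assert (ax0 := Rabs_pos x). assert (n0 := Rabs_pos nu).
assert (X3 : K * Rabs x ^ 3 <= 1 / 16).
{ replace (K * Rabs x ^ 3) with (K * Rabs x * (Rabs x * Rabs x)) by ring.
  assert (K * Rabs x <= 1 / 4) by nra.
  nra. }
assert (X1 : Rabs (2 * A * x) <= 1 / 16).
{ rewrite !Rabs_mult, (Rabs_pos_eq 2) by lra.
  apply Rle_trans with (2 * (K * Rabs nu) * d); [|nra].
  assert (0 <= Rabs A) by apply Rabs_pos. nra. }
assert (X2 : Rabs (3 * B * x ^ 2) <= 1 / 8).
{ rewrite !Rabs_mult, (Rabs_pos_eq 3), <- RPow_abs by lra.
  assert (Rabs B <= 9 / 8 * c) by (apply Rabs_le_between; lra).
  assert (Rabs x ^ 2 <= d ^ 2) by (apply pow_incr; lra). assert (0 <= Rabs x ^ 2) by (apply pow_le; lra).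
  apply Rle_trans with (3 * (9 / 8 * c) * d ^ 2); [|lra].
  apply Rmult_le_compat; try lra. assert (0 <= Rabs B) by apply Rabs_pos. lra. }
apply Rabs_le_between in Q. apply Rabs_le_between in X1. apply Rabs_le_between in X2.
assert (X0 : - (1 / 8) <= nu <= 1 / 8) by (apply Rabs_le_between; exact S5).
apply Rabs_le_between; lra.
Qed.

Lemma unfolding_increasing x : Ioo (- d) d x -> 0 < Derive F x.
Proof. intros Hx. assert (Q := unfolding_derivative_near_1 x Hx). apply Rabs_le_between in Q. lra. Qed.

(** The term [A x] is absorbed by [nu / 4], since [|A| <= K |nu|], and the remainder and
    the variation of [B] by [c x^2 / 4]. *)
Lemma unfolding_displacement x : Ioo (- d) d x ->
  exists q, F x - x = x * q /\
   nu - Rabs nu / 4 - 5 / 4 * c * x ^ 2 <= q <= nu + Rabs nu / 4 - 3 / 4 * c * x ^ 2.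
Proof.
intros Hx. assert (HB := unfolding_cubic_bounds). assert (F0 := unfolding_fixes0).
destruct HU as [_ [H2 [_ [_ [H5 _]]]]]. destruct HS as [c0 [K1 [Hd [S1 [S2 [S3 [S4 [S5 S6]]]]]]]].
destruct (Req_dec x 0) as [->|Nx].
{ exists nu. rewrite F0. split; [ring|]. simpl. generalize (Rabs_pos nu); lra. }
assert (Q := H2 x Hx). assert (ax : Rabs x < d) by (apply Rabs_def1; unfold Ioo in Hx; lra).
assert (ax0 : 0 < Rabs x) by (now apply Rabs_pos_lt). assert (n0 := Rabs_pos nu).
exists ((F x - x) / x). split; [field; auto|].
assert (Q' : Rabs ((F x - x) / x - (nu + A * x + B * x ^ 2)) <= K * Rabs x ^ 3).
{ replace ((F x - x) / x - (nu + A * x + B * x ^ 2)) with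
    ((F x - x - (nu * x + A * x ^ 2 + B * x ^ 3)) / x) by (field; auto).
  unfold Rdiv. rewrite Rabs_mult, Rabs_inv. apply Rle_div_l; auto.
  replace (K * Rabs x ^ 3 * Rabs x) with (K * Rabs x ^ 4) by ring. exact Q. }
assert (x2 : 0 < x ^ 2) by (rewrite <- Rsqr_pow2; now apply Rsqr_pos_lt).
assert (X3 : K * Rabs x ^ 3 <= c / 8 * x ^ 2).
{ rewrite <- (pow2_abs x). replace (K * Rabs x ^ 3) with (K * Rabs x * Rabs x ^ 2) by ring.
  apply Rmult_le_compat_r; [apply pow_le; lra|]. nra. }
assert (X1 : Rabs (A * x) <= Rabs nu / 4).
{ rewrite Rabs_mult. apply Rle_trans with (K * Rabs nu * d); [|nra].
  assert (0 <= Rabs A) by apply Rabs_pos. nra. }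
apply Rabs_le_between in Q'. apply Rabs_le_between in X1.
assert (B1 : - (9 / 8) * c * x ^ 2 <= B * x ^ 2) by (apply Rmult_le_compat_r; lra).
assert (B2 : B * x ^ 2 <= - (7 / 8) * c * x ^ 2) by (apply Rmult_le_compat_r; lra).
lra.
Qed.

Lemma unfolding_displacement_neg x : nu < 0 -> Ioo (- d) d x -> exists w, F x - x = - (x * w) /\
   - nu / 2 + c / 2 * x ^ 2 <= w <= 2 * (- nu + c * x ^ 2).
Proof.
intros n0 Hx. destruct (unfolding_displacement x Hx) as [q [E Q]].
rewrite (Rabs_left nu n0) in Q. exists (- q). split; [rewrite E; ring|].
lra.
Qed.

(** The quotient [Q = (F x - x) / x] is positive up to [s = sqrt (nu / (4 c))]. Beyond
    [s] its derivative has the sign of [2 B x], as [|A|] is at most [K nu < c s] there.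
    Hence [Q] vanishes exactly once. *)
Lemma unfolding_pos_right d' : 0 < nu -> 0 < d' < d -> nu < c * d' ^ 2 / 4 ->
  exists x1, 0 < x1 < d' /\ F x1 = x1 /\ Derive F x1 < 1 /\
  (forall x, 0 < x < x1 -> x < F x) /\ (forall x, x1 < x < d -> F x < x).
Proof.
intros n0 Hd' nd'. assert (HB := unfolding_cubic_bounds).
destruct HU as [H1 [H2 [H3 [_ [H5 _]]]]]. destruct HS as [c0 [K1 [Hd [S1 [S2 [S3 [S4 [S5 S6]]]]]]]].
rewrite (Rabs_pos_eq nu) in * by lra.
set (s := sqrt (nu / (4 * c))).
assert (s2 : s ^ 2 = nu / (4 * c)) by (unfold s; rewrite pow2_sqrt; auto; apply Rdiv_le_0_compat; lra).
assert (s0 : 0 < s) by (apply sqrt_lt_R0, Rdiv_lt_0_compat; lra).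
assert (cs : 4 * c * s ^ 2 = nu) by (rewrite s2; field; lra).
(* [4 K^2 nu < c] means [4 K s < 1], and [K nu = 4 K c s^2]. *)
assert (Ks : K * nu < c * s).
{
  assert (4 * K * s < 1).
  { apply Rnot_le_lt. intros X. assert (1 <= (4 * K * s) ^ 2) by nra.
    replace ((4 * K * s) ^ 2) with (4 * K ^ 2 * (4 * c * s ^ 2) / c) in H by (field; lra).
    rewrite cs in H. apply Rle_div_r in H; lra. }
  rewrite <- cs. replace (K * (4 * c * s ^ 2)) with (4 * K * s * (c * s)) by ring.
  nra. }
assert (sd : s < d').
{ apply Rnot_le_lt. intros X. assert (d' ^ 2 <= s ^ 2) by (apply pow_incr; lra). nra. }
pose (Q := fun x => (F x - x) / x).
assert (EQ : forall x, 0 < x < d -> F x - x = x * Q x) by (intros; unfold Q; field; lra).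
assert (BQ : forall x, 0 < x < d -> 3 / 4 * nu - 5 / 4 * c * x ^ 2 <= Q x <= 5 / 4 * nu - 3 / 4 * c * x ^ 2).
{ intros x Hx. destruct (unfolding_displacement x) as [q [E Hq]]; [unfold Ioo; lra|].
  rewrite (Rabs_pos_eq nu) in Hq by lra.
  replace (Q x) with q by (unfold Q; rewrite E; field; lra). lra. }
assert (Pos : forall x, 0 < x <= s -> 0 < Q x).
{ intros x Hx. assert (x ^ 2 <= s ^ 2) by (apply pow_incr; lra).
  generalize (BQ x ltac:(lra)). nra. }
assert (DQ : forall x, 0 < x < d -> is_derive Q x ((x * Derive F x - F x) / x ^ 2)).
{ intros x Hx. unfold Q. assert (ex_derive F x) by (apply H1; unfold Ioo; lra).
  auto_derive; [repeat split; auto; lra|]. replace (Derive (fun x => F x) x) with (Derive F x) by reflexivity.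
  field. lra. }
assert (Neg : forall x, s <= x < d -> x * Derive F x - F x < 0).
{ intros x Hx. assert (Ix : Ioo (- d) d x) by (unfold Ioo; lra).
  assert (Q2 := H2 x Ix). assert (Q3 := H3 x Ix). rewrite (Rabs_pos_eq x) in Q2, Q3 by lra.
  apply Rabs_le_between in Q2. apply Rabs_le_between in Q3.
  assert (x2 : 0 < x ^ 2) by (apply pow_lt; lra).
  assert (HA : A <= K * nu) by (apply Rle_trans with (Rabs A); auto; apply Rle_abs).
  assert (T2 : A + 2 * B * x + 2 * K * x ^ 2 < 0).
  { assert (B * x <= - (7 / 8) * c * x) by (apply Rmult_le_compat_r; lra).
    assert (K * x <= K * d) by (apply Rmult_le_compat_l; lra).
    assert (K * x ^ 2 <= c / 8 * x).
    { replace (K * x ^ 2) with (K * x * x) by ring. apply Rmult_le_compat_r; lra. }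
    assert (c * s <= c * x) by (apply Rmult_le_compat_l; lra).
    assert (0 < c * x) by (apply Rmult_lt_0_compat; lra). lra. }
  nra. }
assert (Dec : forall x y, s <= x -> x < y -> y < d -> Q y < Q x).
{ intros x y Hx xy Hy. destruct (mean_value Q x y xy) as [z [Hz E]].
  - intros z Hz. eexists; apply DQ; lra.
  - rewrite (is_derive_unique _ _ _ (DQ z ltac:(lra))) in E.
    assert (N := Neg z ltac:(lra)). assert (0 < / z ^ 2) by (apply Rinv_0_lt_compat, pow_lt; lra).
    unfold Rdiv in E. assert ((z * Derive F z - F z) * / z ^ 2 < 0) by nra. nra. }
destruct (ivt (fun x => - Q x) s d' 0) as [x1 [Hx1 E1]].
{ lra. }
{ intros x Hx. apply (continuous_opp Q), (ex_derive_continuous Q x). eexists; apply DQ; lra. }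
{ split; [generalize (Pos s); lra|]. generalize (BQ d'); nra. }
assert (x1d : x1 < d').
{ destruct (proj2 Hx1) as [X|X]; auto. subst x1. generalize (BQ d'); nra. }
exists x1. split; [lra|].
assert (Fx1 : F x1 = x1) by (generalize (EQ x1 ltac:(lra)); nra).
split; [auto|]. split; [|split].
- assert (N := Neg x1 ltac:(lra)). rewrite Fx1 in N. nra.
- intros x Hx. assert (0 < Q x).
  { destruct (Rle_lt_dec x s); [apply Pos; lra|]. generalize (Dec x x1); lra. }
  generalize (EQ x ltac:(lra)). nra.
- intros x Hx. generalize (Dec x1 x) (EQ x ltac:(lra)). nra.
Qed.
End Unfolding.

Lemma unfolding_pitch_neg n F c K d nu A B :
  small_params c K d nu -> unfolding F c K d nu A B -> nu < 0 ->
  Ck n (Ioo (- d) d) F -> monostable n F d.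
Proof.
intros HS HU n0 C. assert (Hd : 0 < d) by apply HS. assert (c0 : 0 < c) by apply HS.
split; [auto|]. split; [auto|]. split; [now apply (unfolding_increasing F c K d nu A B)|].
split; [now apply (unfolding_fixes0 F c K d nu A B)|].
assert (W : forall x, Ioo (- d) d x -> exists w, F x - x = - (x * w) /\ 0 < w).
{ intros x Hx. destruct (unfolding_displacement_neg F c K d nu A B HS HU x n0 Hx) as [w [E Hw]].
  exists w. split; auto. assert (0 <= c * x ^ 2) by (apply Rmult_le_pos; [lra | apply pow2_ge_0]). lra. }
split; intros x Hx; destruct (W x) as [w [E Hw]]; try (unfold Ioo; lra); nra.
Qed.

Lemma unfolding_pitch_pos n F c K d nu A B d' :
  small_params c K d nu -> unfolding F c K d nu A B -> 0 < nu -> 0 < d' < d -> nu < c * d' ^ 2 / 4 ->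
  Ck n (Ioo (- d) d) F -> exists x2 x1, bistable n F d x2 x1 /\ - d' < x2 /\ x1 < d' /\
  Derive F x1 < 1 /\ Derive F x2 < 1.
Proof.
intros HS HU n0 Hd' nd' C.
destruct (unfolding_pos_right F c K d nu A B HS HU d' n0 Hd' nd') as [x1 [X1 [X2 [X3 [X4 X5]]]]].
destruct (unfolding_pos_right (reflect F) c K d nu (- A) B HS (unfolding_reflect _ _ _ _ _ _ _ HU) d' n0 Hd' nd')
  as [y1 [Y1 [Y2 [Y3 [Y4 Y5]]]]].
exists (- y1), x1. split; [|split; [lra|split; [lra|split; [auto|]]]].
- split; [lra|]. split; [lra|]. split; [auto|]. split; [now apply (unfolding_increasing F c K d nu A B)|].
  split; [now apply (unfolding_fixes0 F c K d nu A B)|]. split; [auto|].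
  split; [unfold reflect in Y2; lra|]. split; [auto|]. split; [auto|]. split.
  + intros x Hx. generalize (Y4 (- x)). unfold reflect. rewrite Ropp_involutive. lra.
  + intros x Hx. generalize (Y5 (- x)). unfold reflect. rewrite Ropp_involutive. lra.
- rewrite (is_derive_unique _ _ _ (Derive_reflect F y1 ltac:(apply HU; unfold Ioo; lra))) in Y3. exact Y3.
Qed.

Lemma unfolding_parabolic F c K d : small_params c K d 0 -> unfolding F c K d 0 0 (- c) ->
  Ck 1 (Ioo (- d) d) F -> parabolic F d c K.
Proof.
intros HS HU C. destruct HS as [c0 [K1 [Hd [S1 [S2 [S3 [S4 [S5 S6]]]]]]]].
destruct HU as [H1 [H2 [H3 _]]].
split; [lra|]. split; [auto|]. split; [lra|].
split; [apply (Ck_sub _ (Ioo (- d) d)); auto; unfold Ioo; intros; lra|].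
split; [|split; [|split; [lra|nra]]].
- intros x Hx. assert (Q := H2 x ltac:(unfold Ioo in *; lra)). destruct Hx.
  rewrite (Rabs_pos_eq x) in Q by lra.
  replace (F x - x + c * x ^ 3) with (F x - x - (0 * x + 0 * x ^ 2 + - c * x ^ 3)) by ring. exact Q.
- intros x Hx. assert (Q := H3 x ltac:(unfold Ioo in *; lra)). destruct Hx.
  rewrite (Rabs_pos_eq x) in Q by lra.
  replace (Derive F x - 1 + 3 * c * x ^ 2) with (Derive F x - 1 - (0 + 2 * 0 * x + 3 * - c * x ^ 2)) by ring. exact Q.
Qed.

(** * The logarithmic derivative of the linearization *)

Lemma ln_near_1 r : 1 / 3 <= r -> Rabs (ln r) <= 3 * Rabs (r - 1).
Proof.
intros Hr. assert (U : ln r <= r - 1).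
{ rewrite <- (ln_exp (r - 1)). apply ln_le; [lra|]. generalize (exp_ineq1_le (r - 1)); lra. }
assert (V : - ln r <= / r - 1).
{ rewrite <- ln_Rinv by lra. rewrite <- (ln_exp (/ r - 1)).
  apply ln_le; [apply Rinv_0_lt_compat; lra|]. generalize (exp_ineq1_le (/ r - 1)); lra. }
assert (W : / r <= 3).
{ rewrite <- (Rinv_inv 3). apply Rinv_le_contravar; lra. }
assert (W0 : 0 < / r) by (apply Rinv_0_lt_compat; lra).
replace (/ r - 1) with ((1 - r) * / r) in V by (field; lra).
unfold Rabs; repeat destruct Rcase_abs; nra.
Qed.

Lemma exp_minus_1_bound t a : Rabs t <= a -> Rabs (exp t - 1) <= exp a * Rabs t.
Proof.
intros H. assert (a0 : 0 <= a) by (generalize (Rabs_pos t); lra).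
assert (E1 : 1 <= exp a) by (generalize (exp_ineq1_le a); lra).
destruct (Rle_lt_dec 0 t) as [T|T].
- rewrite (Rabs_pos_eq t) in * by auto.
  assert (1 <= exp t) by (generalize (exp_ineq1_le t); lra).
  rewrite Rabs_pos_eq by lra.
  assert (exp t * (1 - t) <= 1).
  { generalize (exp_ineq1_le (- t)). intros I.
    apply Rle_trans with (exp t * exp (- t)).
    - apply Rmult_le_compat_l; [left; apply exp_pos|lra].
    - rewrite <- exp_plus, Rplus_opp_r, exp_0; lra. }
  assert (exp t <= exp a).
  { destruct H as [H|H]; [left; now apply exp_increasing|subst; lra]. }
  nra.
- rewrite (Rabs_left t) in * by auto.
  assert (exp t <= 1).
  { rewrite <- exp_0. left; apply exp_increasing; lra. }
  rewrite Rabs_left1 by lra. generalize (exp_ineq1_le t). nra.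
Qed.

Section RightSide.
Variables (F phi : R -> R) (c K d nu A B : R).
Hypothesis HS : small_params c K d nu.
Hypothesis cK : c <= K.
Hypothesis HU : unfolding F c K d nu A B.
Hypothesis n0 : nu < 0.
Hypothesis Cphi : Ck 1 (Ioo (- d) d) phi.
Hypothesis Pphi : forall x, Ioo (- d) d x -> 0 < Derive phi x.
Hypothesis phi0 : phi 0 = 0.
Hypothesis phi'0 : Derive phi 0 = 1.
Hypothesis Ephi : forall x, Ioo (- d) d x -> phi (F x) = (1 + nu) * phi x.

Let disp x := x - F x.

Lemma right_in_domain x : 0 < x < d -> Ioo (- d) d x.
Proof. unfold Ioo; intros; lra. Qed.

Lemma displacement_bounds x : 0 < x < d -> disp x > 0 /\
  x * (- nu / 2 + c / 2 * x ^ 2) <= disp x <= x * (2 * (- nu + c * x ^ 2)).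
Proof.
intros Hx. destruct (unfolding_displacement_neg F c K d nu A B HS HU x n0 (right_in_domain x Hx)) as [w [E W]].
assert (c0 : 0 < c) by apply HS. assert (0 <= c * x ^ 2) by (apply Rmult_le_pos; [lra | apply pow2_ge_0]).
unfold disp. replace (x - F x) with (x * w) by lra.
split; [apply Rmult_lt_0_compat; lra|]. split; apply Rmult_le_compat_l; lra.
Qed.

Lemma right_maps x : 0 < x < d -> 0 < F x < x.
Proof.
intros Hx. destruct (displacement_bounds x Hx) as [D _]. unfold disp in D. split; [|lra].
assert (F0 := unfolding_fixes0 F c K d nu A B HS HU). rewrite <- F0 at 1.
apply (deriv_pos_increasing F (- d) d); [| |unfold Ioo; lra|apply right_in_domain, Hx|lra].
- intros y Hy; now apply HU.
- now apply (unfolding_increasing F c K d nu A B).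
Qed.

Lemma linearization_pos x : 0 < x < d -> 0 < phi x.
Proof.
intros Hx. rewrite <- phi0. apply (deriv_pos_increasing phi (- d) d); auto; try apply Cphi; unfold Ioo; lra.
Qed.

(** The ratio of the displacement [x - F x] to [n phi / phi'], with [n = - nu]: the
    latter is what the displacement would be, to first order in [n], if [F] were the
    time-one map of a flow. *)
Definition generator_ratio x := disp x * Derive phi x / (- nu * phi x).

Lemma generator_ratio_pos x : 0 < x < d -> 0 < generator_ratio x.
Proof.
intros Hx. destruct (displacement_bounds x Hx) as [D _]. assert (P := linearization_pos x Hx).
assert (P' := Pphi x (right_in_domain x Hx)). unfold generator_ratio. apply Rdiv_lt_0_compat; nra.
Qed.

Lemma second_derivative_bound x : 0 < x < d -> Rabs (Derive (Derive F) x) <= 10 * K * (- nu + x).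
Proof.
intros Hx. assert (HB := unfolding_cubic_bounds F c K d nu A B HS HU).
destruct HU as [_ [_ [_ [H4 [H5 _]]]]]. destruct HS as [c0 [K1 [Hd [S1 [S2 [S3 [S4 [S5 S6]]]]]]]].
assert (Q := H4 x (right_in_domain x Hx)). rewrite (Rabs_pos_eq x) in Q by lra.
rewrite (Rabs_left nu n0) in H5. apply Rabs_le_between in H5. apply Rabs_le_between in Q.
assert (X2 : K * x ^ 2 <= K * x) by (apply Rmult_le_compat_l; [lra|simpl; nra]).
assert (B1 : - (9 / 8) * K * x <= B * x) by (apply Rmult_le_compat_r; lra).
assert (B2 : B * x <= 0) by nra.
apply Rabs_le_between; lra.
Qed.

(** By the linearization equation one step divides [phi'/phi] by [F' x], while by the
    mean value theorem it multiplies the displacement by [F' xi] with [xi] between [F x]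
    and [x]. *)
Lemma ln_generator_ratio_step x : 0 < x < d ->
  Rabs (ln (generator_ratio (F x)) - ln (generator_ratio x)) <= 60 * K * (- nu + x) * (x - F x).
Proof.
intros Hx. assert (HF := right_maps x Hx). assert (HFx : 0 < F x < d) by lra.
destruct (displacement_bounds x Hx) as [D _]. destruct (displacement_bounds (F x) HFx) as [D2 _].
assert (Ix := right_in_domain x Hx). assert (IFx := right_in_domain (F x) HFx).
assert (M := unfolding_derivative_near_1 F c K d nu A B HS HU). assert (Mx := M x Ix).
assert (K1 : 1 <= K) by apply HS.
assert (nb : Rabs nu <= 1 / 8) by apply HS. rewrite (Rabs_left nu n0) in nb.
assert (DF : forall y, Ioo (- d) d y -> ex_derive F y /\ ex_derive (Derive F) y) by apply HU.
assert (Eder : Derive phi (F x) * Derive F x = (1 + nu) * Derive phi x).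
{ assert (E1 : is_derive (fun x => phi (F x)) x (Derive F x * Derive phi (F x))).
  { apply (is_derive_comp phi F); apply Derive_correct; [apply Cphi, IFx | apply DF, Ix]. }
  assert (E2 : is_derive (fun x => phi (F x)) x ((1 + nu) * Derive phi x)).
  { apply (is_derive_ext_loc (fun x => (1 + nu) * phi x)).
    - generalize (open_locally _ x (open_Ioo (- d) d) Ix). apply filter_imp. intros y Hy; symmetry; auto.
    - apply is_derive_scal, Derive_correct, Cphi, Ix. }
  rewrite <- (is_derive_unique _ _ _ E2), (is_derive_unique _ _ _ E1). ring. }
apply Rabs_le_between in Mx.
set (r := disp (F x) / (disp x * Derive F x)).
assert (P := linearization_pos x Hx).
assert (ER : generator_ratio (F x) = generator_ratio x * r).
{ unfold generator_ratio, r. rewrite (Ephi x Ix).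
  replace (Derive phi (F x)) with ((1 + nu) * Derive phi x / Derive F x) by (rewrite <- Eder; field; lra).
  field. lra. }
assert (r0 : 0 < r) by (unfold r; apply Rdiv_lt_0_compat; nra).
rewrite ER, ln_mult by (auto using generator_ratio_pos).
replace (ln (generator_ratio x) + ln r - ln (generator_ratio x)) with (ln r) by ring.
(* The mean value theorem is used for the displacement, then for [F'] between [xi] and
   [x]. *)
destruct (mean_value F (F x) x (proj2 HF)) as [xi [Hxi Exi]].
{ intros z Hz. apply DF, right_in_domain; lra. }
destruct (mean_value (Derive F) xi x (proj2 Hxi)) as [eta [Heta Eeta]].
{ intros z Hz. apply DF, right_in_domain; lra. }
assert (Mxi := M xi (right_in_domain xi ltac:(lra))). apply Rabs_le_between in Mxi.
fold (disp x) in Exi. assert (Er : r = Derive F xi / Derive F x).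
{ unfold r. replace (disp (F x)) with (F x - F (F x)) by reflexivity. rewrite Exi. unfold disp. field. unfold disp in D; lra. }
assert (r1 : 1 / 3 <= r).
{ rewrite Er. apply (proj1 (Rle_div_r (1 / 3) (Derive F xi) (Derive F x) ltac:(lra))). lra. }
eapply Rle_trans; [apply ln_near_1, r1|].
replace (r - 1) with (- (Derive (Derive F) eta * (x - xi)) / Derive F x) by (rewrite Er, <- Eeta; field; lra).
unfold Rdiv. rewrite Rabs_mult, Rabs_Ropp, Rabs_mult, Rabs_inv.
rewrite (Rabs_pos_eq (x - xi)), (Rabs_pos_eq (Derive F x)) by lra.
assert (S2 := second_derivative_bound eta ltac:(lra)).
assert (I2 : / Derive F x <= 2) by (rewrite <- (Rinv_inv 2); apply Rinv_le_contravar; lra).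
assert (I0 : 0 < / Derive F x) by (apply Rinv_0_lt_compat; lra).
assert (T1 : Rabs (Derive (Derive F) eta) * (x - xi) <= 10 * K * (- nu + x) * (x - F x)).
{ apply Rmult_le_compat; try lra; [apply Rabs_pos|]. eapply Rle_trans; [exact S2|].
  apply Rmult_le_compat_l; lra. }
assert (T0 : 0 <= Rabs (Derive (Derive F) eta) * (x - xi)) by (apply Rmult_le_pos; [apply Rabs_pos|lra]).
apply Rle_trans with (3 * (10 * K * (- nu + x) * (x - F x) * 2)); [|lra].
apply Rmult_le_compat_l; [lra|]. apply Rmult_le_compat; lra.
Qed.

Lemma unfolding_attracting : attracting F (- d) 0 d.
Proof.
assert (F0 := unfolding_fixes0 F c K d nu A B HS HU).
assert (d0 : 0 < d) by apply HS.
assert (c0 : 0 < c) by apply HS.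
split; [lra|]. split; [auto|].
split; [intros x Hx; apply (ex_derive_continuous F x), HU, Hx|].
split; [apply deriv_pos_increasing; [intros y Hy; now apply HU | now apply (unfolding_increasing F c K d nu A B)]|].
split; intros x Hx.
- destruct (unfolding_displacement_neg F c K d nu A B HS HU x n0) as [w [E W]]; [unfold Ioo; lra|].
  assert (0 <= c * x ^ 2) by (apply Rmult_le_pos; [lra | apply pow2_ge_0]). nra.
- generalize (right_maps x Hx); lra.
Qed.

Lemma generator_ratio_lim : tends0 generator_ratio 1.
Proof.
assert (d0 : 0 < d) by apply HS. assert (I0 : Ioo (- d) d 0) by (unfold Ioo; lra).
assert (F0 := unfolding_fixes0 F c K d nu A B HS HU).
assert (F'0 := unfolding_multiplier0 F c K d nu A B HS HU).
assert (T1 : tends0 (fun x => disp x / x) (- nu)).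
{ apply (derive_quotient_tends0 disp).
  - unfold disp. replace (- nu) with (1 - Derive F 0) by (rewrite F'0; ring).
    apply (is_derive_minus (fun x => x) F); [apply (is_derive_id 0)|]. apply Derive_correct, HU, I0.
  - unfold disp. rewrite F0; ring. }
assert (T2 : tends0 (fun x => phi x / x) 1).
{ apply (derive_quotient_tends0 phi); auto. rewrite <- phi'0. apply Derive_correct, Cphi, I0. }
assert (T3 : tends0 (Derive phi) 1).
{ apply tends0_continuous; auto. apply Cphi, I0. }
apply (tends0_ext (fun x => (disp x / x) * Derive phi x / (- nu * (phi x / x)))).
- generalize (near0_lt d d0). apply filter_imp. intros x Hx. assert (P := linearization_pos x Hx).
  unfold generator_ratio. field. lra.
- eapply tends0_eq; [apply tends0_div; [|apply tends0_mult; [exact T1|exact T3]|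
    apply tends0_mult; [apply tends0_const|exact T2]]|]; [|field]; lra.
Qed.

(** Sum the previous bounds along the orbit, which decreases to [0], where the ratio
    tends to [1]. *)
Lemma ln_generator_ratio_bound x : 0 < x < d -> Rabs (ln (generator_ratio x)) <= 60 * K * (- nu + x) * x.
Proof.
intros Hx. assert (K1 : 1 <= K) by apply HS.
set (u := fun n => Nat.iter n F x).
assert (At := unfolding_attracting).
assert (U : forall n, 0 < u n <= x) by (intros n; apply (attracting_iter_right F (- d) 0 d At x n Hx)).
assert (St : forall n, Rabs (ln (generator_ratio (u n)) - ln (generator_ratio x)) <= 60 * K * (- nu + x) * (x - u n)).
{ induction n as [|n IH].
  - unfold u; simpl. rewrite !Rminus_diag, Rabs_R0. lra.
  - assert (Sn := ln_generator_ratio_step (u n) ltac:(generalize (U n); lra)). change (F (u n)) with (u (Datatypes.S n)) in Sn.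
    assert (D0 : 0 <= u n - u (Datatypes.S n)).
    { generalize (right_maps (u n) ltac:(generalize (U n); lra)). unfold u; simpl. lra. }
    replace (ln (generator_ratio (u (Datatypes.S n))) - ln (generator_ratio x)) with
      ((ln (generator_ratio (u (Datatypes.S n))) - ln (generator_ratio (u n))) + (ln (generator_ratio (u n)) - ln (generator_ratio x))) by ring.
    eapply Rle_trans; [apply Rabs_triang|].
    assert (60 * K * (- nu + u n) * (u n - u (Datatypes.S n)) <= 60 * K * (- nu + x) * (u n - u (Datatypes.S n))).
    { apply Rmult_le_compat_r; auto. apply Rmult_le_compat_l; [lra|]. generalize (U n); lra. }
    lra. }
assert (L : is_lim_seq u 0) by (apply (attracting_iter_lim F (- d) 0 d At x), right_in_domain, Hx).
assert (Lln : tends0 (fun y => ln (generator_ratio y)) 0).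
{ rewrite <- ln_1. apply (tends0_comp ln); [|apply generator_ratio_lim].
  apply continuous_ln; lra. }
apply Rle_trans with (60 * K * (- nu + x) * x + 0); [|lra].
apply Rle_plus_epsilon. intros eps e0. rewrite Rplus_0_r.
rewrite tends0_spec in Lln. destruct (Lln eps e0) as [eta [eta0 H]].
apply is_lim_seq_spec in L. destruct (L (mkposreal eta eta0)) as [N HN].
specialize (HN N (le_n N)). simpl in HN. rewrite Rminus_0_r, Rabs_pos_eq in HN by (generalize (U N); lra).
specialize (H (u N) ltac:(generalize (U N); lra)). rewrite Rminus_0_r in H.
assert (S := St N). apply Rabs_def2 in H. apply Rabs_le_between in S. apply Rabs_le_between.
assert (0 <= 60 * K * (- nu + x) * u N).
{ apply Rmult_le_pos; [|generalize (U N); lra]. apply Rmult_le_pos; lra. }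
lra.
Qed.

(** This replaces [phi], which is known only as a limit, by the explicit displacement;
    the error is uniform in [nu]. *)
Lemma log_derivative_estimate x : 0 < x < d ->
  Rabs (Derive phi x / phi x - - nu / disp x) <=
  120 * K * exp (60 * K) * (- nu * ((- nu + x) / (- nu + c * x ^ 2))).
Proof.
intros Hx. assert (c0 : 0 < c) by apply HS.
assert (nb : Rabs nu <= 1 / 8) by apply HS. rewrite (Rabs_left nu n0) in nb.
assert (d1 : d <= 1 / 2) by apply HS.
destruct (displacement_bounds x Hx) as [D [D1 _]]. assert (P := linearization_pos x Hx). assert (Q0 := generator_ratio_pos x Hx).
assert (L := ln_generator_ratio_bound x Hx).
assert (cx : 0 <= c * x ^ 2) by (apply Rmult_le_pos; [lra | apply pow2_ge_0]).
assert (L1 : 60 * K * (- nu + x) * x <= 60 * K).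
{ assert ((- nu + x) * x <= 1) by nra. nra. }
assert (E := exp_minus_1_bound (ln (generator_ratio x)) (60 * K) ltac:(lra)). rewrite exp_ln in E by auto.
replace (Derive phi x / phi x - - nu / disp x) with (- nu / disp x * (generator_ratio x - 1)).
2:{ unfold generator_ratio. field. lra. }
rewrite Rabs_mult, (Rabs_pos_eq (- nu / disp x)) by (apply Rlt_le, Rdiv_lt_0_compat; lra).
assert (X0 : 0 < exp (60 * K)) by apply exp_pos.
assert (E' : Rabs (generator_ratio x - 1) <= exp (60 * K) * (60 * K * (- nu + x) * x)).
{ eapply Rle_trans; [exact E|]. apply Rmult_le_compat_l; lra. }
apply Rle_trans with (- nu / (x * (- nu / 2 + c / 2 * x ^ 2)) * (exp (60 * K) * (60 * K * (- nu + x) * x))).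
- apply Rmult_le_compat; auto; [apply Rlt_le, Rdiv_lt_0_compat; lra | apply Rabs_pos|].
  apply Rmult_le_compat_l; [lra|]. apply Rinv_le_contravar; auto. apply Rmult_lt_0_compat; lra.
- right. field. lra.
Qed.
End RightSide.

(** * Asymmetry of the basin when the multiplier is below 1 *)

(** Coefficients up to order 5 enter both into the asymmetry between the two sides of
    [0], where the terms [nu x] and [B x^3] cancel, and into the multipliers at the
    order that determines [a]. *)
Definition jet5 (F : R -> R) (K d nu A B C E : R) : Prop :=
  (forall x, Ioo (- d) d x ->
     Rabs (F x - x - (nu * x + A * x ^ 2 + B * x ^ 3 + C * x ^ 4 + E * x ^ 5)) <= K * Rabs x ^ 6) /\
  (forall x, Ioo (- d) d x ->
     Rabs (Derive F x - 1 - (nu + 2 * A * x + 3 * B * x ^ 2 + 4 * C * x ^ 3 + 5 * E * x ^ 4))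
       <= K * Rabs x ^ 5).

(** The integral from [0] to [x] of [/ (n + c t^2)^2]. *)
Definition asym_J (c n x : R) : R :=
  / (2 * n) * (x / (n + c * x ^ 2) + atan (x * sqrt (c / n)) / sqrt (c * n)).

Lemma asym_J_derive c n x : 0 < c -> 0 < n ->
  is_derive (asym_J c n) x (/ (n + c * x ^ 2) ^ 2).
Proof.
intros c0 n0. assert (w0 : 0 < n + c * x ^ 2) by (generalize (pow2_ge_0 x); nra).
assert (s0 : 0 < sqrt (c * n)) by (apply sqrt_lt_R0; nra).
assert (q0 : 0 < c / n) by (apply Rdiv_lt_0_compat; auto).
assert (Da : is_derive (fun x => atan (x * sqrt (c / n))) x (sqrt (c / n) * / (1 + (x * sqrt (c / n)) ^ 2))).
{ apply (is_derive_comp atan (fun x => x * sqrt (c / n))).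
  - apply is_derive_Reals, derivable_pt_lim_atan.
  - auto_derive; auto; ring. }
assert (Dq : is_derive (fun x => x / (n + c * x ^ 2)) x ((n - c * x ^ 2) / (n + c * x ^ 2) ^ 2)).
{ auto_derive; [simpl in *; lra|]. field. simpl in *; lra. }
assert (E : sqrt (c / n) = sqrt (c * n) / n).
{ replace (c / n) with (c * n / n ^ 2) by (field; lra).
  rewrite sqrt_div_alt by (apply pow_lt; auto). rewrite sqrt_pow2 by lra. auto. }
assert (Da' : is_derive (fun x => atan (x * sqrt (c / n))) x (sqrt (c * n) / (n + c * x ^ 2))).
{ assert (EE : sqrt (c * n) / (n + c * x ^ 2) = sqrt (c / n) * / (1 + (x * sqrt (c / n)) ^ 2)).
  { rewrite Rpow_mult_distr, <- (Rsqr_pow2 (sqrt _)), Rsqr_sqrt, E by lra. field. lra. }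
  rewrite EE. exact Da. }
assert (D := is_derive_scal _ x (/ (2 * n)) _ (is_derive_plus _ _ x _ _ Dq
   (is_derive_scal_l _ x _ (/ sqrt (c * n)) Da'))).
eapply eq_ind; [exact D|]. change (/ (2 * n) * ((n - c * x ^ 2) / (n + c * x ^ 2) ^ 2 +
  sqrt (c * n) / (n + c * x ^ 2) * / sqrt (c * n)) = / (n + c * x ^ 2) ^ 2).
field. lra.
Qed.

Lemma asym_J_0 c n : asym_J c n 0 = 0.
Proof. unfold asym_J. rewrite Rmult_0_l, atan_0. unfold Rdiv. ring. Qed.

(** The integral from [0] to [x] of [2 n (A + C0 t^2) / (n + c t^2)^2]. *)
Definition asym_main (c C0 n A x : R) : R :=
  2 * n * (A + C0 * n / c) * asym_J c n x - 2 * n * (C0 / c) * (x / (n + c * x ^ 2)).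

Lemma asym_main_derive c C0 n A x : 0 < c -> 0 < n ->
  is_derive (asym_main c C0 n A) x (2 * n * (A + C0 * x ^ 2) / (n + c * x ^ 2) ^ 2).
Proof.
intros c0 n0. assert (w0 : 0 < n + c * x ^ 2) by (generalize (pow2_ge_0 x); nra).
assert (Dq : is_derive (fun x => x / (n + c * x ^ 2)) x ((n - c * x ^ 2) / (n + c * x ^ 2) ^ 2)).
{ auto_derive; [simpl in *; lra|]. field. simpl in *; lra. }
assert (D := is_derive_minus _ _ x _ _ (is_derive_scal _ x (2 * n * (A + C0 * n / c)) _ (asym_J_derive c n x c0 n0))
  (is_derive_scal _ x (2 * n * (C0 / c)) _ Dq)).
eapply eq_ind; [exact D|]. change (2 * n * (A + C0 * n / c) * / (n + c * x ^ 2) ^ 2 -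
  2 * n * (C0 / c) * ((n - c * x ^ 2) / (n + c * x ^ 2) ^ 2) = 2 * n * (A + C0 * x ^ 2) / (n + c * x ^ 2) ^ 2).
field. lra.
Qed.

Section TwoSides.
Variables (F : R -> R) (c K d nu A B C E C0 : R).
Hypothesis HS : small_params c K d nu.
Hypothesis cK : c <= K.
Hypothesis Kc : 1 <= K * c.
Hypothesis HU : unfolding F c K d nu A B.
Hypothesis HJ : jet5 F K d nu A B C E.
Hypothesis HC : Rabs (C - C0) <= K * Rabs nu.
Hypothesis HC0 : Rabs C0 <= K.
Hypothesis HE : Rabs E <= K.
Hypothesis n0 : nu < 0.

Let n := - nu.
Let w x := n + c * x ^ 2.

(** The displacements [a] and [b] on the two sides share the leading part [x * (n + c
    x^2)] and differ, up to smaller terms, by [2 (A x^2 + C x^4)]; in [/ a - / b = (b -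
    a) / (a b)] the errors remain bounded uniformly in [n]. *)
Lemma displacement_asymmetry x : 0 < x < d ->
  Rabs (/ (x - F x) - / (x - reflect F x) - 2 * (A + C0 * x ^ 2) / w x ^ 2) <= 144 * K ^ 7.
Proof.
intros Hx. assert (HUr := unfolding_reflect F c K d nu A B HU).
assert (K1 : 1 <= K) by apply HS. assert (c0 : 0 < c) by apply HS.
assert (d1 : d <= 1 / 2) by apply HS.
assert (Ra := proj2 (displacement_bounds F c K d nu A B HS HU n0 x Hx)).
assert (Rb := proj2 (displacement_bounds (reflect F) c K d nu (- A) B HS HUr n0 x Hx)).
set (a := x - F x) in *. set (b := x - reflect F x) in *. cbv beta in Ra, Rb. fold a in Ra. fold b in Rb.
fold n in Ra, Rb.
assert (Ix : Ioo (- d) d x) by (unfold Ioo; lra). assert (Imx : Ioo (- d) d (- x)) by (unfold Ioo; lra).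
destruct HJ as [J1 _]. assert (Jp := J1 x Ix). assert (Jm := J1 (- x) Imx).
rewrite Rabs_Ropp in Jm. rewrite (Rabs_pos_eq x) in Jp, Jm by lra.
destruct HU as [_ [_ [_ [_ [HA HB]]]]]. rewrite (Rabs_left nu n0) in HA, HB, HC. fold n in HA, HB, HC.
assert (nn : 0 < n <= 1 / 8).
{ assert (Q : Rabs nu <= 1 / 8) by apply HS. rewrite (Rabs_left nu n0) in Q. unfold n; lra. }
set (W := w x). assert (x2 : 0 < x ^ 2) by (apply pow_lt; lra).
assert (x21 : x ^ 2 <= 1) by (simpl; nra).
assert (W0 : 0 < W) by (unfold W, w; nra).
assert (nW : n <= W) by (unfold W, w; nra).
assert (xW : x ^ 2 <= K * W).
{ unfold W, w. nra. }
assert (zW : n + x ^ 2 <= K * W).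
{ unfold W, w. nra. }
set (Rp := F x - x - (nu * x + A * x ^ 2 + B * x ^ 3 + C * x ^ 4 + E * x ^ 5)) in *.
set (Rm := F (- x) - - x - (nu * - x + A * (- x) ^ 2 + B * (- x) ^ 3 + C * (- x) ^ 4 + E * (- x) ^ 5)) in *.
set (g := (B + c) * x ^ 3 + E * x ^ 5). set (p := A * x ^ 2 + C * x ^ 4).
assert (Ea : a = (x * W - g) - (p + Rp)) by (unfold a, W, w, g, p, Rp, n; ring).
assert (Eb : b = (x * W - g) + (p + Rm)) by (unfold b, reflect, W, w, g, p, Rm, n; ring).
assert (x3 : 0 < x ^ 3) by (apply pow_lt; lra). assert (x4 : 0 < x ^ 4) by (apply pow_lt; lra).
assert (x5 : 0 < x ^ 5) by (apply pow_lt; lra). assert (x6 : 0 < x ^ 6) by (apply pow_lt; lra).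
assert (Bg : Rabs g <= K ^ 2 * x ^ 3 * W).
{ unfold g. eapply Rle_trans; [apply Rabs_triang|]. rewrite !Rabs_mult.
  rewrite (Rabs_pos_eq (x ^ 3)), (Rabs_pos_eq (x ^ 5)) by lra.
  apply Rle_trans with (K * n * x ^ 3 + K * x ^ 5).
  - apply Rplus_le_compat; apply Rmult_le_compat_r; lra.
  - replace (K * n * x ^ 3 + K * x ^ 5) with (K * x ^ 3 * (n + x ^ 2)) by ring.
    replace (K ^ 2 * x ^ 3 * W) with (K * x ^ 3 * (K * W)) by ring.
    apply Rmult_le_compat_l; auto. apply Rmult_le_pos; lra. }
assert (BC : Rabs C <= 2 * K).
{ replace C with ((C - C0) + C0) by ring. eapply Rle_trans; [apply Rabs_triang|]. nra. }
assert (Bp : Rabs p <= 2 * K ^ 2 * x ^ 2 * W).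
{ unfold p. eapply Rle_trans; [apply Rabs_triang|]. rewrite !Rabs_mult.
  rewrite (Rabs_pos_eq (x ^ 2)), (Rabs_pos_eq (x ^ 4)) by lra.
  apply Rle_trans with (2 * K * n * x ^ 2 + 2 * K * x ^ 4).
  - apply Rplus_le_compat; apply Rmult_le_compat_r; try lra. assert (0 <= K * n) by nra. lra.
  - replace (2 * K * n * x ^ 2 + 2 * K * x ^ 4) with (2 * K * x ^ 2 * (n + x ^ 2)) by ring.
    replace (2 * K ^ 2 * x ^ 2 * W) with (2 * K * x ^ 2 * (K * W)) by ring.
    apply Rmult_le_compat_l; auto. apply Rmult_le_pos; lra. }
assert (BR : K * x ^ 6 <= K ^ 2 * x ^ 4 * W).
{ replace (K * x ^ 6) with (K * x ^ 4 * x ^ 2) by ring.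
  replace (K ^ 2 * x ^ 4 * W) with (K * x ^ 4 * (K * W)) by ring.
  apply Rmult_le_compat_l; auto. apply Rmult_le_pos; lra. }
assert (BR2 : K ^ 2 * x ^ 4 * W <= K ^ 2 * x ^ 2 * W).
{ apply Rmult_le_compat_r; [lra|]. apply Rmult_le_compat_l; [apply pow2_ge_0|].
  replace (x ^ 4) with (x ^ 2 * x ^ 2) by ring. nra. }
assert (Bp1 : Rabs (p + Rp) <= 3 * K ^ 2 * x ^ 2 * W) by (eapply Rle_trans; [apply Rabs_triang|]; lra).
assert (Bp2 : Rabs (p + Rm) <= 3 * K ^ 2 * x ^ 2 * W) by (eapply Rle_trans; [apply Rabs_triang|]; lra).
assert (ab : 0 < x * W / 2 <= a /\ x * W / 2 <= b).
{ assert (0 < x * W) by (apply Rmult_lt_0_compat; lra).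
  replace (x * W / 2) with (x * (n / 2 + c / 2 * x ^ 2)) by (unfold W, w; field). unfold n in *.
  split; [split|]; try lra. replace (x * (- nu / 2 + c / 2 * x ^ 2)) with (x * W / 2) by (unfold W, w, n; field). lra. }
assert (K2 : 1 <= K ^ 2) by (apply pow_R1_Rle; auto).
assert (K24 : K ^ 2 <= K ^ 4) by (apply Rle_pow; [auto|lia]).
(* Every term of [a b - x^2 W^2] is bounded by a multiple of this one. *)
set (V := K ^ 4 * x ^ 4 * W ^ 2).
assert (W2 : 0 < W ^ 2) by (apply pow_lt; auto).
assert (V0 : 0 <= x ^ 4 * W ^ 2) by (apply Rmult_le_pos; lra).
assert (xle : forall j, x ^ (4 + j) <= x ^ 4).
{ intros j. rewrite pow_add. assert (x ^ j <= 1) by (rewrite <- (pow1 j); apply pow_incr; lra).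
  nra. }
assert (Vj : forall j q, 0 <= q <= K ^ 4 -> q * x ^ (4 + j) * W ^ 2 <= V).
{ intros j q Hq. unfold V. apply Rmult_le_compat_r; [lra|]. apply Rmult_le_compat; try lra.
  - apply pow_le; lra.
  - apply xle. }
assert (Dab : Rabs (a * b - x ^ 2 * W ^ 2) <= 16 * V).
{ replace (a * b - x ^ 2 * W ^ 2) with
    (- (2 * x * W * g) + g * g + x * W * (Rm - Rp) - g * (Rm - Rp) - (p + Rp) * (p + Rm))
    by (rewrite Ea, Eb; ring).
  assert (G1 : Rabs (2 * x * W * g) <= 2 * V).
  { rewrite Rabs_mult, (Rabs_pos_eq (2 * x * W)) by (apply Rmult_le_pos; lra).
    apply Rle_trans with (2 * x * W * (K ^ 2 * x ^ 3 * W)).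
    - apply Rmult_le_compat_l; auto. apply Rmult_le_pos; lra.
    - replace (2 * x * W * (K ^ 2 * x ^ 3 * W)) with (2 * (K ^ 2 * x ^ (4 + 0) * W ^ 2)) by (simpl; ring).
      apply Rmult_le_compat_l; [lra|]. apply Vj; lra. }
  assert (G2 : Rabs (g * g) <= V).
  { rewrite Rabs_mult. apply Rle_trans with ((K ^ 2 * x ^ 3 * W) * (K ^ 2 * x ^ 3 * W)).
    - apply Rmult_le_compat; auto using Rabs_pos.
    - replace ((K ^ 2 * x ^ 3 * W) * (K ^ 2 * x ^ 3 * W)) with (K ^ 4 * x ^ (4 + 2) * W ^ 2) by (simpl; ring).
      apply Vj; lra. }
  assert (BRR : Rabs (Rm - Rp) <= 2 * (K ^ 2 * x ^ 4 * W)).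
  { unfold Rminus. eapply Rle_trans; [apply Rabs_triang|]. rewrite Rabs_Ropp. lra. }
  assert (G3 : Rabs (x * W * (Rm - Rp)) <= 2 * V).
  { rewrite Rabs_mult, (Rabs_pos_eq (x * W)) by (apply Rmult_le_pos; lra).
    apply Rle_trans with (x * W * (2 * (K ^ 2 * x ^ 4 * W))).
    - apply Rmult_le_compat_l; auto. apply Rmult_le_pos; lra.
    - replace (x * W * (2 * (K ^ 2 * x ^ 4 * W))) with (2 * (K ^ 2 * x ^ (4 + 1) * W ^ 2)) by (simpl; ring).
      apply Rmult_le_compat_l; [lra|]. apply Vj; lra. }
  assert (G4 : Rabs (g * (Rm - Rp)) <= 2 * V).
  { rewrite Rabs_mult. apply Rle_trans with ((K ^ 2 * x ^ 3 * W) * (2 * (K ^ 2 * x ^ 4 * W))).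
    - apply Rmult_le_compat; auto using Rabs_pos.
    - replace ((K ^ 2 * x ^ 3 * W) * (2 * (K ^ 2 * x ^ 4 * W))) with (2 * (K ^ 4 * x ^ (4 + 3) * W ^ 2)) by (simpl; ring).
      apply Rmult_le_compat_l; [lra|]. apply Vj; lra. }
  assert (G5 : Rabs ((p + Rp) * (p + Rm)) <= 9 * V).
  { rewrite Rabs_mult. apply Rle_trans with ((3 * K ^ 2 * x ^ 2 * W) * (3 * K ^ 2 * x ^ 2 * W)).
    - apply Rmult_le_compat; auto using Rabs_pos.
    - right. unfold V. ring. }
  apply Rabs_le_between in G1. apply Rabs_le_between in G2. apply Rabs_le_between in G3.
  apply Rabs_le_between in G4. apply Rabs_le_between in G5. apply Rabs_le_between. lra. }
(* The leading part of [b - a]; [C] is replaced by [C0] at the cost of [O(n x^4)]. *)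
set (T := 2 * x ^ 2 * (A + C0 * x ^ 2)).
assert (BT : Rabs T <= 2 * K ^ 2 * x ^ 2 * W).
{ unfold T. rewrite Rabs_mult, (Rabs_pos_eq (2 * x ^ 2)) by lra.
  replace (2 * K ^ 2 * x ^ 2 * W) with (2 * x ^ 2 * (K * (K * W))) by ring.
  apply Rmult_le_compat_l; [lra|]. eapply Rle_trans; [apply Rabs_triang|].
  rewrite Rabs_mult, (Rabs_pos_eq (x ^ 2)) by lra.
  apply Rle_trans with (K * (n + x ^ 2)); [|apply Rmult_le_compat_l; lra].
  assert (Rabs C0 * x ^ 2 <= K * x ^ 2) by (apply Rmult_le_compat_r; lra). lra. }
assert (BS : Rabs ((b - a) - T) <= 4 * K ^ 2 * x ^ 4 * W).
{ replace ((b - a) - T) with (2 * (C - C0) * x ^ 4 + (Rp + Rm)).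
  2:{ rewrite Ea, Eb. unfold T, p. ring. }
  eapply Rle_trans; [apply Rabs_triang|]. rewrite !Rabs_mult, (Rabs_pos_eq 2), (Rabs_pos_eq (x ^ 4)) by lra.
  assert (Rabs (Rp + Rm) <= 2 * (K ^ 2 * x ^ 4 * W)) by (eapply Rle_trans; [apply Rabs_triang|]; lra).
  assert (2 * Rabs (C - C0) * x ^ 4 <= 2 * (K ^ 2 * x ^ 4 * W)); [|lra].
  rewrite Rmult_assoc. apply Rmult_le_compat_l; [lra|].
  replace (K ^ 2 * x ^ 4 * W) with (K * (K * W) * x ^ 4) by ring.
  apply Rmult_le_compat_r; [lra|]. apply Rle_trans with (K * n); auto.
  apply Rmult_le_compat_l; [lra|]. nra. }
assert (xW2 : x ^ 2 / W <= K) by (apply Rle_div_l; lra).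
assert (aabb : x ^ 2 * W ^ 2 / 4 <= a * b).
{ replace (x ^ 2 * W ^ 2 / 4) with ((x * W / 2) * (x * W / 2)) by field. apply Rmult_le_compat; lra. }
assert (q0 : 0 < x ^ 2 * W ^ 2) by (apply Rmult_lt_0_compat; auto).
assert (iab : / (a * b) <= 4 / (x ^ 2 * W ^ 2)).
{ replace (4 / (x ^ 2 * W ^ 2)) with (/ (x ^ 2 * W ^ 2 / 4)) by (field; split; [lra|lra]).
  apply Rinv_le_contravar; lra. }
assert (iab0 : 0 < / (a * b)) by (apply Rinv_0_lt_compat; lra).
replace (/ a - / b - 2 * (A + C0 * x ^ 2) / W ^ 2) with
  (((b - a) - T) * / (a * b) - T * (a * b - x ^ 2 * W ^ 2) * (/ (a * b) * / (x ^ 2 * W ^ 2)))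
  by (unfold T; field; repeat split; lra).
unfold Rminus at 1. eapply Rle_trans; [apply Rabs_triang|]. rewrite Rabs_Ropp.
assert (P1 : Rabs (((b - a) - T) * / (a * b)) <= 16 * K ^ 3).
{ rewrite Rabs_mult, (Rabs_pos_eq (/ (a * b))) by lra.
  apply Rle_trans with (4 * K ^ 2 * x ^ 4 * W * (4 / (x ^ 2 * W ^ 2))).
  - apply Rmult_le_compat; auto using Rabs_pos; lra.
  - replace (4 * K ^ 2 * x ^ 4 * W * (4 / (x ^ 2 * W ^ 2))) with (16 * K ^ 2 * (x ^ 2 / W)) by (field; lra).
    replace (16 * K ^ 3) with (16 * K ^ 2 * K) by ring. apply Rmult_le_compat_l; lra. }
assert (P2 : Rabs (T * (a * b - x ^ 2 * W ^ 2) * (/ (a * b) * / (x ^ 2 * W ^ 2))) <= 128 * K ^ 7).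
{
  rewrite !Rabs_mult, (Rabs_pos_eq (/ (a * b))), (Rabs_pos_eq (/ (x ^ 2 * W ^ 2))) by lra.
  apply Rle_trans with (2 * K ^ 2 * x ^ 2 * W * (16 * V) * (4 / (x ^ 2 * W ^ 2) * / (x ^ 2 * W ^ 2))).
  - apply Rmult_le_compat.
    + apply Rmult_le_pos; apply Rabs_pos.
    + apply Rmult_le_pos; lra.
    + apply Rmult_le_compat; auto using Rabs_pos.
    + apply Rmult_le_compat_r; lra.
  - unfold V. replace (2 * K ^ 2 * x ^ 2 * W * (16 * (K ^ 4 * x ^ 4 * W ^ 2)) * (4 / (x ^ 2 * W ^ 2) * / (x ^ 2 * W ^ 2)))
      with (128 * K ^ 6 * (x ^ 2 / W)) by (field; lra).
    replace (128 * K ^ 7) with (128 * K ^ 6 * K) by ring. apply Rmult_le_compat_l; auto.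
    apply Rmult_le_pos; [lra|]. apply pow_le; lra. }
assert (K ^ 3 <= K ^ 7) by (apply Rle_pow; [auto|lia]). lra.
Qed.
End TwoSides.

Lemma derive_bound_from_0 (u v : R -> R) d x :
  (forall t, 0 < t < d -> exists du dv, is_derive u t du /\ is_derive v t dv /\ Rabs du <= dv) ->
  tends0 u 0 -> tends0 v 0 -> 0 < x < d -> Rabs (u x) <= v x.
Proof.
intros H U V Hx.
assert (Le : forall y, 0 < y < x -> u x - v x <= u y - v y /\ - u x - v x <= - u y - v y).
{ intros y Hy. split; apply Ropp_le_cancel.
  - apply (derive_nonneg_le (fun t => - (u t - v t)) y x); [lra|]. intros t Ht.
    destruct (H t) as [du [dv [D1 [D2 B]]]]; [lra|]. exists (- (du - dv)).
    split; [apply (is_derive_opp (fun t => u t - v t)), (is_derive_minus u v); auto|].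
    apply Rabs_le_between in B; lra.
  - apply (derive_nonneg_le (fun t => - (- u t - v t)) y x); [lra|]. intros t Ht.
    destruct (H t) as [du [dv [D1 [D2 B]]]]; [lra|]. exists (- (- du - dv)).
    split; [apply (is_derive_opp (fun t => - u t - v t)), (is_derive_minus (fun t => - u t) v); auto|].
    + apply (is_derive_opp u); auto.
    + apply Rabs_le_between in B; lra. }
assert (N := near0_lt x (proj1 Hx)).
apply Rabs_le_between. split.
- assert (- u x - v x <= - 0 - 0); [|lra].
  apply (tends0_le (fun _ => - u x - v x) (fun y => - u y - v y)); [|apply tends0_const|].
  + revert N. apply filter_imp. intros y Hy. now apply Le.
  + apply tends0_minus; auto. now apply tends0_opp.
- assert (u x - v x <= 0 - 0); [|lra].
  apply (tends0_le (fun _ => u x - v x) (fun y => u y - v y)); [|apply tends0_const|].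
  + revert N. apply filter_imp. intros y Hy. now apply Le.
  + apply tends0_minus; auto.
Qed.

Definition asym_const (K d' : R) : R :=
  (144 * K ^ 7 + 240 * K * exp (60 * K)) * K + 2 * K ^ 3 / d'.

(** The logarithmic derivative of [phi x / - phi (- x)] is [n * (/ (x - F x) - / (x -
    reflect F x))] up to the errors bounded above. The quotient tends to [1] at [0], so
    integration from [0] gives the main term; the error [n x / (n + c x^2)] integrates
    to [n ln n]. *)
Theorem basin_asymmetry F phi c K d nu A B C E C0 d' :
  small_params c K d nu -> c <= K -> 1 <= K * c ->
  unfolding F c K d nu A B -> jet5 F K d nu A B C E ->
  Rabs (C - C0) <= K * Rabs nu -> Rabs C0 <= K -> Rabs E <= K -> nu < 0 ->
  Ck 1 (Ioo (- d) d) phi -> (forall x, Ioo (- d) d x -> 0 < Derive phi x) ->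
  phi 0 = 0 -> Derive phi 0 = 1 ->
  (forall x, Ioo (- d) d x -> phi (F x) = (1 + nu) * phi x) -> 0 < d' < d ->
  Rabs (ln (phi d') - ln (- phi (- d')) -
     2 * - nu * (A + C0 * - nu / c) * asym_J c (- nu) d') <= asym_const K d' * (- nu * (1 - ln (- nu))).
Proof.
intros HS cK Kc HU HJ HC HC0 HE n0 Cphi Pphi phi0 phi'0 Ephi Hd'.
assert (K1 : 1 <= K) by apply HS. assert (c0 : 0 < c) by apply HS.
assert (d0 : 0 < d <= 1 / 2) by apply HS.
assert (HUr := unfolding_reflect F c K d nu A B HU).
set (psi := reflect phi).
assert (Nx : forall x, Ioo (- d) d x -> Ioo (- d) d (- x)) by (unfold Ioo; intros; lra).
assert (Dpsi : forall x, Ioo (- d) d x -> is_derive psi x (Derive phi (- x))).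
{ intros x Hx. apply Derive_reflect, Cphi, Nx, Hx. }
assert (D'psi : forall x, Ioo (- d) d x -> Derive psi x = Derive phi (- x)).
{ intros x Hx. apply is_derive_unique, Dpsi, Hx. }
assert (Cpsi : Ck 1 (Ioo (- d) d) psi) by now apply reflect_Ck.
assert (Ppsi : forall x, Ioo (- d) d x -> 0 < Derive psi x).
{ intros x Hx. rewrite D'psi by auto. apply Pphi, Nx, Hx. }
assert (psi0 : psi 0 = 0) by (unfold psi, reflect; rewrite Ropp_0, phi0; ring).
assert (psi'0 : Derive psi 0 = 1).
{ rewrite D'psi, Ropp_0 by (unfold Ioo; lra). auto. }
assert (Epsi : forall x, Ioo (- d) d x -> psi (reflect F x) = (1 + nu) * psi x).
{ intros x Hx. unfold psi, reflect. rewrite Ropp_involutive, Ephi by (apply Nx, Hx). ring. }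
assert (L1 := log_derivative_estimate F phi c K d nu A B HS cK HU n0 Cphi Pphi phi0 phi'0 Ephi).
assert (L2 := log_derivative_estimate (reflect F) psi c K d nu (- A) B HS cK HUr n0 Cpsi Ppsi psi0 psi'0 Epsi).
assert (PP := linearization_pos phi d Cphi Pphi phi0). assert (PQ := linearization_pos psi d Cpsi Ppsi psi0).
assert (TR := displacement_asymmetry F c K d nu A B C E C0 HS cK Kc HU HJ HC HC0 HE n0).
set (n := - nu) in *. assert (np : 0 < n) by (unfold n; lra).
assert (n8 : n <= 1 / 8).
{ assert (Q : Rabs nu <= 1 / 8) by apply HS. rewrite (Rabs_left nu n0) in Q. exact Q. }
set (M := 144 * K ^ 7 + 240 * K * exp (60 * K)).
assert (K70 : 0 <= K ^ 7) by (apply pow_le; lra).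
assert (eK0 : 0 <= 120 * K * exp (60 * K)).
{ assert (0 < exp (60 * K)) by apply exp_pos. nra. }
assert (M0 : 0 <= M) by (unfold M; lra).
set (Om := fun x => ln (phi x) - ln (psi x)).
set (Ga := asym_main c C0 n A).
set (Bf := fun x => n * M * (2 * x + (ln (n + c * x ^ 2) - ln n) / (2 * c))).
assert (wp : forall x, 0 < n + c * x ^ 2).
{ intros x. generalize (pow2_ge_0 x). nra. }
assert (Main : Rabs (Om d' - Ga d') <= Bf d').
{ apply (derive_bound_from_0 (fun x => Om x - Ga x) Bf d d'); auto.
  - intros t Ht. assert (It : Ioo (- d) d t) by (unfold Ioo; lra).
    exists (Derive phi t / phi t - Derive psi t / psi t - 2 * n * (A + C0 * t ^ 2) / (n + c * t ^ 2) ^ 2),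
      (n * M * (2 + t / (n + c * t ^ 2))). split; [|split].
    + apply (is_derive_minus Om Ga); [|now apply asym_main_derive].
      apply (is_derive_minus (fun x => ln (phi x)) (fun x => ln (psi x))).
      * apply (is_derive_comp ln phi); [apply is_derive_ln, PP, Ht | apply Derive_correct, Cphi, It].
      * apply (is_derive_comp ln psi); [apply is_derive_ln, PQ, Ht | apply Derive_correct, Cpsi, It].
    + apply (is_derive_scal (fun x => 2 * x + (ln (n + c * x ^ 2) - ln n) / (2 * c))).
      assert (w1 := wp t). auto_derive.
      * simpl in w1. repeat split; auto; lra.
      * simpl in w1. simpl. field. lra.
    + assert (w1 := wp t). assert (q1 := L1 t Ht). assert (q2 := L2 t Ht). assert (q3 := TR t Ht).
      set (y := (n + t) / (n + c * t ^ 2)) in *.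
      assert (By : y <= 1 + t / (n + c * t ^ 2)).
      { unfold y. replace (1 + t / (n + c * t ^ 2)) with ((n + c * t ^ 2 + t) / (n + c * t ^ 2)) by (field; lra).
        apply Rmult_le_compat_r; [left; apply Rinv_0_lt_compat; lra|].
        assert (0 <= c * t ^ 2) by (apply Rmult_le_pos; [lra|apply pow2_ge_0]). lra. }
      assert (t0 : 0 <= t / (n + c * t ^ 2)) by (apply Rlt_le, Rdiv_lt_0_compat; lra).
      cbv beta in q1, q2, q3.
      assert (q3' : Rabs (n * (/ (t - F t) - / (t - reflect F t) - 2 * (A + C0 * t ^ 2) / (n + c * t ^ 2) ^ 2)) <= n * (144 * K ^ 7)).
      { rewrite Rabs_mult, (Rabs_pos_eq n) by lra. apply Rmult_le_compat_l; [lra|exact q3]. }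
      assert (eq : Derive phi t / phi t - Derive psi t / psi t - 2 * n * (A + C0 * t ^ 2) / (n + c * t ^ 2) ^ 2 =
        (Derive phi t / phi t - n / (t - F t)) - (Derive psi t / psi t - n / (t - reflect F t)) +
        n * (/ (t - F t) - / (t - reflect F t) - 2 * (A + C0 * t ^ 2) / (n + c * t ^ 2) ^ 2)).
      { unfold Rdiv. ring. }
      rewrite eq.
      assert (q4 : 120 * K * exp (60 * K) * (n * y) <= 120 * K * exp (60 * K) * (n * (1 + t / (n + c * t ^ 2)))).
      { apply Rmult_le_compat_l; auto. apply Rmult_le_compat_l; lra. }
      assert (q5 : n * M * (2 + t / (n + c * t ^ 2)) =
        2 * (120 * K * exp (60 * K) * (n * (1 + t / (n + c * t ^ 2)))) + n * (144 * K ^ 7) +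
        (144 * K ^ 7 * (n * (1 + t / (n + c * t ^ 2))) + 240 * K * exp (60 * K) * n)) by (unfold M; ring).
      assert (q6 : 0 <= 144 * K ^ 7 * (n * (1 + t / (n + c * t ^ 2))) + 240 * K * exp (60 * K) * n).
      { apply Rplus_le_le_0_compat.
        - apply Rmult_le_pos; [lra|]. apply Rmult_le_pos; lra.
        - apply Rmult_le_pos; lra. }
      apply Rabs_le_between in q1. apply Rabs_le_between in q2. apply Rabs_le_between in q3'.
      apply Rabs_le_between. lra.
  - assert (TO : tends0 Om 0).
    { assert (I0 : Ioo (- d) d 0) by (unfold Ioo; lra).
      assert (T1 : tends0 (fun x => phi x / x) 1).
      { apply derive_quotient_tends0; auto. rewrite <- phi'0. apply Derive_correct, Cphi, I0. }
      assert (T2 : tends0 (fun x => psi x / x) 1).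
      { apply derive_quotient_tends0; auto. rewrite <- psi'0. apply Derive_correct, Cpsi, I0. }
      assert (cl : continuous ln 1).
      { apply continuous_ln; lra. }
      apply (tends0_ext (fun x => ln (phi x / x) - ln (psi x / x))).
      - generalize (near0_lt d (proj1 d0)). apply filter_imp. intros x Hx. unfold Om.
        rewrite !ln_div by (auto; lra). ring.
      - eapply tends0_eq; [apply tends0_minus; eapply (tends0_comp ln); eauto|]. rewrite ln_1; ring. }
    assert (TG : tends0 Ga 0).
    { apply tends0_continuous.
      - apply (ex_derive_continuous Ga 0). eexists. now apply asym_main_derive.
      - unfold Ga, asym_main. rewrite asym_J_0. unfold Rdiv; ring. }
    eapply tends0_eq; [apply tends0_minus; eauto|]. ring.
  - apply tends0_continuous.
    + apply (ex_derive_continuous Bf 0). unfold Bf. auto_derive. repeat split; auto; lra.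
    + unfold Bf. simpl. rewrite !Rmult_0_l, !Rmult_0_r, Rplus_0_r. unfold Rdiv; ring. }
assert (lnn : ln n < 0) by (rewrite <- ln_1; apply ln_increasing; lra).
assert (w1 := wp d').
assert (cd : c * d' ^ 2 <= 1 / 32).
{ apply Rle_trans with (c * d ^ 2); [|apply HS]. apply Rmult_le_compat_l; [lra|]. apply pow_incr; lra. }
assert (lnw : ln (n + c * d' ^ 2) <= 0) by (rewrite <- ln_1; apply ln_le; lra).
assert (ic : / c <= K).
{ apply (Rmult_le_reg_r c); auto. rewrite Rinv_l by lra. lra. }
assert (ic0 : 0 < / c) by (apply Rinv_0_lt_compat; lra).
assert (BB : Bf d' <= M * K * (n * (1 - ln n))).
{ unfold Bf. replace (M * K * (n * (1 - ln n))) with (n * M * (K * (1 - ln n))) by ring.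
  apply Rmult_le_compat_l; [apply Rmult_le_pos; lra|].
  assert ((ln (n + c * d' ^ 2) - ln n) / (2 * c) <= K * - ln n).
  { replace ((ln (n + c * d' ^ 2) - ln n) / (2 * c)) with (/ c * ((ln (n + c * d' ^ 2) - ln n) / 2)) by (field; lra).
    apply Rle_trans with (/ c * - ln n).
    - apply Rmult_le_compat_l; lra.
    - apply Rmult_le_compat_r; lra. }
  lra. }
assert (GG : Rabs (Ga d' - 2 * n * (A + C0 * n / c) * asym_J c n d') <= 2 * K ^ 3 / d' * (n * (1 - ln n))).
{ unfold Ga, asym_main.
  replace (_ - _) with (- (2 * n * (C0 * / c) * (d' / (n + c * d' ^ 2)))) by (unfold Rdiv; ring).
  rewrite Rabs_Ropp, !Rabs_mult, (Rabs_pos_eq 2), (Rabs_pos_eq n), (Rabs_pos_eq (/ c)) by lra.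
  rewrite (Rabs_pos_eq (d' / _)) by (apply Rlt_le, Rdiv_lt_0_compat; lra).
  assert (d'c : d' / (n + c * d' ^ 2) <= K / d').
  { apply Rle_div_l; auto. replace (K / d' * (n + c * d' ^ 2)) with (K * n / d' + K * c * d') by (field; lra).
    assert (0 <= K * n / d') by (apply Rdiv_le_0_compat; [apply Rmult_le_pos|]; lra).
    assert (1 * d' <= K * c * d') by (apply Rmult_le_compat_r; lra). lra. }
  apply Rle_trans with (2 * n * (K * K) * (K / d')).
  - apply Rmult_le_compat; try lra.
    + apply Rmult_le_pos; [lra|]. apply Rmult_le_pos; [apply Rabs_pos|lra].
    + apply Rlt_le, Rdiv_lt_0_compat; lra.
    + apply Rmult_le_compat_l; [lra|]. apply Rmult_le_compat; try lra. apply Rabs_pos.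
  - replace (2 * n * (K * K) * (K / d')) with (2 * K ^ 3 / d' * n) by (field; lra).
    apply Rmult_le_compat_l; [|nra]. apply Rdiv_le_0_compat; [|lra].
    assert (0 <= K ^ 3) by (apply pow_le; lra). lra. }
replace (- phi (- d')) with (psi d') by reflexivity.
fold (Om d').
replace (Om d' - _) with ((Om d' - Ga d') + (Ga d' - 2 * n * (A + C0 * n / c) * asym_J c n d')) by ring.
eapply Rle_trans; [apply Rabs_triang|].
unfold asym_const. fold M. lra.
Qed.

(** * Parameter dependence of zeros and of Koenigs coordinates *)

(** Monotonicity makes the zero unique, encloses it between [t0 - eta] and [t0 + eta]
    for small [s], and turns separate continuity of [H] into continuity of the zero. *)
Lemma monotone_solver (H : R -> R -> R) t0 s1 : 0 < s1 ->
  (forall s, 0 < s < s1 -> forall t t', t0 - 1 <= t -> t < t' -> t' <= t0 + 1 -> H s t < H s t') ->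
  (forall s, 0 < s < s1 -> forall t, t0 - 1 <= t <= t0 + 1 -> continuous (H s) t) ->
  (forall s, 0 < s < s1 -> forall t, t0 - 1 <= t <= t0 + 1 -> continuous (fun s => H s t) s) ->
  (forall eta, 0 < eta <= 1 -> at_right 0 (fun s => H s (t0 - eta) < 0 < H s (t0 + eta))) ->
  exists s2 T, 0 < s2 <= s1 /\ tends0 T t0 /\
  forall s, 0 < s < s2 -> Rabs (T s - t0) < 1 /\ H s (T s) = 0 /\ continuous T s.
Proof.
intros s10 Mono Ct Cs Sg.
assert (N := Sg 1 ltac:(lra)). apply near0_spec in N. destruct N as [s3 [s30 N]].
set (s2 := Rmin s1 s3). assert (A1 := Rmin_l s1 s3). assert (A2 := Rmin_r s1 s3). fold s2 in A1, A2.
assert (s20 : 0 < s2) by (apply Rmin_case; auto).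
set (P := fun s t => t0 - 1 <= t <= t0 + 1 /\ H s t = 0).
set (T := fun s => epsilon (inhabits 0) (P s)).
assert (HT : forall s, 0 < s < s2 -> P s (T s)).
{ intros s Hs. apply (epsilon_spec (inhabits 0) (P s)).
  destruct (ivt (H s) (t0 - 1) (t0 + 1) 0) as [t Ht]; [lra| | |exists t; exact Ht].
  - intros t Ht. apply Ct; lra.
  - specialize (N s ltac:(lra)). lra. }
assert (Enc : forall s a b, 0 < s < s2 -> t0 - 1 <= a -> b <= t0 + 1 -> H s a < 0 < H s b -> a <= t0 + 1 -> t0 - 1 <= b -> a < T s < b).
{ intros s a b Hs Ha Hb Hab Ha' Hb'. destruct (HT s Hs) as [T1 T2]. split; apply Rnot_le_lt; intros [X|X].
  - assert (H s (T s) < H s a) by (apply Mono; lra). lra.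
  - rewrite X in T2; lra.
  - assert (H s b < H s (T s)) by (apply Mono; lra). lra.
  - rewrite <- X in T2; lra. }
exists s2, T. split; [lra|]. split.
- apply tends0_spec. intros eps e0. set (eta := Rmin (eps / 2) 1).
  assert (He : 0 < eta <= 1 /\ eta < eps) by (unfold eta, Rmin; destruct Rle_dec; lra).
  assert (Ne := Sg eta (proj1 He)). apply near0_spec in Ne. destruct Ne as [e1 [e10 Ne]].
  exists (Rmin e1 s2). split; [apply Rmin_case; auto|]. intros s Hs.
  assert (B1 := Rmin_l e1 s2). assert (B2 := Rmin_r e1 s2).
  assert (Q := Enc s (t0 - eta) (t0 + eta) ltac:(lra) ltac:(lra) ltac:(lra) (Ne s ltac:(lra)) ltac:(lra) ltac:(lra)).
  apply Rabs_def1; lra.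
- intros s Hs.
  assert (Q := Enc s (t0 - 1) (t0 + 1) Hs ltac:(lra) ltac:(lra) (N s ltac:(lra)) ltac:(lra) ltac:(lra)).
  destruct (HT s Hs) as [T1 T2]. split; [apply Rabs_def1; lra|]. split; [exact T2|].
  apply filterlim_locally. intros eps. assert (e0 := cond_pos eps).
  set (e := Rmin (eps / 2) (Rmin (T s - (t0 - 1)) (t0 + 1 - T s))).
  assert (He : 0 < e < eps /\ e <= T s - (t0 - 1) /\ e <= t0 + 1 - T s).
  { unfold e, Rmin; repeat destruct Rle_dec; lra. }
  clearbody e.
  assert (L1 : H s (T s - e) < 0) by (rewrite <- T2; apply Mono; lra).
  assert (L2 : 0 < H s (T s + e)) by (rewrite <- T2; apply Mono; lra).
  assert (N1 : locally s (fun z => H z (T s - e) < 0)).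
  { apply (Cs s ltac:(lra) (T s - e) ltac:(lra) (fun y => y < 0)). now apply (open_lt 0). }
  assert (N2 : locally s (fun z => 0 < H z (T s + e))).
  { apply (Cs s ltac:(lra) (T s + e) ltac:(lra) (fun y => 0 < y)). now apply (open_gt 0). }
  assert (N3 := open_locally (Ioo 0 s2) s (open_Ioo 0 s2) Hs).
  generalize (filter_and _ _ N1 (filter_and _ _ N2 N3)). apply filter_imp. intros z [Z1 [Z2 Z3]].
  assert (Qz := Enc z (T s - e) (T s + e) Z3 ltac:(lra) ltac:(lra) (conj Z1 Z2) ltac:(lra) ltac:(lra)).
  unfold ball; simpl; unfold AbsRing_ball, abs, minus, plus, opp; simpl. apply Rabs_def1; lra.
Qed.

(** Comparing orbits and passing to the limit gives [phi <= psi]. Strictness comes from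
    one further step: [m * phi x = phi (F x) <= psi (F x) < psi (G x) = m * psi x]. *)
Lemma koenigs_strict_comparison F G phi psi a b m :
  attracting F a 0 b -> attracting G a 0 b -> 0 < m ->
  phi 0 = 0 -> is_derive phi 0 1 -> (forall x, Ioo a b x -> phi (F x) = m * phi x) ->
  psi 0 = 0 -> is_derive psi 0 1 -> (forall x, Ioo a b x -> psi (G x) = m * psi x) ->
  (forall x y, Ioo a b x -> Ioo a b y -> x < y -> psi x < psi y) ->
  (forall x, Ioo a b x -> x <> 0 -> F x < G x) ->
  forall x, Ioo a b x -> x <> 0 -> phi x < psi x.
Proof.
intros AF AG m0 p0 dp ep q0 dq eq Mq Lt.
assert (F0 : F 0 = 0) by apply AF. assert (G0 : G 0 = 0) by apply AG.
assert (Le : forall y, Ioo a b y -> F y <= G y).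
{ intros y Hy. destruct (Req_dec y 0) as [->|N]; [lra|]. left; auto. }
assert (MG : forall x y, Ioo a b x -> Ioo a b y -> x <= y -> G x <= G y).
{ intros x y Hx Hy [L|L]; [left; now apply AG | subst; lra]. }
assert (It : forall n y, Ioo a b y -> Nat.iter n F y <= Nat.iter n G y).
{ intros n y Hy. assert (I1 := fun n => attracting_iter_maps F a 0 b AF y n Hy).
  assert (I2 := fun n => attracting_iter_maps G a 0 b AG y n Hy).
  induction n as [|n IH]; simpl; [lra|].
  apply Rle_trans with (G (Nat.iter n F y)); auto. }
assert (LE : forall y, Ioo a b y -> phi y <= psi y).
{ intros y Hy.
  apply (is_lim_seq_le (fun n => Nat.iter n F y / m ^ n) (fun n => Nat.iter n G y / m ^ n) (phi y) (psi y)).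
  - intros n. apply Rmult_le_compat_r; auto. left; apply Rinv_0_lt_compat, pow_lt, m0.
  - apply (koenigs_limit F a b); auto.
  - apply (koenigs_limit G a b); auto. }
intros x Hx Nx.
assert (IF := attracting_maps F a 0 b AF x Hx). assert (IG := attracting_maps G a 0 b AG x Hx).
assert (L1 := LE (F x) IF). assert (L2 := Mq _ _ IF IG (Lt x Hx Nx)).
rewrite ep in L1 by auto. rewrite (eq x Hx) in L2. nra.
Qed.

(** Along the orbit of [x] the quantity [ln (F^n x) - n ln (1 + nu)] changes at each
    step by at most a multiple of the displacement, so its total change telescopes. *)
Lemma koenigs_log_size F phi c K d nu A B : small_params c K d nu -> c <= K ->
  unfolding F c K d nu A B -> nu < 0 -> Ck 1 (Ioo (- d) d) phi ->
  (forall x, Ioo (- d) d x -> 0 < Derive phi x) -> phi 0 = 0 -> Derive phi 0 = 1 ->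
  (forall x, Ioo (- d) d x -> phi (F x) = (1 + nu) * phi x) ->
  forall x, 0 < x < d -> Rabs (ln (phi x) - ln x) <= 24 * K / - nu * x.
Proof.
intros HS cK HU n0 Cp Pp p0 p'0 Ep x Hx.
assert (At := unfolding_attracting F c K d nu A B HS HU n0).
assert (K1 : 1 <= K) by apply HS.
assert (nb : Rabs nu <= 1 / 8) by apply HS. rewrite (Rabs_left nu n0) in nb.
assert (PP := linearization_pos phi d Cp Pp p0).
assert (d1 : 0 < d <= 1 / 2) by apply HS.
assert (St : forall y, 0 < y < d -> Rabs (ln (F y) - ln y - ln (1 + nu)) <= 24 * K / - nu * (y - F y)).
{ intros y Hy. assert (Iy : Ioo (- d) d y) by (unfold Ioo; lra).
  assert (Fy := right_maps F c K d nu A B HS HU n0 y Hy).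
  assert (D := proj1 (proj2 (displacement_bounds F c K d nu A B HS HU n0 y Hy))). cbv beta in D.
  assert (HB := unfolding_cubic_bounds F c K d nu A B HS HU).
  assert (HU' := HU). destruct HU' as [_ [H2 [_ [_ [HA _]]]]]. assert (Q := H2 y Iy).
  rewrite (Rabs_pos_eq y) in Q by lra. rewrite (Rabs_left nu n0) in HA.
  assert (Ratio : Rabs (F y / (y * (1 + nu)) - 1) <= 4 * K * y).
  { replace (F y / (y * (1 + nu)) - 1) with ((F y - y - nu * y) / (y * (1 + nu))) by (field; lra).
    unfold Rdiv. rewrite Rabs_mult, Rabs_inv, (Rabs_pos_eq (y * (1 + nu))) by (apply Rmult_le_pos; lra).
    apply Rle_div_l; [apply Rmult_lt_0_compat; lra|].
    assert (y2 : 0 < y ^ 2) by (apply pow_lt; lra).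
    assert (B1 : Rabs (A * y ^ 2) <= K * y ^ 2 / 8).
    { rewrite Rabs_mult, (Rabs_pos_eq (y ^ 2)) by lra. assert (K * - nu <= K / 8) by nra. nra. }
    assert (B2 : Rabs (B * y ^ 3) <= K * y ^ 2).
    { replace (B * y ^ 3) with (B * y * y ^ 2) by ring. rewrite Rabs_mult, (Rabs_pos_eq (y ^ 2)) by lra.
      apply Rmult_le_compat_r; [lra|]. rewrite Rabs_mult, (Rabs_pos_eq y) by lra.
      assert (Rabs B <= 2 * K) by (apply Rabs_le_between; lra). nra. }
    assert (B3 : K * y ^ 4 <= K * y ^ 2).
    { apply Rmult_le_compat_l; [lra|]. replace (y ^ 4) with (y ^ 2 * y ^ 2) by ring.
      assert (y ^ 2 <= 1) by (simpl; nra). nra. }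
    apply Rabs_le_between in Q. apply Rabs_le_between in B1. apply Rabs_le_between in B2.
    assert (X : Rabs (F y - y - nu * y) <= 3 * (K * y ^ 2)) by (apply Rabs_le_between; lra).
    eapply Rle_trans; [exact X|].
    replace (4 * K * y * (y * (1 + nu))) with (4 * (1 + nu) * (K * y ^ 2)) by ring.
    apply Rmult_le_compat_r; [|lra]. apply Rmult_le_pos; lra. }
  assert (r3 : 1 / 3 <= F y / (y * (1 + nu))).
  { destruct (unfolding_displacement F c K d nu A B HS HU y Iy) as [q [Eq Hq]].
    apply (proj1 (Rle_div_r (1 / 3) (F y) (y * (1 + nu)) ltac:(apply Rmult_lt_0_compat; lra))).
    rewrite (Rabs_left nu n0) in Hq.
    assert (c * y ^ 2 <= 1 / 32).
    { apply Rle_trans with (c * d ^ 2); [|apply HS]. apply Rmult_le_compat_l; [lra|]. apply pow_incr; lra. }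
    nra. }
  replace (ln (F y) - ln y - ln (1 + nu)) with (ln (F y / (y * (1 + nu)))).
  2:{ rewrite ln_div, ln_mult by (try apply Rmult_lt_0_compat; lra). ring. }
  eapply Rle_trans; [apply ln_near_1, r3|].
  apply Rle_trans with (3 * (4 * K * y)); [lra|].
  assert (Dy : y * (- nu / 2) <= y - F y).
  { assert (0 <= y * (c / 2 * y ^ 2)) by (apply Rmult_le_pos; [lra|apply Rmult_le_pos; [lra|apply pow2_ge_0]]). lra. }
  replace (3 * (4 * K * y)) with (24 * K / - nu * (y * (- nu / 2))) by (field; lra).
  apply Rmult_le_compat_l; auto. apply Rdiv_le_0_compat; lra. }
set (u := fun n => Nat.iter n F x).
assert (U : forall n, 0 < u n <= x) by (intros n; apply (attracting_iter_right F (- d) 0 d At x n Hx)).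
assert (Tel : forall n, Rabs (ln (u n) - ln x - INR n * ln (1 + nu)) <= 24 * K / - nu * (x - u n)).
{ induction n as [|n IH].
  - unfold u; simpl. replace (ln x - ln x - 0 * ln (1 + nu)) with 0 by ring.
    rewrite Rabs_R0. lra.
  - assert (Sn := St (u n) ltac:(generalize (U n); lra)).
    change (F (u n)) with (u (S n)) in Sn. rewrite S_INR.
    replace (ln (u (S n)) - ln x - (INR n + 1) * ln (1 + nu)) with
      ((ln (u (S n)) - ln (u n) - ln (1 + nu)) + (ln (u n) - ln x - INR n * ln (1 + nu))) by ring.
    eapply Rle_trans; [apply Rabs_triang|]. lra. }
assert (Iter := linearization_iter F (- d) 0 d phi (1 + nu) At Ep).
assert (Lp : forall n, ln (phi (u n)) = INR n * ln (1 + nu) + ln (phi x)).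
{ intros n. unfold u. rewrite Iter by (unfold Ioo; lra).
  rewrite ln_mult, ln_pow by (auto; try apply pow_lt; lra). ring. }
assert (L : is_lim_seq u 0) by (apply (attracting_iter_lim F (- d) 0 d At x); unfold Ioo; lra).
assert (T1 : tends0 (fun y => ln (phi y / y)) 0).
{ rewrite <- ln_1. apply (tends0_comp ln).
  - apply continuous_ln; lra.
  - apply derive_quotient_tends0; auto. rewrite <- p'0. apply Derive_correct, Cp. unfold Ioo; lra. }
apply Rle_plus_epsilon. intros eps e0.
rewrite tends0_spec in T1. destruct (T1 eps e0) as [eta [eta0 H]].
apply is_lim_seq_spec in L. destruct (L (mkposreal eta eta0)) as [N HN].
specialize (HN N (le_n N)). simpl in HN. rewrite Rminus_0_r, Rabs_pos_eq in HN by (generalize (U N); lra).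
specialize (H (u N) ltac:(generalize (U N); lra)). rewrite Rminus_0_r in H.
rewrite ln_div in H by (try apply PP; generalize (U N); lra). rewrite Lp in H.
assert (S := Tel N). apply Rabs_def2 in H. apply Rabs_le_between in S. apply Rabs_le_between.
assert (0 <= 24 * K / - nu * u N).
{ apply Rmult_le_pos; [apply Rdiv_le_0_compat; lra|generalize (U N); lra]. }
lra.
Qed.

Lemma iter_param_continuous (F : R -> R -> R) d x s0 : 0 < x < d ->
  (forall y, 0 < y <= x -> 0 < F s0 y <= y) ->
  (forall y, 0 < y < d -> continuity_2d_pt F s0 y) ->
  forall n, continuous (fun s => Nat.iter n (F s) x) s0.
Proof.
intros Hx HF C. assert (U : forall n, 0 < Nat.iter n (F s0) x <= x).
{ induction n as [|n IH]; simpl; [lra|]. generalize (HF _ IH); lra. }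
induction n as [|n IH]; simpl.
- apply continuous_const.
- apply filterlim_locally. intros eps.
  destruct (C (Nat.iter n (F s0) x) ltac:(generalize (U n); lra) eps) as [del Hdel].
  assert (N1 := proj1 (filterlim_locally _ _) IH del).
  assert (N2 : locally s0 (fun s => Rabs (s - s0) < del)) by (exists del; auto).
  generalize (filter_and _ _ N1 N2). apply filter_imp. intros s [S1 S2].
  apply (Hdel s (Nat.iter n (F s) x)); auto.
Qed.

(** Stopping the limit after [n] steps makes an error of at most a multiple of [F^n d'],
    by the previous lemma applied at that point. For [s] near [s0] this is uniformly
    small, and the truncations are continuous in [s]. *)
Lemma koenigs_param_continuous (F : R -> R -> R) (nu A B : R -> R) c K d d' s0 : c <= K ->
  locally s0 (fun s => small_params c K d (nu s) /\ unfolding (F s) c K d (nu s) (A s) (B s) /\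
    nu s < 0 /\ Ck 2 (Ioo (- d) d) (F s)) ->
  continuous nu s0 -> (forall y, 0 < y < d -> continuity_2d_pt F s0 y) -> 0 < d' < d ->
  continuous (fun s => ln (koenigs_value (F s) (1 + nu s) d')) s0.
Proof.
intros cK HL Cnu CF Hd'.
destruct (locally_singleton _ _ HL) as [S0 [U0 [n0 C0]]].
assert (At := unfolding_attracting (F s0) c K d (nu s0) (A s0) (B s0) S0 U0 n0).
assert (K1 : 1 <= K) by apply S0.
set (u := fun n s => Nat.iter n (F s) d').
assert (Cu : forall n, continuous (u n) s0).
{ apply (iter_param_continuous F d); auto. intros y Hy.
  generalize (right_maps (F s0) c K d (nu s0) (A s0) (B s0) S0 U0 n0 y). lra. }
assert (L : is_lim_seq (fun n => u n s0) 0) by (apply (attracting_iter_lim _ _ _ _ At d'); unfold Ioo; lra).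
assert (N1 : locally s0 (fun s => nu s < nu s0 / 2)).
{ apply (Cnu (fun y => y < nu s0 / 2)). apply (open_lt (nu s0 / 2)). lra. }
set (Q := 48 * K / - nu s0). assert (Q0 : 0 < Q) by (apply Rdiv_lt_0_compat; lra).
assert (Est : locally s0 (fun s => forall n, 0 < u n s /\
   Rabs (ln (koenigs_value (F s) (1 + nu s) d') - (ln (u n s) - INR n * ln (1 + nu s))) <= Q * u n s)).
{ generalize (filter_and _ _ HL N1). apply filter_imp. intros s [[HS [HU [Hn HC]]] Hn2] n.
  assert (Ats := unfolding_attracting (F s) c K d (nu s) (A s) (B s) HS HU Hn).
  assert (Fm := unfolding_multiplier0 (F s) c K d (nu s) (A s) (B s) HS HU).
  destruct (monostable_linearization 0 (F s) d) as [phi [Cp [Pp [p0 [p'0 [Ep Vp]]]]]].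
  { now apply (unfolding_pitch_neg 2 (F s) c K d (nu s) (A s) (B s)). }
  { rewrite Fm; lra. }
  rewrite Fm in Ep, Vp. rewrite (Vp d') by (unfold Ioo; lra).
  assert (U : 0 < u n s <= d') by (apply (attracting_iter_right (F s) (- d) 0 d Ats d' n Hd')).
  split; [lra|].
  assert (Z := koenigs_log_size (F s) phi c K d (nu s) (A s) (B s) HS cK HU Hn (Ck_S _ _ _ Cp) Pp p0 p'0 Ep (u n s) ltac:(lra)).
  assert (It := linearization_iter (F s) (- d) 0 d phi (1 + nu s) Ats Ep n d' ltac:(unfold Ioo; lra)).
  change (Nat.iter n (F s) d') with (u n s) in It.
  assert (nb : Rabs (nu s) <= 1 / 8) by apply HS. rewrite (Rabs_left (nu s) Hn) in nb.
  assert (PP := linearization_pos phi d (Ck_S _ _ _ Cp) Pp p0).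
  rewrite It, ln_mult, ln_pow in Z by (try apply pow_lt; auto; lra).
  assert (24 * K / - nu s <= Q).
  { unfold Q. replace (48 * K / - nu s0) with (24 * K / (- (nu s0 / 2))) by (field; lra).
    apply Rmult_le_compat_l; [lra|]. apply Rinv_le_contravar; lra. }
  replace (ln (phi d') - (ln (u n s) - INR n * ln (1 + nu s))) with
    (INR n * ln (1 + nu s) + ln (phi d') - ln (u n s)) by ring.
  eapply Rle_trans; [exact Z|]. apply Rmult_le_compat_r; lra. }
apply filterlim_locally. intros eps. assert (e0 := cond_pos eps).
apply is_lim_seq_spec in L.
assert (e1 : 0 < eps / 8 / Q) by (apply Rdiv_lt_0_compat; lra).
destruct (L (mkposreal _ e1)) as [n Hn]. specialize (Hn n (le_n n)). simpl in Hn.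
rewrite Rminus_0_r in Hn. apply Rabs_def2 in Hn. destruct Hn as [Hn _].
apply Rlt_div_r in Hn; auto.
destruct (locally_singleton _ _ Est n) as [P0 E0].
assert (Cl : continuous (fun s => ln (u n s) - INR n * ln (1 + nu s)) s0).
{ assert (nb : Rabs (nu s0) <= 1 / 8) by apply S0. rewrite (Rabs_left (nu s0) n0) in nb.
  apply (continuous_minus (fun s => ln (u n s)) (fun s => INR n * ln (1 + nu s))).
  - apply (continuous_comp (u n) ln); auto. now apply continuous_ln.
  - apply (continuous_mult (fun _ => INR n) (fun s => ln (1 + nu s))); [apply continuous_const|].
    apply (continuous_comp (fun s => 1 + nu s) ln); [|apply continuous_ln; lra].
    apply (continuous_plus (fun _ => 1) nu); auto. apply continuous_const. }
assert (N2 : locally s0 (fun s => u n s < eps / 4 / Q)).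
{ apply (Cu n (fun y => y < eps / 4 / Q)). apply (open_lt (eps / 4 / Q)).
  apply Rlt_div_r; auto. lra. }
assert (e2 : 0 < eps / 2) by lra.
assert (N3 := proj1 (filterlim_locally _ _) Cl (mkposreal _ e2)).
generalize (filter_and _ _ Est (filter_and _ _ N2 N3)). apply filter_imp. intros s [E1 [E2 E3]].
destruct (E1 n) as [P1 E1']. apply Rlt_div_r in E2; auto.
unfold ball in *; simpl in *; unfold AbsRing_ball, abs, minus, plus, opp in *; simpl in *.
apply Rabs_le_between in E1'. apply Rabs_le_between in E0. apply Rabs_def2 in E3.
apply Rabs_def1; lra.
Qed.

(** * Prescribing the multipliers of the normal form *)

Lemma g_derive nu a b y : is_derive (fun y => g y nu a b) y
  (1 + (nu + 2 * (b * nu) * y - 3 * y ^ 2 + 5 * a * y ^ 4)).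
Proof. unfold g. auto_derive; auto. ring. Qed.

Lemma g_Derive nu a b y : Derive (fun y => g y nu a b) y =
  1 + (nu + 2 * (b * nu) * y - 3 * y ^ 2 + 5 * a * y ^ 4).
Proof. apply is_derive_unique, g_derive. Qed.

Lemma g_derive2 nu a b y : is_derive (Derive (fun y => g y nu a b)) y
  (2 * (b * nu) - 6 * y + 20 * a * y ^ 3).
Proof.
apply (is_derive_ext (fun y => 1 + (nu + 2 * (b * nu) * y - 3 * y ^ 2 + 5 * a * y ^ 4))).
- intros t. now rewrite g_Derive.
- auto_derive; auto. ring.
Qed.

Lemma Ck_pow n (U : R -> Prop) m : open U -> Ck n U (fun x => x ^ m).
Proof.
intros oU. induction m as [|m IH]; simpl.
- apply Ck_const.
- apply Ck_mult; auto. apply Ck_id.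
Qed.

Lemma g_Ck n (U : R -> Prop) nu a b : open U -> Ck n U (fun y => g y nu a b).
Proof.
intros oU. apply (Ck_ext n U (fun y => y + nu * y + (-1) * y ^ 3 + a * y ^ 5 + (b * nu) * y ^ 2)); auto.
- intros y _. unfold g. ring.
- repeat apply Ck_plus; auto; try apply Ck_scal; auto using Ck_id, Ck_pow.
Qed.

Lemma g_unfolding nu a b K d : 0 < d <= 1 / 2 -> 10 * Rabs a <= K -> Rabs b <= K -> 0 <= K ->
  unfolding (fun y => g y nu a b) 1 K d nu (b * nu) (-1) /\
  jet5 (fun y => g y nu a b) K d nu (b * nu) (-1) 0 a.
Proof.
intros Hd Ha Hb K0.
assert (Hy : forall y, Ioo (- d) d y -> Rabs y <= 1 / 2).
{ intros y [Y1 Y2]. apply Rabs_le_between; lra. }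
assert (Pa : forall q y j, 0 <= q <= 20 -> Rabs y <= 1 / 2 -> Rabs (q * a * y ^ S j) <= K * Rabs y ^ j).
{ intros q y j Hq Y. rewrite !Rabs_mult, (Rabs_pos_eq q), <- RPow_abs by lra. simpl.
  assert (0 <= Rabs y ^ j) by (apply pow_le, Rabs_pos). assert (0 <= Rabs a) by apply Rabs_pos.
  replace (q * Rabs a * (Rabs y * Rabs y ^ j)) with (q * Rabs y * Rabs a * Rabs y ^ j) by ring.
  apply Rmult_le_compat_r; auto. assert (q * Rabs y <= 10) by nra. nra. }
split.
- split; [|split; [|split; [|split; [|split]]]].
  + intros y _. split; eexists; [apply g_derive | apply g_derive2].
  + intros y Iy. replace (_ - _) with (1 * a * y ^ 5) by (unfold g; ring). apply Pa; auto; lra.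
  + intros y Iy. rewrite g_Derive. replace (_ - _) with (5 * a * y ^ 4) by ring. apply Pa; auto; lra.
  + intros y Iy. rewrite (is_derive_unique _ _ _ (g_derive2 nu a b y)).
    replace (_ - _) with (20 * a * y ^ 3) by ring. apply Pa; auto; lra.
  + rewrite Rabs_mult. apply Rmult_le_compat_r; auto using Rabs_pos.
  + replace (-1 + 1) with 0 by ring. rewrite Rabs_R0. apply Rmult_le_pos; auto using Rabs_pos.
- split; intros y Iy.
  + replace (_ - _) with 0 by (unfold g; ring). rewrite Rabs_R0. apply Rmult_le_pos; auto. apply pow_le, Rabs_pos.
  + rewrite g_Derive. replace (_ - _) with 0 by ring. rewrite Rabs_R0. apply Rmult_le_pos; auto. apply pow_le, Rabs_pos.
Qed.

(** The square [u] of a fixed point of [g] with multiplier [1 - n - nu]. Eliminating [b]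
    from the equations of the fixed point and of the multiplier leaves [3 a u^2 = u -
    n]; the root close to [n] is written so that it is also defined at [a = 0]. *)
Definition fix_sq (a n : R) : R := 2 * n / (1 + sqrt (1 - 12 * a * n)).

(** The value of [b * nu] which the equation of that fixed point then requires. *)
Definition fix_bnu (a n nu : R) : R := (2 * fix_sq a n + n - 3 * nu) / (3 * sqrt (fix_sq a n)).

Lemma fix_sq_pos a n : 0 < n -> 0 < fix_sq a n.
Proof.
intros Hn. assert (0 <= sqrt (1 - 12 * a * n)) by apply sqrt_pos.
unfold fix_sq. apply Rdiv_lt_0_compat; lra.
Qed.

Lemma fix_sq_eq a n : 0 <= 1 - 12 * a * n -> 3 * a * fix_sq a n ^ 2 = fix_sq a n - n.
Proof.
intros H. set (s := sqrt (1 - 12 * a * n)). assert (s0 : 0 <= s) by apply sqrt_pos.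
assert (E : s * s = 1 - 12 * a * n) by (apply sqrt_sqrt; auto).
unfold fix_sq. fold s.
replace (3 * a * (2 * n / (1 + s)) ^ 2) with (n * (12 * a * n) / (1 + s) ^ 2) by (field; lra).
replace (12 * a * n) with (1 - s * s) by lra. field. lra.
Qed.

Lemma fix_sq_increasing n a a' : 0 < n -> 0 <= 1 - 12 * a' * n -> a < a' -> fix_sq a n < fix_sq a' n.
Proof.
intros Hn H L. assert (0 <= sqrt (1 - 12 * a' * n)) by apply sqrt_pos.
assert (sqrt (1 - 12 * a' * n) < sqrt (1 - 12 * a * n)) by (apply sqrt_lt_1; nra).
unfold fix_sq. apply Rmult_lt_compat_l; [lra|]. apply Rinv_lt_contravar; [nra|lra].
Qed.

Lemma fix_bnu_increasing n nu a a' : 0 < n < 3 * nu -> 0 <= 1 - 12 * a' * n -> a < a' ->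
  fix_bnu a n nu < fix_bnu a' n nu.
Proof.
intros Hn H L. assert (L' := fix_sq_increasing n a a' (proj1 Hn) H L).
assert (P := fix_sq_pos a n (proj1 Hn)). assert (P' := fix_sq_pos a' n (proj1 Hn)).
assert (F : forall a, 0 < fix_sq a n -> fix_bnu a n nu =
   2 / 3 * sqrt (fix_sq a n) + - (nu - n / 3) * / sqrt (fix_sq a n)).
{ intros x Hx. unfold fix_bnu. assert (S0 := sqrt_lt_R0 _ Hx).
  replace (fix_sq x n) with (sqrt (fix_sq x n) * sqrt (fix_sq x n)) at 1 by (apply sqrt_sqrt; lra).
  field. lra. }
rewrite !F by auto. assert (S0 := sqrt_lt_R0 _ P).
assert (S1 : sqrt (fix_sq a n) < sqrt (fix_sq a' n)) by (apply sqrt_lt_1; lra).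
assert (/ sqrt (fix_sq a' n) < / sqrt (fix_sq a n)) by (apply Rinv_lt_contravar; [nra|lra]).
nra.
Qed.

Lemma fix_sq_fixed a n nu b : 0 < n -> 0 <= 1 - 12 * a * n -> b * nu = fix_bnu a n nu ->
  g (sqrt (fix_sq a n)) nu a b = sqrt (fix_sq a n) /\
  Derive (fun y => g y nu a b) (sqrt (fix_sq a n)) = 1 - n - nu.
Proof.
intros Hn H Hb. assert (P := fix_sq_pos a n Hn). assert (Q := fix_sq_eq a n H).
set (u := fix_sq a n) in *. set (y := sqrt u). assert (y0 : 0 < y) by (apply sqrt_lt_R0; auto).
assert (E : y ^ 2 = u) by (unfold y; rewrite <- Rsqr_pow2; apply Rsqr_sqrt; lra).
assert (Eb : b * nu * y = (2 * u + n - 3 * nu) / 3).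
{ rewrite Hb. unfold fix_bnu. fold u. fold y. field. lra. }
rewrite g_Derive. split.
- unfold g. replace (y ^ 3) with (y * y ^ 2) by ring. replace (y ^ 5) with (y * (y ^ 2) ^ 2) by ring.
  replace (b * nu * y ^ 2) with (y * (b * nu * y)) by ring. rewrite Eb, E.
  replace (a * (y * u ^ 2)) with (y * (3 * a * u ^ 2) / 3) by field. rewrite Q. field.
- replace (2 * (b * nu) * y) with (2 * (b * nu * y)) by ring. rewrite Eb.
  replace (y ^ 4) with ((y ^ 2) ^ 2) by ring. rewrite E.
  replace (5 * a * u ^ 2) with (5 * (3 * a * u ^ 2) / 3) by field. rewrite Q. field.
Qed.

Lemma fix_sq_fixed_neg a n nu b : 0 < n -> 0 <= 1 - 12 * a * n -> - (b * nu) = fix_bnu a n nu ->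
  g (- sqrt (fix_sq a n)) nu a b = - sqrt (fix_sq a n) /\
  Derive (fun y => g y nu a b) (- sqrt (fix_sq a n)) = 1 - n - nu.
Proof.
intros Hn H Hb.
destruct (fix_sq_fixed a n nu (- b) Hn H) as [H1 H2]; [rewrite <- Hb; ring|].
rewrite g_Derive in *. set (y := sqrt (fix_sq a n)) in *. split.
- unfold g in *. replace ((- y) ^ 3) with (- y ^ 3) by ring. replace ((- y) ^ 5) with (- y ^ 5) by ring.
  replace ((- y) ^ 2) with (y ^ 2) by ring. lra.
- rewrite <- H2. ring.
Qed.

Lemma continuous_sqrt_pos u (s : R) : 0 < u s -> continuous u s -> continuous (fun s => sqrt (u s)) s.
Proof.
intros P C. apply (continuous_comp u sqrt); auto. apply continuity_pt_filterlim, continuity_pt_sqrt; lra.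
Qed.

Lemma continuous_div (u v : R -> R) (s : R) : v s <> 0 -> continuous u s -> continuous v s ->
  continuous (fun s => u s / v s) s.
Proof.
intros N U V. apply (continuous_mult u (fun s => / v s)); auto.
apply (continuous_comp v Rinv); auto. now apply continuous_Rinv.
Qed.

Lemma fix_bnu_continuous (a n nu : R -> R) s : 0 < n s -> 0 < 1 - 12 * a s * n s ->
  continuous a s -> continuous n s -> continuous nu s ->
  continuous (fun s => fix_bnu (a s) (n s) (nu s)) s.
Proof.
intros Hn H Ca Cn Cnu.
assert (C12 : continuous (fun s => 1 - 12 * a s * n s) s).
{ apply (continuous_minus (fun _ => 1) (fun s => 12 * a s * n s)); [apply continuous_const|].
  apply (continuous_mult (fun s => 12 * a s) n); auto.
  apply (continuous_mult (fun _ => 12) a); auto. apply continuous_const. }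
assert (Cu : continuous (fun s => fix_sq (a s) (n s)) s).
{ unfold fix_sq. assert (0 <= sqrt (1 - 12 * a s * n s)) by apply sqrt_pos.
  apply (continuous_div (fun s => 2 * n s) (fun s => 1 + sqrt (1 - 12 * a s * n s))); [lra| |].
  - apply (continuous_mult (fun _ => 2) n); auto. apply continuous_const.
  - apply (continuous_plus (fun _ => 1) (fun s => sqrt (1 - 12 * a s * n s))); [apply continuous_const|].
    now apply continuous_sqrt_pos. }
assert (P := fix_sq_pos (a s) (n s) Hn). assert (S0 := sqrt_lt_R0 _ P).
unfold fix_bnu. apply (continuous_div (fun s => 2 * fix_sq (a s) (n s) + n s - 3 * nu s)
  (fun s => 3 * sqrt (fix_sq (a s) (n s)))); [lra| |].
- apply (continuous_minus (fun s => 2 * fix_sq (a s) (n s) + n s) (fun s => 3 * nu s)).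
  + apply (continuous_plus (fun s => 2 * fix_sq (a s) (n s)) n); auto.
    apply (continuous_mult (fun _ => 2) (fun s => fix_sq (a s) (n s))); auto. apply continuous_const.
  + apply (continuous_mult (fun _ => 3) nu); auto. apply continuous_const.
- apply (continuous_mult (fun _ => 3) (fun s => sqrt (fix_sq (a s) (n s)))); [apply continuous_const|].
  now apply continuous_sqrt_pos.
Qed.

Section Matching.
Variables (nu n1 n2 : R -> R) (s1 e0 S0 : R).
Hypothesis s10 : 0 < s1.
Hypothesis nup : forall s, 0 < s < s1 -> 0 < nu s.
Hypothesis Cnu : forall s, 0 < s < s1 -> continuous nu s.
Hypothesis Cn1 : forall s, 0 < s < s1 -> continuous n1 s.
Hypothesis Cn2 : forall s, 0 < s < s1 -> continuous n2 s.
Hypothesis Tnu : tends0 nu 0.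
Let sg s := sqrt (nu s).
Let e1 s := (n1 s - nu s) / (nu s * sg s).
Let e2 s := (n2 s - nu s) / (nu s * sg s).
Hypothesis Te1 : tends0 e1 e0.
Hypothesis Te2 : tends0 e2 (- e0).
Hypothesis TS : tends0 (fun s => (e1 s + e2 s) / sg s) S0.

Lemma matching_near : at_right 0 (fun s => 0 < s < s1 /\ 0 < nu s /\ 0 < sg s /\ sg s * sg s = nu s).
Proof.
generalize (near0_lt s1 s10). apply filter_imp. intros s Hs.
assert (P := nup s Hs). repeat split; try lra.
- now apply sqrt_lt_R0.
- apply sqrt_sqrt; lra.
Qed.

Lemma sqrt_nu_tends0 : tends0 sg 0.
Proof. now apply sqrt_tends0. Qed.

Lemma offset_ratio (n e : R -> R) (l : R) : (forall s, e s = (n s - nu s) / (nu s * sg s)) -> tends0 e l ->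
  tends0 (fun s => n s / nu s) 1 /\ tends0 n 0.
Proof.
intros E Te.
assert (T1 : tends0 (fun s => n s / nu s) 1).
{ apply (tends0_ext (fun s => 1 + sg s * e s)).
  - generalize matching_near. apply filter_imp. intros s [Hs [P [Q R]]]. rewrite E. field. lra.
  - eapply tends0_eq; [apply tends0_plus; [apply tends0_const|apply tends0_mult; [apply sqrt_nu_tends0|exact Te]]|]. ring. }
split; auto.
apply (tends0_ext (fun s => n s / nu s * nu s)).
- generalize matching_near. apply filter_imp. intros s [Hs [P [Q R]]]. field. lra.
- eapply tends0_eq; [apply tends0_mult; [exact T1|exact Tnu]|]. ring.
Qed.

Lemma fix_sq_ratio (n a : R -> R) (a0 : R) : tends0 (fun s => n s / nu s) 1 -> tends0 n 0 -> tends0 a a0 ->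
  tends0 (fun s => fix_sq (a s) (n s) / nu s) 1.
Proof.
intros T1 T2 Ta.
apply (tends0_ext (fun s => 2 * (n s / nu s) / (1 + sqrt (1 - 12 * a s * n s)))).
- generalize matching_near. apply filter_imp. intros s [Hs [P [Q R]]]. unfold fix_sq.
  assert (0 <= sqrt (1 - 12 * a s * n s)) by apply sqrt_pos. field. lra.
- eapply tends0_eq.
  + apply tends0_div; [|apply tends0_mult; [apply tends0_const|exact T1]|].
    2:{ apply tends0_plus; [apply tends0_const|]. apply tends0_sqrt.
        2:{ apply tends0_minus; [apply tends0_const|]. apply tends0_mult; [|exact T2].
            apply tends0_mult; [apply tends0_const|exact Ta]. }
        lra. }
    replace (1 - 12 * a0 * 0) with 1 by ring. rewrite sqrt_1. lra.
  + replace (1 - 12 * a0 * 0) with 1 by ring. rewrite sqrt_1. field.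
Qed.

(** The quotient [(n - nu) / nu^(3/2)] is isolated because its limit is known for the
    multipliers of [f]. *)
Lemma fix_bnu_rescaled (n : R) (nus a : R) : 0 < nus -> 0 < n -> 0 <= 1 - 12 * a * n ->
  fix_bnu a n nus = sqrt nus ^ 2 *
    ((n - nus) / (nus * sqrt nus) + 2 * a * sqrt nus * (fix_sq a n / nus) ^ 2) / sqrt (fix_sq a n / nus).
Proof.
intros P Hn H. assert (Q := fix_sq_eq a n H). assert (Up := fix_sq_pos a n Hn).
set (u := fix_sq a n) in *. assert (sp := sqrt_lt_R0 _ P). assert (up := sqrt_lt_R0 _ Up).
assert (E : sqrt nus * sqrt nus = nus) by (apply sqrt_sqrt; lra).
rewrite sqrt_div_alt by auto. unfold fix_bnu. fold u.
set (q := sqrt nus) in *. rewrite <- E.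
replace (2 * u + n - 3 * (q * q)) with (3 * (n - q * q) + 2 * (3 * a * u ^ 2)) by (rewrite Q; ring).
field. lra.
Qed.

Lemma matching_small (A : R) : 0 < A -> at_right 0 (fun s => forall a, Rabs a <= A ->
  0 < 1 - 12 * a * n1 s /\ 0 < 1 - 12 * a * n2 s /\ 0 < n1 s < 3 * nu s /\ 0 < n2 s < 3 * nu s).
Proof.
intros A0.
destruct (offset_ratio n1 e1 e0 ltac:(reflexivity) Te1) as [R1 Z1].
destruct (offset_ratio n2 e2 (- e0) ltac:(reflexivity) Te2) as [R2 Z2].
assert (iA : 0 < / (12 * A)) by (apply Rinv_0_lt_compat; lra).
assert (l13 : 1 < 3) by lra. assert (l01 : 0 < 1) by lra.
generalize (filter_and _ _ matching_near (filter_and _ _ (tends0_lt _ _ _ Z1 iA) (filter_and _ _ (tends0_lt _ _ _ Z2 iA)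
  (filter_and _ _ (tends0_lt _ 1 3 R1 l13) (filter_and _ _ (tends0_lt _ 1 3 R2 l13)
  (filter_and _ _ (tends0_gt _ 1 0 R1 l01) (tends0_gt _ 1 0 R2 l01))))))).
apply filter_imp. intros s [[Hs [P _]] [B1 [B2 [B3 [B4 [B5 B6]]]]]] a Ha.
assert (G : forall n, n < / (12 * A) -> n / nu s < 3 -> 0 < n / nu s -> 0 < 1 - 12 * a * n /\ 0 < n < 3 * nu s).
{ intros n H1 H2 H3.
  assert (n0 : 0 < n) by (replace n with (n / nu s * nu s) by (field; lra); apply Rmult_lt_0_compat; lra).
  assert (n3 : n < 3 * nu s) by (apply Rlt_div_l in H2; lra).
  split; [|lra]. apply Rabs_le_between in Ha.
  assert (12 * A * n < 1).
  { apply Rmult_lt_compat_l with (r := 12 * A) in H1; [|lra]. rewrite Rinv_r in H1 by lra. lra. }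
  nra. }
destruct (G (n1 s) B1 B3 B5). destruct (G (n2 s) B2 B4 B6). auto.
Qed.

(** The leading terms cancel, because [e1] and [e2] have opposite limits. What remains
    at the order [nu^(3/2)] consists of [(e1 + e2) / sqrt nu], of the product of [e2]
    with the difference of the two fixed points, and of the contribution of [a]. *)
Lemma fix_bnu_sum_asymptotics a :
  tends0 (fun s => (fix_bnu a (n1 s) (nu s) + fix_bnu a (n2 s) (nu s)) / sg s ^ 3) (S0 - e0 ^ 2 + 4 * a).
Proof.
destruct (offset_ratio n1 e1 e0 ltac:(reflexivity) Te1) as [R1 Z1].
destruct (offset_ratio n2 e2 (- e0) ltac:(reflexivity) Te2) as [R2 Z2].
assert (TU1 := fix_sq_ratio n1 (fun _ => a) a R1 Z1 (tends0_const a)).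
assert (TU2 := fix_sq_ratio n2 (fun _ => a) a R2 Z2 (tends0_const a)).
set (U1 := fun s => fix_sq a (n1 s) / nu s) in *. set (U2 := fun s => fix_sq a (n2 s) / nu s) in *.
assert (TQ1 : tends0 (fun s => sqrt (U1 s)) 1) by (rewrite <- sqrt_1; apply tends0_sqrt; auto; lra).
assert (TQ2 : tends0 (fun s => sqrt (U2 s)) 1) by (rewrite <- sqrt_1; apply tends0_sqrt; auto; lra).
assert (A0 : 0 < Rabs a + 1) by (generalize (Rabs_pos a); lra).
apply (tends0_ext (fun s => (e1 s + e2 s) / sg s / sqrt (U1 s) +
   e2 s * ((e1 s - e2 s + 3 * a * sg s * (U1 s ^ 2 - U2 s ^ 2)) /
     (sqrt (U1 s) * sqrt (U2 s) * (sqrt (U1 s) + sqrt (U2 s)))) +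
   2 * a * (U1 s ^ 2 / sqrt (U1 s) + U2 s ^ 2 / sqrt (U2 s)))).
- generalize (filter_and _ _ matching_near (matching_small _ A0)). apply filter_imp.
  intros s [[Hs [P [Q E]]] Sm]. destruct (Sm a) as [D1 [D2 [N1 N2]]]; [lra|].
  rewrite !fix_bnu_rescaled by lra. fold (sg s). fold (e1 s). fold (e2 s). fold (U1 s). fold (U2 s).
  assert (V1 : 0 < U1 s) by (apply Rdiv_lt_0_compat; auto; apply fix_sq_pos; lra).
  assert (V2 : 0 < U2 s) by (apply Rdiv_lt_0_compat; auto; apply fix_sq_pos; lra).
  assert (X1 := sqrt_lt_R0 _ V1). assert (X2 := sqrt_lt_R0 _ V2).
  assert (Y1 : sqrt (U1 s) * sqrt (U1 s) = U1 s) by (apply sqrt_sqrt; lra).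
  assert (Y2 : sqrt (U2 s) * sqrt (U2 s) = U2 s) by (apply sqrt_sqrt; lra).
  assert (W1 : U1 s = 1 + sg s * e1 s + 3 * a * nu s * U1 s ^ 2).
  { assert (Q1 := fix_sq_eq a (n1 s) ltac:(lra)). unfold U1 at 1.
    replace (fix_sq a (n1 s)) with (n1 s + 3 * a * fix_sq a (n1 s) ^ 2) by lra.
    unfold e1, U1. field. lra. }
  assert (W2 : U2 s = 1 + sg s * e2 s + 3 * a * nu s * U2 s ^ 2).
  { assert (Q2 := fix_sq_eq a (n2 s) ltac:(lra)). unfold U2 at 1.
    replace (fix_sq a (n2 s)) with (n2 s + 3 * a * fix_sq a (n2 s) ^ 2) by lra.
    unfold e2, U2. field. lra. }
  assert (W : e1 s - e2 s + 3 * a * sg s * (U1 s ^ 2 - U2 s ^ 2) = (U1 s - U2 s) / sg s).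
  { rewrite W1 at 2. rewrite W2 at 2. rewrite <- E. field. lra. }
  rewrite W. set (x1 := sqrt (U1 s)) in *. set (x2 := sqrt (U2 s)) in *.
  rewrite <- Y1, <- Y2. field. repeat split; lra.
- eapply tends0_eq.
  + apply tends0_plus; [apply tends0_plus|].
    * apply tends0_div; [|exact TS|exact TQ1]. lra.
    * apply tends0_mult; [exact Te2|]. apply tends0_div.
      2:{ apply tends0_plus; [apply tends0_minus; [exact Te1|exact Te2]|].
          apply tends0_mult; [apply tends0_mult; [apply tends0_const|apply sqrt_nu_tends0]|].
          apply tends0_minus; apply tends0_pow; [exact TU1|exact TU2]. }
      2:{ apply tends0_mult; [apply tends0_mult; [exact TQ1|exact TQ2]|apply tends0_plus; [exact TQ1|exact TQ2]]. }
      lra.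
    * apply tends0_mult; [apply tends0_const|].
      apply tends0_plus; apply tends0_div; try (apply tends0_pow); try exact TU1; try exact TU2;
        try exact TQ1; try exact TQ2; lra.
  + field.
Qed.

(** The fixed point on the right requires [b * nu = fix_bnu a n1 nu], the one on the
    left [- b * nu = fix_bnu a n2 nu]. So [a] has to make the sum of these two values
    vanish, a monotone equation, and the first value then defines [b]. *)
Theorem multiplier_matching (a0 : R) : 4 * a0 = e0 ^ 2 - S0 ->
  exists s2 a b, 0 < s2 <= s1 /\ tends0 a a0 /\ tends0 b e0 /\
  forall s, 0 < s < s2 -> Rabs (a s - a0) < 1 /\ continuous a s /\ continuous b s /\
    exists y1 y2, 0 < y1 /\ 0 < y2 /\ y1 ^ 2 <= 6 * nu s /\ y2 ^ 2 <= 6 * nu s /\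
    g y1 (nu s) (a s) (b s) = y1 /\ Derive (fun y => g y (nu s) (a s) (b s)) y1 = 1 - n1 s - nu s /\
    g (- y2) (nu s) (a s) (b s) = - y2 /\ Derive (fun y => g y (nu s) (a s) (b s)) (- y2) = 1 - n2 s - nu s.
Proof.
intros Ea0.
set (AA := Rabs a0 + 2). assert (A0 : 0 < AA) by (unfold AA; generalize (Rabs_pos a0); lra).
assert (Sm := matching_small AA A0). apply near0_spec in Sm. destruct Sm as [s3 [s30 Sm]].
set (s4 := Rmin s1 s3). assert (B1 := Rmin_l s1 s3). assert (B2 := Rmin_r s1 s3). fold s4 in B1, B2.
assert (s40 : 0 < s4) by (apply Rmin_case; auto).
assert (InA : forall t, t <= a0 + 1 -> a0 - 1 <= t -> Rabs t <= AA).
{ intros t H1 H2. unfold AA. apply Rabs_le_between.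
  assert (a0 <= Rabs a0) by apply Rle_abs. assert (- a0 <= Rabs a0) by (rewrite <- Rabs_Ropp; apply Rle_abs). lra. }
set (H := fun s t => fix_bnu t (n1 s) (nu s) + fix_bnu t (n2 s) (nu s)).
destruct (monotone_solver H a0 s4 s40) as [s2 [a [Hs2 [Ta Ha]]]].
- intros s Hs t t' T1 T2 T3. destruct (Sm s ltac:(lra) t') as [D1 [D2 [N1 N2]]]; [apply InA; lra|].
  unfold H. apply Rplus_lt_compat; apply fix_bnu_increasing; lra.
- intros s Hs t Ht. destruct (Sm s ltac:(lra) t) as [D1 [D2 [N1 N2]]]; [apply InA; lra|].
  apply (continuous_plus (fun t => fix_bnu t (n1 s) (nu s)) (fun t => fix_bnu t (n2 s) (nu s)));
   [apply (fix_bnu_continuous (fun t => t) (fun _ => n1 s) (fun _ => nu s)) |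
    apply (fix_bnu_continuous (fun t => t) (fun _ => n2 s) (fun _ => nu s))];
    try lra; try apply continuous_const; apply continuous_id.
- intros s Hs t Ht. destruct (Sm s ltac:(lra) t) as [D1 [D2 [N1 N2]]]; [apply InA; lra|].
  apply (continuous_plus (fun s => fix_bnu t (n1 s) (nu s)) (fun s => fix_bnu t (n2 s) (nu s)));
   [apply (fix_bnu_continuous (fun _ => t) n1 nu) | apply (fix_bnu_continuous (fun _ => t) n2 nu)];
    try lra; try apply continuous_const; first [apply Cn1|apply Cn2|apply Cnu]; lra.
- intros eta Heta.
  assert (l1 : S0 - e0 ^ 2 + 4 * (a0 - eta) < 0) by lra.
  assert (l2 : 0 < S0 - e0 ^ 2 + 4 * (a0 + eta)) by lra.
  assert (L1 := tends0_lt _ _ 0 (fix_bnu_sum_asymptotics (a0 - eta)) l1).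
  assert (L2 := tends0_gt _ _ 0 (fix_bnu_sum_asymptotics (a0 + eta)) l2).
  generalize (filter_and _ _ matching_near (filter_and _ _ L1 L2)). apply filter_imp.
  intros s [[Hs [P [Q E]]] [M1 M2]]. assert (q3 : 0 < sg s ^ 3) by (apply pow_lt; auto).
  split.
  + apply Rlt_div_l in M1; auto. unfold H. lra.
  + apply Rlt_div_r in M2; auto. unfold H. lra.
- exists s2, a, (fun s => fix_bnu (a s) (n1 s) (nu s) / nu s).
  split; [lra|]. split; [auto|]. split.
  + destruct (offset_ratio n1 e1 e0 ltac:(reflexivity) Te1) as [R1 Z1].
    assert (TU1 := fix_sq_ratio n1 a a0 R1 Z1 Ta).
    apply (tends0_ext (fun s => (e1 s + 2 * a s * sg s * (fix_sq (a s) (n1 s) / nu s) ^ 2) / sqrt (fix_sq (a s) (n1 s) / nu s))).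
    * generalize (filter_and _ _ matching_near (near0_lt s2 (proj1 Hs2))). apply filter_imp.
      intros s [[Hs [P [Q E]]] Hs']. destruct (Ha s Hs') as [Ha1 _]. apply Rabs_def2 in Ha1.
      destruct (Sm s ltac:(lra) (a s)) as [D1 [D2 [N1 N2]]]; [apply InA; lra|].
      rewrite fix_bnu_rescaled by lra. fold (sg s). fold (e1 s).
      assert (V1 : 0 < fix_sq (a s) (n1 s) / nu s) by (apply Rdiv_lt_0_compat; auto; apply fix_sq_pos; lra).
      assert (X1 := sqrt_lt_R0 _ V1). replace (sg s ^ 2) with (nu s) by (rewrite <- E; ring).
      field. split; lra.
    * eapply tends0_eq.
      -- apply tends0_div; [|apply tends0_plus; [exact Te1|]|apply tends0_sqrt; [|exact TU1]; lra].
         2:{ apply tends0_mult; [|apply tends0_pow; exact TU1]. apply tends0_mult; [|apply sqrt_nu_tends0].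
             apply tends0_mult; [apply tends0_const|exact Ta]. }
         rewrite sqrt_1; lra.
      -- rewrite sqrt_1. field.
  + intros s Hs. destruct (Ha s Hs) as [Ha1 [Ha2 Ha3]]. split; [auto|]. split; [auto|].
    apply Rabs_def2 in Ha1. destruct (Sm s ltac:(lra) (a s)) as [D1 [D2 [N1 N2]]]; [apply InA; lra|].
    split.
    { apply (continuous_div (fun s => fix_bnu (a s) (n1 s) (nu s)) nu); [lra| |apply Cnu; lra].
      apply (fix_bnu_continuous a n1 nu); auto; try lra; [apply Cn1|apply Cnu]; lra. }
    assert (Sz : forall n, 0 < n < 3 * nu s -> sqrt (fix_sq (a s) n) ^ 2 <= 6 * nu s).
    { intros n Hn. assert (Up := fix_sq_pos (a s) n (proj1 Hn)).
      rewrite <- Rsqr_pow2, Rsqr_sqrt by lra. unfold fix_sq.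
      assert (Z := sqrt_pos (1 - 12 * a s * n)). apply Rle_div_l; nra. }
    exists (sqrt (fix_sq (a s) (n1 s))), (sqrt (fix_sq (a s) (n2 s))).
    split; [apply sqrt_lt_R0, fix_sq_pos; lra|]. split; [apply sqrt_lt_R0, fix_sq_pos; lra|].
    split; [auto|]. split; [auto|].
    assert (Eb : fix_bnu (a s) (n1 s) (nu s) / nu s * nu s = fix_bnu (a s) (n1 s) (nu s)) by (field; lra).
    destruct (fix_sq_fixed (a s) (n1 s) (nu s) (fix_bnu (a s) (n1 s) (nu s) / nu s)) as [G1 G2]; try lra.
    destruct (fix_sq_fixed_neg (a s) (n2 s) (nu s) (fix_bnu (a s) (n1 s) (nu s) / nu s)) as [G3 G4]; try lra.
    { rewrite Eb. unfold H in Ha2. lra. }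
Qed.
End Matching.

(** * Taylor expansion in a family *)

Lemma unfolding_weaken F c K K' d d' nu A B : K <= K' -> d' <= d ->
  unfolding F c K d nu A B -> unfolding F c K' d' nu A B.
Proof.
intros HK Hd [H1 [H2 [H3 [H4 [H5 H6]]]]].
assert (I : forall x, Ioo (- d') d' x -> Ioo (- d) d x) by (unfold Ioo; intros; lra).
assert (M : forall x j, K * Rabs x ^ j <= K' * Rabs x ^ j).
{ intros; apply Rmult_le_compat_r; auto. apply pow_le, Rabs_pos. }
assert (N : K * Rabs nu <= K' * Rabs nu) by (apply Rmult_le_compat_r; auto using Rabs_pos).
split; [auto|]. split; [|split; [|split; [|split]]]; try lra;
 intros x Hx; eapply Rle_trans; try apply M; auto.
Qed.

Lemma jet5_weaken F K K' d d' nu A B C E : K <= K' -> d' <= d ->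
  jet5 F K d nu A B C E -> jet5 F K' d' nu A B C E.
Proof.
intros HK Hd [H1 H2].
assert (I : forall x, Ioo (- d') d' x -> Ioo (- d) d x) by (unfold Ioo; intros; lra).
assert (M : forall x j, K * Rabs x ^ j <= K' * Rabs x ^ j).
{ intros; apply Rmult_le_compat_r; auto. apply pow_le, Rabs_pos. }
split; intros x Hx; eapply Rle_trans; try apply M; auto.
Qed.

(** Integrating a bound on the remainder of the derivative raises its order by one. *)
Lemma taylor_step (u v P P' : R -> R) d K j :
  (forall x, Ioo (- d) d x -> is_derive u x (v x)) ->
  (forall x, is_derive P x (P' x)) -> u 0 = P 0 ->
  (forall x, Ioo (- d) d x -> Rabs (v x - P' x) <= K * Rabs x ^ j) -> 0 <= K ->
  forall x, Ioo (- d) d x -> Rabs (u x - P x) <= K * Rabs x ^ (S j).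
Proof.
intros Du DP E B K0 x Hx.
assert (G : forall z, Rmin 0 x <= z <= Rmax 0 x -> Ioo (- d) d z /\ Rabs z <= Rabs x).
{ intros z. unfold Rmin, Rmax, Ioo in *. destruct Rle_dec; intros Hz; split; try lra.
  - rewrite !Rabs_pos_eq; lra.
  - rewrite !Rabs_left1; lra. }
destruct (MVT_gen (fun t => u t - P t) 0 x (fun t => v t - P' t)) as [z [Hz Ez]].
- intros z Hz. apply (is_derive_minus u P); auto. apply Du, G; lra.
- intros z Hz. apply continuity_pt_filterlim. apply (ex_derive_continuous (fun t => u t - P t) z).
  exists (v z - P' z). apply (is_derive_minus u P); auto. apply Du, G; lra.
- destruct (G z Hz) as [Iz Lz]. rewrite E in Ez.
  replace (u x - P x) with ((v z - P' z) * x) by lra. rewrite Rabs_mult. simpl.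
  replace (K * (Rabs x * Rabs x ^ j)) with (K * Rabs x ^ j * Rabs x) by ring.
  apply Rmult_le_compat_r; [apply Rabs_pos|]. eapply Rle_trans; [apply B, Iz|].
  apply Rmult_le_compat_l; auto. apply pow_incr. split; auto using Rabs_pos.
Qed.

Lemma Ck_Derive_n n (U : R -> Prop) h k x : Ck n U h -> (k < n)%nat -> U x ->
  is_derive (Derive_n h k) x (Derive_n h (S k) x).
Proof.
revert h n. induction k as [|k IH]; intros h n C L Ux.
- destruct n; [lia|]. simpl. apply (Ck_deriv n U); auto.
- destruct n; [lia|]. destruct C as [_ C].
  assert (D := IH (Derive h) n C ltac:(lia) Ux).
  assert (E : forall j t, Derive_n (Derive h) j t = Derive_n h (S j) t).
  { intros j t. rewrite (Derive_n_comp h j 1). now rewrite Nat.add_comm. }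
  rewrite (E (S k)) in D. apply (is_derive_ext (Derive_n (Derive h) k)); auto.
Qed.

Definition coef (F : R -> R) (k : nat) : R := Derive_n F k 0 / INR (fact k).

Lemma taylor_jets F d K n : (6 <= n)%nat -> 0 < d <= 1 -> 0 <= K -> Ck n (Ioo (- d) d) F -> F 0 = 0 ->
  (forall x, Ioo (- d) d x -> Rabs (Derive_n F 6 x) <= K) ->
  jet5 F K d (Derive F 0 - 1) (coef F 2) (coef F 3) (coef F 4) (coef F 5) /\
  forall K', K + 20 * Rabs (coef F 4) + 20 * Rabs (coef F 5) <= K' ->
  (forall x, Ioo (- d) d x -> ex_derive F x /\ ex_derive (Derive F) x) /\
  (forall x, Ioo (- d) d x ->
     Rabs (F x - x - ((Derive F 0 - 1) * x + coef F 2 * x ^ 2 + coef F 3 * x ^ 3)) <= K' * Rabs x ^ 4) /\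
  (forall x, Ioo (- d) d x ->
     Rabs (Derive F x - 1 - ((Derive F 0 - 1) + 2 * coef F 2 * x + 3 * coef F 3 * x ^ 2)) <= K' * Rabs x ^ 3) /\
  (forall x, Ioo (- d) d x ->
     Rabs (Derive (Derive F) x - (2 * coef F 2 + 6 * coef F 3 * x)) <= K' * Rabs x ^ 2).
Proof.
intros Hn Hd K0 C F0 H6.
set (q2 := Derive_n F 2 0). set (q3 := Derive_n F 3 0). set (q4 := Derive_n F 4 0). set (q5 := Derive_n F 5 0).
assert (D : forall k, (k < 6)%nat -> forall x, Ioo (- d) d x -> is_derive (Derive_n F k) x (Derive_n F (S k) x)).
{ intros k Hk x Hx. apply (Ck_Derive_n n (Ioo (- d) d)); auto. lia. }
assert (T5 : forall x, Ioo (- d) d x -> Rabs (Derive_n F 5 x - q5) <= K * Rabs x ^ 1).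
{ apply (taylor_step _ (Derive_n F 6) (fun _ => q5) (fun _ => 0)); [| | | |exact K0].
  - exact (D 5%nat ltac:(lia)).
  - intros; auto_derive; auto.
  - reflexivity.
  - intros x Hx. rewrite Rminus_0_r. simpl pow. rewrite Rmult_1_r. auto. }
assert (T4 : forall x, Ioo (- d) d x -> Rabs (Derive_n F 4 x - (q4 + q5 * x)) <= K * Rabs x ^ 2).
{ apply (taylor_step _ (Derive_n F 5) (fun x => q4 + q5 * x) (fun _ => q5)); [| | | |exact K0].
  - exact (D 4%nat ltac:(lia)).
  - intros; auto_derive; auto. ring.
  - unfold q4; ring.
  - exact T5. }
assert (T3 : forall x, Ioo (- d) d x -> Rabs (Derive_n F 3 x - (q3 + q4 * x + q5 * x ^ 2 / 2)) <= K * Rabs x ^ 3).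
{ apply (taylor_step _ (Derive_n F 4) (fun x => q3 + q4 * x + q5 * x ^ 2 / 2) (fun x => q4 + q5 * x)); [| | | |exact K0].
  - exact (D 3%nat ltac:(lia)).
  - intros; auto_derive; auto. field.
  - unfold q3; field.
  - exact T4. }
assert (T2 : forall x, Ioo (- d) d x ->
  Rabs (Derive_n F 2 x - (q2 + q3 * x + q4 * x ^ 2 / 2 + q5 * x ^ 3 / 6)) <= K * Rabs x ^ 4).
{ apply (taylor_step _ (Derive_n F 3) (fun x => q2 + q3 * x + q4 * x ^ 2 / 2 + q5 * x ^ 3 / 6)
    (fun x => q3 + q4 * x + q5 * x ^ 2 / 2)); [| | | |exact K0].
  - exact (D 2%nat ltac:(lia)).
  - intros; auto_derive; auto. field.
  - unfold q2; field.
  - exact T3. }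
assert (T1 : forall x, Ioo (- d) d x ->
  Rabs (Derive_n F 1 x - (Derive F 0 + q2 * x + q3 * x ^ 2 / 2 + q4 * x ^ 3 / 6 + q5 * x ^ 4 / 24)) <= K * Rabs x ^ 5).
{ apply (taylor_step _ (Derive_n F 2) (fun x => Derive F 0 + q2 * x + q3 * x ^ 2 / 2 + q4 * x ^ 3 / 6 + q5 * x ^ 4 / 24)
    (fun x => q2 + q3 * x + q4 * x ^ 2 / 2 + q5 * x ^ 3 / 6)); [| | | |exact K0].
  - exact (D 1%nat ltac:(lia)).
  - intros; auto_derive; auto. field.
  - change (Derive_n F 1 0) with (Derive F 0). field.
  - exact T2. }
assert (T0 : forall x, Ioo (- d) d x ->
  Rabs (Derive_n F 0 x - (Derive F 0 * x + q2 * x ^ 2 / 2 + q3 * x ^ 3 / 6 + q4 * x ^ 4 / 24 + q5 * x ^ 5 / 120)) <= K * Rabs x ^ 6).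
{ apply (taylor_step _ (Derive_n F 1) (fun x => Derive F 0 * x + q2 * x ^ 2 / 2 + q3 * x ^ 3 / 6 + q4 * x ^ 4 / 24 + q5 * x ^ 5 / 120)
    (fun x => Derive F 0 + q2 * x + q3 * x ^ 2 / 2 + q4 * x ^ 3 / 6 + q5 * x ^ 4 / 24)); [| | | |exact K0].
  - exact (D 0%nat ltac:(lia)).
  - intros; auto_derive; auto. field.
  - simpl. rewrite F0. field.
  - exact T1. }
assert (c2 : coef F 2 = q2 / 2) by (unfold coef, q2; simpl fact; simpl INR; field).
assert (c3 : coef F 3 = q3 / 6) by (unfold coef, q3; simpl fact; simpl INR; field).
assert (c4 : coef F 4 = q4 / 24) by (unfold coef, q4; simpl fact; simpl INR; field).
assert (c5 : coef F 5 = q5 / 120) by (unfold coef, q5; simpl fact; simpl INR; field).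
split; [split|].
- intros x Hx. rewrite c2, c3, c4, c5.
  replace (_ - _ - _) with (Derive_n F 0 x - (Derive F 0 * x + q2 * x ^ 2 / 2 + q3 * x ^ 3 / 6 + q4 * x ^ 4 / 24 + q5 * x ^ 5 / 120))
   by (simpl Derive_n; field). auto.
- intros x Hx. rewrite c2, c3, c4, c5.
  replace (_ - _ - _) with (Derive_n F 1 x - (Derive F 0 + q2 * x + q3 * x ^ 2 / 2 + q4 * x ^ 3 / 6 + q5 * x ^ 4 / 24))
   by (change (Derive_n F 1 x) with (Derive F x); field). auto.
- intros K' HK'.
  assert (X : forall x, Ioo (- d) d x -> 0 <= Rabs x <= 1).
  { intros x [X1 X2]. split; [apply Rabs_pos|]. apply Rabs_le_between; lra. }
  assert (Pw : forall x i j, 0 <= Rabs x <= 1 -> Rabs x ^ (i + j) <= Rabs x ^ i).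
  { intros x i j Hx. rewrite pow_add. assert (Rabs x ^ j <= 1) by (rewrite <- (pow1 j); apply pow_incr; lra).
    assert (0 <= Rabs x ^ i) by (apply pow_le; lra). nra. }
  assert (Fin : forall r s t x i, Ioo (- d) d x -> 0 <= s <= 20 -> 0 <= t <= 20 ->
    Rabs (r - (s * coef F 4 * x ^ i + t * coef F 5 * x ^ S i)) <= K * Rabs x ^ (i + 2) -> Rabs r <= K' * Rabs x ^ i).
  { intros r s t x i Hx Hs Ht Hr. assert (Y := X x Hx).
    assert (P2 : Rabs x ^ S i <= Rabs x ^ i) by (generalize (Pw x i 1%nat Y); rewrite Nat.add_1_r; auto).
    assert (P0 : 0 <= Rabs x ^ i) by (apply pow_le; lra).
    assert (G1 : Rabs (s * coef F 4 * x ^ i) <= 20 * Rabs (coef F 4) * Rabs x ^ i).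
    { rewrite !Rabs_mult, (Rabs_pos_eq s), <- RPow_abs by lra. apply Rmult_le_compat_r; auto.
      apply Rmult_le_compat_r; [apply Rabs_pos|lra]. }
    assert (G2 : Rabs (t * coef F 5 * x ^ S i) <= 20 * Rabs (coef F 5) * Rabs x ^ i).
    { rewrite !Rabs_mult, (Rabs_pos_eq t), <- RPow_abs by lra.
      apply Rmult_le_compat; auto.
      - apply Rmult_le_pos; [lra|apply Rabs_pos].
      - apply pow_le; lra.
      - apply Rmult_le_compat_r; [apply Rabs_pos|lra]. }
    assert (G3 : K * Rabs x ^ (i + 2) <= K * Rabs x ^ i) by (apply Rmult_le_compat_l; auto).
    assert (G4 : (K + 20 * Rabs (coef F 4) + 20 * Rabs (coef F 5)) * Rabs x ^ i <= K' * Rabs x ^ i)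
      by (apply Rmult_le_compat_r; auto).
    apply Rabs_le_between in G1. apply Rabs_le_between in G2. apply Rabs_le_between in Hr.
    apply Rabs_le_between. lra. }
  split; [|split; [|split]].
  + intros x Hx. split; eexists; [apply (D 0%nat); auto; lia | apply (D 1%nat); auto; lia].
  + intros x Hx. apply (Fin _ 1 1 x 4%nat Hx); try lra. rewrite c2, c3, c4, c5.
    replace (_ - _) with (Derive_n F 0 x - (Derive F 0 * x + q2 * x ^ 2 / 2 + q3 * x ^ 3 / 6 + q4 * x ^ 4 / 24 + q5 * x ^ 5 / 120))
      by (simpl Derive_n; field). auto.
  + intros x Hx. apply (Fin _ 4 5 x 3%nat Hx); try lra. rewrite c2, c3, c4, c5.
    replace (_ - _) with (Derive_n F 1 x - (Derive F 0 + q2 * x + q3 * x ^ 2 / 2 + q4 * x ^ 3 / 6 + q5 * x ^ 4 / 24))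
      by (change (Derive_n F 1 x) with (Derive F x); field). auto.
  + intros x Hx. apply (Fin _ 12 20 x 2%nat Hx); try lra. rewrite c2, c3, c4, c5.
    replace (_ - _) with (Derive_n F 2 x - (q2 + q3 * x + q4 * x ^ 2 / 2 + q5 * x ^ 3 / 6))
      by (change (Derive_n F 2 x) with (Derive (Derive F) x); field). auto.
Qed.

Lemma ex_diff_n_Ck r (U : R * R -> Prop) f mu (I : R -> Prop) : open I ->
  (forall x, I x -> U (x, mu)) -> C2d_on r U f -> Ck r I (fun x => f x mu).
Proof.
intros oI HI. revert f. induction r as [|r IH]; intros f H.
- intros x Ix. assert (C := proj1 (H x mu (HI x Ix))).
  apply filterlim_locally. intros eps. destruct (C eps) as [d Hd]. exists d. intros y Hy.
  apply Hd; auto. rewrite Rminus_diag, Rabs_R0. apply cond_pos.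
- split.
  + intros x Ix. apply (H x mu (HI x Ix)).
  + apply (IH (fun u v => Derive (fun z => f z v) u)).
    intros x mu' Hx. apply (H x mu' Hx).
Qed.

Section Family.
Variables (r : nat) (U : R * R -> Prop) (f : R -> R -> R).
Hypothesis hr : (7 <= r)%nat.
Hypothesis hU : open U.
Hypothesis hf : C2d_on r U f.

Lemma open_locally_2d x mu : U (x, mu) -> locally_2d (fun u v => U (u, v)) x mu.
Proof.
intros H. apply locally_2d_locally. generalize (hU _ H). apply filter_imp. now intros [u v].
Qed.

Lemma partial_continuous p q x mu : (p + q <= r)%nat -> U (x, mu) -> continuity_2d_pt (partial_derive p q f) x mu.
Proof.
intros L H. assert (E := ex_diff_n_deriv r p q L f x mu (hf x mu H)).
destruct (r - (p + q))%nat; apply E.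
Qed.

Lemma coef_is_derive k x mu : (k < r)%nat -> U (x, mu) ->
  is_derive (fun mu => partial_derive k 0 f x mu) mu (partial_derive k 1 f x mu).
Proof.
intros L H. rewrite <- Derive_partial_derive.
- apply Derive_correct. apply (ex_diff_n_ex_deriv_inf_2 r k 0); [lia|]. apply hf, H.
- generalize (open_locally_2d x mu H). apply locally_2d_impl, locally_2d_forall.
  intros u v Huv. apply (ex_diff_n_m r); [lia|]. apply hf, Huv.
Qed.
End Family.

(** * Multipliers of an unfolding *)

Lemma tends0_bounded_mult u v K : at_right 0 (fun x => Rabs (u x) <= K) -> tends0 v 0 ->
  tends0 (fun x => u x * v x) 0.
Proof.
intros B V. apply (tends0_small _ v K); auto. revert B. apply filter_imp. intros x Hx.
rewrite Rabs_mult. apply Rmult_le_compat_r; auto using Rabs_pos.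
Qed.

Section OneSide.
Variables (F : R -> R -> R) (x nu A B C E : R -> R) (c K d s1 al C0 E0 : R).
Hypothesis s10 : 0 < s1.
Hypothesis HS : forall s, 0 < s < s1 -> small_params c K d (nu s).
Hypothesis HU : forall s, 0 < s < s1 -> unfolding (F s) c K d (nu s) (A s) (B s).
Hypothesis HJ : forall s, 0 < s < s1 -> jet5 (F s) K d (nu s) (A s) (B s) (C s) (E s).
Hypothesis nup : forall s, 0 < s < s1 -> 0 < nu s.
Hypothesis Hx : forall s, 0 < s < s1 -> 0 < x s < d /\ F s (x s) = x s.
Hypothesis Tnu : tends0 nu 0.
Hypothesis TA : tends0 (fun s => A s / nu s) al.
Hypothesis TB : tends0 B (- c).
Hypothesis TC : tends0 C C0.
Hypothesis TE : tends0 E E0.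

Let sg s := sqrt (nu s).
Let X s := x s / sg s.
Let e s := ((1 - Derive (F s) (x s) - nu s) - nu s) / (nu s * sg s).
Let rho s := (F s (x s) - x s - (nu s * x s + A s * x s ^ 2 + B s * x s ^ 3 + C s * x s ^ 4 + E s * x s ^ 5)) / x s ^ 6.
Let rho' s := (Derive (F s) (x s) - 1 - (nu s + 2 * A s * x s + 3 * B s * x s ^ 2 + 4 * C s * x s ^ 3 + 5 * E s * x s ^ 4)) / x s ^ 5.

Lemma fixed_point_near : at_right 0 (fun s => 0 < s < s1 /\ 0 < nu s /\ 0 < sg s /\ nu s = sg s * sg s /\ 0 < x s).
Proof.
generalize (near0_lt s1 s10). apply filter_imp. intros s Hs. assert (P := nup s Hs).
repeat split; try lra; try apply (Hx s Hs).
- now apply sqrt_lt_R0.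
- symmetry; apply sqrt_sqrt; lra.
Qed.

Lemma cubic_coefficient_pos : 0 < c.
Proof. apply (HS (s1 / 2)). lra. Qed.

Lemma rescaled_range : at_right 0 (fun s => 0 < X s /\ X s ^ 2 <= 5 / (3 * c)).
Proof.
assert (c0 := cubic_coefficient_pos). generalize fixed_point_near. apply filter_imp. intros s [Hs [P [Q [N Px]]]].
assert (X0 : 0 < X s) by (apply Rdiv_lt_0_compat; auto). split; auto.
destruct (Hx s Hs) as [Hx1 Hx2].
destruct (unfolding_displacement (F s) c K d (nu s) (A s) (B s) (HS s Hs) (HU s Hs) (x s)) as [q [Eq Hq]].
{ unfold Ioo; lra. }
rewrite Hx2, (Rabs_pos_eq (nu s)) in * by lra.
assert (q0 : q = 0) by (apply (Rmult_eq_reg_l (x s)); lra). rewrite q0 in Hq.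
unfold X. replace ((x s / sg s) ^ 2) with (x s ^ 2 / nu s) by (rewrite N; field; lra).
apply Rle_div_l; auto. replace (5 / (3 * c) * nu s) with ((5 * nu s / 3) / c) by (field; lra).
apply (proj1 (Rle_div_r _ _ _ c0)). lra.
Qed.

Lemma rescaled_bounded : at_right 0 (fun s => Rabs (X s) <= 5 / (3 * c) + 1).
Proof.
generalize rescaled_range. apply filter_imp. intros s [P Q]. rewrite Rabs_pos_eq by lra. nra.
Qed.

Lemma remainders_bounded : at_right 0 (fun s => Rabs (rho s) <= K /\ Rabs (rho' s) <= K).
Proof.
generalize fixed_point_near. apply filter_imp. intros s [Hs [P [Q [N Px]]]].
destruct (Hx s Hs) as [Hx1 Hx2]. destruct (HJ s Hs) as [J1 J2].
assert (I : Ioo (- d) d (x s)) by (unfold Ioo; lra).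
specialize (J1 _ I). specialize (J2 _ I). rewrite (Rabs_pos_eq (x s)) in * by lra.
split; unfold rho, rho', Rdiv; rewrite Rabs_mult, Rabs_inv.
- rewrite (Rabs_pos_eq (x s ^ 6)) by (apply pow_le; lra). apply Rle_div_l; auto. apply pow_lt; lra.
- rewrite (Rabs_pos_eq (x s ^ 5)) by (apply pow_le; lra). apply Rle_div_l; auto. apply pow_lt; lra.
Qed.

(** Dividing [x] by [sqrt nu] balances [nu x] against [B x^3]. Three times the equation
    of the fixed point is combined with the multiplier in order to eliminate [B]. *)
Lemma rescaled_equations : at_right 0 (fun s =>
  1 + A s / nu s * sg s * X s + B s * X s ^ 2 + C s * sg s * X s ^ 3 +
    sg s ^ 2 * (E s * X s ^ 4 + rho s * sg s * X s ^ 5) = 0 /\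
  e s = A s / nu s * X s - C s * X s ^ 3 - 2 * E s * sg s * X s ^ 4 +
    sg s ^ 2 * ((3 * rho s - rho' s) * X s ^ 5)).
Proof.
generalize fixed_point_near. apply filter_imp. intros s [Hs [P [Q [N Px]]]].
destruct (Hx s Hs) as [Hx1 Hx2].
assert (Z : nu s + A s * x s + B s * x s ^ 2 + C s * x s ^ 3 + E s * x s ^ 4 + rho s * x s ^ 5 = 0).
{ unfold rho. rewrite Hx2. field. lra. }
assert (M : Derive (F s) (x s) = 1 + (nu s + 2 * A s * x s + 3 * B s * x s ^ 2 + 4 * C s * x s ^ 3 + 5 * E s * x s ^ 4 + rho' s * x s ^ 5)).
{ unfold rho'. field. lra. }
assert (Ex : x s = sg s * X s) by (unfold X; field; lra).
set (q := sg s) in *. split.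
- apply (Rmult_eq_reg_l (nu s)); [|lra]. rewrite Rmult_0_r, <- Z, Ex, N. field. lra.
- unfold e. rewrite M.
  replace (1 - (1 + (nu s + 2 * A s * x s + 3 * B s * x s ^ 2 + 4 * C s * x s ^ 3 + 5 * E s * x s ^ 4 + rho' s * x s ^ 5)) - nu s - nu s)
   with (3 * (nu s + A s * x s + B s * x s ^ 2 + C s * x s ^ 3 + E s * x s ^ 4 + rho s * x s ^ 5) +
     (- 3 * nu s - 2 * A s * x s - 3 * B s * x s ^ 2 - 4 * C s * x s ^ 3 - 5 * E s * x s ^ 4 - rho' s * x s ^ 5)) by (rewrite Z; ring).
  rewrite Ex. fold q. rewrite N. field. lra.
Qed.

Lemma sqrt_family_tends0 : tends0 sg 0.
Proof. now apply sqrt_tends0. Qed.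

Lemma rescaled_pow_bounded j : exists M, at_right 0 (fun s => Rabs (X s ^ j) <= M).
Proof.
exists ((5 / (3 * c) + 1) ^ j). generalize rescaled_bounded. apply filter_imp. intros s Hs.
rewrite <- RPow_abs. apply pow_incr. split; auto using Rabs_pos.
Qed.

(** The rescaled equation tends to [1 - c X^2 = 0]. *)
Lemma rescaled_lim : tends0 X (sqrt (/ c)).
Proof.
assert (c0 := cubic_coefficient_pos). assert (Tsg := sqrt_family_tends0).
assert (Bd : forall u l j, tends0 u l -> tends0 (fun s => X s ^ j * (u s * sg s)) 0).
{ intros u l j Hu. destruct (rescaled_pow_bounded j) as [M HM]. apply (tends0_bounded_mult _ _ M); auto.
  eapply tends0_eq; [apply tends0_mult; [exact Hu|exact Tsg]|]. ring. }
assert (Tr : tends0 (fun s => rho s * sg s) 0).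
{ apply (tends0_bounded_mult _ _ K); auto. generalize remainders_bounded. apply filter_imp. tauto. }
assert (T2 : tends0 (fun s => X s ^ 2) (/ c)).
{ apply (tends0_ext (fun s => (1 + (X s ^ 1 * (A s / nu s * sg s) + X s ^ 3 * (C s * sg s) +
     (X s ^ 4 * (E s * sg s) * sg s + X s ^ 5 * (rho s * sg s * sg s) * sg s))) / - B s)).
  - assert (l0 : - c < 0) by lra.
    generalize (filter_and _ _ (tends0_lt _ _ _ TB l0) rescaled_equations). apply filter_imp.
    intros s [HB [R _]]. apply (Rmult_eq_reg_l (- B s)); [|lra].
    replace (- B s * X s ^ 2) with (1 + A s / nu s * sg s * X s + C s * sg s * X s ^ 3 +
      sg s ^ 2 * (E s * X s ^ 4 + rho s * sg s * X s ^ 5)) by lra.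
    unfold Rdiv. rewrite (Rmult_comm (- B s)), Rmult_assoc, Rinv_l by lra. ring.
  - eapply tends0_eq.
    + apply tends0_div; [|apply tends0_plus; [apply tends0_const|apply tends0_plus;
        [apply tends0_plus; [apply (Bd _ _ 1%nat TA)|apply (Bd _ _ 3%nat TC)]|]]|apply tends0_opp; exact TB].
      2:{ apply tends0_plus; (apply tends0_mult; [|exact Tsg]); [apply (Bd _ _ 4%nat TE)|apply (Bd _ _ 5%nat Tr)]. }
      lra.
    + field. lra. }
apply (tends0_ext (fun s => sqrt (X s ^ 2))).
- generalize rescaled_range. apply filter_imp. intros s [P _]. apply sqrt_pow2. lra.
- apply tends0_sqrt; auto. now apply Rinv_0_lt_compat.
Qed.

Lemma offset_lim : tends0 e (al * sqrt (/ c) - C0 * sqrt (/ c) ^ 3).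
Proof.
assert (TX := rescaled_lim). assert (Tsg := sqrt_family_tends0).
apply (tends0_ext (fun s => A s / nu s * X s - C s * X s ^ 3 - 2 * E s * sg s * X s ^ 4 +
    ((3 * rho s - rho' s) * (sg s ^ 2)) * X s ^ 5)).
- generalize rescaled_equations. apply filter_imp. intros s [_ H]. rewrite H. ring.
- eapply tends0_eq.
  + apply tends0_plus; [apply tends0_minus; [apply tends0_minus|]|].
    * apply tends0_mult; [exact TA|exact TX].
    * apply tends0_mult; [exact TC|apply tends0_pow, TX].
    * apply tends0_mult; [|apply tends0_pow, TX]. apply tends0_mult; [|exact Tsg].
      apply tends0_mult; [apply tends0_const|exact TE].
    * apply tends0_mult; [|apply tends0_pow, TX].
      apply (tends0_bounded_mult _ _ (4 * K)).
      -- generalize remainders_bounded. apply filter_imp. intros s [R1 R2]. unfold Rminus.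
         eapply Rle_trans; [apply Rabs_triang|]. rewrite Rabs_Ropp, Rabs_mult, (Rabs_pos_eq 3); lra.
      -- eapply tends0_eq; [apply tends0_pow, Tsg|]. ring.
  + ring.
Qed.
End OneSide.

(** The rescaled equations give the limits at both fixed points, on the left by
    reflection. They cancel in the sum, whose next order involves the difference of the
    two rescaled fixed points; that difference, divided by [sqrt nu], is obtained by
    subtracting their equations. *)
Theorem multiplier_asymptotics (F : R -> R -> R) (x1 x2 nu A B C E : R -> R) c K d s1 al C0 E0 :
  0 < s1 ->
  (forall s, 0 < s < s1 -> small_params c K d (nu s) /\ unfolding (F s) c K d (nu s) (A s) (B s) /\
    jet5 (F s) K d (nu s) (A s) (B s) (C s) (E s) /\ 0 < nu s /\
    (0 < x1 s < d /\ F s (x1 s) = x1 s) /\ (- d < x2 s < 0 /\ F s (x2 s) = x2 s)) ->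
  tends0 nu 0 -> tends0 (fun s => A s / nu s) al -> tends0 B (- c) -> tends0 C C0 -> tends0 E E0 ->
  let e x s := ((1 - Derive (F s) (x s) - nu s) - nu s) / (nu s * sqrt (nu s)) in
  let xi := sqrt (/ c) in
  let e0 := xi * (al - C0 / c) in
  tends0 (e x1) e0 /\ tends0 (e x2) (- e0) /\
  tends0 (fun s => (e x1 s + e x2 s) / sqrt (nu s))
    ((al + C0 / c) / c * (al - 3 * C0 / c) - 4 * E0 / c ^ 2).
Proof.
intros s10 H Tnu TA TB TC TE e xi e0.
assert (c0 : 0 < c) by (apply (H (s1 / 2)); lra).
assert (xip : 0 < xi) by (apply sqrt_lt_R0, Rinv_0_lt_compat; auto).
assert (xi2 : xi ^ 2 = / c).
{ unfold xi. rewrite <- Rsqr_pow2. apply Rsqr_sqrt. left; apply Rinv_0_lt_compat; auto. }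
assert (xi3 : xi ^ 3 = xi / c) by (replace (xi ^ 3) with (xi * xi ^ 2) by ring; now rewrite xi2).
assert (xi4 : xi ^ 4 = / c ^ 2).
{ replace (xi ^ 4) with (xi ^ 2 * xi ^ 2) by ring. rewrite xi2. field. lra. }
set (y := fun s => - x2 s). set (G := fun s => reflect (F s)).
(* The left fixed point is treated as a right one of the reflected family. *)
assert (JR : forall s, 0 < s < s1 -> jet5 (G s) K d (nu s) (- A s) (B s) (- C s) (E s)).
{ intros s Hs. destruct (H s Hs) as [_ [HU [[J1 J2] _]]].
  assert (N : forall z, Ioo (- d) d z -> Ioo (- d) d (- z)) by (unfold Ioo; intros; lra).
  split; intros z Hz.
  - assert (Q := J1 (- z) (N z Hz)). rewrite Rabs_Ropp in Q. unfold G, reflect. rewrite <- Rabs_Ropp.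
    replace (- _) with (F s (- z) - - z - (nu s * - z + A s * (- z) ^ 2 + B s * (- z) ^ 3 + C s * (- z) ^ 4 + E s * (- z) ^ 5)) by ring.
    exact Q.
  - assert (Q := J2 (- z) (N z Hz)). rewrite Rabs_Ropp in Q.
    change (Derive (G s) z) with (Derive (reflect (F s)) z).
    rewrite (is_derive_unique _ _ _ (Derive_reflect (F s) z ltac:(apply HU, N, Hz))).
    replace (_ - _ - _) with (Derive (F s) (- z) - 1 - (nu s + 2 * A s * - z + 3 * B s * (- z) ^ 2 + 4 * C s * (- z) ^ 3 + 5 * E s * (- z) ^ 4)) by ring.
    exact Q. }
assert (Hy : forall s, 0 < s < s1 -> 0 < y s < d /\ G s (y s) = y s).
{ intros s Hs. destruct (H s Hs) as [_ [_ [_ [_ [_ [H1 H2]]]]]]. unfold y, G, reflect. rewrite Ropp_involutive, H2. lra. }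
assert (HS : forall s, 0 < s < s1 -> small_params c K d (nu s)) by (intros; now apply H).
assert (HU : forall s, 0 < s < s1 -> unfolding (F s) c K d (nu s) (A s) (B s)) by (intros; now apply H).
assert (HJ : forall s, 0 < s < s1 -> jet5 (F s) K d (nu s) (A s) (B s) (C s) (E s)) by (intros; now apply H).
assert (Hn : forall s, 0 < s < s1 -> 0 < nu s) by (intros; now apply H).
assert (Hx : forall s, 0 < s < s1 -> 0 < x1 s < d /\ F s (x1 s) = x1 s) by (intros; now apply H).
assert (UR : forall s, 0 < s < s1 -> unfolding (G s) c K d (nu s) (- A s) (B s)).
{ intros s Hs. apply unfolding_reflect, HU, Hs. }
assert (TA' : tends0 (fun s => - A s / nu s) (- al)).
{ apply (tends0_ext (fun s => - (A s / nu s))); [|now apply tends0_opp].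
  apply filter_forall. intros s. unfold Rdiv; ring. }
assert (TC' : tends0 (fun s => - C s) (- C0)) by now apply tends0_opp.
assert (L1 := offset_lim F x1 nu A B C E c K d s1 al C0 E0 s10 HS HU HJ Hn Hx Tnu TA TB TC TE).
assert (L2 := offset_lim G y nu (fun s => - A s) B (fun s => - C s) E c K d s1 (- al) (- C0) E0 s10 HS UR JR Hn Hy Tnu TA' TB TC' TE).
assert (X1 := rescaled_lim F x1 nu A B C E c K d s1 al C0 E0 s10 HS HU HJ Hn Hx Tnu TA TB TC TE).
assert (X2 := rescaled_lim G y nu (fun s => - A s) B (fun s => - C s) E c K d s1 (- al) (- C0) E0 s10 HS UR JR Hn Hy Tnu TA' TB TC' TE).
assert (Q1 := rescaled_equations F x1 nu A B C E d s1 s10 Hn Hx).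
assert (Q2 := rescaled_equations G y nu (fun s => - A s) B (fun s => - C s) E d s1 s10 Hn Hy).
assert (R1 := remainders_bounded F x1 nu A B C E K d s1 s10 HJ Hn Hx).
assert (R2 := remainders_bounded G y nu (fun s => - A s) B (fun s => - C s) E K d s1 s10 JR Hn Hy).
assert (Nr := fixed_point_near F x1 nu d s1 s10 Hn Hx).
assert (Tsg := sqrt_family_tends0 nu Tnu).
cbv beta zeta in L1, L2, X1, X2, Q1, Q2, R1, R2, Nr, Tsg. fold xi in L1, L2, X1, X2.
set (X := fun s => x1 s / sqrt (nu s)) in *. set (Y := fun s => y s / sqrt (nu s)) in *.
set (r1 := fun s => (F s (x1 s) - x1 s - (nu s * x1 s + A s * x1 s ^ 2 + B s * x1 s ^ 3 + C s * x1 s ^ 4 + E s * x1 s ^ 5)) / x1 s ^ 6) in *.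
set (r1' := fun s => (Derive (F s) (x1 s) - 1 - (nu s + 2 * A s * x1 s + 3 * B s * x1 s ^ 2 + 4 * C s * x1 s ^ 3 + 5 * E s * x1 s ^ 4)) / x1 s ^ 5) in *.
set (r2 := fun s => (G s (y s) - y s - (nu s * y s + - A s * y s ^ 2 + B s * y s ^ 3 + - C s * y s ^ 4 + E s * y s ^ 5)) / y s ^ 6) in *.
set (r2' := fun s => (Derive (G s) (y s) - 1 - (nu s + 2 * - A s * y s + 3 * B s * y s ^ 2 + 4 * - C s * y s ^ 3 + 5 * E s * y s ^ 4)) / y s ^ 5) in *.
assert (Ee2 : at_right 0 (fun s => (1 - Derive (G s) (y s) - nu s - nu s) / (nu s * sqrt (nu s)) = e x2 s)).
{ generalize (near0_lt s1 s10). apply filter_imp. intros s Hs. unfold e.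
  destruct (H s Hs) as [_ [HUs [_ [_ [_ [P1 P2]]]]]].
  unfold G. rewrite (is_derive_unique _ _ _ (Derive_reflect (F s) (y s) ltac:(apply HUs; unfold Ioo, y; lra))).
  unfold y. now rewrite Ropp_involutive. }
split; [|split].
- eapply tends0_eq; [exact L1|]. unfold e0. rewrite xi3. field. lra.
- eapply tends0_eq; [apply (tends0_ext _ _ _ Ee2 L2)|]. unfold e0. rewrite xi3. field. lra.
-
  (* The difference quotient of the two rescaled fixed points. *)
  set (D := fun s => (X s - Y s) / sqrt (nu s)).
  assert (TD : tends0 D ((al + C0 / c) / c)).
  { apply (tends0_ext (fun s => (A s / nu s + C s * (X s ^ 2 - X s * Y s + Y s ^ 2) +
       (E s * ((X s - Y s) * (X s ^ 2 + Y s ^ 2)) * sqrt (nu s) +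
        (r1 s * sqrt (nu s) * X s ^ 5 - r2 s * sqrt (nu s) * Y s ^ 5) / (X s + Y s) * sqrt (nu s))) / - B s)).
    - assert (l0 : - c < 0) by lra.
      assert (NB := tends0_lt _ _ _ TB l0).
      assert (NX := tends0_gt _ _ _ X1 xip). assert (NY := tends0_gt _ _ _ X2 xip).
      generalize (filter_and _ _ NB (filter_and _ _ NX (filter_and _ _ NY (filter_and _ _ Nr (filter_and _ _ Q1 Q2))))).
      apply filter_imp. intros s [HB [HX [HY [[Hs [P [Q [N _]]]] [[Z1 _] [Z2 _]]]]]].
      fold (X s) in Z1. fold (Y s) in Z2. fold (r1 s) in Z1. fold (r2 s) in Z2.
      set (q := sqrt (nu s)) in *. set (al' := A s / nu s) in *.
      replace (- A s / nu s) with (- al') in Z2 by (unfold al', Rdiv; ring).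
      change (X s > 0) in HX. change (Y s > 0) in HY.
      unfold D. fold q. clearbody al'.
      apply (Rmult_eq_reg_l (- B s * (q * (X s + Y s)))); [|apply Rmult_integral_contrapositive; split; [lra|apply Rmult_integral_contrapositive; split; lra]].
      apply Rminus_diag_uniq.
      replace (- B s * (q * (X s + Y s)) * ((X s - Y s) / q)) with (- (B s * X s ^ 2) + B s * Y s ^ 2) by (field; lra).
      replace (B s * X s ^ 2) with (- (1 + al' * q * X s + C s * q * X s ^ 3 + q ^ 2 * (E s * X s ^ 4 + r1 s * q * X s ^ 5))) by lra.
      replace (B s * Y s ^ 2) with (- (1 + - al' * q * Y s + - C s * q * Y s ^ 3 + q ^ 2 * (E s * Y s ^ 4 + r2 s * q * Y s ^ 5))) by lra.
      field. lra.
    - eapply tends0_eq.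
      + apply tends0_div; [|apply tends0_plus; [apply tends0_plus; [exact TA|]|]|apply tends0_opp; exact TB].
        2:{ apply tends0_mult; [exact TC|]. apply tends0_plus; [apply tends0_minus|].
            - apply tends0_pow; exact X1.
            - apply tends0_mult; [exact X1|exact X2].
            - apply tends0_pow; exact X2. }
        2:{ apply tends0_plus; (apply tends0_mult; [|exact Tsg]).
            - apply tends0_mult; [exact TE|]. apply tends0_mult; [apply tends0_minus; [exact X1|exact X2]|].
              apply tends0_plus; apply tends0_pow; [exact X1|exact X2].
            - apply tends0_div; [|apply tends0_minus; apply tends0_mult|apply tends0_plus; [exact X1|exact X2]].
              2:{ apply (tends0_bounded_mult _ _ K); [|exact Tsg]. generalize R1. apply filter_imp. tauto. }
              2:{ apply tends0_pow; exact X1. }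
              2:{ apply (tends0_bounded_mult _ _ K); [|exact Tsg]. generalize R2. apply filter_imp. tauto. }
              2:{ apply tends0_pow; exact X2. }
              lra. }
        lra.
      + replace (xi * xi) with (xi ^ 2) by ring. rewrite xi2. field. lra. }
  apply (tends0_ext (fun s => D s * (A s / nu s - C s * (X s ^ 2 + X s * Y s + Y s ^ 2)) - 2 * E s * (X s ^ 4 + Y s ^ 4) +
     ((3 * r1 s - r1' s) * sqrt (nu s) * X s ^ 5 + (3 * r2 s - r2' s) * sqrt (nu s) * Y s ^ 5))).
  + generalize (filter_and _ _ Nr (filter_and _ _ Q1 (filter_and _ _ Q2 Ee2))).
    apply filter_imp. intros s [[Hs [P [Q [N _]]]] [[_ Z1] [[_ Z2] EE]]].
    fold (r1 s) in Z1. fold (r1' s) in Z1. fold (r2 s) in Z2. fold (r2' s) in Z2.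
    fold (X s) in Z1. fold (Y s) in Z2.
    rewrite <- EE, Z2. unfold e. rewrite Z1. unfold D. fold (X s). fold (Y s).
    replace (- A s / nu s) with (- (A s / nu s)) by (unfold Rdiv; ring).
    field. lra.
  + eapply tends0_eq.
    * apply tends0_plus; [apply tends0_minus|apply tends0_plus].
      -- apply tends0_mult; [exact TD|]. apply tends0_minus; [exact TA|]. apply tends0_mult; [exact TC|].
         apply tends0_plus; [apply tends0_plus; [apply tends0_pow; exact X1|apply tends0_mult; [exact X1|exact X2]]|apply tends0_pow; exact X2].
      -- apply tends0_mult; [apply tends0_mult; [apply tends0_const|exact TE]|].
         apply tends0_plus; apply tends0_pow; [exact X1|exact X2].
      -- apply tends0_mult; [|apply tends0_pow; exact X1]. apply (tends0_bounded_mult _ _ (4 * K)); [|exact Tsg].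
         generalize R1. apply filter_imp. intros s [B1 B2]. fold (r1 s) in B1. fold (r1' s) in B2. unfold Rminus at 1.
         eapply Rle_trans; [apply Rabs_triang|]. rewrite Rabs_Ropp, Rabs_mult, (Rabs_pos_eq 3); lra.
      -- apply tends0_mult; [|apply tends0_pow; exact X2]. apply (tends0_bounded_mult _ _ (4 * K)); [|exact Tsg].
         generalize R2. apply filter_imp. intros s [B1 B2]. fold (r2 s) in B1. fold (r2' s) in B2. unfold Rminus at 1.
         eapply Rle_trans; [apply Rabs_triang|]. rewrite Rabs_Ropp, Rabs_mult, (Rabs_pos_eq 3); lra.
    * replace (xi * xi) with (xi ^ 2) by ring. rewrite xi2, xi4. field. lra.
Qed.

(** * Prescribing the asymmetry of the normal form *)

(** The logarithm of the ratio in which [0] divides the interval from [- x] to [x] in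
    the Koenigs coordinate, an invariant under scaling of the coordinate. *)
Definition asymmetry (F : R -> R) (m x : R) : R :=
  ln (koenigs_value F m x) - ln (koenigs_value (reflect F) m x).

Lemma reflect_iter F n x : Nat.iter n (reflect F) x = - Nat.iter n F (- x).
Proof.
induction n as [|n IH]; simpl; [ring|]. rewrite IH. unfold reflect. now rewrite Ropp_involutive.
Qed.

Lemma koenigs_value_reflect F m x : koenigs_value (reflect F) m x = - koenigs_value F m (- x).
Proof.
unfold koenigs_value. rewrite (Lim_seq_ext _ (fun n => - (Nat.iter n F (- x) / m ^ n))).
- rewrite Lim_seq_opp. destruct (Lim_seq _); simpl; ring.
- intros n. rewrite reflect_iter. unfold Rdiv; ring.
Qed.

(** With the scaling by [sqrt c] between the two neighbourhoods, the leading terms of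
    both asymmetries contain the same integral. *)
Lemma asym_J_scale c n x : 0 < c -> 0 < n -> asym_J 1 n (sqrt c * x) = sqrt c * asym_J c n x.
Proof.
intros c0 n0. assert (sc := sqrt_lt_R0 _ c0). assert (sn := sqrt_lt_R0 _ n0).
assert (E : sqrt c * sqrt c = c) by (apply sqrt_sqrt; lra).
unfold asym_J. rewrite !Rmult_1_l.
replace ((sqrt c * x) ^ 2) with (c * x ^ 2) by (rewrite <- E at 1; ring).
replace (sqrt (1 / n)) with (/ sqrt n).
2:{ rewrite sqrt_div_alt, sqrt_1 by auto. unfold Rdiv; ring. }
rewrite (sqrt_div_alt c n), (sqrt_mult c n) by lra.
replace (sqrt c * x * / sqrt n) with (x * (sqrt c / sqrt n)) by (unfold Rdiv; ring).
assert (0 < n + c * x ^ 2) by (generalize (pow2_ge_0 x); nra).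
field. lra.
Qed.

(** The leading term of the asymmetry is of order [sqrt n], larger than the error [n ln
    n]. *)
Lemma asym_J_lower c n x : 0 < c -> 0 < n -> 0 < x -> n <= c * x ^ 2 ->
  PI / 8 * sqrt n / sqrt c <= n ^ 2 * asym_J c n x.
Proof.
intros c0 n0 x0 H. assert (sc := sqrt_lt_R0 _ c0). assert (sn := sqrt_lt_R0 _ n0).
assert (En : sqrt n * sqrt n = n) by (apply sqrt_sqrt; lra).
assert (At : PI / 4 <= atan (x * sqrt (c / n))).
{ rewrite <- atan_1. assert (L : 1 <= x * sqrt (c / n)).
  { rewrite sqrt_div_alt by auto. replace (x * (sqrt c / sqrt n)) with (x * sqrt c / sqrt n) by (unfold Rdiv; ring).
    apply (proj1 (Rle_div_r _ _ _ sn)). rewrite Rmult_1_l.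
    rewrite <- (sqrt_Rsqr x) by lra. rewrite <- sqrt_mult by (try apply Rle_0_sqr; lra).
    apply sqrt_le_1_alt. unfold Rsqr. simpl in H. lra. }
  destruct L as [L|L]; [left; now apply atan_increasing|rewrite <- L; lra]. }
unfold asym_J. rewrite (sqrt_mult c n) by lra.
assert (X : 0 <= x / (n + c * x ^ 2)) by (apply Rdiv_le_0_compat; nra).
apply Rle_trans with (n ^ 2 * (/ (2 * n) * ((PI / 4) / (sqrt c * sqrt n)))).
- right. replace (n ^ 2) with (n * (sqrt n * sqrt n)) by (rewrite En; ring). field. lra.
- apply Rmult_le_compat_l; [apply pow2_ge_0|]. apply Rmult_le_compat_l; [left; apply Rinv_0_lt_compat; lra|].
  assert (PI / 4 / (sqrt c * sqrt n) <= atan (x * sqrt (c / n)) / (sqrt c * sqrt n)).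
  { apply Rmult_le_compat_r; auto. left. apply Rinv_0_lt_compat. apply Rmult_lt_0_compat; auto. }
  lra.
Qed.

Lemma asymmetry_estimate F c K d nu A B C E C0 d' :
  small_params c K d nu -> c <= K -> 1 <= K * c ->
  unfolding F c K d nu A B -> jet5 F K d nu A B C E ->
  Rabs (C - C0) <= K * Rabs nu -> Rabs C0 <= K -> Rabs E <= K -> nu < 0 ->
  Ck 2 (Ioo (- d) d) F -> 0 < d' < d ->
  0 < koenigs_value F (1 + nu) d' /\ koenigs_value F (1 + nu) (- d') < 0 /\
  Rabs (asymmetry F (1 + nu) d' - 2 * - nu * (A + C0 * - nu / c) * asym_J c (- nu) d')
    <= asym_const K d' * (- nu * (1 - ln (- nu))).
Proof.
intros HS cK Kc HU HJ HC HC0 HE n0 CF Hd'.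
assert (Fm := unfolding_multiplier0 F c K d nu A B HS HU).
destruct (monostable_linearization 0 F d) as [phi [Cp [Pp [p0 [p'0 [Ep Vp]]]]]].
{ now apply (unfolding_pitch_neg 2 F c K d nu A B). }
{ rewrite Fm; lra. }
rewrite Fm in Ep, Vp.
assert (M := deriv_pos_increasing phi (- d) d (proj1 Cp) Pp).
assert (Q1 : 0 < phi d') by (rewrite <- p0; apply M; unfold Ioo; lra).
assert (Q2 : phi (- d') < 0) by (rewrite <- p0; apply M; unfold Ioo; lra).
unfold asymmetry. rewrite koenigs_value_reflect, !Vp by (unfold Ioo; lra).
split; [auto|]. split; [auto|].
apply (basin_asymmetry F phi c K d nu A B C E C0 d'); auto. now apply Ck_S.
Qed.

Lemma continuity_2d_pt_reflect (F : R -> R -> R) s x : continuity_2d_pt F s (- x) ->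
  continuity_2d_pt (fun s x => reflect (F s) x) s x.
Proof.
intros H eps. destruct (H eps) as [d Hd]. exists d. intros u v Hu Hv.
unfold reflect. replace (- F u (- v) - - F s (- x)) with (- (F u (- v) - F s (- x))) by ring.
rewrite Rabs_Ropp. apply Hd; auto. replace (- v - - x) with (- (v - x)) by ring. now rewrite Rabs_Ropp.
Qed.

Lemma asymmetry_continuous (F : R -> R -> R) (nu A B : R -> R) c K d d' s0 : c <= K ->
  locally s0 (fun s => small_params c K d (nu s) /\ unfolding (F s) c K d (nu s) (A s) (B s) /\
    nu s < 0 /\ Ck 2 (Ioo (- d) d) (F s)) ->
  continuous nu s0 -> (forall y, Ioo (- d) d y -> continuity_2d_pt F s0 y) -> 0 < d' < d ->
  continuous (fun s => asymmetry (F s) (1 + nu s) d') s0.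
Proof.
intros cK HL Cnu CF Hd'.
apply (continuous_minus (fun s => ln (koenigs_value (F s) (1 + nu s) d'))
  (fun s => ln (koenigs_value (reflect (F s)) (1 + nu s) d'))).
- apply (koenigs_param_continuous F nu A B c K d); auto. intros y Hy. apply CF; unfold Ioo; lra.
- apply (koenigs_param_continuous (fun s => reflect (F s)) nu (fun s => - A s) B c K d); auto.
  + revert HL. apply filter_imp. intros s [H1 [H2 [H3 H4]]]. split; [auto|]. split; [now apply unfolding_reflect|].
    split; [auto|now apply reflect_Ck].
  + intros y Hy. apply continuity_2d_pt_reflect, CF. unfold Ioo; lra.
Qed.

(** As [nu < 0], a larger [b] lowers [g] on both sides of [0], and with it the Koenigs
    coordinates of both ends of the interval. *)
Lemma g_asymmetry_decreasing nu a b b' K e e' : small_params 1 K e nu -> nu < 0 ->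
  10 * Rabs a <= K -> Rabs b <= K -> Rabs b' <= K -> 0 < e' < e -> b < b' ->
  asymmetry (fun y => g y nu a b') (1 + nu) e' < asymmetry (fun y => g y nu a b) (1 + nu) e'.
Proof.
intros HS n0 Ha Hb Hb' He L.
assert (K0 : 1 <= K) by apply HS. assert (e0 : 0 < e <= 1 / 2) by apply HS.
destruct (g_unfolding nu a b K e e0 Ha Hb ltac:(lra)) as [U _].
destruct (g_unfolding nu a b' K e e0 Ha Hb' ltac:(lra)) as [U' _].
assert (Lin : forall t, unfolding (fun y => g y nu a t) 1 K e nu (t * nu) (-1) ->
  exists phi, (forall x y, Ioo (- e) e x -> Ioo (- e) e y -> x < y -> phi x < phi y) /\ phi 0 = 0 /\ is_derive phi 0 1 /\
  (forall x, Ioo (- e) e x -> phi (g x nu a t) = (1 + nu) * phi x) /\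
  (forall x, Ioo (- e) e x -> koenigs_value (fun y => g y nu a t) (1 + nu) x = phi x)).
{ intros t Ut. assert (Fm := unfolding_multiplier0 _ 1 K e nu _ _ HS Ut).
  destruct (monostable_linearization 0 (fun y => g y nu a t) e) as [phi [Cp [Pp [p0 [p'0 [Ep Vp]]]]]].
  { apply (unfolding_pitch_neg 2 _ 1 K e nu (t * nu) (-1)); auto. apply g_Ck, open_Ioo. }
  { rewrite Fm; lra. }
  rewrite Fm in Ep, Vp. exists phi. split; [apply deriv_pos_increasing; auto; apply Cp|].
  split; [auto|]. split; [|auto]. rewrite <- p'0. apply Derive_correct, Cp. unfold Ioo; lra. }
destruct (Lin b U) as [psi [M [z [D [E V]]]]]. destruct (Lin b' U') as [phi [M' [z' [D' [E' V']]]]].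
assert (At := unfolding_attracting _ 1 K e nu _ _ HS U n0). assert (At' := unfolding_attracting _ 1 K e nu _ _ HS U' n0).
assert (nb : Rabs nu <= 1 / 8) by apply HS. rewrite (Rabs_left nu n0) in nb.
assert (Cmp : forall x, Ioo (- e) e x -> x <> 0 -> phi x < psi x).
{ apply (koenigs_strict_comparison (fun y => g y nu a b') (fun y => g y nu a b) phi psi (- e) e (1 + nu)); auto; [lra|].
  intros x Hx Nx. unfold g. assert (0 < x ^ 2) by (rewrite <- Rsqr_pow2; now apply Rsqr_pos_lt).
  assert (0 < (b' - b) * - nu * x ^ 2) by (apply Rmult_lt_0_compat; [apply Rmult_lt_0_compat; lra|auto]). lra. }
unfold asymmetry. rewrite !koenigs_value_reflect, !V, !V' by (unfold Ioo; lra).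
assert (C1 := Cmp e' ltac:(unfold Ioo; lra) ltac:(lra)).
assert (C2 := Cmp (- e') ltac:(unfold Ioo; lra) ltac:(lra)).
assert (P1 : 0 < phi e') by (rewrite <- z'; apply M'; unfold Ioo; lra).
assert (P2 : psi (- e') < 0) by (rewrite <- z; apply M; unfold Ioo; lra).
assert (ln (phi e') < ln (psi e')) by (apply ln_increasing; lra).
assert (ln (- psi (- e')) < ln (- phi (- e'))) by (apply ln_increasing; lra).
lra.
Qed.

Lemma sqrt_ln_tends0 : tends0 (fun n => sqrt n * (1 - ln n)) 0.
Proof.
assert (T : tends0 sqrt 0).
{ apply (sqrt_tends0 (fun x => x)), tends0_id. }
assert (P : at_right 0 (fun x => 0 < sqrt x)).
{ generalize (near0_lt 1 Rlt_0_1). apply filter_imp. intros x Hx. apply sqrt_lt_R0; lra. }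
assert (T2 : tends0 (fun x => sqrt (sqrt x)) 0) by (apply (tends0_subst sqrt sqrt 0 P T T)).
apply (tends0_squeeze (fun _ => 0) _ (fun n => sqrt n + 4 * sqrt (sqrt n))).
- generalize (near0_lt 1 Rlt_0_1). apply filter_imp. intros n Hn.
  assert (s0 : 0 < sqrt n) by (apply sqrt_lt_R0; lra). assert (q0 : 0 < sqrt (sqrt n)) by (apply sqrt_lt_R0; lra).
  assert (E1 : sqrt n * sqrt n = n) by (apply sqrt_sqrt; lra).
  assert (E2 : sqrt (sqrt n) * sqrt (sqrt n) = sqrt n) by (apply sqrt_sqrt; lra).
  set (t := sqrt (sqrt n)) in *.
  assert (L0 : ln n < 0) by (rewrite <- ln_1; apply ln_increasing; lra).
  split; [apply Rmult_le_pos; lra|].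
  assert (L : - ln n <= 4 * / t).
  { rewrite <- E1, <- E2. rewrite !ln_mult by (try apply Rmult_lt_0_compat; auto).
    assert (- ln t <= / t).
    { rewrite <- ln_Rinv by auto. rewrite <- (ln_exp (/ t)) at 2. apply ln_le; [now apply Rinv_0_lt_compat|].
      generalize (exp_ineq1_le (/ t)); lra. }
    lra. }
  assert (sqrt n * - ln n <= 4 * t).
  { apply Rle_trans with (sqrt n * (4 * / t)); [apply Rmult_le_compat_l; lra|].
    right. rewrite <- E2. field. lra. }
  lra.
- apply tends0_const.
- eapply tends0_eq; [apply tends0_plus; [exact T|apply tends0_mult; [apply tends0_const|exact T2]]|]. ring.
Qed.

(** The difference of the asymmetries of [F] and [g] increases with [b] and equals [2
    n^2 J (A / n + C0 / c + sqrt c * b)] up to [O(n ln n)], where [n = - nu] and [n^2 J]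
    is at least a multiple of [sqrt n]. Its zero is thus close to the zero [b0] of the
    limit of the bracket. *)
Theorem asymmetry_matching (F : R -> R -> R) (nu A B C E : R -> R) c K d d' e al C0 a0 s1 :
  0 < s1 -> c <= K -> 1 <= K * c -> Rabs C0 <= K -> 10 * Rabs a0 <= K ->
  let b0 := sqrt (/ c) * (al - C0 / c) in
  let e' := sqrt c * d' in
  Rabs b0 + 2 <= K -> 0 < d' < d -> 0 < e' < e ->
  (forall s, 0 < s < s1 -> small_params c K d (nu s) /\ small_params 1 K e (nu s) /\
    unfolding (F s) c K d (nu s) (A s) (B s) /\
    jet5 (F s) K d (nu s) (A s) (B s) (C s) (E s) /\
    Rabs (C s - C0) <= K * Rabs (nu s) /\ Rabs (E s) <= K /\ nu s < 0 /\
    Ck 2 (Ioo (- d) d) (F s) /\ continuous nu s /\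
    (forall x, Ioo (- d) d x -> continuity_2d_pt F s x)) ->
  tends0 nu 0 -> tends0 (fun s => A s / nu s) al ->
  exists s2 b, 0 < s2 <= s1 /\ tends0 b b0 /\
  forall s, 0 < s < s2 -> Rabs (b s - b0) < 1 /\ continuous b s /\
    koenigs_value (F s) (1 + nu s) d' * koenigs_value (fun y => g y (nu s) a0 (b s)) (1 + nu s) (- e') =
    koenigs_value (fun y => g y (nu s) a0 (b s)) (1 + nu s) e' * koenigs_value (F s) (1 + nu s) (- d').
Proof.
intros s10 cK Kc HC0 Ha b0 e' Hb0 Hd' He' H Tnu TA.
assert (c0 : 0 < c) by (apply (H (s1 / 2)); lra).
assert (K1 : 1 <= K) by (apply (H (s1 / 2)); lra).
assert (e12 : 0 < e <= 1 / 2) by (apply (H (s1 / 2)); lra).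
assert (sc := sqrt_lt_R0 _ c0).
set (G := fun s b y => g y (nu s) a0 b).
assert (Hg : forall s b, Rabs b <= K ->
   unfolding (G s b) 1 K e (nu s) (b * nu s) (-1) /\ jet5 (G s b) K e (nu s) (b * nu s) (-1) 0 a0).
{ intros s b Hb. apply g_unfolding; auto; lra. }
assert (Bb : forall b, Rabs (b - b0) <= 2 -> Rabs b <= K).
{ intros b Hb. replace b with ((b - b0) + b0) by ring. eapply Rle_trans; [apply Rabs_triang|]. lra. }
set (H0 := fun s b => asymmetry (F s) (1 + nu s) d' - asymmetry (G s b) (1 + nu s) e').
assert (near1 : forall b, b0 - 1 <= b <= b0 + 1 -> Rabs b <= K).
{ intros b Hb. apply Bb. apply Rabs_le_between; lra. }
assert (CG : forall s b, 0 < s < s1 -> forall y, continuity_2d_pt (fun s y => G s b y) s y).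
{ intros s b Hs y. unfold G, g.
  assert (Cn : continuity_2d_pt (fun s _ => nu s) s y).
  { apply (continuity_1d_2d_pt_comp nu (fun s _ => s)); [|apply continuity_2d_pt_id1].
    apply continuity_pt_filterlim. now apply H. }
  assert (Cp : forall j, continuity_2d_pt (fun _ y => y ^ j) s y).
  { intros j. apply (continuity_1d_2d_pt_comp (fun y => y ^ j) (fun _ y => y)); [|apply continuity_2d_pt_id2].
    apply derivable_continuous_pt, derivable_pt_pow. }
  assert (Cy : continuity_2d_pt (fun _ y => y) s y) by apply continuity_2d_pt_id2.
  apply continuity_2d_pt_plus; [apply continuity_2d_pt_plus; [apply continuity_2d_pt_minus; [apply continuity_2d_pt_plus|]|]|]; auto.
  - apply continuity_2d_pt_mult; auto.
  - apply continuity_2d_pt_mult; auto using continuity_2d_pt_const.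
  - apply continuity_2d_pt_mult; auto. apply continuity_2d_pt_mult; auto using continuity_2d_pt_const. }
assert (CGb : forall s b y, continuity_2d_pt (fun b y => G s b y) b y).
{ intros s b y. unfold G, g.
  assert (Cp : forall j, continuity_2d_pt (fun _ y => y ^ j) b y).
  { intros j. apply (continuity_1d_2d_pt_comp (fun y => y ^ j) (fun _ y => y)); [|apply continuity_2d_pt_id2].
    apply derivable_continuous_pt, derivable_pt_pow. }
  assert (Cy : continuity_2d_pt (fun _ y => y) b y) by apply continuity_2d_pt_id2.
  assert (Cb : continuity_2d_pt (fun b _ => b) b y) by apply continuity_2d_pt_id1.
  apply continuity_2d_pt_plus; [apply continuity_2d_pt_plus; [apply continuity_2d_pt_minus; [apply continuity_2d_pt_plus|]|]|]; auto.
  - apply continuity_2d_pt_mult; auto using continuity_2d_pt_const.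
  - apply continuity_2d_pt_mult; auto using continuity_2d_pt_const.
  - apply continuity_2d_pt_mult; auto. apply continuity_2d_pt_mult; auto using continuity_2d_pt_const. }
destruct (monotone_solver H0 b0 s1 s10) as [s2 [b [Hs2 [Tb Hb]]]].
- intros s Hs t t' T1 T2 T3. destruct (H s Hs) as [_ [S2 [_ [_ [_ [_ [n0 _]]]]]]].
  unfold H0. assert (asymmetry (G s t') (1 + nu s) e' < asymmetry (G s t) (1 + nu s) e'); [|lra].
  apply (g_asymmetry_decreasing (nu s) a0 t t' K e e'); auto; apply near1; lra.
- intros s Hs t Ht. destruct (H s Hs) as [_ [S2 [_ [_ [_ [_ [n0 _]]]]]]].
  apply (continuous_minus (fun _ => asymmetry (F s) (1 + nu s) d') (fun b => asymmetry (G s b) (1 + nu s) e'));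
    [apply continuous_const|].
  apply (asymmetry_continuous (G s) (fun _ => nu s) (fun b => b * nu s) (fun _ => -1) 1 K e e'); auto.
  + exists (mkposreal 1 Rlt_0_1). intros z Hz.
    assert (Hz' : Rabs (z - t) < 1) by exact Hz. apply Rabs_def2 in Hz'.
    split; [auto|]. split; [apply Hg, Bb, Rabs_le_between; lra|]. split; [auto|]. apply g_Ck, open_Ioo.
  + apply continuous_const.
- intros s Hs t Ht.
  assert (L := open_locally (Ioo 0 s1) s (open_Ioo 0 s1) Hs).
  apply (continuous_minus (fun s => asymmetry (F s) (1 + nu s) d') (fun s => asymmetry (G s t) (1 + nu s) e')).
  + apply (asymmetry_continuous F nu A B c K d d'); auto; try now apply H.
    revert L. apply filter_imp. intros z Hz. destruct (H z Hz) as [Q1 [Q2 [Q3 [Q4 [Q5 [Q6 [Q7 [Q8 _]]]]]]]]. auto.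
  + apply (asymmetry_continuous (fun s => G s t) nu (fun s => t * nu s) (fun _ => -1) 1 K e e'); auto; try now apply H.
    revert L. apply filter_imp. intros z Hz. destruct (H z Hz) as [Q1 [Q2 [Q3 [Q4 [Q5 [Q6 [Q7 [Q8 _]]]]]]]].
    split; [auto|]. split; [apply Hg, near1, Ht|]. split; [auto|]. apply g_Ck, open_Ioo.
- intros eta Heta.
  set (n := fun s => - nu s).
  assert (Tn : tends0 n 0) by (eapply tends0_eq; [apply tends0_opp; exact Tnu|ring]).
  assert (Nn : at_right 0 (fun s => 0 < n s)).
  { generalize (near0_lt s1 s10). apply filter_imp. intros s Hs. unfold n.
    destruct (H s Hs) as [_ [_ [_ [_ [_ [_ [n0 _]]]]]]]. lra. }
  set (KK := asym_const K d' + asym_const K e').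
  assert (Ts : tends0 (fun s => KK * (sqrt (n s) * (1 - ln (n s)))) 0).
  { eapply tends0_eq; [apply tends0_mult; [apply tends0_const|
      apply (tends0_subst (fun n => sqrt n * (1 - ln n)) n 0 Nn Tn sqrt_ln_tends0)]|]. ring. }
  assert (pi0 := PI_RGT_0).
  assert (l1 : 0 < PI / 16 * eta) by (apply Rmult_lt_0_compat; lra).
  assert (Nerr := tends0_lt _ _ _ Ts l1).
  assert (Tbr : tends0 (fun s => A s / n s + C0 / c) (- al + C0 / c)).
  { apply tends0_plus; [|apply tends0_const]. apply (tends0_ext (fun s => - (A s / nu s))).
    - revert Nn. apply filter_imp. intros s Hn. unfold n in *. field. lra.
    - now apply tends0_opp. }
  assert (sb : sqrt c * b0 = al - C0 / c).
  { unfold b0. rewrite sqrt_inv. field. lra. }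
  assert (l2 : 0 < sqrt c * eta / 2).
  { assert (0 < sqrt c * eta) by (apply Rmult_lt_0_compat; lra). lra. }
  assert (l3 : - al + C0 / c < - al + C0 / c + sqrt c * eta / 2) by lra.
  assert (l4 : - al + C0 / c - sqrt c * eta / 2 < - al + C0 / c) by lra.
  assert (Nb1 := tends0_lt _ _ _ Tbr l3). assert (Nb2 := tends0_gt _ _ _ Tbr l4).
  assert (l5 : 0 < c * d' ^ 2) by (apply Rmult_lt_0_compat; auto; apply pow_lt; lra).
  assert (Nsm := tends0_lt _ _ _ Tn l5).
  generalize (filter_and _ _ (near0_lt s1 s10) (filter_and _ _ Nn (filter_and _ _ Nerr (filter_and _ _ Nb1 (filter_and _ _ Nb2 Nsm))))).
  apply filter_imp. intros s [Hs [Hn [He [Hb1 [Hb2 Hsm]]]]].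
  destruct (H s Hs) as [S1 [S2 [HU [HJ [HC [HE [n0 [CF _]]]]]]]].
  destruct (asymmetry_estimate (F s) c K d (nu s) (A s) (B s) (C s) (E s) C0 d') as [_ [_ EF]]; auto.
  assert (EG : forall t, b0 - 1 <= t <= b0 + 1 ->
    Rabs (asymmetry (G s t) (1 + nu s) e' - 2 * n s * (t * nu s) * (sqrt c * asym_J c (n s) d')) <=
      asym_const K e' * (n s * (1 - ln (n s)))).
  { intros t Ht. destruct (Hg s t (near1 t Ht)) as [U J].
    destruct (asymmetry_estimate (G s t) 1 K e (nu s) (t * nu s) (-1) 0 a0 0 e') as [_ [_ Q]]; auto; try lra.
    - replace (0 - 0) with 0 by ring. rewrite Rabs_R0. apply Rmult_le_pos; [lra|apply Rabs_pos].
    - rewrite Rabs_R0; lra.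
    - apply g_Ck, open_Ioo.
    - unfold e' at 2 in Q. rewrite (asym_J_scale c (- nu s) d' c0 Hn) in Q. fold (n s) in Q.
      replace (t * nu s + 0 * n s / 1) with (t * nu s) in Q by field. exact Q. }
  fold (n s) in EF. set (J := asym_J c (n s) d') in *.
  assert (JL := asym_J_lower c (n s) d' c0 Hn (proj1 Hd') (Rlt_le _ _ Hsm)). fold J in JL.
  assert (sn := sqrt_lt_R0 _ Hn). assert (En : sqrt (n s) * sqrt (n s) = n s) by (apply sqrt_sqrt; lra).
  assert (Err : KK * (n s * (1 - ln (n s))) < PI / 16 * eta * sqrt (n s)).
  { rewrite <- En at 1. replace (KK * (sqrt (n s) * sqrt (n s) * (1 - ln (n s)))) with
      (KK * (sqrt (n s) * (1 - ln (n s))) * sqrt (n s)) by ring. apply Rmult_lt_compat_r; auto. }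
  assert (Main : forall t, b0 - 1 <= t <= b0 + 1 ->
    Rabs (H0 s t - 2 * (n s ^ 2 * J) * (A s / n s + C0 / c + sqrt c * t)) <= KK * (n s * (1 - ln (n s)))).
  { intros t Ht. specialize (EG t Ht). unfold H0.
    replace (_ - _) with ((asymmetry (F s) (1 + nu s) d' - 2 * n s * (A s + C0 * n s / c) * J) -
      (asymmetry (G s t) (1 + nu s) e' - 2 * n s * (t * nu s) * (sqrt c * J))).
    2:{ generalize (asymmetry (F s) (1 + nu s) d') (asymmetry (G s t) (1 + nu s) e'). intros aF aG.
        replace (nu s) with (- n s) by (unfold n; ring). field. split; lra. }
    unfold Rminus at 1. eapply Rle_trans; [apply Rabs_triang|]. rewrite Rabs_Ropp. unfold KK. lra. }
  assert (NJ : sqrt c * eta / 2 * (PI / 8 * sqrt (n s) / sqrt c) = PI / 16 * eta * sqrt (n s)) by (field; lra).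
  assert (NJ0 : 0 <= PI / 8 * sqrt (n s) / sqrt c).
  { apply Rdiv_le_0_compat; auto. apply Rmult_le_pos; lra. }
  split.
  + assert (M := Main (b0 - eta) ltac:(lra)). apply Rabs_le_between in M.
    assert (n s ^ 2 * J * (A s / n s + C0 / c + sqrt c * (b0 - eta)) <= - (PI / 16 * eta * sqrt (n s))); [|lra].
    rewrite <- NJ.
    assert (sqrt c * eta / 2 * (PI / 8 * sqrt (n s) / sqrt c) <= sqrt c * eta / 2 * (n s ^ 2 * J)) by (apply Rmult_le_compat_l; lra).
    assert (n s ^ 2 * J * (A s / n s + C0 / c + sqrt c * (b0 - eta)) <= n s ^ 2 * J * - (sqrt c * eta / 2)) by (apply Rmult_le_compat_l; lra).
    lra.
  + assert (M := Main (b0 + eta) ltac:(lra)). apply Rabs_le_between in M.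
    assert (PI / 16 * eta * sqrt (n s) <= n s ^ 2 * J * (A s / n s + C0 / c + sqrt c * (b0 + eta))); [|lra].
    rewrite <- NJ.
    assert (sqrt c * eta / 2 * (PI / 8 * sqrt (n s) / sqrt c) <= sqrt c * eta / 2 * (n s ^ 2 * J)) by (apply Rmult_le_compat_l; lra).
    assert (n s ^ 2 * J * (sqrt c * eta / 2) <= n s ^ 2 * J * (A s / n s + C0 / c + sqrt c * (b0 + eta))) by (apply Rmult_le_compat_l; lra).
    lra.
- exists s2, b. split; [lra|]. split; [auto|]. intros s Hs.
  destruct (Hb s Hs) as [Hb1 [Hb2 Hb3]]. split; [auto|]. split; [auto|].
  destruct (H s ltac:(lra)) as [S1 [S2 [HU [HJ [HC [HE [n0 [CF _]]]]]]]].
  destruct (asymmetry_estimate (F s) c K d (nu s) (A s) (B s) (C s) (E s) C0 d') as [PF [NF _]]; auto.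
  assert (Hbs : b0 - 1 <= b s <= b0 + 1) by (apply Rabs_def2 in Hb1; lra).
  destruct (Hg s (b s) (near1 _ Hbs)) as [U J].
  destruct (asymmetry_estimate (G s (b s)) 1 K e (nu s) (b s * nu s) (-1) 0 a0 0 e') as [PG [NG _]]; auto; try lra.
  { replace (0 - 0) with 0 by ring. rewrite Rabs_R0. apply Rmult_le_pos; [lra|apply Rabs_pos]. }
  { rewrite Rabs_R0; lra. }
  { apply g_Ck, open_Ioo. }
  fold (G s (b s)). unfold H0, asymmetry in Hb2. rewrite !koenigs_value_reflect in Hb2.
  set (kf := koenigs_value (F s) (1 + nu s) d') in *. set (kf' := koenigs_value (F s) (1 + nu s) (- d')) in *.
  set (kg := koenigs_value (G s (b s)) (1 + nu s) e') in *. set (kg' := koenigs_value (G s (b s)) (1 + nu s) (- e')) in *.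
  assert (ln (kf * - kg') = ln (kg * - kf')) by (rewrite !ln_mult by lra; lra).
  assert (kf * - kg' = kg * - kf') by (apply ln_inv; auto; apply Rmult_lt_0_compat; lra).
  lra.
Qed.

(** * The Taylor coefficients of the given family *)

Lemma is_derive_remainder u l x : is_derive u x l -> forall eps, 0 < eps ->
  exists del, 0 < del /\ forall t, Rabs (t - x) < del -> Rabs (u t - u x - l * (t - x)) <= eps * Rabs (t - x).
Proof.
intros D eps e0. apply is_derive_Reals in D. destruct (D eps e0) as [del Hdel].
exists del. split; [apply cond_pos|]. intros t Ht.
destruct (Req_dec t x) as [->|N].
- rewrite !Rminus_diag, Rmult_0_r, Rminus_0_r, Rabs_R0. lra.
- specialize (Hdel (t - x) ltac:(lra) Ht). replace (x + (t - x)) with t in Hdel by ring.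
  replace (u t - u x - l * (t - x)) with (((u t - u x) / (t - x) - l) * (t - x)) by (field; lra).
  rewrite Rabs_mult. apply Rmult_le_compat_r; [apply Rabs_pos|lra].
Qed.

Lemma is_derive_lipschitz_at u l x : is_derive u x l ->
  exists del, 0 < del /\ forall t, Rabs (t - x) < del -> Rabs (u t - u x) <= (Rabs l + 1) * Rabs (t - x).
Proof.
intros D. destruct (is_derive_remainder u l x D 1 Rlt_0_1) as [del [d0 H]].
exists del. split; auto. intros t Ht. specialize (H t Ht).
replace (u t - u x) with ((u t - u x - l * (t - x)) + l * (t - x)) by ring.
eapply Rle_trans; [apply Rabs_triang|]. rewrite (Rabs_mult l). lra.
Qed.

Section FromF.
Variables (r : nat) (U : R * R -> Prop) (f : R -> R -> R).
Hypothesis hr : (7 <= r)%nat.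
Hypothesis hU : open U.
Hypothesis hU0 : U (0, 0).
Hypothesis hf : C2d_on r U f.
Hypothesis hf0 : locally 0 (fun mu => f 0 mu = 0).
Hypothesis hfx : partial_derive 1 0 f 0 0 = 1.
Hypothesis hfxx : partial_derive 2 0 f 0 0 = 0.
Hypothesis hfxmu : 0 < partial_derive 1 1 f 0 0.
Hypothesis hfxxx : partial_derive 3 0 f 0 0 < 0.

Definition fmap (mu x : R) : R := f x mu.
Definition f_nu (mu : R) : R := Derive (fmap mu) 0 - 1.
Definition f_coef (k : nat) (mu : R) : R := coef (fmap mu) k.
Definition f_c : R := - f_coef 3 0.

Lemma f_coef_partial k mu : f_coef k mu = partial_derive k 0 f 0 mu / INR (fact k).
Proof. reflexivity. Qed.

Lemma f_coef_derive k mu : (k < r)%nat -> U (0, mu) ->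
  is_derive (f_coef k) mu (partial_derive k 1 f 0 mu / INR (fact k)).
Proof.
intros L H. apply (is_derive_ext (fun mu => / INR (fact k) * partial_derive k 0 f 0 mu)).
- intros t. rewrite f_coef_partial. unfold Rdiv. apply Rmult_comm.
- replace (partial_derive k 1 f 0 mu / INR (fact k)) with (/ INR (fact k) * partial_derive k 1 f 0 mu) by (unfold Rdiv; ring).
  apply is_derive_scal, (coef_is_derive r U f hr hU hf); auto.
Qed.

Lemma f_nu_derive mu : U (0, mu) -> is_derive f_nu mu (partial_derive 1 1 f 0 mu).
Proof.
intros H. rewrite <- (Rminus_0_r (partial_derive 1 1 f 0 mu)).
apply (is_derive_minus (fun mu => partial_derive 1 0 f 0 mu) (fun _ => 1)).
- apply (coef_is_derive r U f hr hU hf); auto. lia.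
- apply (is_derive_const 1).
Qed.

Lemma f_nu_0 : f_nu 0 = 0.
Proof. unfold f_nu. change (Derive (fmap 0) 0) with (partial_derive 1 0 f 0 0). lra. Qed.

Lemma f_coef2_0 : f_coef 2 0 = 0.
Proof. rewrite f_coef_partial, hfxx. unfold Rdiv; ring. Qed.

Lemma f_c_pos : 0 < f_c.
Proof. unfold f_c. rewrite f_coef_partial. simpl fact. simpl INR. lra. Qed.

(** The Taylor coefficients are Lipschitz in [mu], and [|mu|] is bounded by a multiple
    of [|nu|] because the derivative of [nu] at [0] is positive; so their variation is
    [O(nu)]. *)
Theorem f_unfolding : exists d K m, 0 < d <= 1 /\ 0 < m /\ 0 <= K /\
  forall mu, - m < mu < m ->
  (forall x, Ioo (- d) d x -> U (x, mu)) /\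
  Ck r (Ioo (- d) d) (fmap mu) /\
  unfolding (fmap mu) f_c K d (f_nu mu) (f_coef 2 mu) (f_coef 3 mu) /\
  jet5 (fmap mu) K d (f_nu mu) (f_coef 2 mu) (f_coef 3 mu) (f_coef 4 mu) (f_coef 5 mu) /\
  Rabs (f_coef 4 mu - f_coef 4 0) <= K * Rabs (f_nu mu) /\ Rabs (f_coef 5 mu) <= K /\
  (0 < mu -> 0 < f_nu mu) /\ (mu < 0 -> f_nu mu < 0).
Proof.
set (n1 := partial_derive 1 1 f 0 0) in *.
destruct (open_locally_2d U hU 0 0 hU0) as [dU HdU].
destruct (partial_continuous r U f hf 6 0 0 0 ltac:(lia) hU0 (mkposreal 1 Rlt_0_1)) as [d6 Hd6]. simpl in Hd6.
set (K6 := Rabs (partial_derive 6 0 f 0 0) + 1).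
destruct (locally_ball_lt 0 _ hf0) as [m0 [m00 Hm0]].
destruct (is_derive_remainder f_nu n1 0 (f_nu_derive 0 hU0) (n1 / 2) ltac:(lra)) as [m1 [m10 Hm1]].
assert (Lip : forall k, (k < r)%nat -> exists L del, 0 <= L /\ 0 < del /\
   forall t, Rabs t < del -> Rabs (f_coef k t - f_coef k 0) <= L * Rabs t).
{ intros k Hk. destruct (is_derive_lipschitz_at _ _ _ (f_coef_derive k 0 Hk hU0)) as [del [d0 Hd]].
  exists (Rabs (partial_derive k 1 f 0 0 / INR (fact k)) + 1), del.
  split; [generalize (Rabs_pos (partial_derive k 1 f 0 0 / INR (fact k))); lra|]. split; [auto|].
  intros t Ht. specialize (Hd t). rewrite Rminus_0_r in Hd. auto. }
destruct (Lip 2%nat ltac:(lia)) as [L2 [m2 [L20 [m20 Hm2]]]].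
destruct (Lip 3%nat ltac:(lia)) as [L3 [m3 [L30 [m30 Hm3]]]].
destruct (Lip 4%nat ltac:(lia)) as [L4 [m4 [L40 [m40 Hm4]]]].
destruct (Lip 5%nat ltac:(lia)) as [L5 [m5 [L50 [m50 Hm5]]]].
set (d := Rmin 1 (Rmin dU d6)).
assert (Hd : 0 < d /\ d <= 1 /\ d <= dU /\ d <= d6).
{ assert (a1 := cond_pos dU). assert (a2 := cond_pos d6). unfold d, Rmin. repeat destruct Rle_dec; lra. }
set (m := Rmin 1 (Rmin (Rmin dU d6) (Rmin (Rmin m0 m1) (Rmin (Rmin m2 m3) (Rmin m4 m5))))).
assert (Hm : 0 < m /\ m <= 1 /\ m <= dU /\ m <= d6 /\ m <= m0 /\ m <= m1 /\ m <= m2 /\ m <= m3 /\ m <= m4 /\ m <= m5).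
{ unfold m.
  assert (G : forall a b q, q <= Rmin a b -> q <= a /\ q <= b).
  { intros a b q Hq. generalize (Rmin_l a b) (Rmin_r a b). lra. }
  set (mm := Rmin 1 _).
  assert (P0 : 0 < mm) by (unfold mm; repeat apply Rmin_case; auto; lra).
  destruct (G 1 _ mm (Rle_refl _)) as [G1 G2]. destruct (G _ _ _ G2) as [G3 G4].
  destruct (G _ _ _ G3). destruct (G _ _ _ G4) as [G5 G6]. destruct (G _ _ _ G5). destruct (G _ _ _ G6) as [G7 G8].
  destruct (G _ _ _ G7). destruct (G _ _ _ G8). lra. }
set (Q := 2 / n1 * (L2 + L3 + L4)).
assert (Q0 : 0 <= Q).
{ unfold Q. apply Rmult_le_pos; [apply Rlt_le, Rdiv_lt_0_compat; lra|lra]. }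
set (C4 := Rabs (f_coef 4 0) + L4). set (C5 := Rabs (f_coef 5 0) + L5).
assert (C40 : 0 <= C4) by (unfold C4; generalize (Rabs_pos (f_coef 4 0)); lra).
assert (C50 : 0 <= C5) by (unfold C5; generalize (Rabs_pos (f_coef 5 0)); lra).
assert (K60 : 0 < K6) by (unfold K6; generalize (Rabs_pos (partial_derive 6 0 f 0 0)); lra).
set (K := K6 + 20 * C4 + 20 * C5 + Q).
exists d, K, m. split; [lra|]. split; [lra|]. split; [unfold K; lra|].
intros mu Hmu. assert (Amu : Rabs mu < m) by (apply Rabs_def1; lra).
assert (HU : forall x, Ioo (- d) d x -> U (x, mu)).
{ intros x [X1 X2]. apply HdU; rewrite Rminus_0_r; [apply Rabs_def1|]; lra. }
assert (CF : Ck r (Ioo (- d) d) (fmap mu)).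
{ apply (ex_diff_n_Ck r U f mu); auto using open_Ioo. }
assert (F0 : fmap mu 0 = 0) by (apply Hm0; rewrite Rminus_0_r; lra).
assert (B6 : forall x, Ioo (- d) d x -> Rabs (Derive_n (fmap mu) 6 x) <= K6).
{ intros x [X1 X2]. change (Derive_n (fmap mu) 6 x) with (partial_derive 6 0 f x mu).
  assert (Z := Hd6 x mu ltac:(rewrite Rminus_0_r; apply Rabs_def1; lra) ltac:(rewrite Rminus_0_r; lra)).
  unfold K6. replace (partial_derive 6 0 f x mu) with
    ((partial_derive 6 0 f x mu - partial_derive 6 0 f 0 0) + partial_derive 6 0 f 0 0) by ring.
  eapply Rle_trans; [apply Rabs_triang|]. lra. }
destruct (taylor_jets (fmap mu) d K6 r ltac:(lia) ltac:(lra) ltac:(lra) CF F0 B6) as [J T].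
assert (Nu : Rabs (f_nu mu - n1 * mu) <= n1 / 2 * Rabs mu).
{ generalize (Hm1 mu). rewrite f_nu_0, !Rminus_0_r. intros Z; apply Z; lra. }
assert (Nlow : n1 / 2 * Rabs mu <= Rabs (f_nu mu)).
{ assert (E : Rabs (n1 * mu) = n1 * Rabs mu) by (rewrite Rabs_mult, (Rabs_pos_eq n1); lra).
  replace (n1 * mu) with (- (f_nu mu - n1 * mu) + f_nu mu) in E by ring.
  assert (Z := Rabs_triang (- (f_nu mu - n1 * mu)) (f_nu mu)). rewrite Rabs_Ropp in Z. lra. }
assert (Mu : Rabs mu <= 2 / n1 * Rabs (f_nu mu)).
{ replace (Rabs mu) with (2 / n1 * (n1 / 2 * Rabs mu)) by (field; lra).
  apply Rmult_le_compat_l; auto. apply Rlt_le, Rdiv_lt_0_compat; lra. }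
assert (KQ : Q <= K) by (unfold K; lra).
assert (LB : forall L, 0 <= L -> L <= L2 + L3 + L4 -> L * Rabs mu <= K * Rabs (f_nu mu)).
{ intros L HL0 HL. apply Rle_trans with (L * (2 / n1 * Rabs (f_nu mu))); [apply Rmult_le_compat_l; auto|].
  apply Rle_trans with (Q * Rabs (f_nu mu)); [|apply Rmult_le_compat_r; auto using Rabs_pos].
  replace (L * (2 / n1 * Rabs (f_nu mu))) with (2 / n1 * L * Rabs (f_nu mu)) by ring.
  apply Rmult_le_compat_r; [apply Rabs_pos|]. unfold Q. apply Rmult_le_compat_l; auto.
  apply Rlt_le, Rdiv_lt_0_compat; lra. }
assert (c4 : Rabs (f_coef 4 mu) <= C4).
{ unfold C4. replace (f_coef 4 mu) with ((f_coef 4 mu - f_coef 4 0) + f_coef 4 0) by ring.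
  eapply Rle_trans; [apply Rabs_triang|]. specialize (Hm4 mu ltac:(lra)).
  assert (L4 * Rabs mu <= L4 * 1) by (apply Rmult_le_compat_l; lra). lra. }
assert (c5 : Rabs (f_coef 5 mu) <= C5).
{ unfold C5. replace (f_coef 5 mu) with ((f_coef 5 mu - f_coef 5 0) + f_coef 5 0) by ring.
  eapply Rle_trans; [apply Rabs_triang|]. specialize (Hm5 mu ltac:(lra)).
  assert (L5 * Rabs mu <= L5 * 1) by (apply Rmult_le_compat_l; lra). lra. }
destruct (T K) as [T1 [T2 [T3 T4]]].
{ change (coef (fmap mu) 4) with (f_coef 4 mu). change (coef (fmap mu) 5) with (f_coef 5 mu). unfold K. lra. }
split; [auto|]. split; [auto|]. split; [|split; [|split; [|split; [|split]]]].
- split; [auto|]. split; [auto|]. split; [auto|]. split; [auto|]. split.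
  + replace (f_coef 2 mu) with (f_coef 2 mu - f_coef 2 0) by (rewrite f_coef2_0; ring).
    eapply Rle_trans; [apply Hm2; lra|]. apply LB; lra.
  + replace (f_coef 3 mu + f_c) with (f_coef 3 mu - f_coef 3 0) by (unfold f_c; ring).
    eapply Rle_trans; [apply Hm3; lra|]. apply LB; lra.
- apply (jet5_weaken (fmap mu) K6 K d d); auto; [unfold K; lra|lra].
- eapply Rle_trans; [apply Hm4; lra|]. apply LB; lra.
- unfold K. lra.
- intros P. rewrite (Rabs_pos_eq mu) in Nu by lra. apply Rabs_le_between in Nu.
  assert (0 < n1 * mu) by (apply Rmult_lt_0_compat; lra). lra.
- intros P. rewrite (Rabs_left mu) in Nu by lra. apply Rabs_le_between in Nu.
  assert (0 < n1 * - mu) by (apply Rmult_lt_0_compat; lra). lra.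
Qed.

Lemma f_coef2_ratio : filterlim (fun mu => f_coef 2 mu / f_nu mu) (locally' 0)
  (locally (partial_derive 2 1 f 0 0 / (2 * partial_derive 1 1 f 0 0))).
Proof.
assert (D2 := f_coef_derive 2 0 ltac:(lia) hU0). assert (D1 := f_nu_derive 0 hU0).
assert (Quo : forall u l, is_derive u 0 l -> u 0 = 0 -> filterlim (fun t => u t / t) (locally' 0) (locally l)).
{ intros u l D Z. apply filterlim_locally. intros eps. apply is_derive_Reals in D.
  destruct (D eps (cond_pos eps)) as [del Hdel]. exists del. intros t Ht Nt.
  assert (Ht' : Rabs t < del) by (rewrite <- (Rminus_0_r t); exact Ht).
  specialize (Hdel t Nt Ht'). rewrite Rplus_0_l, Z, Rminus_0_r in Hdel. exact Hdel. }
assert (T2 := Quo _ _ D2 f_coef2_0). assert (T1 := Quo _ _ D1 f_nu_0).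
apply (filterlim_ext_loc (fun t => (f_coef 2 t / t) * / (f_nu t / t))).
- assert (Nz : locally' 0 (fun t => 0 < f_nu t / t)).
  { apply (T1 (fun y => 0 < y)). now apply (open_gt 0). }
  destruct Nz as [e He]. exists e. intros t Ht Nt. specialize (He t Ht Nt).
  assert (f_nu t <> 0) by (intros Z; rewrite Z in He; unfold Rdiv in He; rewrite Rmult_0_l in He; lra).
  field. auto.
- replace (partial_derive 2 1 f 0 0 / (2 * partial_derive 1 1 f 0 0)) with
    (partial_derive 2 1 f 0 0 / INR (fact 2) * / partial_derive 1 1 f 0 0) by (simpl fact; simpl INR; field; lra).
  eapply filterlim_comp_2; [exact T2| |apply (filterlim_mult (K := R_AbsRing))].
  apply (filterlim_comp _ _ _ _ Rinv _ _ _ T1).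
  apply continuous_Rinv; lra.
Qed.
End FromF.

(** * Choice of the neighbourhoods and of the parameter functions *)

(** A strict sign change of [F s y - y] on both sides of the fixed point persists for
    nearby parameters and encloses the fixed point. *)
Lemma zero_continuous (F : R -> R -> R) (x : R -> R) l q s0 :
  locally s0 (fun s => l < x s < q /\ F s (x s) = x s /\
    (forall y, l < y < x s -> y < F s y) /\ (forall y, x s < y < q -> F s y < y)) ->
  (forall y, l < y < q -> continuous (fun s => F s y) s0) -> continuous x s0.
Proof.
intros HL C. destruct (locally_singleton _ _ HL) as [X0 [X1 [X2 X3]]].
apply filterlim_locally. intros eps. assert (e0 := cond_pos eps).
set (e := Rmin (eps / 2) (Rmin ((x s0 - l) / 2) ((q - x s0) / 2))).
assert (He : 0 < e /\ e < eps /\ e < x s0 - l /\ e < q - x s0).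
{ unfold e, Rmin; repeat destruct Rle_dec; lra. }
clearbody e.
assert (L1 : locally s0 (fun s => x s0 - e < F s (x s0 - e))).
{ assert (P := X2 (x s0 - e) ltac:(lra)).
  apply (C (x s0 - e) ltac:(lra) (fun z => x s0 - e < z)). now apply (open_gt (x s0 - e)). }
assert (L2 : locally s0 (fun s => F s (x s0 + e) < x s0 + e)).
{ assert (P := X3 (x s0 + e) ltac:(lra)).
  apply (C (x s0 + e) ltac:(lra) (fun z => z < x s0 + e)). now apply (open_lt (x s0 + e)). }
generalize (filter_and _ _ HL (filter_and _ _ L1 L2)). apply filter_imp. intros s [[Y0 [Y1 [Y2 Y3]]] [S1 S2]].
unfold ball; simpl; unfold AbsRing_ball, abs, minus, plus, opp; simpl.
assert (x s0 - e < x s).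
{ apply Rnot_le_lt. intros [Z|Z]; [generalize (Y3 (x s0 - e)); lra|rewrite <- Z in S1; lra]. }
assert (x s < x s0 + e).
{ apply Rnot_le_lt. intros [Z|Z]; [generalize (Y2 (x s0 + e)); lra|rewrite Z in S2; lra]. }
apply Rabs_def1; lra.
Qed.

(** The parameter functions are constructed separately on the two sides of [mu = 0],
    with a common limit [q]. *)
Definition glue (up un : R -> R) (q mu : R) : R :=
  if Rlt_dec 0 mu then up mu else if Rlt_dec mu 0 then un (- mu) else q.

Lemma glue_pos up un q mu : 0 < mu -> glue up un q mu = up mu.
Proof. unfold glue. destruct Rlt_dec; lra. Qed.

Lemma glue_neg up un q mu : mu < 0 -> glue up un q mu = un (- mu).
Proof. unfold glue. repeat destruct Rlt_dec; lra. Qed.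

Lemma glue_0 up un q : glue up un q 0 = q.
Proof. unfold glue. repeat destruct Rlt_dec; lra. Qed.

Lemma glue_continuous up un q m : tends0 up q -> tends0 un q ->
  (forall s, 0 < s < m -> continuous up s) -> (forall s, 0 < s < m -> continuous un s) ->
  forall mu, - m < mu < m -> continuous (glue up un q) mu.
Proof.
intros Tp Tn Cp Cn mu Hmu. destruct (Rtotal_order mu 0) as [L|[L|L]].
- apply (continuous_ext_loc _ (fun mu => un (- mu))).
  + generalize (open_lt 0 mu L). apply filter_imp. intros y Hy. symmetry. now apply glue_neg.
  + apply (continuous_comp Ropp un); [|apply Cn; lra].
    apply (ex_derive_continuous Ropp mu). auto_derive. auto.
- subst mu. apply filterlim_locally. rewrite glue_0. intros eps.
  rewrite tends0_spec in Tp, Tn. destruct (Tp eps (cond_pos eps)) as [e1 [e10 E1]].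
  destruct (Tn eps (cond_pos eps)) as [e2 [e20 E2]].
  assert (m0 : 0 < Rmin e1 e2) by (apply Rmin_case; auto).
  exists (mkposreal _ m0). intros t Lt. unfold ball in *; simpl in *.
  unfold AbsRing_ball, abs, minus, plus, opp in *; simpl in *.
  assert (A1 := Rmin_l e1 e2). assert (A2 := Rmin_r e1 e2). apply Rabs_def2 in Lt.
  destruct (Rtotal_order t 0) as [T|[T|T]].
  + rewrite glue_neg by auto. apply E2. lra.
  + subst t. rewrite glue_0. replace (q + - q) with 0 by ring. rewrite Rabs_R0. apply cond_pos.
  + rewrite glue_pos by auto. apply E1. lra.
- apply (continuous_ext_loc _ up).
  + generalize (open_gt 0 mu L). apply filter_imp. intros y Hy. symmetry. now apply glue_pos.
  + apply Cp; lra.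
Qed.

Lemma tends0_pos_side (u : R -> R) l : filterlim u (locally' 0) (locally l) -> tends0 u l.
Proof.
intros H P HP. destruct (H P HP) as [e He]. exists e. intros t Ht Pt. apply He; auto. lra.
Qed.

Lemma tends0_neg_side (u : R -> R) l : filterlim u (locally' 0) (locally l) -> tends0 (fun s => u (- s)) l.
Proof.
intros H P HP. destruct (H P HP) as [e He]. exists e. intros t Ht Pt. apply He; [|lra].
unfold ball in *; simpl in *; unfold AbsRing_ball, abs, minus, plus, opp in *; simpl in *.
replace (- t + - 0) with (- (t + - 0)) by ring. now rewrite Rabs_Ropp.
Qed.

Lemma tends0_opp_arg (u : R -> R) l : continuous u 0 -> u 0 = l -> tends0 (fun s => u (- s)) l.
Proof.
intros C E. apply tends0_continuous; [|now rewrite Ropp_0].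
apply (continuous_comp Ropp u); [apply (ex_derive_continuous Ropp 0); auto_derive; auto | now rewrite Ropp_0].
Qed.

Lemma bistable_le n n' F d x2 x1 : (n <= n')%nat -> bistable n' F d x2 x1 -> bistable n F d x2 x1.
Proof.
intros L [H1 [H2 [H3 H4]]]. split; [auto|]. split; [auto|]. split; [|auto]. now apply (Ck_le n n').
Qed.

Lemma monostable_le n n' F d : (n <= n')%nat -> monostable n' F d -> monostable n F d.
Proof.
intros L [H1 [H2 H3]]. split; [auto|]. split; [|auto]. now apply (Ck_le n n').
Qed.

Definition small_bound (c K q : R) : R :=
  Rmin (Rmin (c / (8 * K ^ 2)) (/ (8 * K ^ 2))) q.

Lemma small_params_intro c K d nu q : 0 < c -> 1 <= K -> c <= K -> 0 < d ->
  d <= / 8 -> d <= / (8 * K) -> d <= c / (8 * K) -> Rabs nu < small_bound c K q ->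
  small_params c K d nu.
Proof.
intros c0 K1 cK d0 D1 D2 D3 Hn.
assert (B1 := Rlt_le_trans _ _ _ Hn (Rmin_l _ _)).
assert (B2 := Rlt_le_trans _ _ _ B1 (Rmin_l _ _)). assert (B3 := Rlt_le_trans _ _ _ B1 (Rmin_r _ _)).
assert (KK : K <= K ^ 2) by (simpl; nra).
assert (n0 := Rabs_pos nu).
apply Rlt_div_r in B2; [|lra].
assert (B3' : Rabs nu * (8 * K ^ 2) < 1).
{ apply Rmult_lt_compat_r with (r := 8 * K ^ 2) in B3; [|lra]. rewrite Rinv_l in B3 by lra. exact B3. }
assert (Kd : K * d <= 1 / 8).
{ apply Rmult_le_compat_l with (r := K) in D2; [|lra]. replace (K * / (8 * K)) with (1 / 8) in D2 by (field; lra). exact D2. }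
assert (Kd' : K * d <= c / 8).
{ apply Rmult_le_compat_l with (r := K) in D3; [|lra]. replace (K * (c / (8 * K))) with (c / 8) in D3 by (field; lra). exact D3. }
assert (Kn : K * Rabs nu <= K ^ 2 * Rabs nu) by (apply Rmult_le_compat_r; auto).
assert (n1 : Rabs nu <= K ^ 2 * Rabs nu) by nra.
repeat split; try lra.
replace (c * d ^ 2) with (c * d * d) by ring.
nra.
Qed.

Section Main.
Variables (r : nat) (U : R * R -> Prop) (f : R -> R -> R).
Hypothesis hr : (7 <= r)%nat.
Hypothesis hU : open U.
Hypothesis hU0 : U (0, 0).
Hypothesis hf : C2d_on r U f.
Hypothesis hf0 : locally 0 (fun mu => f 0 mu = 0).
Hypothesis hfx : partial_derive 1 0 f 0 0 = 1.
Hypothesis hfxx : partial_derive 2 0 f 0 0 = 0.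
Hypothesis hfxmu : 0 < partial_derive 1 1 f 0 0.
Hypothesis hfxxx : partial_derive 3 0 f 0 0 < 0.

Let nu := f_nu f.
Let c := f_c f.
Let C0 := f_coef f 4 0.
Let E0 := f_coef f 5 0.
Let al := partial_derive 2 1 f 0 0 / (2 * partial_derive 1 1 f 0 0).
Let a0 := E0 / c ^ 2 + C0 ^ 2 / c ^ 3.
Let b0 := sqrt (/ c) * (al - C0 / c).

(** One choice of radii and of parameter range for which all estimates hold for [f] and
    [g] together. The radius for [g] is [sqrt c * d'], since the scaling by [sqrt c]
    turns [- c x^3] into [- y^3]. *)
Definition uniform_data (K d e d' m : R) : Prop :=
  1 <= K /\ c <= K /\ 1 <= K * c /\ Rabs C0 <= K /\ 10 * (Rabs a0 + 1) <= K /\ Rabs b0 + 2 <= K /\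
  0 < d' < d /\ 0 < sqrt c * d' < e /\ 0 < e <= 1 / 2 /\ 0 < m /\
  forall mu, - m < mu < m ->
    small_params c K d (nu mu) /\ small_params 1 K e (nu mu) /\ Rabs (nu mu) < c * d' ^ 2 / 8 /\
    (forall x, Ioo (- d) d x -> U (x, mu)) /\
    Ck r (Ioo (- d) d) (fmap f mu) /\
    unfolding (fmap f mu) c K d (nu mu) (f_coef f 2 mu) (f_coef f 3 mu) /\
    jet5 (fmap f mu) K d (nu mu) (f_coef f 2 mu) (f_coef f 3 mu) (f_coef f 4 mu) (f_coef f 5 mu) /\
    Rabs (f_coef f 4 mu - C0) <= K * Rabs (nu mu) /\ Rabs (f_coef f 5 mu) <= K /\
    (0 < mu -> 0 < nu mu) /\ (mu < 0 -> nu mu < 0).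

Lemma uniform_data_exists : exists K d e d' m, uniform_data K d e d' m.
Proof.
assert (c0 : 0 < c) by (apply f_c_pos; auto).
destruct (f_unfolding r U f hr hU hU0 hf hf0 hfx hfxx hfxmu) as [d1 [K1 [m1 [Hd1 [m10 [K10 H]]]]]].
assert (sc := sqrt_lt_R0 _ c0). assert (ic : 0 < / c) by now apply Rinv_0_lt_compat.
set (K := 1 + K1 + c + / c + Rabs C0 + 10 * (Rabs a0 + 1) + (Rabs b0 + 2)).
assert (q1 := Rabs_pos C0). assert (q2 := Rabs_pos a0). assert (q3 := Rabs_pos b0).
assert (KK : 1 <= K /\ K1 <= K /\ c <= K /\ / c <= K /\ Rabs C0 <= K /\ 10 * (Rabs a0 + 1) <= K /\ Rabs b0 + 2 <= K).
{ unfold K. lra. }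
clearbody K. destruct KK as [k1 [k2 [k3 [k4 [k5 [k6 k7]]]]]].
assert (Kc : 1 <= K * c).
{ apply Rmult_le_compat_r with (r := c) in k4; [|lra]. rewrite Rinv_l in k4; lra. }
assert (i1 : 0 < / (8 * K)) by (apply Rinv_0_lt_compat; lra).
assert (i2 : 0 < c / (8 * K)) by (apply Rdiv_lt_0_compat; lra).
set (d := Rmin d1 (Rmin (/ 8) (Rmin (/ (8 * K)) (c / (8 * K))))).
assert (Hd : 0 < d /\ d <= d1 /\ d <= / 8 /\ d <= / (8 * K) /\ d <= c / (8 * K)).
{ unfold d, Rmin. repeat destruct Rle_dec; lra. }
set (e := Rmin (/ 8) (/ (8 * K))).
assert (He : 0 < e /\ e <= / 8 /\ e <= / (8 * K)) by (unfold e, Rmin; destruct Rle_dec; lra).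
clearbody d e.
set (d' := Rmin (d / 2) (e / (2 * sqrt c))).
assert (Hd' : 0 < d' /\ d' < d /\ sqrt c * d' < e).
{ assert (i3 : 0 < e / (2 * sqrt c)) by (apply Rdiv_lt_0_compat; lra).
  assert (a1 := Rmin_l (d / 2) (e / (2 * sqrt c))). assert (a2 := Rmin_r (d / 2) (e / (2 * sqrt c))). fold d' in a1, a2.
  split; [apply Rmin_case; lra|]. split; [lra|].
  apply Rmult_le_compat_l with (r := sqrt c) in a2; [|lra].
  replace (sqrt c * (e / (2 * sqrt c))) with (e / 2) in a2 by (field; lra). lra. }
clearbody d'.
set (q := c * d' ^ 2 / 8). assert (q0 : 0 < q).
{ unfold q. assert (0 < c * d' ^ 2) by (apply Rmult_lt_0_compat; auto; apply pow_lt; lra). lra. }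
set (w := Rmin (small_bound c K q) (small_bound 1 K q)).
assert (K20 : 0 < 8 * K ^ 2) by (assert (0 < K ^ 2) by (apply pow_lt; lra); lra).
assert (w0 : 0 < w).
{ unfold w, small_bound. repeat apply Rmin_case; auto; try (apply Rdiv_lt_0_compat; lra); apply Rinv_0_lt_compat; lra. }
assert (Cn : continuous nu 0).
{ apply (ex_derive_continuous nu 0). eexists. apply (f_nu_derive r U f hr hU hf 0 hU0). }
assert (Ln : locally 0 (fun mu => Rabs (nu mu) < w)).
{ generalize (proj1 (filterlim_locally _ _) Cn (mkposreal w w0)). apply filter_imp. intros mu Hm.
  unfold ball in Hm; simpl in Hm; unfold AbsRing_ball, abs, minus, plus, opp in Hm; simpl in Hm.
  unfold nu in Hm at 2. rewrite (f_nu_0 f hfx), Ropp_0, Rplus_0_r in Hm. exact Hm. }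
destruct (locally_ball_lt 0 _ Ln) as [m2 [m20 Hm2]].
assert (a1 := Rmin_l m1 m2). assert (a2 := Rmin_r m1 m2).
exists K, d, e, d', (Rmin m1 m2).
assert (sd : 0 < sqrt c * d') by (apply Rmult_lt_0_compat; lra).
assert (m0 : 0 < Rmin m1 m2) by (apply Rmin_case; auto).
do 6 (split; [lra|]). split; [lra|]. split; [lra|]. split; [lra|]. split; [lra|].
intros mu Hmu. destruct (H mu ltac:(lra)) as [H1 [H2 [H3 [H4 [H5 [H6 [H7 H8]]]]]]].
assert (B := Hm2 mu ltac:(rewrite Rminus_0_r; apply Rabs_def1; lra)). cbv beta in B.
assert (B1 := Rlt_le_trans _ _ _ B (Rmin_l _ _)). assert (B2 := Rlt_le_trans _ _ _ B (Rmin_r _ _)).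
assert (B3 := Rlt_le_trans _ _ _ B1 (Rmin_r _ _)).
assert (I : forall x, Ioo (- d) d x -> Ioo (- d1) d1 x) by (unfold Ioo; intros; lra).
split; [now apply (small_params_intro c K d (nu mu) q)|].
split; [apply (small_params_intro 1 K e (nu mu) q); auto; try lra; unfold Rdiv; lra|].
split; [exact B3|]. split; [auto|].
split; [apply (Ck_sub _ (Ioo (- d1) d1)); auto|].
split; [apply (unfolding_weaken _ c K1 K d1 d); auto; lra|].
split; [apply (jet5_weaken _ K1 K d1 d); auto; lra|].
split; [|split; [lra|auto]].
eapply Rle_trans; [exact H5|]. apply Rmult_le_compat_r; [apply Rabs_pos|auto].
Qed.

Section WithData.
Variables (K d e d' m : R).
Hypothesis HD : uniform_data K d e d' m.
Let e' := sqrt c * d'.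
Let N := Ioo (- d') d'.
Let M := Ioo (- e') e'.

Lemma leading_coefficient_pos : 0 < c.
Proof. apply f_c_pos; auto. Qed.

Lemma uniform_at mu : - m < mu < m ->
    small_params c K d (nu mu) /\ small_params 1 K e (nu mu) /\ Rabs (nu mu) < c * d' ^ 2 / 8 /\
    (forall x, Ioo (- d) d x -> U (x, mu)) /\
    Ck r (Ioo (- d) d) (fmap f mu) /\
    unfolding (fmap f mu) c K d (nu mu) (f_coef f 2 mu) (f_coef f 3 mu) /\
    jet5 (fmap f mu) K d (nu mu) (f_coef f 2 mu) (f_coef f 3 mu) (f_coef f 4 mu) (f_coef f 5 mu) /\
    Rabs (f_coef f 4 mu - C0) <= K * Rabs (nu mu) /\ Rabs (f_coef f 5 mu) <= K /\
    (0 < mu -> 0 < nu mu) /\ (mu < 0 -> nu mu < 0).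
Proof. apply HD. Qed.

Lemma axis_in_domain mu : - m < mu < m -> U (0, mu).
Proof. intros H. apply (uniform_at mu H). destruct HD as [_ [_ [_ [_ [_ [_ [Hd _]]]]]]]. unfold Ioo; lra. Qed.

Lemma f_nu_continuous mu : - m < mu < m -> continuous nu mu.
Proof.
intros H. apply (ex_derive_continuous nu mu). eexists. apply (f_nu_derive r U f hr hU hf mu), axis_in_domain, H.
Qed.

Lemma f_coef_continuous k mu : (k < r)%nat -> - m < mu < m -> continuous (f_coef f k) mu.
Proof.
intros L H. apply (ex_derive_continuous (f_coef f k) mu). eexists. apply (f_coef_derive r U f hr hU hf k mu L), axis_in_domain, H.
Qed.

Lemma g_uniform mu a b : - m < mu < m -> Rabs (a - a0) <= 1 -> Rabs (b - b0) <= 2 ->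
  unfolding (fun y => g y (nu mu) a b) 1 K e (nu mu) (b * nu mu) (-1) /\
  jet5 (fun y => g y (nu mu) a b) K e (nu mu) (b * nu mu) (-1) 0 a.
Proof.
intros H Ha Hb. destruct HD as [K1 [_ [_ [_ [Ka [Kb [_ [_ [He _]]]]]]]]].
apply g_unfolding; auto; try lra.
- replace a with ((a - a0) + a0) by ring. generalize (Rabs_triang (a - a0) a0). lra.
- replace b with ((b - b0) + b0) by ring. generalize (Rabs_triang (b - b0) b0). lra.
Qed.

Lemma negative_matching : exists s2 b, 0 < s2 <= m /\ tends0 b b0 /\
  forall s, 0 < s < s2 -> Rabs (b s - b0) < 1 /\ continuous b s /\
    koenigs_value (fmap f (- s)) (1 + nu (- s)) d' * koenigs_value (fun y => g y (nu (- s)) a0 (b s)) (1 + nu (- s)) (- e') =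
    koenigs_value (fun y => g y (nu (- s)) a0 (b s)) (1 + nu (- s)) e' * koenigs_value (fmap f (- s)) (1 + nu (- s)) (- d').
Proof.
assert (HD' := HD). destruct HD' as [K1 [cK [Kc [KC [Ka [Kb [Hd [He' [He [m0 Hmu]]]]]]]]]].
apply (asymmetry_matching (fun s => fmap f (- s)) (fun s => nu (- s)) (fun s => f_coef f 2 (- s))
  (fun s => f_coef f 3 (- s)) (fun s => f_coef f 4 (- s)) (fun s => f_coef f 5 (- s)) c K d d' e al C0 a0 m); auto; try lra.
- intros s Hs. assert (Ms : - m < - s < m) by lra.
  destruct (Hmu (- s) Ms) as [H1 [H2 [H3 [H4 [H5 [H6 [H7 [H8 [H9 [H10 H11]]]]]]]]]].
  split; [auto|]. split; [auto|]. split; [auto|]. split; [auto|]. split; [auto|]. split; [auto|].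
  split; [apply H11; lra|]. split; [apply (Ck_le 2 r); auto; lia|]. split.
  + apply (continuous_comp Ropp nu); [apply (ex_derive_continuous Ropp s); auto_derive; auto | now apply f_nu_continuous].
  + intros x Hx eps. destruct (partial_continuous r U f hf 0 0 x (- s) ltac:(lia) (H4 x Hx) eps) as [del Hdel].
    exists del. intros u v Hu Hv. unfold fmap. apply Hdel; auto.
    replace (- u - - s) with (- (u - s)) by ring. now rewrite Rabs_Ropp.
- apply tends0_opp_arg; [apply f_nu_continuous; lra|]. apply f_nu_0; auto.
- apply (tends0_neg_side (fun mu => f_coef f 2 mu / nu mu)).
  apply (f_coef2_ratio r U f hr hU hU0 hf hfx hfxx hfxmu).
Qed.

Lemma scaled_radius_sq : e' ^ 2 = c * d' ^ 2.
Proof.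
unfold e'. rewrite Rpow_mult_distr, <- (Rsqr_pow2 (sqrt c)), Rsqr_sqrt; auto. left; apply leading_coefficient_pos.
Qed.

Lemma f_bistable mu : 0 < mu < m -> exists x2 x1, bistable r (fmap f mu) d x2 x1 /\ - d' < x2 /\ x1 < d' /\
  Derive (fmap f mu) x1 < 1 /\ Derive (fmap f mu) x2 < 1.
Proof.
intros H. assert (HD' := HD). destruct HD' as [_ [_ [_ [_ [_ [_ [Hd _]]]]]]].
destruct (uniform_at mu ltac:(lra)) as [H1 [H2 [H3 [H4 [H5 [H6 [H7 [H8 [H9 [H10 H11]]]]]]]]]].
specialize (H10 ltac:(lra)). rewrite (Rabs_pos_eq (nu mu)) in H3 by lra.
assert (0 < c * d' ^ 2) by (apply Rmult_lt_0_compat; [apply leading_coefficient_pos | apply pow_lt; lra]).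
apply (unfolding_pitch_pos r (fmap f mu) c K d (nu mu) (f_coef f 2 mu) (f_coef f 3 mu) d'); auto. lra.
Qed.

Lemma g_bistable mu a b : 0 < mu < m -> Rabs (a - a0) <= 1 -> Rabs (b - b0) <= 2 ->
  exists y2 y1, bistable r (fun y => g y (nu mu) a b) e y2 y1 /\ - e' < y2 /\ y1 < e' /\
  Derive (fun y => g y (nu mu) a b) y1 < 1 /\ Derive (fun y => g y (nu mu) a b) y2 < 1.
Proof.
intros H Ha Hb. assert (HD' := HD). destruct HD' as [_ [_ [_ [_ [_ [_ [Hd [He' _]]]]]]]].
destruct (uniform_at mu ltac:(lra)) as [H1 [H2 [H3 [H4 [H5 [H6 [H7 [H8 [H9 [H10 H11]]]]]]]]]].
specialize (H10 ltac:(lra)). rewrite (Rabs_pos_eq (nu mu)) in H3 by lra.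
destruct (g_uniform mu a b ltac:(lra) Ha Hb) as [UG _].
apply (unfolding_pitch_pos r _ 1 K e (nu mu) (b * nu mu) (-1) e'); auto.
- rewrite scaled_radius_sq. lra.
- apply g_Ck, open_Ioo.
Qed.

Definition fix_pair (mu : R) (p : R * R) : Prop :=
  bistable r (fmap f mu) d (fst p) (snd p) /\ - d' < fst p /\ snd p < d' /\
  Derive (fmap f mu) (snd p) < 1 /\ Derive (fmap f mu) (fst p) < 1.

Definition fix_points (mu : R) : R * R := epsilon (inhabits (0, 0)) (fix_pair mu).
Definition left_fixed (mu : R) : R := fst (fix_points mu).
Definition right_fixed (mu : R) : R := snd (fix_points mu).

Lemma fixed_points_spec mu : 0 < mu < m -> bistable r (fmap f mu) d (left_fixed mu) (right_fixed mu) /\ - d' < left_fixed mu /\ right_fixed mu < d' /\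
  Derive (fmap f mu) (right_fixed mu) < 1 /\ Derive (fmap f mu) (left_fixed mu) < 1.
Proof.
intros H. apply (epsilon_spec (inhabits (0, 0)) (fix_pair mu)).
destruct (f_bistable mu H) as [x2 [x1 P]]. exists (x2, x1). exact P.
Qed.

Lemma fixed_points_continuous mu : 0 < mu < m -> continuous right_fixed mu /\ continuous left_fixed mu.
Proof.
intros H. assert (L := open_locally (Ioo 0 m) mu (open_Ioo 0 m) H).
assert (Cf : forall y, Ioo (- d) d y -> continuous (fun s => fmap f s y) mu).
{ intros y Hy. destruct (uniform_at mu ltac:(lra)) as [_ [_ [_ [HU _]]]].
  assert (C := partial_continuous r U f hf 0 0 y mu ltac:(lia) (HU y Hy)).
  apply filterlim_locally. intros eps. destruct (C eps) as [del Hdel]. exists del. intros s Hs.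
  apply Hdel; [rewrite Rminus_diag, Rabs_R0; apply cond_pos|exact Hs]. }
assert (HP : forall s, Ioo 0 m s -> bistable r (fmap f s) d (left_fixed s) (right_fixed s)) by (intros s Hs; apply fixed_points_spec, Hs).
split.
- apply (zero_continuous (fmap f) right_fixed 0 d).
  + revert L. apply filter_imp. intros s Hs.
    destruct (HP s Hs) as [P1 [P2 [P3 [P4 [P5 [P6 [P7 [P8 [P9 [P10 P11]]]]]]]]]]. auto.
  + intros y Hy. apply Cf. unfold Ioo; lra.
- apply (zero_continuous (fmap f) left_fixed (- d) 0).
  + revert L. apply filter_imp. intros s Hs.
    destruct (HP s Hs) as [P1 [P2 [P3 [P4 [P5 [P6 [P7 [P8 [P9 [P10 P11]]]]]]]]]]. auto.
  + intros y Hy. apply Cf. unfold Ioo; lra.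
Qed.

Lemma multiplier_offset_continuous (x : R -> R) mu : 0 < mu < m -> continuous x mu -> Ioo (- d) d (x mu) ->
  continuous (fun s => 1 - Derive (fmap f s) (x s) - nu s) mu.
Proof.
intros H Cx Hx. destruct (uniform_at mu ltac:(lra)) as [_ [_ [_ [HU _]]]].
assert (C := partial_continuous r U f hf 1 0 (x mu) mu ltac:(lia) (HU _ Hx)).
apply (continuous_minus (fun s => 1 - Derive (fmap f s) (x s)) nu); [|apply f_nu_continuous; lra].
apply (continuous_minus (fun _ => 1) (fun s => Derive (fmap f s) (x s))); [apply continuous_const|].
apply filterlim_locally. intros eps. destruct (C eps) as [del Hdel].
assert (N1 := proj1 (filterlim_locally _ _) Cx del).
assert (N2 : locally mu (fun s => Rabs (s - mu) < del)) by (exists del; auto).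
generalize (filter_and _ _ N1 N2). apply filter_imp. intros s [S1 S2]. apply (Hdel (x s) s); auto.
Qed.

Lemma positive_matching : exists s2 a b, 0 < s2 <= m /\ tends0 a a0 /\ tends0 b b0 /\
  forall s, 0 < s < s2 -> Rabs (a s - a0) < 1 /\ Rabs (b s - b0) < 1 /\ continuous a s /\ continuous b s /\
    exists y1 y2, 0 < y1 /\ 0 < y2 /\ y1 ^ 2 <= 6 * nu s /\ y2 ^ 2 <= 6 * nu s /\
    g y1 (nu s) (a s) (b s) = y1 /\
    Derive (fun y => g y (nu s) (a s) (b s)) y1 = Derive (fmap f s) (right_fixed s) /\
    g (- y2) (nu s) (a s) (b s) = - y2 /\
    Derive (fun y => g y (nu s) (a s) (b s)) (- y2) = Derive (fmap f s) (left_fixed s).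
Proof.
assert (m0 : 0 < m) by apply HD. assert (c0 := leading_coefficient_pos).
set (n1 := fun s => 1 - Derive (fmap f s) (right_fixed s) - nu s).
set (n2 := fun s => 1 - Derive (fmap f s) (left_fixed s) - nu s).
assert (Tnu : tends0 nu 0) by (apply tends0_continuous; [apply f_nu_continuous; lra | apply f_nu_0; auto]).
assert (TA : tends0 (fun s => f_coef f 2 s / nu s) al).
{ apply tends0_pos_side, (f_coef2_ratio r U f hr hU hU0 hf hfx hfxx hfxmu). }
assert (TB : tends0 (f_coef f 3) (- c)).
{ apply tends0_continuous; [apply f_coef_continuous; [lia|lra]|]. unfold c, f_c. ring. }
assert (TC : tends0 (f_coef f 4) C0) by (apply tends0_continuous; [apply f_coef_continuous; [lia|lra]|reflexivity]).
assert (TE : tends0 (f_coef f 5) E0) by (apply tends0_continuous; [apply f_coef_continuous; [lia|lra]|reflexivity]).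
destruct (multiplier_asymptotics (fmap f) right_fixed left_fixed nu (f_coef f 2) (f_coef f 3) (f_coef f 4) (f_coef f 5)
  c K d m al C0 E0) as [Te1 [Te2 TS]]; auto.
{ intros s Hs. destruct (uniform_at s ltac:(lra)) as [H1 [H2 [H3 [H4 [H5 [H6 [H7 [H8 [H9 [H10 H11]]]]]]]]]].
  destruct (fixed_points_spec s Hs) as [[P1 [P2 [P3 [P4 [P5 [P6 [P7 P8]]]]]]] _].
  split; [auto|]. split; [auto|]. split; [auto|]. split; [apply H10; lra|]. auto. }
destruct (multiplier_matching nu n1 n2 m b0 ((al + C0 / c) / c * (al - 3 * C0 / c) - 4 * E0 / c ^ 2) m0)
  with (a0 := a0) as [s2 [a [b [Hs2 [Ta [Tb Hab]]]]]]; auto.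
- intros s Hs. apply (uniform_at s ltac:(lra)). lra.
- intros s Hs. apply f_nu_continuous. lra.
- intros s Hs. destruct (fixed_points_spec s Hs) as [[P1 [P2 _]] _]. apply multiplier_offset_continuous; auto.
  + now apply fixed_points_continuous.
  + unfold Ioo; lra.
- intros s Hs. destruct (fixed_points_spec s Hs) as [[P1 [P2 _]] _]. apply multiplier_offset_continuous; auto.
  + now apply fixed_points_continuous.
  + unfold Ioo; lra.
- unfold a0, b0. rewrite Rpow_mult_distr, <- (Rsqr_pow2 (sqrt _)), Rsqr_sqrt by (left; now apply Rinv_0_lt_compat).
  field. lra.
- assert (Nb : at_right 0 (fun s => Rabs (b s - b0) < 1)).
  { rewrite tends0_spec in Tb. apply near0_spec. apply Tb. lra. }
  apply near0_spec in Nb. destruct Nb as [s3 [s30 Nb]].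
  assert (a1 := Rmin_l s2 s3). assert (a2 := Rmin_r s2 s3).
  exists (Rmin s2 s3), a, b. split; [split; [apply Rmin_case; lra|lra]|]. split; [auto|]. split; [auto|].
  intros s Hs. destruct (Hab s ltac:(lra)) as [A1 [A2 [A3 [y1 [y2 [B1 [B2 [B3 [B4 [B5 [B6 [B7 B8]]]]]]]]]]]].
  split; [auto|]. split; [apply Nb; lra|]. split; [auto|]. split; [auto|].
  exists y1, y2. unfold n1 in B6. unfold n2 in B8. repeat (split; [auto; lra|]). lra.
Qed.

Lemma conjugate_positive mu a b y1 y2 : 0 < mu < m -> Rabs (a - a0) <= 1 -> Rabs (b - b0) <= 2 ->
  0 < y1 -> 0 < y2 -> y1 ^ 2 <= 6 * nu mu -> y2 ^ 2 <= 6 * nu mu ->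
  g y1 (nu mu) a b = y1 ->
  Derive (fun y => g y (nu mu) a b) y1 = Derive (fmap f mu) (right_fixed mu) ->
  g (- y2) (nu mu) a b = - y2 ->
  Derive (fun y => g y (nu mu) a b) (- y2) = Derive (fmap f mu) (left_fixed mu) ->
  conjugate_on_basins (r - 1) (fmap f mu) N (fun y => g y (nu mu) a b) M.
Proof.
intros H Ha Hb p1 p2 q1 q2 E1 D1 E2 D2. assert (HD' := HD). destruct HD' as [_ [_ [_ [_ [_ [_ [Hd [He _]]]]]]]].
destruct (uniform_at mu ltac:(lra)) as [S1 [S2 [S3 [_ [_ [UF [_ [_ [_ [Sp _]]]]]]]]]].
destruct (g_uniform mu a b ltac:(lra) Ha Hb) as [UG _].
specialize (Sp ltac:(lra)). rewrite Rabs_pos_eq in S3 by lra.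
destruct (fixed_points_spec mu H) as [PF [F2 [F1 [L1 L2]]]].
destruct (g_bistable mu a b H Ha Hb) as [z2 [z1 [PG [G2 [G1 _]]]]].
fold e' in He, G2, G1. assert (Ee := scaled_radius_sq).
replace (r - 1)%nat with (S (S (r - 3))) by lia.
apply (bistable_le (S (S (r - 3)))) in PF; [|lia].
apply (bistable_le (S (S (r - 3)))) in PG; [|lia].
assert (ze : z1 < e' /\ - e' < z2 /\ e' < e) by lra.
assert (small : forall y, 0 < y -> y ^ 2 <= 6 * nu mu -> y < e') by (intros y Y1 Y2; nra).
assert (B1 := small y1 p1 q1). assert (B2 := small y2 p2 q2).
assert (Z := bistable_fixed _ _ _ _ _ PG e' ze).
destruct PG as [PG1 [PG2 PG']].
assert (Y1 : z1 = y1).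
{ assert (X : fixed_in (fun y => g y (nu mu) a b) (Ioo (- e') e') y1) by (split; [unfold Ioo; lra|exact E1]).
  apply Z in X. lra. }
assert (Y2 : z2 = - y2).
{ assert (X : fixed_in (fun y => g y (nu mu) a b) (Ioo (- e') e') (- y2)) by (split; [unfold Ioo; lra|exact E2]).
  apply Z in X. lra. }
assert (PG : bistable (S (S (r - 3))) (fun y => g y (nu mu) a b) e z2 z1) by (split; auto).
subst z1 z2.
assert (MF := unfolding_multiplier0 _ _ _ _ _ _ _ S1 UF). assert (MG := unfolding_multiplier0 _ _ _ _ _ _ _ S2 UG).
apply (bistable_conjugate _ _ d (left_fixed mu) (right_fixed mu) _ e (- y2) y1); auto; try lra.
Qed.

Lemma conjugate_negative mu b : - m < mu < 0 -> Rabs (b - b0) <= 2 ->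
  koenigs_value (fmap f mu) (1 + nu mu) d' * koenigs_value (fun y => g y (nu mu) a0 b) (1 + nu mu) (- e') =
  koenigs_value (fun y => g y (nu mu) a0 b) (1 + nu mu) e' * koenigs_value (fmap f mu) (1 + nu mu) (- d') ->
  conjugate_on_basins (r - 1) (fmap f mu) N (fun y => g y (nu mu) a0 b) M.
Proof.
intros H Hb Kv. assert (HD' := HD). destruct HD' as [_ [_ [_ [_ [_ [_ [Hd [He [_ [m0 _]]]]]]]]]].
fold e' in He.
destruct (uniform_at mu ltac:(lra)) as [S1 [S2 [_ [_ [CF [UF [_ [_ [_ [_ Sn]]]]]]]]]].
destruct (g_uniform mu a0 b ltac:(lra)) as [UG _]; auto. { rewrite Rminus_diag, Rabs_R0; lra. }
specialize (Sn ltac:(lra)).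
assert (MF := unfolding_multiplier0 _ _ _ _ _ _ _ S1 UF). assert (MG := unfolding_multiplier0 _ _ _ _ _ _ _ S2 UG).
fold nu in MF.
replace (r - 1)%nat with (S (S (r - 3))) by lia.
apply (monostable_conjugate _ _ d _ e); auto.
- apply (monostable_le _ r); [lia|]. apply (unfolding_pitch_neg _ _ _ _ _ _ _ _ S1 UF); auto.
- apply (unfolding_pitch_neg _ _ _ _ _ _ _ _ S2 UG); auto. apply g_Ck, open_Ioo.
- now rewrite MF, MG.
- rewrite MF; lra.
- rewrite MF, MG. exact Kv.
Qed.

Lemma conjugate_zero : exists h, C_conjugacy 1 (fmap f 0) N (fun y => g y (nu 0) a0 b0) M h.
Proof.
assert (HD' := HD). destruct HD' as [_ [_ [_ [_ [_ [_ [Hd [He [_ [m0 _]]]]]]]]]].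
fold e' in He.
destruct (uniform_at 0 ltac:(lra)) as [S1 [S2 [_ [_ [CF [UF _]]]]]].
destruct (g_uniform 0 a0 b0 ltac:(lra)) as [UG _]; try (rewrite Rminus_diag, Rabs_R0; lra).
assert (n0 : nu 0 = 0) by now apply f_nu_0.
assert (A0 : f_coef f 2 0 = 0) by now apply f_coef2_0.
assert (B0 : f_coef f 3 0 = - c) by (unfold c, f_c; ring).
rewrite n0 in S1, S2, UF, UG |- *. rewrite A0, B0 in UF. rewrite Rmult_0_r in UG.
apply (Ck_le 1) in CF; [|lia].
assert (CG : Ck 1 (Ioo (- e) e) (fun y => g y 0 a0 b0)) by apply g_Ck, open_Ioo.
assert (RF := unfolding_reflect _ _ _ _ _ _ _ UF). assert (RG := unfolding_reflect _ _ _ _ _ _ _ UG).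
rewrite Ropp_0 in RF, RG.
apply (parabolic_conjugacy _ d c K _ e 1 K).
- apply (unfolding_fixes0 _ _ _ _ _ _ _ S1 UF).
- apply (unfolding_fixes0 _ _ _ _ _ _ _ S2 UG).
- now apply unfolding_parabolic.
- apply (unfolding_parabolic (reflect (fmap f 0))); auto. now apply reflect_Ck.
- now apply unfolding_parabolic.
- apply (unfolding_parabolic (reflect (fun y => g y 0 a0 b0))); auto. now apply reflect_Ck.
- unfold Ioo; lra.
- unfold Ioo; lra.
Qed.

Lemma fixed_points_negative mu : - m < mu < 0 ->
  (forall x, fixed_in (fmap f mu) N x <-> x = 0) /\ stable (fmap f mu) 0.
Proof.
intros H. assert (HD' := HD). destruct HD' as [_ [_ [_ [_ [_ [_ [Hd [He [_ [m0 _]]]]]]]]]].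
destruct (uniform_at mu ltac:(lra)) as [S1 [S2 [_ [_ [CF [UF [_ [_ [_ [_ Sn]]]]]]]]]].
assert (P : monostable 1 (fmap f mu) d).
{ apply (unfolding_pitch_neg _ _ _ _ _ _ _ _ S1 UF); [apply Sn; lra|apply (Ck_le 1 r); auto; lia]. }
split; [now apply (monostable_fixed 0 _ d)|].
apply (attracting_stable _ (- d) 0 d), (monostable_attracting 0), P.
Qed.

Lemma fixed_points_positive mu : 0 < mu < m -> exists x1 x2,
  x1 <> 0 /\ x2 <> 0 /\ x1 <> x2 /\
  (forall x, fixed_in (fmap f mu) N x <-> x = 0 \/ x = x1 \/ x = x2) /\
  unstable (fmap f mu) 0 /\ stable (fmap f mu) x1 /\ stable (fmap f mu) x2.
Proof.
intros H. assert (HD' := HD). destruct HD' as [_ [_ [_ [_ [_ [_ [Hd _]]]]]]].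
destruct (fixed_points_spec mu H) as [P [F2 [F1 _]]]. apply (bistable_le 1) in P; [|lia].
exists (right_fixed mu), (left_fixed mu). assert (P' := P). destruct P' as [P1 [P2 _]].
split; [lra|]. split; [lra|]. split; [lra|].
split; [apply (bistable_fixed 0 _ d _ _ P); lra|].
split; [apply (bistable_unstable 0 _ d _ _ P)|].
split; [apply (bistable_stable_right 0 _ d _ _ P)|apply (bistable_stable_left 0 _ d _ _ P)].
Qed.

Lemma f_nu_C1 m' : m' <= m -> C_on 1 (fun mu => - m' < mu < m') nu.
Proof.
intros L. assert (O : open (fun mu => - m' < mu < m')) by apply (open_Ioo (- m') m').
apply Ck_C_on; auto. apply (Ck_intro 0 _ nu (fun mu => partial_derive 1 1 f 0 mu)); auto.
- intros mu Hmu. apply (f_nu_derive r U f); auto. apply axis_in_domain. lra.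
- intros mu Hmu.
  assert (C := partial_continuous r U f hf 1 1 0 mu ltac:(lia) (axis_in_domain mu ltac:(lra))).
  apply filterlim_locally. intros eps. destruct (C eps) as [del Hdel]. exists del. intros s Hs.
  apply Hdel; [rewrite Rminus_diag, Rabs_R0; apply cond_pos|exact Hs].
Qed.

Lemma a0_formula : a0 = 3 * partial_derive 5 0 f 0 0 / (10 * partial_derive 3 0 f 0 0 ^ 2)
            - 3 * partial_derive 4 0 f 0 0 ^ 2 / (8 * partial_derive 3 0 f 0 0 ^ 3).
Proof.
unfold a0, c, f_c, C0, E0. rewrite !f_coef_partial. simpl fact. rewrite !INR_IZR_INZ. simpl IZR.
field. lra.
Qed.

Lemma b0_formula : b0 = sqrt (6 / - partial_derive 3 0 f 0 0)
            * (partial_derive 4 0 f 0 0 / (4 * partial_derive 3 0 f 0 0)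
               + partial_derive 2 1 f 0 0 / (2 * partial_derive 1 1 f 0 0)).
Proof.
unfold b0, c, f_c, C0, al. rewrite !f_coef_partial. simpl fact. rewrite !INR_IZR_INZ. simpl IZR.
f_equal; [f_equal|]; field; lra.
Qed.

(** For [mu < 0] there is only one condition to satisfy, and [a] can be kept equal to
    its value at [0]. *)
Lemma parameter_functions_exist : exists mu0 a b, 0 < mu0 <= m /\
  (forall mu, - mu0 < mu < mu0 -> continuous a mu) /\ (forall mu, - mu0 < mu < mu0 -> continuous b mu) /\
  a 0 = a0 /\ b 0 = b0 /\
  forall mu, - mu0 < mu < mu0 -> mu <> 0 ->
    conjugate_on_basins (r - 1) (fmap f mu) N (fun y => g y (nu mu) (a mu) (b mu)) M.
Proof.
destruct negative_matching as [sn [bn [Sn [Tn Hn]]]].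
destruct positive_matching as [sp [ap [bp [Sp [Ta [Tb Hp]]]]]].
assert (A1 := Rmin_l sn sp). assert (A2 := Rmin_r sn sp).
exists (Rmin sn sp), (glue ap (fun _ => a0) a0), (glue bp bn b0).
split; [split; [apply Rmin_case; lra|lra]|]. split.
{ apply glue_continuous; auto.
  - intros P HP. exists (mkposreal _ Rlt_0_1). intros. now apply locally_singleton.
  - intros s Hs. apply Hp; lra.
  - intros. apply continuous_const. }
split.
{ apply glue_continuous; auto; intros s Hs; [apply Hp|apply Hn]; lra. }
split; [apply glue_0|]. split; [apply glue_0|].
intros mu Hmu n0. destruct (Rtotal_order mu 0) as [L|[L|L]]; [|lra|].
- rewrite !glue_neg by auto. destruct (Hn (- mu) ltac:(lra)) as [B [_ Kv]]. rewrite Ropp_involutive in Kv.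
  apply conjugate_negative; auto; lra.
- rewrite !glue_pos by auto.
  destruct (Hp mu ltac:(lra)) as [B1 [B2 [_ [_ [y1 [y2 [P1 [P2 [Q1 [Q2 [E1 [D1 [E2 D2]]]]]]]]]]]]].
  apply (conjugate_positive mu _ _ y1 y2); auto; lra.
Qed.
End WithData.
End Main.

Theorem theorem3p3
  (r : nat) (hr : (7 <= r)%nat)
  (U : R * R -> Prop) (hU : open U) (hU0 : U (0, 0))
  (f : R -> R -> R) (hf : C2d_on r U f)
  (hf0 : locally 0 (fun mu => f 0 mu = 0))
  (hfx : partial_derive 1 0 f 0 0 = 1)
  (hfxx : partial_derive 2 0 f 0 0 = 0)
  (hfxmu : 0 < partial_derive 1 1 f 0 0)
  (hfxxx : partial_derive 3 0 f 0 0 < 0) :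
  exists (N : R -> Prop) (mu0 : R),
    open N /\ N 0 /\ 0 < mu0 /\
    (forall x mu, N x -> - mu0 < mu < mu0 -> U (x, mu)) /\
    (forall mu, - mu0 < mu < 0 ->
       (forall x, fixed_in (fun z => f z mu) N x <-> x = 0) /\
       stable (fun z => f z mu) 0) /\
    (forall mu, 0 < mu < mu0 ->
       exists x1 x2 : R,
         x1 <> 0 /\ x2 <> 0 /\ x1 <> x2 /\
         (forall x, fixed_in (fun z => f z mu) N x <->
                    x = 0 \/ x = x1 \/ x = x2) /\
         unstable (fun z => f z mu) 0 /\
         stable (fun z => f z mu) x1 /\
         stable (fun z => f z mu) x2) /\
    exists (M : R -> Prop) (nu a b : R -> R),
      open M /\ M 0 /\
      C_on 1 (fun mu => - mu0 < mu < mu0) nu /\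
      (forall mu, - mu0 < mu < mu0 -> continuous a mu) /\
      (forall mu, - mu0 < mu < mu0 -> continuous b mu) /\
      nu 0 = 0 /\
      Derive nu 0 = partial_derive 1 1 f 0 0 /\
      a 0 = 3 * partial_derive 5 0 f 0 0 / (10 * partial_derive 3 0 f 0 0 ^ 2)
            - 3 * partial_derive 4 0 f 0 0 ^ 2
              / (8 * partial_derive 3 0 f 0 0 ^ 3) /\
      b 0 = sqrt (6 / - partial_derive 3 0 f 0 0)
            * (partial_derive 4 0 f 0 0 / (4 * partial_derive 3 0 f 0 0)
               + partial_derive 2 1 f 0 0 / (2 * partial_derive 1 1 f 0 0)) /\
      (forall mu, - mu0 < mu < mu0 -> mu <> 0 ->
         conjugate_on_basins (r - 1)
           (fun x => f x mu) N (fun y => g y (nu mu) (a mu) (b mu)) M) /\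
      (exists h : R -> R,
         C_conjugacy 1 (fun x => f x 0) N
           (fun y => g y (nu 0) (a 0) (b 0)) M h).
Proof.
destruct (uniform_data_exists r U f) as [K [d [e [d' [m HD]]]]]; auto.
destruct (parameter_functions_exist r U f) with (K := K) (d := d) (e := e) (d' := d') (m := m)
  as [mu0 [a [b [Hm [Ca [Cb [Ea [Eb Hc]]]]]]]]; auto.
assert (Hd : 0 < d' < d) by apply HD. assert (He : 0 < sqrt (f_c f) * d') by apply HD.
exists (Ioo (- d') d'), mu0.
split; [apply open_Ioo|]. split; [unfold Ioo; lra|]. split; [lra|].
split. { intros x mu Hx Hmu. apply (uniform_at r U f K d e d' m HD mu); [lra|]. unfold Ioo in *; lra. }
split. { intros mu Hmu. apply (fixed_points_negative r U f) with (K := K) (d := d) (e := e) (m := m); auto; lra. }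
split. { intros mu Hmu. apply (fixed_points_positive r U f) with (K := K) (d := d) (e := e) (m := m); auto; lra. }
exists (Ioo (- (sqrt (f_c f) * d')) (sqrt (f_c f) * d')), (f_nu f), a, b.
split; [apply open_Ioo|]. split; [unfold Ioo; lra|].
split. { apply (f_nu_C1 r U f) with (K := K) (d := d) (e := e) (d' := d') (m := m); auto; lra. }
split; [auto|]. split; [auto|]. split; [now apply f_nu_0|].
split. { apply is_derive_unique, (f_nu_derive r U f); auto. }
split. { rewrite Ea. now apply a0_formula. }
split. { rewrite Eb. now apply b0_formula. }
split; [exact Hc|]. rewrite Ea, Eb. now apply (conjugate_zero r U f) with (K := K) (d := d) (e := e) (m := m).
Qed.
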